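(* For every $\varepsilon>0$ with $\varepsilon a_0<a_1$ let $(u_\varepsilon,\Theta_\varepsilon,a_\varepsilon)$ be a quasi-static evolution of the homogenized brittle damage model with boundary datum $w$ (as defined in the context), and let $\sigma_\varepsilon=a_\varepsilon u_\varepsilon'$ be its stress. Then there exist a subsequence $\varepsilon\searrow0$ (not relabeled, independent of $t$) and absolutely continuous functions $$(u,e,p,\sigma,\mu):[0,T]\to BV((0,L))\times\mathbb R\times\mathcal M([0,L])\times K\times\mathcal M([0,L])$$ such that for all $t\in[0,T]$, as $\varepsilon\searrow0$, \begin{align*} &u_\varepsilon(t)\rightharpoonup u(t)\ \text{ weakly-* in } BV((0,L)),\\ &\mu_\varepsilon(t):=\tfrac{1-\Theta_\varepsilon(t)}{\varepsilon}\,\mathcal L^1\llcorner(0,L)\rightharpoonup\mu(t)\ \text{ weakly-* in }\mathcal M([0,L]),\\ &\sigma_\varepsilon(t)\to\sigma(t)\ \text{ in }\mathbb R,\\ &e_\varepsilon(t):=\tfrac{\sigma_\varepsilon(t)}{a_1}\Theta_\varepsilon(t)\rightharpoonup e(t)\ \text{ weakly in }L^2((0,L)),\\ &p_\varepsilon(t):=\tfrac{\sigma_\varepsilon(t)}{a_0}\mu_\varepsilon(t)\rightharpoonup p(t)\ \text{ weakly-* in }\mathcal M([0,L]), \end{align*} and the following hold for all $t\in[0,T]$: (i) (additive decomposition) $Du(t)=e(t)\,\mathcal L^1\llcorner(0,L)+p(t)\llcorner(0,L)$ in $\mathcal M((0,L))$; (ii) (relaxed Dirichlet condition) $p(t)\llcorner\{0,L\}=(w(t)-u(t))(\delta_L-\delta_0)$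 in $\mathcal M(\{0,L\})$; (iii) (constitutive equation) $\sigma(t)=a_1e(t)$; (iv) (equilibrium equation) $\sigma(t)'=0$ in $H^{-1}((0,L))$; (v) (stress constraint) $\sigma(t)\in K$. Furthermore, the effective compliance $$c:t\in[0,T]\mapsto\frac{\mu(t)}{a_0}+\frac1{a_1}\mathcal L^1\llcorner(0,L)\in\mathcal M([0,L];\mathbb R^+)$$ is non-decreasing in time and satisfies: (vi) (constitutive equation) $Du(t)=\sigma(t)\,c(t)\llcorner(0,L)$ in $\mathcal M((0,L))$ for all $t\in[0,T]$; (vii) (Griffith evolution law) $\dot c(t)\,(2\kappa a_0-\sigma(t)^2)=0$ in $\mathcal M([0,L];\mathbb R^+)$ for $\mathcal L^1$-a.e. $t\in[0,T]$.
   Context: Fix constants $L,T,\kappa,a_0,a_1>0$ and $w\in AC([0,T];H^1(\mathbb R))$ (absolutely continuous in time). Dots denote time derivatives and primes denote space derivatives; $w(t)$ is identified with its continuous representative. Set $K=[-\sqrt{2\kappa a_0},\sqrt{2\kappa a_0}]$. Brittle damage evolution. For $\varepsilon>0$ with $\varepsilon a_0<a_1$, a quasi-static evolution of the homogenized brittle damage model is a triple of weakly-* measurable maps $u_\varepsilon:[0,T]\to H^1((0,L))$, $\Theta_\varepsilon:[0,T]\to L^\infty((0,L);[0,1])$, $a_\varepsilon=\big(\frac{1-\Theta_\varepsilon}{\varepsilon a_0}+\frac{\Theta_\varepsilon}{a_1}\big)^{-1}:[0,T]\to L^\infty((0,L))$ such that: - $u_\varepsilon(t)\in w(t)+H^1_0((0,L))$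 for all $t\in[0,T]$; - (initial minimality) for all $v\in w(0)+H^1_0((0,L))$ and $\theta\in L^\infty((0,L);[0,1])$, $\int_0^L\big(\frac12a_\varepsilon(0)|u_\varepsilon'(0)|^2+\frac\kappa\varepsilon(1-\Theta_\varepsilon(0))\big)dx\le\int_0^L\big(\frac12\frac{\varepsilon a_0a_1}{\theta a_1+(1-\theta)\varepsilon a_0}|v'|^2+\frac\kappa\varepsilon\theta\big)dx$; - (monotonicity) for all $0\le s\le t\le T$, $a_\varepsilon(t)\le a_\varepsilon(s)$ and $\Theta_\varepsilon(t)\le\Theta_\varepsilon(s)$ a.e. in $(0,L)$; - (one-sided minimality) for all $t\in[0,T]$, $v\in w(t)+H^1_0((0,L))$, $\theta\in L^\infty((0,L);[0,1])$, $\frac12\int_0^La_\varepsilon(t)|u_\varepsilon'(t)|^2dx\le\frac12\int_0^L\frac{\varepsilon a_0a_\varepsilon(t)}{\theta a_\varepsilon(t)+(1-\theta)\varepsilon a_0}|v'|^2dx+\frac\kappa\varepsilon\int_0^L\theta\,\Theta_\varepsilon(t)\,dx$; - (energy balance) $\mathcal E_\varepsilon(t):=\frac12\int_0^La_\varepsilon(t)|u_\varepsilon'(t)|^2dx+\frac\kappa\varepsilon\int_0^L(1-\Theta_\varepsilon(t))dx$ satisfies $\mathcal E_\varepsilon(t)=\mathcal E_\varepsilon(0)+\int_0^t\int_0^La_\varepsilon(s)u_\varepsilon'(s)\dot w'(s)\,dx\,ds$ for all $t\in[0,T]$. The stress $\sigma_\varepsilon(t)=a_\varepsilon(t)u_\varepsilon'(t)$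 is constant in space and is identified with a real number. $\mathcal M(X)$ is the space of bounded Radon measures on $X$ and $\mathcal M(X;\mathbb R^+)$ the non-negative ones; $\mathcal M([0,L])$ is the dual of $C([0,L])$. $(w(t)-u(t))(\delta_L-\delta_0)$ means $(w(t)(L)-u(t)(L))\delta_L-(w(t)(0)-u(t)(0))\delta_0$, where $u(t)(0),u(t)(L)$ are the inner traces of $u(t)\in BV((0,L))$. For an absolutely continuous map $f$ with values in the dual of a separable Banach space, $\dot f(t)$ is the weak-* limit of $(f(s)-f(t))/(s-t)$ as $s\to t$, which exists for a.e. $t$. *)

(* Defs.v *)
From HB Require Import structures.
From mathcomp Require Import all_boot all_order all_algebra.
From mathcomp Require Import all_classical all_reals all_analysis.
From mathcomp Require Import measurable_realfun.

Set Implicit Arguments.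
Unset Strict Implicit.
Unset Printing Implicit Defensive.
Import Order.TTheory GRing.Theory Num.Theory.
Import numFieldNormedType.Exports.

Local Open Scope classical_set_scope.
Local Open Scope ring_scope.

(* Elements of L^2, L^oo, H^1 and BV are represented by functions R -> R; only
   their values almost everywhere on the domain D matter. *)

Section Lebesgue_Sobolev.
Context {R : realType}.
Implicit Types (D : set R) (f g v phi : R -> R).
Local Notation leb := (@lebesgue_measure R).

Definition L1 D f : Prop := leb.-integrable D (EFin \o f).

Definition L2 D f : Prop := measurable_fun D f /\ L1 D (fun x => f x ^+ 2).

(* L^oo(D; [0, 1]) *)
Definition Linf01 D f : Prop :=
  measurable_fun D f /\ {ae leb, forall x, D x -> 0 <= f x <= 1}.

(* Weak and distributional derivatives are tested on C^1_c(D); by mollification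
   this gives the same derivatives as testing on the smooth functions. *)
Definition test_fun D phi : Prop :=
  [/\ forall x, derivable phi x 1,
      continuous (derive1 phi) &
      exists K, [/\ compact K, K `<=` D & forall x, ~ K x -> phi x = 0]].

Definition weak_deriv D f g : Prop :=
  forall phi, test_fun D phi ->
    \int[leb]_(x in D) (f x * derive1 phi x)
    = - \int[leb]_(x in D) (g x * phi x).

Definition H1 D f : Prop := L2 D f /\ exists2 g, L2 D g & weak_deriv D f g.

(* A representative of f', for f in H^1(D). *)
Definition wderiv D f : R -> R :=
  xget (fun=> 0) [set g | L2 D g /\ weak_deriv D f g].

Definition H1inner D f g : R :=
  \int[leb]_(x in D) (f x * g x)
  + \int[leb]_(x in D) (wderiv D f x * wderiv D g x).

Definition H1dist D f g : R :=
  let h := fun x => f x - g x in Num.sqrt (H1inner D h h).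

(* The closure of C^1_c(D) in H^1(D). *)
Definition H10 D f : Prop :=
  H1 D f /\ exists2 phi_ : nat -> R -> R, (forall n, test_fun D (phi_ n)) &
    H1dist D (phi_ n) f @[n --> \oo] --> (0 : R).

Definition weak_L2_cvg D (f_ : nat -> R -> R) f : Prop :=
  [/\ forall n, L2 D (f_ n), L2 D f &
    forall g, L2 D g ->
      \int[leb]_(x in D) (f_ n x * g x) @[n --> \oo]
      --> \int[leb]_(x in D) (f x * g x)].

End Lebesgue_Sobolev.

Section Measures.
Context {R : realType}.
Local Notation leb := (@lebesgue_measure R).

(* Signed bounded Radon measures on the line; a measure on X `<=` R is one that
   does not charge the complement of X. *)
Definition smeas := {charge set (measurableTypeR R) -> \bar R}.

Implicit Types (nu : smeas) (X D : set R) (f g phi : R -> R).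

Definition meas_on X nu : Prop :=
  forall A, measurable A -> nu (A `\` X) = 0%E.

(* Equality in M(X) of the restrictions to X. *)
Definition meas_eq_on X nu1 nu2 : Prop :=
  forall A, measurable A -> A `<=` X -> nu1 A = nu2 A.

Definition meas_le nu1 nu2 : Prop :=
  forall A, measurable A -> (nu1 A <= nu2 A)%E.

Definition meas_zero : smeas := @czero _ (measurableTypeR R) R.

Definition meas_scale (r : R) nu : smeas := cscale r nu.

Definition meas_add nu1 nu2 : smeas := cadd nu1 nu2.

Definition meas_sub nu1 nu2 : smeas := meas_add nu1 (meas_scale (- 1) nu2).

Definition meas_dirac (x : R) : smeas :=
  charge_of_finite_measure (@dirac _ (measurableTypeR R) x R).

(* f L^1 restricted to D, for f in L^1(D). *)
Definition meas_density D f : smeas :=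
  match pselect (leb.-integrable setT (EFin \o (f \_ D))) with
  | left intf => induced_charge intf
  | right _ => meas_zero
  end.

Definition hahn_posset nu : set (measurableTypeR R) :=
  projT1 (cid (Hahn_decomposition nu)).

Definition hahn_negset nu : set (measurableTypeR R) :=
  projT1 (cid (projT2 (cid (Hahn_decomposition nu)))).

Definition hahn_posnegP nu :
    hahn_decomposition nu (hahn_posset nu) (hahn_negset nu) :=
  projT2 (cid (projT2 (cid (Hahn_decomposition nu)))).

Definition meas_integral nu X f : R :=
  \int[jordan_pos (hahn_posnegP nu)]_(x in X) f x
  - \int[jordan_neg (hahn_posnegP nu)]_(x in X) f x.

(* The total variation norm of a measure and the distance it induces. *)
Definition meas_norm nu : R := fine (charge_variation (hahn_posnegP nu) setT).

Definition meas_dist nu1 nu2 : R := meas_norm (meas_sub nu1 nu2).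

(* Weak-* convergence in M([0, L]) = C([0, L])^*, along a filter. *)
Definition wstar_cvg (L : R) {I : Type} (F : set_system I) (nu_ : I -> smeas)
    nu : Prop :=
  forall phi, {within `[0, L], continuous phi} ->
    meas_integral (nu_ i) `[0, L] phi @[i --> F]
    --> meas_integral nu `[0, L] phi.

End Measures.
Arguments smeas R : clear implicits.

Section BV.
Context {R : realType}.
Implicit Types (D : set R) (f g u phi : R -> R) (L : R).
Local Notation leb := (@lebesgue_measure R).

Definition distr_deriv_meas D u (nu : smeas R) : Prop :=
  meas_on D nu /\
  forall phi, test_fun D phi ->
    \int[leb]_(x in D) (u x * derive1 phi x) = - meas_integral nu D phi.

Definition BVfun D u : Prop := L1 D u /\ exists nu, distr_deriv_meas D u nu.

(* The measure Du, for u in BV(D). *)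
Definition BVderiv D u : smeas R :=
  match pselect (exists nu, distr_deriv_meas D u nu) with
  | left ex_nu => projT1 (cid ex_nu)
  | right _ => meas_zero
  end.

Definition BVdist D f g : R :=
  let h := fun x => f x - g x in
  \int[leb]_(x in D) `|h x| + meas_norm (BVderiv D h).

(* Weak-* convergence in BV((0, L)): convergence in L^1 and weak-* convergence
   of the derivatives in M((0, L)) = C_0((0, L))^*. *)
Definition wstar_BV_cvg L (u_ : nat -> R -> R) u : Prop :=
  [/\ forall n, BVfun `]0, L[ (u_ n), BVfun `]0, L[ u,
      \int[leb]_(x in `]0, L[) `|u_ n x - u x| @[n --> \oo] --> (0 : R) &
      forall phi, {within `[0, L], continuous phi} -> phi 0 = 0 -> phi L = 0 ->
        meas_integral (BVderiv `]0, L[ (u_ n)) `]0, L[ phi @[n --> \oo]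
        --> meas_integral (BVderiv `]0, L[ u) `]0, L[ phi].

(* Inner traces at a of u in BV((a, b)) and at b of u in BV((a, b)), as
   one-sided approximate limits. *)
Definition traceL (a : R) u : R :=
  xget 0 [set l | r^-1 * \int[leb]_(x in `]a, (a + r)[) `|u x - l|
                  @[r --> (0 : R)^'+] --> (0 : R)].

Definition traceR (b : R) u : R :=
  xget 0 [set l | r^-1 * \int[leb]_(x in `](b - r), b[) `|u x - l|
                  @[r --> (0 : R)^'+] --> (0 : R)].

End BV.

Section Time.
Context {R : realType}.
Local Notation leb := (@lebesgue_measure R).

Definition abs_continuous (X : Type) (dist : X -> X -> R) (T : R) (f : R -> X) : Prop :=
  forall eta, 0 < eta -> exists2 delta, 0 < delta &
    forall (n : nat) (a b : 'I_n -> R),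
      (forall i, [/\ 0 <= a i, a i <= b i & b i <= T]) ->
      (forall i j, i != j -> b i <= a j \/ b j <= a i) ->
      \sum_(i < n) (b i - a i) < delta ->
      \sum_(i < n) dist (f (a i)) (f (b i)) < eta.

Definition Rdist (x y : R) : R := `|x - y|.

(* Measurability on [0, T] for the Lebesgue (completed Borel) sigma-algebra. *)
Definition time_measurable (T : R) (f : R -> R) : Prop :=
  @measurable_fun _ _ (g_sigma_algebraType (completed_algebra_gen leb))
    (measurableTypeR R) `[0, T] f.

(* v is the time derivative of w : [0, T] -> H^1(R) at t: the weak limit in the
   Hilbert space H^1(R) of the difference quotients. *)
Definition H1_time_deriv (T : R) (w : R -> R -> R) (t : R) (v : R -> R) : Prop :=
  H1 setT v /\
  forall z, H1 setT z ->
    H1inner setT (fun x => (w s x - w t x) / (s - t)) z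
      @[s --> within `[0, T] t^'] --> H1inner setT v z.

(* The time derivative of w at t; it exists for a.e. t when w is absolutely
   continuous, and H1_dot T w t is 0 at the other times. *)
Definition H1_dot (T : R) (w : R -> R -> R) (t : R) : R -> R :=
  xget (fun=> 0) [set v | H1_time_deriv T w t v].

(* nu is the time derivative of c : [0, T] -> M([0, L]) at t. *)
Definition meas_time_deriv (L T : R) (c : R -> smeas R) (t : R) (nu : smeas R) :
    Prop :=
  meas_on `[0, L] nu /\
  wstar_cvg L (within `[0, T] t^')
    (fun s => meas_scale (s - t)^-1 (meas_sub (c s) (c t))) nu.

End Time.

Section Brittle_damage.
Context {R : realType}.
Local Notation leb := (@lebesgue_measure R).

Definition brittle_energy (L kappa eps : R) (u Theta a : R -> R) : R :=
  2^-1 * \int[leb]_(x in `]0, L[) (a x * wderiv `]0, L[ u x ^+ 2)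
  + kappa / eps * \int[leb]_(x in `]0, L[) (1 - Theta x).

Record brittle_evolution (L T kappa a0 a1 : R) (w : R -> R -> R) (eps : R)
    (u Theta a : R -> R -> R) : Prop := BrittleEvolution {
  be_u_H1 : forall t : R, 0 <= t <= T -> H1 `]0, L[ (u t) ;
  be_Theta_Linf : forall t : R, 0 <= t <= T -> Linf01 `]0, L[ (Theta t) ;
  be_a_measurable : forall t : R, 0 <= t <= T -> measurable_fun `]0, L[ (a t) ;
  be_a_def : forall t : R, 0 <= t <= T ->
    {ae leb, forall x, 0 < x < L ->
      a t x = ((1 - Theta t x) / (eps * a0) + Theta t x / a1)^-1} ;
  be_u_wmeasurable : forall z, H1 `]0, L[ z ->
    time_measurable T (fun t => H1inner `]0, L[ (u t) z) ;
  be_Theta_wmeasurable : forall z, L1 `]0, L[ z ->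
    time_measurable T (fun t => \int[leb]_(x in `]0, L[) (Theta t x * z x)) ;
  be_a_wmeasurable : forall z, L1 `]0, L[ z ->
    time_measurable T (fun t => \int[leb]_(x in `]0, L[) (a t x * z x)) ;
  be_dirichlet : forall t : R, 0 <= t <= T ->
    H10 `]0, L[ (fun x => u t x - w t x) ;
  be_initial_minimality : forall v theta,
    H1 `]0, L[ v -> H10 `]0, L[ (fun x => v x - w 0 x) ->
    Linf01 `]0, L[ theta ->
    \int[leb]_(x in `]0, L[)
      (2^-1 * a 0 x * wderiv `]0, L[ (u 0) x ^+ 2
       + kappa / eps * (1 - Theta 0 x))
    <= \int[leb]_(x in `]0, L[)
      (2^-1 * (eps * a0 * a1 / (theta x * a1 + (1 - theta x) * (eps * a0)))
         * wderiv `]0, L[ v x ^+ 2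
       + kappa / eps * theta x) ;
  be_monotonicity : forall s t : R, 0 <= s -> s <= t -> t <= T ->
    {ae leb, forall x, 0 < x < L -> a t x <= a s x /\ Theta t x <= Theta s x} ;
  be_one_sided_minimality : forall (t : R) v theta, 0 <= t <= T ->
    H1 `]0, L[ v -> H10 `]0, L[ (fun x => v x - w t x) ->
    Linf01 `]0, L[ theta ->
    2^-1 * \int[leb]_(x in `]0, L[) (a t x * wderiv `]0, L[ (u t) x ^+ 2)
    <= 2^-1 * \int[leb]_(x in `]0, L[)
         (eps * a0 * a t x / (theta x * a t x + (1 - theta x) * (eps * a0))
          * wderiv `]0, L[ v x ^+ 2)
       + kappa / eps * \int[leb]_(x in `]0, L[) (theta x * Theta t x) ;
  be_energy_balance : forall t : R, 0 <= t <= T ->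
    brittle_energy L kappa eps (u t) (Theta t) (a t)
    = brittle_energy L kappa eps (u 0) (Theta 0) (a 0)
      + \int[leb]_(s in `[0, t]) \int[leb]_(x in `]0, L[)
          (a s x * wderiv `]0, L[ (u s) x * wderiv setT (H1_dot T w s) x)
}.

(* The real number a u', which is constant in space. *)
Definition stress (L : R) (u a : R -> R) : R :=
  xget 0 [set s | {ae leb, forall x, 0 < x < L ->
                     a x * wderiv `]0, L[ u x = s}].

(* mu_eps = (1 - Theta_eps) / eps L^1 restricted to (0, L) *)
Definition damage_meas (L eps : R) (Theta : R -> R) : smeas R :=
  meas_density `]0, L[ (fun x => (1 - Theta x) / eps).

Definition compliance (L a0 a1 : R) (mu : smeas R) : smeas R :=
  meas_add (meas_scale a0^-1 mu) (meas_density `]0, L[ (fun=> a1^-1)).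

End Brittle_damage.

(* Main.v *)
(* Put W(t) = w(t)(L) - w(t)(0), S = sqrt(2 kappa a0), and let C_eps(t) be the integral of
   1 / a_eps(t), so that sigma_eps = W / C_eps. One-sided minimality gives |W| <= S_eps C_eps
   with S_eps -> S. The energy equals W^2 / (2 C_eps) + kappa |mu_eps|, where |mu_eps| is an
   affine function of C_eps; its balance prevents C_eps from growing while
   |W| < S_eps C_eps. Hence C_eps(t) = max (L / a1, max_[0, t] |W| / S_eps): stresses and
   masses of mu_eps converge for every t without extraction. Since t |-> mu_eps(t) is
   non-decreasing with mass converging to a continuous function of t, a diagonal extraction on
   the distribution functions of mu_eps at rational times and points gives mu(t) for every t,
   and u(t)(x) = w(t)(0) + sigma(t) (mu(t)([0, x]) / a0 + x / a1).
   If |sigma(t)| < S, the total compliance is constant near t, so the difference quotients of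
   c, which are non-negative measures, have mass 0: this is the Griffith law.
   All absolutely continuous quantities are controlled by the variation V of w in H^1. The
   time derivative of w enters only through the derivative of W, after showing that the path
   w is weakly differentiable in H^1 almost everywhere. *)
From HB Require Import structures.
Require Import Defs.
From mathcomp Require Import all_boot all_order all_algebra.
From mathcomp Require Import all_classical all_reals all_analysis.
From mathcomp Require Import measurable_realfun ring lra.
Import Order.TTheory GRing.Theory Num.Theory.
Import numFieldNormedType.Exports.
Set Implicit Arguments.
Unset Strict Implicit.
Unset Printing Implicit Defensive.
Local Open Scope classical_set_scope.
Local Open Scope ring_scope.

(** * Integrals and the space L^2 *)

(** [C_eps] is only known to be monotone, so the energy balance cannot be differentiated along it.
    Two estimates stand in for the derivative. At any time (C(t) - C(s))^2 is at most a multiple of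
    V(t) - V(s), because W^2 / (2 C) + S^2 C / 2 is strictly convex above its minimizer C = |W| / S:
    this excludes jumps. While |W| / C stays uniformly below S, C(t) - C(s) is even of order (V(t) -
    V(s))^2, and adding up over ever finer subdivisions leaves no growth at all. The value of S_eps
    comes from 1 / a_eps = 1 / a1 + bt rho_eps, where rho_eps is the density of mu_eps and bt = 1 /
    a0 - eps / a1: a unit of compliance costs kappa / bt, and S_eps^2 / 2 is this cost. The bound
    |W| <= S_eps C_eps cannot come from varying theta when the bar is damaged everywhere; the
    compliance is then L / (eps a0), which for small eps is large enough for the bounded function W.
    The energy balance integrates a stress against [H1_dot], a choice made at each time separately;
    no measurability in time is at hand for it before it is replaced, almost everywhere, by the
    derivative of W. *)

Section Integrals.
Context d (X : measurableType d) (R : realType) (mu : {measure set X -> \bar R}).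
Implicit Types (D : set X) (f g h : X -> R).
Local Notation intg D f := (mu.-integrable D (EFin \o f)).

Lemma intgM D f : intg D f -> measurable_fun D f.
Proof. by move=> /measurable_int /measurable_EFinP. Qed.

Lemma intgD D f g : measurable D -> intg D f -> intg D g ->
  intg D (fun x => f x + g x).
Proof. by move=> mD fi gi; have := integrableD mD fi gi; apply: eq_integrable. Qed.

Lemma intgN D f : measurable D -> intg D f -> intg D (fun x => - f x).
Proof. by move=> mD fi; have := integrableN fi; apply: eq_integrable. Qed.

Lemma intgB D f g : measurable D -> intg D f -> intg D g ->
  intg D (fun x => f x - g x).
Proof. by move=> mD fi gi; apply: intgD => //; exact: intgN. Qed.

Lemma intgZ D f k : measurable D -> intg D f -> intg D (fun x => k * f x).
Proof. by move=> mD fi; have := integrableZl mD k fi; apply: eq_integrable. Qed.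

Lemma intg_abs D f : measurable D -> intg D f -> intg D (fun x => `|f x|).
Proof. by move=> mD fi; exact: integrable_norm. Qed.

Lemma intgS D D' f : measurable D -> measurable D' -> D' `<=` D ->
  intg D f -> intg D' f.
Proof. by move=> mD mD' DD'; exact: integrableS. Qed.

Lemma intg_ae_le D f g : measurable D -> measurable_fun D f -> intg D g ->
  {ae mu, forall x, D x -> `|f x| <= g x} -> intg D f.
Proof.
move=> mD mf gi fg; apply/integrableP; split; first exact/measurable_EFinP.
have /integrableP[mg ig] := intg_abs mD gi.
apply: le_lt_trans ig; apply: ae_ge0_le_integral => //.
- by apply/measurable_EFinP; apply: measurableT_comp.
- by apply: measurableT_comp.
- apply: filterS fg => x fg Dx; rewrite lee_fin normr_id.
  by rewrite (le_trans (fg Dx))// ler_norm.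
Qed.

Lemma ae_eq_Rint D f g : measurable D -> measurable_fun D f -> measurable_fun D g ->
  {ae mu, forall x, D x -> f x = g x} ->
  \int[mu]_(x in D) f x = \int[mu]_(x in D) g x.
Proof.
move=> mD mf mg fg; congr fine; apply: ae_eq_integral => //; try exact/measurable_EFinP.
by apply: filterS fg => x + Dx => /(_ Dx) ->.
Qed.

Lemma ae_Rint_ge0 D f : measurable D -> measurable_fun D f ->
  {ae mu, forall x, D x -> 0 <= f x} -> 0 <= \int[mu]_(x in D) f x.
Proof.
move=> mD mf f0; rewrite (@ae_eq_Rint D f (fun x => `|f x|))//.
- exact: Rintegral_ge0.
- exact: measurableT_comp.
- by apply: filterS f0 => x + Dx => /(_ Dx) f0; rewrite ger0_norm.
Qed.

Lemma ae_le_Rint D f g : measurable D -> intg D f -> intg D g ->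
  {ae mu, forall x, D x -> f x <= g x} ->
  \int[mu]_(x in D) f x <= \int[mu]_(x in D) g x.
Proof.
move=> mD fi gi fg; rewrite -subr_ge0 -RintegralB//; apply: ae_Rint_ge0 => //.
  exact/intgM/intgB.
by apply: filterS fg => x + Dx => /(_ Dx); rewrite subr_ge0.
Qed.

Lemma Rint_eq0 D f : measurable D -> measurable_fun D f ->
  {ae mu, forall x, D x -> f x = 0} -> \int[mu]_(x in D) f x = 0.
Proof.
move=> mD mf f0; rewrite (@ae_eq_Rint D f (fun=> 0))//.
by rewrite Rintegral_cst// mul0r.
Qed.

Lemma ae_eq0_Rint D f : measurable D -> intg D f ->
  {ae mu, forall x, D x -> 0 <= f x} -> \int[mu]_(x in D) f x <= 0 ->
  {ae mu, forall x, D x -> f x = 0}.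
Proof.
move=> mD fi f0 If.
have {}If : \int[mu]_(x in D) `|f x| = 0.
  apply/eqP; rewrite eq_le; apply/andP; split; last exact: Rintegral_ge0.
  rewrite (@ae_eq_Rint D _ f)//.
  - exact/intgM/intg_abs.
  - exact/intgM.
  - by apply: filterS f0 => x + Dx => /(_ Dx) f0; rewrite ger0_norm.
have : (\int[mu]_(x in D) `|(EFin \o f) x| = 0)%E.
  rewrite -[LHS]fineK//; last exact: (integrable_fin_num mD (intg_abs mD fi)).
  by congr EFin.
move/(ae_eq_integral_abs mu mD (measurable_int mu fi)).
by apply: filterS => x + Dx => /(_ Dx) [].
Qed.

Lemma Rint_norm_le D f g : measurable D -> measurable_fun D f -> intg D g ->
  {ae mu, forall x, D x -> `|f x| <= g x} ->
  `|\int[mu]_(x in D) f x| <= \int[mu]_(x in D) g x.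
Proof.
move=> mD mf gi fg; have fi := intg_ae_le mD mf gi fg.
by apply: (le_trans (le_normr_Rintegral mD fi)); apply: ae_le_Rint => //; exact: intg_abs.
Qed.

Lemma Rint_setI D A f : \int[mu]_(x in D `&` A) f x
  = \int[mu]_(x in D) (f x * \1_A x).
Proof.
rewrite Rintegral_mkcondr; apply: eq_Rintegral => x _.
by rewrite patchE indicE; case: ifPn => _; rewrite ?mulr1 ?mulr0.
Qed.

Lemma Rint_dct D (f_ : nat -> X -> R) f g : measurable D ->
  (forall n, measurable_fun D (f_ n)) -> measurable_fun D f -> intg D g ->
  {ae mu, forall x, D x -> f_ n x @[n --> \oo] --> f x} ->
  (forall n, {ae mu, forall x, D x -> `|f_ n x| <= g x}) ->
  \int[mu]_(x in D) f_ n x @[n --> \oo] --> \int[mu]_(x in D) f x.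
Proof.
move=> mD mf_ mf gi f_f f_g.
have f_g' : {ae mu, forall x n, D x -> `|f_ n x| <= g x}.
  have /ae_foralln : forall n, {ae mu, forall x, D x -> `|f_ n x| <= g x} by [].
  by apply: filterS => x h n; exact: h.
have [] := @dominated_convergence _ _ _ mu D mD (fun n => EFin \o f_ n) (EFin \o f)
  (EFin \o g).
- by move=> n; exact/measurable_EFinP.
- exact/measurable_EFinP.
- by apply: filterS f_f => x h Dx; apply: cvg_EFin; [exact: nearW|exact: h].
- exact: gi.
- by apply: filterS f_g' => x h n Dx; rewrite lee_fin; exact: h.
move=> fi _ cvf; apply: fine_cvg.
rewrite fineK//; exact: (integrable_fin_num mD fi).
Qed.

End Integrals.

Local Notation l_intgD := (@intgD _ _ _ (@lebesgue_measure _)).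
Local Notation l_intgB := (@intgB _ _ _ (@lebesgue_measure _)).
Local Notation l_intgZ := (@intgZ _ _ _ (@lebesgue_measure _)).
Local Notation l_intg_abs := (@intg_abs _ _ _ (@lebesgue_measure _)).
Local Notation l_intgS := (@intgS _ _ _ (@lebesgue_measure _)).
Local Notation l_intg_ae_le := (@intg_ae_le _ _ _ (@lebesgue_measure _)).
Local Notation l_ae_eq_Rint := (@ae_eq_Rint _ _ _ (@lebesgue_measure _)).
Local Notation l_ae_le_Rint := (@ae_le_Rint _ _ _ (@lebesgue_measure _)).
Local Notation l_ae_eq0_Rint := (@ae_eq0_Rint _ _ _ (@lebesgue_measure _)).
Local Notation l_Rint_norm_le := (@Rint_norm_le _ _ _ (@lebesgue_measure _)).

Lemma lebS {R : realType} (P Q : R -> Prop) :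
  {ae @lebesgue_measure R, forall x, P x} -> (forall x, P x -> Q x) ->
  {ae @lebesgue_measure R, forall x, Q x}.
Proof.
move=> p PQ; have F := @ae_filter_ringOfSetsType _ _ _ (@lebesgue_measure R).
exact: (@filterS _ _ F _ _ PQ p).
Qed.

Lemma lebI {R : realType} (P Q : R -> Prop) :
  {ae @lebesgue_measure R, forall x, P x} -> {ae @lebesgue_measure R, forall x, Q x} ->
  {ae @lebesgue_measure R, forall x, P x /\ Q x}.
Proof.
move=> p q; have F := @ae_filter_ringOfSetsType _ _ _ (@lebesgue_measure R).
exact: (@filterI _ _ F _ _ p q).
Qed.

Section L2_space.
Context {R : realType}.
Local Notation leb := (@lebesgue_measure R).
Implicit Types (D : set R) (f g h : R -> R).

Definition norm2 D f : R := Num.sqrt (\int[leb]_(x in D) (f x ^+ 2)).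

Lemma L2_le D f g : measurable D -> measurable_fun D f -> L2 D g ->
  {ae leb, forall x, D x -> `|f x| <= `|g x|} -> L2 D f.
Proof.
move=> mD mf [mg gi] fg; split => //.
apply: (l_intg_ae_le mD _ gi); first exact: measurable_funX.
apply: (lebS fg) => x + Dx => /(_ Dx) fgx.
by rewrite normrX -[g x ^+ 2]real_normK ?num_real// lerXn2r ?nnegrE.
Qed.

Lemma L2M D f g : measurable D -> L2 D f -> L2 D g -> L1 D (fun x => f x * g x).
Proof.
move=> mD [mf fi] [mg gi]; apply: (l_intg_ae_le mD _ (l_intgD mD fi gi)).
  exact: measurable_funM.
apply: aeW => x Dx; rewrite normrM.
have := sqr_ge0 (`|f x| - `|g x|); rewrite -[f x ^+ 2]real_normK ?num_real//.
rewrite -[g x ^+ 2]real_normK ?num_real//.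
have := normr_ge0 (f x); have := normr_ge0 (g x).
move: `|f x| `|g x| => p q; nra.
Qed.

Lemma L2Z D f k : measurable D -> L2 D f -> L2 D (fun x => k * f x).
Proof.
move=> mD [mf fi]; split; first exact: measurable_funM.
have := l_intgZ (k ^+ 2) mD fi; apply: eq_integrable => // x _ /=.
by rewrite exprMn.
Qed.

Lemma L2N D f : measurable D -> L2 D f -> L2 D (fun x => - f x).
Proof.
move=> mD [mf fi]; split; first exact: measurableT_comp.
by move: fi; apply: eq_integrable => // x _ /=; rewrite sqrrN.
Qed.

Lemma L2D D f g : measurable D -> L2 D f -> L2 D g -> L2 D (fun x => f x + g x).
Proof.
move=> mD fi gi; have fgi := L2M mD fi gi.
case: fi gi => [mf fi] [mg gi]; split; first exact: measurable_funD.
have := l_intgD mD (l_intgD mD fi (l_intgZ 2 mD fgi)) gi.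
by apply: eq_integrable => // x _ /=; congr EFin; ring.
Qed.

Lemma L2B D f g : measurable D -> L2 D f -> L2 D g -> L2 D (fun x => f x - g x).
Proof. by move=> mD fi gi; apply: L2D => //; exact: L2N. Qed.

Lemma L2S D D' f : measurable D -> measurable D' -> D' `<=` D -> L2 D f -> L2 D' f.
Proof.
move=> mD mD' DD' [mf fi]; split; first exact: measurable_funS mf.
exact: l_intgS fi.
Qed.

Lemma L2_1 D : measurable D -> (leb D < +oo)%E -> L2 D (fun=> 1).
Proof.
move=> mD Doo; split => //; apply: measurable_bounded_integrable => //.
by exists 1; split => // x x1 y _ /=; rewrite expr1n normr1 ltW.
Qed.

Lemma L2_L1 D f : measurable D -> (leb D < +oo)%E -> L2 D f -> L1 D f.
Proof.
move=> mD Doo fi; have := L2M mD fi (L2_1 mD Doo).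
by apply: eq_integrable => // x _ /=; rewrite mulr1.
Qed.

Lemma bounded_L1 D f M : measurable D -> (leb D < +oo)%E -> measurable_fun D f ->
  (forall x, D x -> `|f x| <= M) -> L1 D f.
Proof.
move=> mD Doo mf fM; apply: measurable_bounded_integrable => //.
by exists M; split; [exact: num_real|move=> y My x Dx /=; apply: (le_trans (fM _ Dx)); exact: ltW].
Qed.

Lemma bounded_L2 D f M : measurable D -> (leb D < +oo)%E -> measurable_fun D f ->
  (forall x, D x -> `|f x| <= M) -> L2 D f.
Proof.
move=> mD Doo mf fM; split => //; apply: (@bounded_L1 _ _ (M ^+ 2)) => //.
  exact: measurable_funX.
move=> x Dx; rewrite normrX lerXn2r ?nnegrE//; last exact: fM.
by apply: le_trans (fM _ Dx).
Qed.

(** The quadratic form [q] is nonnegative as the integral of (s f + t g)^2. For c > 0 its value at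
    (c, -b) is c (a c - b^2). *)
Lemma Cauchy_Schwarz D f g : measurable D -> L2 D f -> L2 D g ->
  (\int[leb]_(x in D) (f x * g x)) ^+ 2
  <= \int[leb]_(x in D) (f x ^+ 2) * \int[leb]_(x in D) (g x ^+ 2).
Proof.
move=> mD fi gi; have fgi := L2M mD fi gi.
set a := \int[leb]_(x in D) (f x ^+ 2); set c := \int[leb]_(x in D) (g x ^+ 2).
set b := \int[leb]_(x in D) _.
have q (s t : R) : 0 <= s ^+ 2 * a + 2 * s * t * b + t ^+ 2 * c.
  have : 0 <= \int[leb]_(x in D) ((s * f x + t * g x) ^+ 2).
    by apply: Rintegral_ge0 => x _; exact: sqr_ge0.
  rewrite (_ : (fun x => _) = (fun x => (s ^+ 2 * f x ^+ 2 + (2 * s * t) * (f x * g x))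
      + t ^+ 2 * g x ^+ 2)); last by apply/funext => x; ring.
  have [_ fi2] := fi; have [_ gi2] := gi.
  rewrite RintegralD//; [|exact: (l_intgD _ (l_intgZ _ _ _) (l_intgZ _ _ _))|exact: l_intgZ].
  by rewrite RintegralD//; try exact: l_intgZ; rewrite !RintegralZl.
have a0 : 0 <= a by apply: Rintegral_ge0 => x _; exact: sqr_ge0.
have c0 : 0 <= c by apply: Rintegral_ge0 => x _; exact: sqr_ge0.
have [c_eq0|cn0] := eqVneq c 0.
  rewrite c_eq0 mulr0; have [->|bn0] := eqVneq b 0; first by rewrite expr0n.
  (* With c = 0 and b != 0 the form is affine in its second variable; this choice gives it the value
     - a - 2 < 0. *)
  have := q 1 (- (a + 1) / b); rewrite c_eq0.
  rewrite (_ : _ + _ + _ = - a - 2); first lra.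
  by field.
have := q c (- b); have {}c0 : 0 < c by rewrite lt_neqAle eq_sym cn0.
rewrite (_ : _ + _ + _ = c * (a * c - b ^+ 2)); last ring.
by rewrite pmulr_rge0// subr_ge0.
Qed.

Lemma norm2_ge0 D f : 0 <= norm2 D f. Proof. exact: sqrtr_ge0. Qed.

Lemma norm2_sqr D f : norm2 D f ^+ 2 = \int[leb]_(x in D) (f x ^+ 2).
Proof. by rewrite sqr_sqrtr//; apply: Rintegral_ge0 => x _; exact: sqr_ge0. Qed.

Lemma CS_norm D f g : measurable D -> L2 D f -> L2 D g ->
  `|\int[leb]_(x in D) (f x * g x)| <= norm2 D f * norm2 D g.
Proof.
move=> mD fi gi; rewrite -(@ler_pXn2r _ 2)// ?nnegrE ?mulr_ge0 ?norm2_ge0//.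
rewrite real_normK ?num_real// exprMn !norm2_sqr; exact: Cauchy_Schwarz.
Qed.

Lemma norm2Z D f k : measurable D -> L2 D f ->
  norm2 D (fun x => k * f x) = `|k| * norm2 D f.
Proof.
move=> mD [mf fi]; rewrite /norm2; under eq_Rintegral do rewrite exprMn.
rewrite RintegralZl// sqrtrM ?sqr_ge0// sqrtr_sqr//.
Qed.

Lemma norm2D D f g : measurable D -> L2 D f -> L2 D g ->
  norm2 D (fun x => f x + g x) <= norm2 D f + norm2 D g.
Proof.
move=> mD fi gi; have fgi := L2M mD fi gi.
have [_ fi2] := fi; have [_ gi2] := gi.
rewrite -(@ler_pXn2r _ 2)// ?nnegrE ?addr_ge0 ?norm2_ge0//.
rewrite norm2_sqr (_ : (fun x => _) = (fun x => (f x ^+ 2 + 2 * (f x * g x))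
      + g x ^+ 2)); last by apply/funext => x; ring.
rewrite RintegralD//; last exact: (l_intgD _ _ (l_intgZ _ _ _)).
rewrite RintegralD//; last exact: l_intgZ.
rewrite RintegralZl// -!norm2_sqr.
have := le_trans (ler_norm _) (CS_norm mD fi gi).
move: (norm2 _ f) (norm2 _ g) => p q; lra.
Qed.

Lemma norm2_le D f g : measurable D -> measurable_fun D f -> L2 D g ->
  {ae leb, forall x, D x -> `|f x| <= `|g x|} -> norm2 D f <= norm2 D g.
Proof.
move=> mD mf gi fg; have [_ fi2] := L2_le mD mf gi fg; have [_ gi2] := gi.
rewrite ler_wsqrtr//; apply: l_ae_le_Rint => //.
apply: (lebS fg) => x + Dx => /(_ Dx) fgx.
by rewrite -[g x ^+ 2]real_normK ?num_real// -[f x ^+ 2]real_normK ?num_real// lerXn2r ?nnegrE.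
Qed.

Lemma norm2N D f : norm2 D (fun x => - f x) = norm2 D f.
Proof. by rewrite /norm2; under eq_Rintegral do rewrite sqrrN. Qed.

Lemma norm2_ae D f g : measurable D -> measurable_fun D f -> measurable_fun D g ->
  {ae leb, forall x, D x -> f x = g x} -> norm2 D f = norm2 D g.
Proof.
move=> mD mf mg fg; rewrite /norm2 (@ae_eq_Rint _ _ _ leb D _ (fun x => g x ^+ 2))//;
  try exact: measurable_funX.
by apply: (lebS fg) => x + Dx => ->.
Qed.

Lemma norm2_0 D : measurable D -> norm2 D (fun=> 0) = 0.
Proof.
move=> mD; rewrite /norm2; under eq_Rintegral do rewrite expr0n/=.
by rewrite Rintegral_cst// mul0r sqrtr0.
Qed.

Lemma Rint_norm_norm2 D f : measurable D -> (leb D < +oo)%E -> L2 D f ->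
  \int[leb]_(x in D) `|f x| <= Num.sqrt (fine (leb D)) * norm2 D f.
Proof.
move=> mD Doo fi; have afi : L2 D (fun x => `|f x|).
  apply: (L2_le mD _ fi); first by case: fi => mf _; exact: measurableT_comp.
  by apply: aeW => x _; rewrite normr_id.
have := CS_norm mD (L2_1 mD Doo) afi; under eq_Rintegral do rewrite mul1r.
move=> /(le_trans (ler_norm _))/le_trans; apply.
rewrite /norm2; under eq_Rintegral do rewrite expr1n.
rewrite Rintegral_cst// mul1r.
by under eq_Rintegral do rewrite real_normK ?num_real//.
Qed.

Lemma norm2_eq0 D f : measurable D -> L2 D f -> norm2 D f = 0 ->
  {ae leb, forall x, D x -> f x = 0}.
Proof.
move=> mD [mf fi] f0; have := l_ae_eq0_Rint mD fi.
rewrite -norm2_sqr f0 expr0n/= lexx => /(_ _ isT) [].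
  by apply: aeW => x _; exact: sqr_ge0.
move=> A [mA A0 AD]; exists A; split => // x /= xn; apply: AD => /=; apply: contra_not xn => h Dx.
by have /eqP := h Dx; rewrite expf_eq0/= => /eqP.
Qed.

End L2_space.

(** * Absolutely continuous paths *)

Section Variation.
Context {R : realType}.
(** [dl s t] stands for the distance between the values of a path at times [s] and [t]. The axioms
    are asked on [0, T] only, where the path takes its values in H^1. *)
Variables (T : R) (dl : R -> R -> R).
Implicit Types (l : seq (R * R)) (xs ys : seq R) (p q : R * R).
Local Notation ok t := (0 <= t <= T).

Definition disj_itv p q := (p.2 <= q.1) || (q.2 <= p.1).
Definition good_itv p := [&& 0 <= p.1, p.1 <= p.2 & p.2 <= T].
Definition good_itvs l := all good_itv l && pairwise disj_itv l.

Fixpoint itvs (s : R) xs := if xs is x :: ys then (s, x) :: itvs x ys else [::].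

Let len l := \sum_(p <- l) (p.2 - p.1).
Let tot l := \sum_(p <- l) dl p.1 p.2.

Hypothesis dl_ge0 : forall s t, ok s -> ok t -> 0 <= dl s t.
Hypothesis dlxx : forall s, ok s -> dl s s = 0.
Hypothesis dl_triangle : forall r s t, ok r -> ok s -> ok t ->
  dl r t <= dl r s + dl s t.
Hypothesis dl_ac : abs_continuous dl T id.

(** Families indexed by ['I_n] become lists, which can be concatenated and refined. *)
Lemma abs_continuous_seq (eta : R) : 0 < eta -> exists2 delta, 0 < delta &
  forall l, good_itvs l -> len l < delta -> tot l < eta.
Proof.
move=> /dl_ac[delta d0 H]; exists delta => // l /andP[/allP gl pl] ll.
have := H (size l) (fun i => (nth (0, 0) l i).1) (fun i => (nth (0, 0) l i).2).
rewrite /len (big_nth (0, 0)) big_mkord in ll *.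
rewrite /tot (big_nth (0, 0)) big_mkord; apply => //.
- by move=> i; have /and3P[] := gl _ (mem_nth (0, 0) (ltn_ord i)).
- move=> i j ij; have /pairwiseP := pl => /(_ (0, 0)) pl'.
  have [ltij|ltji|/ord_inj eij] := ltngtP i j; last by rewrite eij eqxx in ij.
  + by have /orP := pl' _ _ (ltn_ord i) (ltn_ord j) ltij.
  + by have /orP[|] := pl' _ _ (ltn_ord j) (ltn_ord i) ltji; [right|left].
Qed.

Lemma itvs_cat s xs ys : itvs s (xs ++ ys) = itvs s xs ++ itvs (last s xs) ys.
Proof. by elim: xs s => //= x xs IH s; rewrite IH. Qed.

Lemma mem_itvs s xs p : path <=%R s xs -> p \in itvs s xs ->
  [/\ s <= p.1, p.1 <= p.2 & p.2 <= last s xs].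
Proof.
elim: xs s => //= x xs IH s /andP[sx px]; rewrite inE => /predU1P[->|pin] /=.
  split => //; elim: (xs) (x) px => //= y ys IHy x' /andP[xy /IHy].
  exact: le_trans.
by have [xp1 ? ?] := IH _ px pin; split => //; exact: le_trans xp1.
Qed.

Lemma pairwise_itvs s xs : path <=%R s xs -> pairwise disj_itv (itvs s xs).
Proof.
elim: xs s => //= x xs IH s /andP[sx px]; rewrite IH// andbT.
by apply/allP => p /(mem_itvs px)[xp _ _]; rewrite /disj_itv /= xp.
Qed.

Lemma len_itvs s xs : len (itvs s xs) = last s xs - s.
Proof.
rewrite /len; elim: xs s => [|x xs IH] s /=; first by rewrite big_nil subrr.
by rewrite big_cons IH /=; ring.
Qed.

Lemma good_itvs_path s xs : ok s -> path <=%R s xs -> last s xs <= T ->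
  good_itvs (itvs s xs).
Proof.
move=> /andP[s0 sT] px lT; rewrite /good_itvs pairwise_itvs// andbT.
apply/allP => p /(mem_itvs px)[sp pp pl].
by rewrite /good_itv pp (le_trans s0 sp) (le_trans pl lT).
Qed.

Definition chain s t xs := path <=%R s xs && (last s xs == t).

(** Inserting [m] splits one interval of the chain, and by the triangle inequality this can only
    raise the sum. *)
Lemma chain_insert s m t xs : ok s -> ok t -> s <= m -> m <= t -> chain s t xs ->
  exists ys zs, [/\ chain s m ys, chain m t zs &
    tot (itvs s xs) <= tot (itvs s ys) + tot (itvs m zs)].
Proof.
rewrite /chain /tot => oks okt; elim: xs s oks => [|x xs IH] s oks sm mt /=.
  move=> /eqP st; subst t.
  have -> : m = s by apply/eqP; rewrite eq_le mt.
  by exists [::], [::]; rewrite /= eqxx !big_nil addr0.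
move=> /andP[/andP[sx px] /eqP lt].
have xt : x <= t.
  rewrite -lt; elim: (xs) (x) px => //= y ys IHy x' /andP[xy /IHy].
  exact: le_trans.
have okx : ok x.
  by case/andP: oks => s0 _; case/andP: okt => _ tT; rewrite (le_trans s0 sx) (le_trans xt tT).
have [xm|mx] := leP x m.
  have [|ys [zs [/andP[pys lys] czs h]]] := IH x okx xm mt; first by rewrite px lt eqxx.
  exists (x :: ys), zs; split => //=; first by rewrite sx pys.
  by rewrite !big_cons/= -addrA lerD2l.
exists [:: m], (x :: xs); split => /=; rewrite ?sm ?eqxx ?(ltW mx) ?px ?lt ?eqxx//.
rewrite !big_cons big_nil /= addr0 addrA lerD2r dl_triangle//.
by case/andP: oks => s0 _; case/andP: okt => _ tT; rewrite (le_trans s0 sm) (le_trans mt tT).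
Qed.

Let sums s t := [set tot (itvs s xs) | xs in [set xs | chain s t xs]].

(** A chain over a length below [delta] contributes at most 1, and [0, T] is cut into finitely many
    such lengths; their number is the bound. *)
Lemma chain_bounded : exists M, forall s t xs, ok s -> ok t -> chain s t xs ->
  tot (itvs s xs) <= M.
Proof.
have [delta d0 H] := abs_continuous_seq ltr01.
(* Pieces have length delta / 2, so that each is strictly shorter than the [delta] of the
   modulus. *)
have step n s t xs : ok s -> ok t -> chain s t xs -> t - s < n%:R * (delta / 2) ->
    tot (itvs s xs) <= n%:R.
  elim: n s t xs => [|n IH] s t xs oks okt cxs.
    rewrite mul0r subr_lt0 => ts; have /andP[pxs /eqP lxs] := cxs.
    have := len_itvs s xs; rewrite lxs => lts.
    have : 0 <= len (itvs s xs).
      rewrite /len big_seq; apply: sumr_ge0 => p /(mem_itvs pxs)[_ pp _].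
      by rewrite subr_ge0.
    by rewrite lts subr_ge0 leNgt ts.
  move=> ts; have /andP[pxs /eqP lxs] := cxs.
  have [ht|ht] := leP (t - s) (delta / 2).
    apply: ltW; apply: (@lt_le_trans _ _ 1); last by rewrite ler1n.
    apply: H; last by rewrite len_itvs lxs (le_lt_trans ht)// ltr_pdivrMr// ltr_pMr// ltr1n.
    by apply: good_itvs_path => //; rewrite lxs; case/andP: okt.
  have h0 : 0 < delta / 2 by rewrite divr_gt0.
  have sm : s <= s + delta / 2 by rewrite lerDl ltW.
  have mt : s + delta / 2 <= t by rewrite addrC -lerBrDr ltW.
  have okm : ok (s + delta / 2).
    by case/andP: oks => s0 _; case/andP: okt => _ tT; rewrite (le_trans s0 sm) (le_trans mt tT).
  have [ys [zs [cys czs /le_trans]]] := chain_insert oks okt sm mt cxs; apply.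
  have A : tot (itvs s ys) <= 1.
    have /andP[pys /eqP lys] := cys.
    apply: ltW; apply: H; first by apply: good_itvs_path => //; rewrite lys; case/andP: okm.
    by rewrite len_itvs lys addrC addKr ltr_pdivrMr// ltr_pMr// ltr1n.
  have B : tot (itvs (s + delta / 2) zs) <= n%:R.
    by apply: (IH _ t) => //; move: ts; rewrite -natr1; lra.
  by rewrite -natr1; lra.
have [n hn] : exists n : nat, T < n%:R * (delta / 2).
  have h0 : 0 < delta / 2 by rewrite divr_gt0.
  exists (Num.truncn (T / (delta / 2))).+1; rewrite -ltr_pdivrMr//.
  exact: truncnS_gt.
exists n%:R => s t xs oks okt cxs; apply: (step _ _ t) => //.
by apply: le_lt_trans hn; case/andP: oks => s0 _; case/andP: okt => _ tT; lra.
Qed.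

Let var s t := sup (sums s t).

Lemma chain1 s t : s <= t -> chain s t [:: t].
Proof. by move=> st; rewrite /chain /= st eqxx. Qed.

Let has_sup_sums s t : ok s -> ok t -> s <= t -> has_sup (sums s t).
Proof.
move=> oks okt st; split; first by exists (tot (itvs s [:: t])), [:: t]; [exact: chain1|].
by have [M HM] := chain_bounded; exists M => _ [xs cxs <-]; exact: HM cxs.
Qed.

Let var_ub s t xs : ok s -> ok t -> s <= t -> chain s t xs -> tot (itvs s xs) <= var s t.
Proof.
move=> oks okt st cxs; have [_ hs] := has_sup_sums oks okt st.
by apply: ub_le_sup => //; exists xs.
Qed.

Let var_add s m t : ok s -> ok m -> ok t -> s <= m -> m <= t ->
  var s t = var s m + var m t.
Proof.
move=> oks okm okt sm mt; have st := le_trans sm mt.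
apply/eqP; rewrite eq_le; apply/andP; split.
  apply: ge_sup; first by case: (has_sup_sums oks okt st).
  move=> _ [xs cxs <-]; have [ys [zs [cys czs /le_trans]]] := chain_insert oks okt sm mt cxs.
  by apply; rewrite lerD// var_ub.
rewrite -lerBrDr; apply: ge_sup; first by case: (has_sup_sums oks okm sm).
move=> _ [ys cys <-]; rewrite lerBrDl -lerBrDr.
apply: ge_sup; first by case: (has_sup_sums okm okt mt).
move=> _ [zs czs <-]; rewrite lerBrDl.
have /andP[pys /eqP lys] := cys; have /andP[pzs /eqP lzs] := czs.
have := @var_ub s t (ys ++ zs) oks okt st; rewrite /chain cat_path last_cat lys pys pzs lzs eqxx.
by move/(_ isT); rewrite itvs_cat lys {1}/tot big_cat.
Qed.

(** Each interval is replaced by a chain that misses its variation by less than [c]. The total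
    length does not change, so the modulus of absolute continuity applies to the refined list. That
    new intervals lie inside old ones is carried along to keep them disjoint. *)
Let refine l c : 0 < c -> good_itvs l -> exists l', [/\ good_itvs l',
  len l' = len l, (forall p, p \in l' -> exists2 q, q \in l & q.1 <= p.1 /\ p.2 <= q.2) &
  \sum_(p <- l) var p.1 p.2 <= tot l' + c * (size l)%:R].
Proof.
move=> c0; elim: l => [|[s t] l IH].
  by move=> _; exists [::]; split => //; rewrite /tot !big_nil mulr0 addr0.
rewrite /good_itvs /= => /andP[/andP[gst gl] /andP[dl' pl]].
have [|l' [/andP[gl' pl'] ll' sub le']] := IH; first by rewrite /good_itvs gl pl.
have /and3P[/= s0 st tT] := gst.
have oks : ok s by rewrite s0 (le_trans st tT).
have okt : ok t by rewrite tT (le_trans s0 st).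
have [_ [xs cxs <-] hx] := sup_adherent c0 (has_sup_sums oks okt st).
have /andP[pxs /eqP lxs] := cxs.
have lT : last s xs <= T by rewrite lxs.
have /andP[gx px] := good_itvs_path oks pxs lT.
exists (itvs s xs ++ l'); split.
- rewrite /good_itvs all_cat gx gl' pairwise_cat px pl' /= !andbT.
  apply/allrelP => p q pin /sub[q' q'in [q'q qq']].
  have [sp pp] := mem_itvs pxs pin; rewrite lxs => pt.
  have /allP /(_ _ q'in) := dl'; rewrite /disj_itv /= => /orP[tq|qs].
    by rewrite (le_trans pt (le_trans tq q'q)).
  by rewrite (le_trans qq' (le_trans qs sp)) orbT.
- by rewrite /len big_cat big_cons/= -/(len (itvs s xs)) len_itvs lxs -/(len l') ll'.
- move=> p; rewrite mem_cat => /orP[/(mem_itvs pxs)[sp pp]|/sub[q qin qp]].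
    by rewrite lxs => pt; exists (s, t); rewrite ?inE ?eqxx.
  by exists q => //; rewrite inE qin orbT.
- rewrite /tot big_cat big_cons/= -/(tot l') -/(tot (itvs s xs)) -natr1.
  by move: hx; rewrite -/(var s t); lra.
Qed.

(** [V] is the total variation from 0 to t. Its absolute continuity follows by testing the modulus
    of the path on refinements of the given intervals. *)
Lemma variation_function : exists V : R -> R, abs_continuous Rdist T V /\
  forall s t, 0 <= s -> s <= t -> t <= T -> dl s t <= V t - V s.
Proof.
exists (var 0); have varB s t : 0 <= s -> s <= t -> t <= T -> var 0 t - var 0 s = var s t.
  move=> s0 st tT; rewrite (@var_add 0 s t)//; last first.
  - by rewrite (le_trans s0 st).
  - by rewrite s0 (le_trans st).
  - by rewrite lexx (le_trans s0 (le_trans st tT)).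
  by ring.
have var_ge s t : 0 <= s -> s <= t -> t <= T -> dl s t <= var s t.
  move=> s0 st tT; have := @var_ub s t [:: t]; rewrite /tot big_cons big_nil addr0.
  by apply; rewrite ?s0 ?tT ?(le_trans s0 st) ?(le_trans st tT)// chain1.
split; last by move=> s t *; rewrite varB// var_ge.
move=> eta eta0; have [|delta d0 H] := @abs_continuous_seq (eta / 2); first by rewrite divr_gt0.
exists delta => // n a b ab disj lab.
pose l := [seq (a i, b i) | i <- enum 'I_n].
have gl : good_itvs l.
  apply/andP; split; first by apply/allP => p /mapP[i _ ->]; apply/and3P; exact: ab.
  rewrite pairwise_map; apply: (@sub_pairwise _ (fun i j => i != j)); last first.
    by rewrite -uniq_pairwise enum_uniq.
  by move=> i j ij; apply/orP; exact: disj.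
(* The [n] intervals lose at most [c] each, hence at most eta / 2 together; n + 1 avoids a division
   by 0. *)
pose c := eta / (2 * (n.+1)%:R).
have c0 : 0 < c by rewrite divr_gt0// mulr_gt0.
have [l' [gl' ll' _ le']] := refine c0 gl.
have ll : len l' < delta by rewrite ll' /len big_map big_enum.
have := H l' gl' ll => tl'.
rewrite (eq_bigr (fun i => var (a i) (b i))); last first.
  move=> i _; have [a0 ab' bT] := ab i; rewrite /Rdist distrC varB// ger0_norm//.
  apply: le_trans (var_ge _ _ a0 ab' bT); apply: dl_ge0.
    by rewrite a0 (le_trans ab').
  by rewrite bT (le_trans a0).
move: le'; rewrite /l size_map big_map big_enum /= size_enum_ord => /le_lt_trans; apply.
have : c * n%:R <= eta / 2; last lra.
have n0 : (n.+1%:R : R) != 0 by rewrite pnatr_eq0.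
have : c * n.+1%:R = eta / 2 by rewrite /c; field.
by rewrite -natr1; lra.
Qed.

End Variation.

(** The absolute continuity of every component of the limit is reduced to that of the variation of
    [w] by this domination. Dividing by [K + 1] covers the case K = 0. *)
Lemma abs_continuous_dominated {R : realType} (X : Type) (dist : X -> X -> R) (T K : R)
    (V : R -> R) (f : R -> X) : abs_continuous Rdist T V -> 0 <= K ->
  (forall s t, 0 <= s -> s <= t -> t <= T -> dist (f s) (f t) <= K * `|V t - V s|) ->
  abs_continuous dist T f.
Proof.
move=> acV K0 fV eta eta0; have K1 : 0 < K + 1 by rewrite ltr_wpDl.
have [|delta d0 H] := acV (eta / (K + 1)); first by rewrite divr_gt0.
exists delta => // n a b ab disj lab.
apply: (@le_lt_trans _ _ ((K + 1) * \sum_(i < n) Rdist (V (a i)) (V (b i)))).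
  rewrite mulr_sumr; apply: ler_sum => i _; have [? ? ?] := ab i.
  rewrite (le_trans (fV _ _ _ _ _))// /Rdist distrC ler_wpM2r//; lra.
by rewrite mulrC -ltr_pdivlMr//; exact: H.
Qed.

(** * Stieltjes measures of absolutely continuous functions *)

Section Stieltjes_density.
Context {R : realType}.
Local Notation leb := (@lebesgue_measure R).
Local Notation ls := lebesgue_stieltjes_measure.

Lemma lebesgue_stieltjes_itv (F : cumulative R R) (a b : R) : a <= b ->
  ls F `]a, b]%classic = (F b - F a)%:E.
Proof.
move=> ab; rewrite /lebesgue_stieltjes_measure /measure_extension/=.
by rewrite measurable_mu_extE/=; [rewrite wlength_itv_bnd|exact: is_ocitv].
Qed.

Variables (T : R) (F : cumulative R R).
Hypothesis T0 : 0 < T.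
Hypothesis F_ac : abs_continuous Rdist T F.

Let dl s t := Rdist (F s) (F t).

(** The trace of ]p.1, p.2] on ]0, T], where absolute continuity is known. An empty trace is encoded
    as (0, 0), which is still a good interval and has increment 0. *)
Let clip (p : R * R) : R * R :=
  let a := Num.max 0 p.1 in let b := Num.min T p.2 in
  if a < b then (a, b) else (0, 0).

Let clip_good p : good_itv T (clip p).
Proof.
rewrite /clip /good_itv; case: ifPn => /= [ab|_]; last by rewrite lexx (ltW T0).
by rewrite le_max lexx (ltW ab) ge_min lexx.
Qed.

Let clip_cases p : (clip p).1 < (clip p).2 \/ clip p = (0, 0).
Proof. by rewrite /clip; case: ifPn => /= ?; [left|right]. Qed.

Let clipE p : `]p.1, p.2]%classic `&` `]0, T]%classic = `](clip p).1, (clip p).2]%classic.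
Proof.
rewrite /clip; apply/seteqP; split => x /=; rewrite !in_itv/=.
  move=> [/andP[px xp] /andP[x0 xT]].
  have m1 : Num.max 0 p.1 < x by rewrite gt_max x0 px.
  have m2 : x <= Num.min T p.2 by rewrite le_min xp xT.
  by rewrite (lt_le_trans m1 m2)/= m1 m2.
case: ifPn => /= ab; last by move=> /andP[x0 /(lt_le_trans x0)]; rewrite ltxx.
by move=> /andP[]; rewrite gt_max le_min => /andP[-> ->] /andP[-> ->].
Qed.

Let clip_disj p q : p.1 < p.2 -> q.1 < q.2 -> [disjoint `]p.1, p.2]%classic & `]q.1, q.2]%classic] ->
  disj_itv (clip p) (clip q).
Proof.
move=> pp qq dpq; rewrite /disj_itv; have /and3P[c0 cc cT] := clip_good p.
have /and3P[d0 dd dT] := clip_good q.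
apply/negPn/negP; rewrite negb_or -!ltNge => /andP[h1 h2].
have hp : (clip p).1 < (clip p).2.
  by have [//|e] := clip_cases p; move: h1 d0; rewrite e /= => /lt_le_trans h /h; rewrite ltxx.
have hq : (clip q).1 < (clip q).2.
  by have [//|e] := clip_cases q; move: h2 c0; rewrite e /= => /lt_le_trans h /h; rewrite ltxx.
pose x := Num.min (clip p).2 (clip q).2.
move: dpq; apply/negP/set0P; exists x; split.
  have : (`](clip p).1, (clip p).2]%classic) x by rewrite /= in_itv/= /x lt_min hp h2 ge_min lexx.
  by rewrite -clipE => -[].
have : (`](clip q).1, (clip q).2]%classic) x by rewrite /= in_itv/= /x lt_min hq h1 ge_min lexx orbT.
by rewrite -clipE => -[].
Qed.

(** The intervals of a cover may overlap, whereas absolute continuity speaks of disjoint ones: the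
    finite union is first rewritten as a disjoint union of half-open intervals. *)
Lemma stieltjes_ocitv_small (eta : R) : 0 < eta -> exists2 delta, 0 < delta &
  forall (B : nat -> set R) n, (forall k, ocitv (B k)) ->
    (leb (\big[setU/set0]_(k < n) B k) < delta%:E)%E ->
    (ls F (\big[setU/set0]_(k < n) B k `&` `]0%R, T]%classic) <= eta%:E)%E.
Proof.
move=> /(@abs_continuous_seq _ T dl F_ac)[delta d0 H]; exists delta => // B n Bo.
set U := \big[setU/set0]_(k < n) B k => Ud.
have [D [finD D0 tD mD UE]] : exists D : set (set R),
    [/\ finite_set D, forall X, D X -> X !=set0, trivIset D id,
      forall X, X \in D -> ocitv X & U = \bigcup_(X in D) X].
  apply: (@SetRing.ring_finite_set _ (ocitv_type R) U).
  apply: bigsetU_measurable => k _.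
  exact: (sub_gen_smallest (Bo k)).
have /choice[ab abP] : forall X : set R, exists p : R * R, D X -> p.1 < p.2 /\ X = `]p.1, p.2]%classic.
  move=> X; have [DX|] := pselect (D X); last by exists (0, 0).
  have /ocitvP[X0|[p pp ->]] := mD X (mem_set DX); last by exists p.
  by have := D0 X DX; rewrite X0 => -[].
pose sD := finmap.enum_fset (fset_set D).
pose l := [seq clip (ab X) | X <- sD].
have inD X : X \in sD -> D X by move=> h; apply/set_mem; rewrite -(in_fset_set finD).
have gl : good_itvs T l.
  apply/andP; split; first by apply/allP => p /mapP[X _ ->]; exact: clip_good.
  rewrite pairwise_map.
  apply: (@sub_in_pairwise _ (mem sD) (fun X Y => X != Y)); last first.
  - by rewrite -uniq_pairwise finmap.fset_uniq.
  - by apply/allP.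
  move=> X Y /inD DX /inD DY XY /=.
  have [pX eX] := abP X DX; have [pY eY] := abP Y DY.
  apply: clip_disj => //; rewrite -eX -eY; apply/disj_setPS => x XYx.
  by case/eqP: XY; apply: (tD X Y DX DY); exists x.
have mI (X : set R) : D X -> measurable (X : set (measurableTypeR R)).
  by move=> DX; have [_ ->] := abP X DX.
have sumE (G : cumulative R R) : ls G (U `&` `]0%R, T]%classic)
    = (\sum_(p <- l) (G p.2 - G p.1))%:E.
  rewrite UE setI_bigcupl measure_fin_bigcup//; last first.
  - by move=> X DX; apply: measurableI => //; exact: mI.
  - by move=> X Y DX DY [x [[xX _] [xY _]]]; apply: tD => //; exists x.
  rewrite fsbig_finite//= -sumEFin /l big_map big_seq [RHS]big_seq; apply: eq_bigr => X /inD DX.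
  have [_ eX] := abP X DX; rewrite [in LHS]eX clipE lebesgue_stieltjes_itv//.
  by have /and3P[] := clip_good (ab X).
rewrite sumE lee_fin; apply/ltW; apply: le_lt_trans (H l gl _).
  by apply: ler_sum => p _; rewrite /dl /Rdist distrC ler_norm.
rewrite -lte_fin; apply: le_lt_trans Ud.
have -> : (\sum_(p <- l) (p.2 - p.1))%:E = leb (U `&` `]0%R, T]%classic).
  by rewrite /lebesgue_measure sumE.
have mU : measurable (U : set (measurableTypeR R)).
  by rewrite /U; apply: bigsetU_measurable => k _; have /ocitvP[->|[p _ ->]] := Bo k.
by apply: le_measure; rewrite ?inE//; exact: measurableI.
Qed.

Definition stieltjes_restr := mrestr (ls F) (measurable_itv `]0, T]).

Lemma stieltjes_restr_itv (a b : R) : 0 <= a -> a <= b -> b <= T ->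
  stieltjes_restr `]a, b]%classic = (F b - F a)%:E.
Proof.
move=> a0 ab bT; rewrite /stieltjes_restr /mrestr (_ : _ `&` _ = `]a, b]%classic).
  exact: lebesgue_stieltjes_itv.
apply/seteqP; split => x /=; rewrite !in_itv/=; first by case.
by move=> /andP[ax xb]; rewrite ax xb (le_lt_trans a0 ax) (le_trans xb bT).
Qed.

(** A Lebesgue-null set has a cover by half-open intervals of total length below [delta]. The finite
    unions of the cover have Stieltjes measure at most [eta], and continuity from below passes this
    to the whole cover. *)
Lemma stieltjes_dominates : stieltjes_restr `<< leb.
Proof.
move=> N /= nN A mA AN; have A0 := nN A mA AN.
apply/eqP; rewrite eq_le measure_ge0 andbT.
apply/lee_addgt0Pr => eta eta0; rewrite add0e.
have [delta d0 H] := stieltjes_ocitv_small eta0.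
have : (leb A < delta%:E)%E by rewrite A0 lte_fin.
rewrite {1}/lebesgue_measure /lebesgue_stieltjes_measure /measure_extension /=.
rewrite /mu_ext => /ereal_inf_lt[_ [B [Bo AB] <-]] Bd.
have mB k : measurable (B k : set (measurableTypeR R)) by have /ocitvP[->|[p _ ->]] := Bo k.
pose U n := \big[setU/set0]_(k < n) B k.
have mU n : measurable (U n : set (measurableTypeR R)) by exact: bigsetU_measurable.
have cvU : ls F (U n `&` `]0%R, T]%classic) @[n --> \oo] --> ls F (\bigcup_n (U n `&` `]0%R, T]%classic)).
  apply: nondecreasing_cvg_mu.
  - by move=> n; exact: measurableI.
  - by apply: bigcup_measurable => n _; exact: measurableI.
  - move=> m n mn; apply/subsetPset => x []; rewrite /U -!bigcup_mkord.
    by move=> [k /= km Bx] xT; split => //; exists k => //=; exact: leq_trans km mn.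
have Ueta n : (ls F (U n `&` `]0%R, T]%classic) <= eta%:E)%E.
  apply: H; first by move=> k; exact: Bo.
  apply: le_lt_trans Bd; apply: le_trans (nneseries_lim_ge n _) => //.
  rewrite big_mkord; apply: le_trans (Boole_inequality _ _) _ => //.
  apply: lee_sum => k _; rewrite le_eqVlt; apply/orP; left; apply/eqP.
  have <- : leb (B k) = wlength idfun (B k); last by [].
  rewrite /lebesgue_measure /lebesgue_stieltjes_measure /measure_extension.
  by rewrite measurable_mu_extE//; exact: Bo.
apply: (@le_trans _ _ (ls F (\bigcup_n (U n `&` `]0%R, T]%classic)))).
  apply: le_measure; rewrite ?inE.
  - exact: measurableI.
  - by apply: bigcup_measurable => n _; exact: measurableI.
  - move=> x [/AB[k _ Bx] xT]; exists k.+1 => //; split => //.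
    by rewrite /U -bigcup_mkord; exists k => //=.
by rewrite -(cvg_lim _ cvU)//; apply: lime_le; [apply/cvg_ex; eexists; exact: cvU|exact: nearW].
Qed.

End Stieltjes_density.

(** * Densities and almost everywhere derivatives *)

Section Absolutely_continuous.
Context {R : realType}.
Local Notation leb := (@lebesgue_measure R).

(** Composition with the projection on [0, T] extends a function by constants, so that notions on
    the whole line, such as cumulative functions and measurability, apply to functions of time. *)
Definition clamp (T t : R) : R := Num.max 0 (Num.min T t).

Lemma clampE (T t : R) : 0 <= t <= T -> clamp T t = t.
Proof. by move=> /andP[t0 tT]; rewrite /clamp (min_idPr tT) (max_idPr t0). Qed.

Lemma clamp_itv (T t : R) : 0 <= T -> 0 <= clamp T t <= T.
Proof. by move=> T0; rewrite /clamp le_max lexx/= ge_max T0 ge_min lexx. Qed.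

Lemma clamp_le (T s t : R) : s <= t -> clamp T s <= clamp T t.
Proof.
move=> st; rewrite /clamp ge_max !le_max lexx/= le_min !ge_min lexx st /= orbT.
by rewrite orbT.
Qed.

Lemma clamp_dist (T s t : R) : 0 <= T -> s <= t -> clamp T t - clamp T s <= t - s.
Proof.
move=> T0 st; rewrite /clamp /Num.max /Num.min.
by repeat case: ifPn; rewrite -?leNgt => *; lra.
Qed.

Lemma abs_continuous_cont (T : R) (V : R -> R) : abs_continuous Rdist T V ->
  forall eta, 0 < eta -> exists2 delta, 0 < delta & forall s t, 0 <= s -> s <= t -> t <= T ->
    t - s < delta -> `|V s - V t| < eta.
Proof.
move=> ac eta /ac[delta d0 H]; exists delta => // s t s0 st tT std.
have := H 1%N (fun=> s) (fun=> t); rewrite !big_ord_recl !big_ord0 !addr0; apply => //.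
by move=> i j; rewrite !ord1 eqxx.
Qed.

(* Radon-Nikodym applied to the Stieltjes measure of V. *)
Lemma nondecreasing_ac_density (T : R) (V : R -> R) : 0 < T ->
  (forall s t, 0 <= s -> s <= t -> t <= T -> V s <= V t) ->
  abs_continuous Rdist T V ->
  exists2 g : R -> R, L1 setT g & forall s t, 0 <= s -> s <= t -> t <= T ->
    V t - V s = \int[leb]_(x in `]s, t]) g x.
Proof.
move=> T0 Vnd ac; pose F t := V (clamp T t).
have Fnd : nondecreasing F.
  move=> s t st; have /andP[s0 sT] := clamp_itv s (ltW T0).
  by have /andP[t0 tT] := clamp_itv t (ltW T0); apply: Vnd => //; exact: clamp_le.
have Frc : right_continuous F.
  move=> x; apply/cvgrPdist_lt => e e0; have [delta d0 H] := abs_continuous_cont ac e0.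
  near=> y; have xy : x <= y by [].
  have /andP[s0 _] := clamp_itv x (ltW T0); have /andP[_ tT] := clamp_itv y (ltW T0).
  apply: H => //; first exact: clamp_le.
  apply: le_lt_trans (clamp_dist (ltW T0) xy) _.
  by rewrite ltrBlDl; near: y; apply: nbhs_right_lt; rewrite ltrDl.
pose Fc : cumulative R R := HB.pack_for (cumulative R R) F (isCumulative.Build R _ R F Fnd Frc).
have Fac : abs_continuous Rdist T Fc.
  apply: (abs_continuous_dominated ac ler01) => s t s0 st tT.
  rewrite mul1r /Rdist distrC /= /F !clampE//; first by rewrite s0 (le_trans st).
  by rewrite tT (le_trans s0).
have dom := stieltjes_dominates T0 Fac.
have nuoo : (lebesgue_stieltjes_measure Fc `]0%R, T]%classic < +oo)%E.
  by rewrite lebesgue_stieltjes_itv ?ltry// ltW.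
have mI : @measurable _ (measurableTypeR R) `]0, T]%classic by exact: measurable_itv.
pose nu : {finite_measure set (measurableTypeR R) -> \bar R} := mfrestr mI nuoo.
have [f [f0 ffin fi fE]] := @radon_nikodym_sigma_finite _ _ R leb nu dom.
exists (fine \o f).
  by move: fi; apply: eq_integrable => // x _ /=; rewrite fineK.
move=> s t s0 st tT.
have : nu `]s, t]%classic = (F t - F s)%:E by apply: stieltjes_restr_itv.
rewrite fE// /F !clampE ?s0 ?tT ?(le_trans st) ?(le_trans s0)// => h.
rewrite /Rintegral -[LHS]/(fine (V t - V s)%:E) -h; congr fine; apply: eq_integral => x _.
by rewrite /= fineK.
Unshelve. all: by end_near. Qed.

(** [V] and [V + f] are both nondecreasing and absolutely continuous; their densities are
    subtracted. *)
Lemma ac_density (T : R) (V f : R -> R) : 0 < T -> abs_continuous Rdist T V ->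
  (forall s t, 0 <= s -> s <= t -> t <= T -> `|f t - f s| <= V t - V s) ->
  exists2 g : R -> R, L1 setT g & forall s t, 0 <= s -> s <= t -> t <= T ->
    f t - f s = \int[leb]_(x in `]s, t]) g x.
Proof.
move=> T0 ac fV.
have Vnd s t : 0 <= s -> s <= t -> t <= T -> V s <= V t.
  by move=> s0 st tT; rewrite -subr_ge0; apply: le_trans (fV _ _ s0 st tT).
have [g gi gE] := nondecreasing_ac_density T0 Vnd ac.
have [||h hi hE] := @nondecreasing_ac_density T (fun t => V t + f t) T0.
- move=> s t s0 st tT; have := fV _ _ s0 st tT; rewrite ler_norml => /andP[? ?]; lra.
- apply: (abs_continuous_dominated ac (ler0n _ 2)) => s t s0 st tT; rewrite /Rdist.
  rewrite [leRHS](_ : _ = `|V t - V s| + `|V t - V s|); last ring.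
  rewrite (_ : _ - _ = - ((V t - V s) + (f t - f s))); last ring.
  rewrite normrN (le_trans (ler_normD _ _))// lerD2l.
  by rewrite (le_trans (fV _ _ s0 st tT))// ler_norm.
exists (fun x => h x - g x); first exact: l_intgB.
move=> s t s0 st tT; rewrite RintegralB//; [|exact: l_intgS hi|exact: l_intgS gi].
by rewrite -hE// -gE//; ring.
Qed.

Lemma derivable_quot (F : R -> R) (t : R) : derivable F t 1 ->
  (F s - F t) / (s - t) @[s --> t^'] --> derive1 F t.
Proof.
move=> dF; have : (fun h => h^-1 *: ((F \o shift t) (h *: 1) - F t)) h @[h --> 0^'] --> derive1 F t.
  by rewrite derive1E; exact: dF.
move=> /cvgrPdist_lt cF; apply/cvgrPdist_lt => e e0.
have := cF e e0; rewrite /prop_near1 /= /dnbhs /within /=.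
move=> /nbhs_ballP[d d0 H]; apply/nbhs_ballP; exists d => //= s ts st.
have := H (s - t); rewrite /ball /= sub0r normrN distrC => /(_ ts).
by rewrite subr_eq0 => /(_ st); rewrite /GRing.scale /= mulr1 subrK mulrC.
Qed.

(** Lebesgue differentiation of the primitive of [g]. Interior times only, so that both one-sided
    quotients are covered by the representation. *)
Lemma density_derivable (T : R) (f g : R -> R) : L1 setT g ->
  (forall s t, 0 <= s -> s <= t -> t <= T ->
    f t - f s = \int[leb]_(x in `]s, t]) g x) ->
  {ae leb, forall t, 0 < t < T ->
    (f s - f t) / (s - t) @[s --> t^'] --> g t}.
Proof.
move=> gi fE.
have := @FTC1 R g (BRight 0) _ _; case.
- by move=> y; exact: l_intgS gi.
- by have := integrable_locally measurableT gi; rewrite patch_setT.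
move=> N [mN N0 sub]; exists N; split => // t /= nt; apply: sub => /= h; apply: nt.
move=> /andP[t0 tT].
have [] := h; first by rewrite lte_fin.
set F := fun x => _ => dF F't.
have cF := derivable_quot dF; rewrite F't in cF.
apply: cvg_trans cF; apply: near_eq_cvg.
have [e0 te] : exists2 e : R, 0 < e & forall s, `|t - s| < e -> 0 < s < T.
  exists (Num.min t (T - t)); first by rewrite lt_min t0 subr_gt0.
  by move=> s; rewrite lt_min !ltr_norml => /andP[/andP[? ?] /andP[? ?]]; apply/andP; split; lra.
move=> near_t; rewrite /dnbhs; apply/nbhs_ballP; exists e0 => //= s ts _.
have /andP[s0 sT] := near_t s ts.
rewrite /F /=.
have FE x : 0 < x < T -> \int[leb]_(x in `]0, x]) g x = f x - f 0.
  by move=> /andP[x0 xT]; rewrite fE// ltW.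
by rewrite !FE ?s0 ?t0//; congr (_ / _); ring.
Qed.

End Absolutely_continuous.

(** * Test functions *)

Section Test_functions.
Context {R : realType}.
Local Notation leb := (@lebesgue_measure R).
Implicit Types (f g : R -> R) (D : set R) (c d s x y : R).

(** The square of the positive part is the simplest C^1 function with a kink in its derivative; its
    second differences give test functions whose derivatives are explicit. *)
Definition sqpos s x : R := (Num.max (x - s) 0) ^+ 2.

Lemma sqpos_taylor s x h :
  `|sqpos s (x + h) - sqpos s x - h * (2 * Num.max (x - s) 0)| <= h ^+ 2.
Proof.
rewrite /sqpos ler_norml /Num.max.
by (do 2 case: ifPn); rewrite -?leNgt => *; apply/andP; split; nra.
Qed.

Lemma is_derive_sqpos s x : is_derive x 1 (sqpos s) (2 * Num.max (x - s) 0).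
Proof.
suff : (fun h => h^-1 *: ((sqpos s \o shift x) (h *: 1) - sqpos s x)) h @[h --> 0^']
    --> 2 * Num.max (x - s) 0.
  move=> H; apply: DeriveDef; first by apply/cvg_ex; exists (2 * Num.max (x - s) 0).
  exact: (cvg_lim _ H).
apply/cvgrPdist_lt => e e0; rewrite /prop_near1 /= /dnbhs /within /=.
apply/nbhs_ballP; exists e => //= h; rewrite /ball /= sub0r normrN => he h0.
rewrite /GRing.scale /= mulr1 distrC addrC [h + x]addrC.
set k := 2 * _; have -> : - k + h^-1 * (sqpos s (x + h) - sqpos s x)
    = h^-1 * (sqpos s (x + h) - sqpos s x - h * k) by field.
rewrite normrM (le_lt_trans _ he)// normfV ler_pdivrMl ?normr_gt0//.
by rewrite -normrM -expr2 [leRHS]ger0_norm ?sqr_ge0//; exact: sqpos_taylor.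
Qed.

(** A C^1 ramp from 0 to 1 across [s - dl, s + dl]: the normalized second difference of [sqpos]. *)
Definition step dl s x : R :=
  (2 * dl ^+ 2)^-1 * (sqpos (s - dl) x - 2 * sqpos s x + sqpos (s + dl) x).

(** The derivative of [step]: the hat function of mass 1 and half-width [dl] centred at [s]. *)
Definition tent dl s x : R :=
  (dl ^+ 2)^-1 * (Num.max (x - (s - dl)) 0 - 2 * Num.max (x - s) 0
    + Num.max (x - (s + dl)) 0).

Lemma is_derive_step dl s x : dl != 0 -> is_derive x 1 (step dl s) (tent dl s x).
Proof.
move=> dl0; pose k := (2 * dl ^+ 2)^-1.
have -> : step dl s = k *: ((sqpos (s - dl) - 2 *: sqpos s) + sqpos (s + dl)) by [].
have H1 := is_derive_sqpos (s - dl) x; have H2 := is_derive_sqpos s x.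
have H3 := is_derive_sqpos (s + dl) x.
apply: is_derive_eq; rewrite /tent /k /GRing.scale /=.
by field.
Qed.

Lemma step_le0 dl s x : 0 < dl -> x <= s - dl -> step dl s x = 0.
Proof.
move=> d0 xs; rewrite /step /sqpos.
rewrite !(max_idPr _) ?expr0n/= ?mulr0 ?subr0 ?addr0 ?mulr0//; lra.
Qed.

Lemma step_ge1 dl s x : 0 < dl -> s + dl <= x -> step dl s x = 1.
Proof.
move=> d0 xs; rewrite /step /sqpos.
rewrite !(max_idPl _); try lra.
by field; rewrite gt_eqF.
Qed.

Lemma step_itv dl s x : 0 < dl -> 0 <= step dl s x <= 1.
Proof.
move=> d0; have k0 : 0 < 2 * dl ^+ 2 by rewrite mulr_gt0 ?exprn_gt0.
rewrite /step mulrC divr_ge0 ?(ltW k0)//= ?ler_pdivrMr ?mul1r//.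
- by rewrite /sqpos /Num.max; (do 3 case: ifPn); rewrite -?leNgt => *; nra.
- by rewrite /sqpos /Num.max; (do 3 case: ifPn); rewrite -?leNgt => *; nra.
Qed.

Lemma tent_out dl s x : 0 < dl -> x <= s - dl \/ s + dl <= x -> tent dl s x = 0.
Proof.
move=> d0 [xs|xs]; rewrite /tent; first by rewrite !(max_idPr _) ?mulr0 ?subr0 ?addr0 ?mulr0//; lra.
have -> : Num.max (x - (s - dl)) 0 = x - (s - dl) by apply/max_idPl; lra.
have -> : Num.max (x - s) 0 = x - s by apply/max_idPl; lra.
have -> : Num.max (x - (s + dl)) 0 = x - (s + dl) by apply/max_idPl; lra.
ring.
Qed.

Lemma tent_ge0 dl s x : 0 < dl -> 0 <= tent dl s x.
Proof.
move=> d0; rewrite /tent mulr_ge0 ?invr_ge0 ?sqr_ge0//.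
by rewrite /Num.max; (do 3 case: ifPn); rewrite -?leNgt => *; lra.
Qed.

Lemma continuous_max0 s : continuous (fun x => Num.max (x - s) 0 : R).
Proof.
move=> x; rewrite (_ : (fun _ => _) = fun y => 2^-1 * ((y - s) + `|y - s|)); last first.
  by apply/funext => y; rewrite maxr_absE addr0 subr0 mulrC.
have cs : y - s @[y --> x] --> x - s by apply: cvgB => //; exact: cvg_cst.
apply: cvgM; first exact: cvg_cst.
by apply: cvgD => //; exact: cvg_norm.
Qed.

Lemma tent_continuous dl s : continuous (tent dl s).
Proof.
move=> x; apply: cvgM; first exact: cvg_cst.
apply: cvgD; last exact: continuous_max0.
apply: cvgB; first exact: continuous_max0.
by apply: cvgM; [exact: cvg_cst|exact: continuous_max0].
Qed.

(** A plateau that rises around c + 2 dl and falls around d - 2 dl. A margin [dl] is left at both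
    ends of ]c, d[, which makes the support compact in the open interval. *)
Definition bump c d dl x : R := step dl (c + 2 * dl) x - step dl (d - 2 * dl) x.

Lemma is_derive_bump c d dl x : dl != 0 ->
  is_derive x 1 (bump c d dl) (tent dl (c + 2 * dl) x - tent dl (d - 2 * dl) x).
Proof.
move=> d0; have H1 := is_derive_step (c + 2 * dl) x d0.
have H2 := is_derive_step (d - 2 * dl) x d0.
have -> : bump c d dl = step dl (c + 2 * dl) - step dl (d - 2 * dl) by [].
exact: is_deriveB.
Qed.

Lemma bump_out c d dl x : 0 < dl -> 6 * dl <= d - c -> ~ (c + dl <= x <= d - dl) ->
  bump c d dl x = 0.
Proof.
move=> d0 dcd /negP; rewrite negb_and -!ltNge /bump => /orP[h|h].
  by rewrite !step_le0 ?subr0//; lra.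
by rewrite !step_ge1 ?subrr//; lra.
Qed.

Lemma bump_itv c d dl x : 0 < dl -> 6 * dl <= d - c -> 0 <= bump c d dl x <= 1.
Proof.
move=> d0 dcd; rewrite /bump; have [h|h] := leP x (d - 3 * dl).
  have := step_itv (c + 2 * dl) x d0; rewrite [step dl (d - _) _]step_le0 ?subr0//; lra.
have := step_itv (d - 2 * dl) x d0; rewrite [step dl (c + _) _]step_ge1//; last lra.
by move: (step _ _ _) => z; lra.
Qed.

Lemma bump_in c d dl x : 0 < dl -> c + 3 * dl <= x <= d - 3 * dl -> bump c d dl x = 1.
Proof. by move=> d0 /andP[cx xd]; rewrite /bump step_ge1 ?step_le0 ?subr0//; lra. Qed.

Lemma bump_test D c d dl : `]c, d[%classic `<=` D -> 0 < dl -> 6 * dl <= d - c ->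
  test_fun D (bump c d dl).
Proof.
move=> cdD d0 dcd; have dn0 : dl != 0 by rewrite gt_eqF.
split.
- by move=> x; have [] := is_derive_bump c d x dn0.
- have -> : derive1 (bump c d dl) = (fun x => tent dl (c + 2 * dl) x - tent dl (d - 2 * dl) x).
    by apply/funext => x; rewrite derive1E; have [_ ->] := is_derive_bump c d x dn0.
  by move=> x; apply: cvgB; exact: tent_continuous.
- exists `[c + dl, d - dl]%classic; split.
  + exact: segment_compact.
  + move=> x /=; rewrite in_itv/= => /andP[? ?]; apply: cdD; rewrite /= in_itv/=; apply/andP; split; lra.
  + by move=> x nx; apply: bump_out => //; rewrite -in_itv.
Qed.

Lemma derive1_bump c d dl : 0 < dl ->
  derive1 (bump c d dl) = (fun x => tent dl (c + 2 * dl) x - tent dl (d - 2 * dl) x).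
Proof.
move=> d0; have dn0 : dl != 0 by rewrite gt_eqF.
by apply/funext => x; rewrite derive1E; have [_ ->] := is_derive_bump c d x dn0.
Qed.

(** The factor 1 / 6 gives c + 3 dl <= d - 3 dl, so that the rise ends before the fall begins. *)
Definition dlseq c d (n : nat) : R := (d - c) / 6 * n.+1%:R^-1.

Lemma dlseq_gt0 c d n : c < d -> 0 < dlseq c d n.
Proof. by move=> cd; rewrite mulr_gt0 ?divr_gt0 ?subr_gt0// invr_gt0 ltr0n. Qed.

Lemma dlseq_le c d n : c < d -> 6 * dlseq c d n <= d - c.
Proof.
move=> cd; have : dlseq c d n <= (d - c) / 6; last lra.
rewrite /dlseq ler_piMr ?divr_ge0 ?subr_ge0 ?(ltW cd)//.
by rewrite invf_le1 ?ltr0n// ler1n.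
Qed.

Lemma dlseq_cvg c d : dlseq c d n @[n --> \oo] --> 0.
Proof.
rewrite -[X in _ --> X](mulr0 ((d - c) / 6)); apply: cvgM; first exact: cvg_cst.
exact: cvg_harmonic.
Qed.

Definition bumps c d n x := bump c d (dlseq c d n) x.

Lemma bumps_test D c d n : `]c, d[%classic `<=` D -> c < d -> test_fun D (bumps c d n).
Proof. by move=> cdD cd; apply: bump_test => //; [exact: dlseq_gt0|exact: dlseq_le]. Qed.

Lemma bumps_itv c d n x : c < d -> 0 <= bumps c d n x <= 1.
Proof. by move=> cd; apply: bump_itv; [exact: dlseq_gt0|exact: dlseq_le]. Qed.

Lemma bumps_out c d n x : c < d -> ~ (`]c, d[%classic x) -> bumps c d n x = 0.
Proof.
move=> cd nx; have d0 := dlseq_gt0 n cd; apply: bump_out => //; first exact: dlseq_le.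
move=> /andP[h1 h2]; apply: nx; rewrite /= in_itv/=; apply/andP; split; lra.
Qed.

Lemma bumps_cvg c d x : c < d -> bumps c d n x @[n --> \oo] --> (\1_(`]c, d[%classic) x : R).
Proof.
move=> cd; rewrite indicE; case: (boolP (x \in _)) => [|xn]; last first.
  apply: cvg_near_cst; apply: nearW => n; apply: bumps_out => //.
  by move=> h; move: xn; rewrite mem_set.
rewrite inE /= in_itv/= => /andP[cx xd].
apply: cvg_near_cst.
have m0 : 0 < Num.min (x - c) (d - x) / 3 by rewrite divr_gt0// lt_min !subr_gt0 cx xd.
have /cvgrPdist_lt/(_ _ m0) := dlseq_cvg c d.
apply: filterS => n; rewrite sub0r normrN gtr0_norm ?dlseq_gt0//.
rewrite ltr_pdivlMr// lt_min => /andP[h1 h2].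
by apply: bump_in; [exact: dlseq_gt0|apply/andP; split; lra].
Qed.

End Test_functions.

(** * Signed measures *)

Lemma addr_exchange (V : zmodType) (a b c d : V) : a + b = c + d -> a - d = c - b.
Proof. by move=> h; apply/(addIr b)/(addIr d); rewrite subrK [_ + b + d]addrAC subrK h. Qed.

Section Charges.
Context {R : realType}.
Local Notation leb := (@lebesgue_measure R).
Local Notation MR := (measurableTypeR R).
Local Notation measu := {measure set MR -> \bar R}.
Implicit Types (nu : smeas R) (m : measu) (X D A : set MR) (f g : R -> R) (M B r : R).

Definition jpos nu := jordan_pos (hahn_posnegP nu).
Definition jneg nu := jordan_neg (hahn_posnegP nu).

Lemma charge_jordan nu A : measurable A -> nu A = (jpos nu A - jneg nu A)%E.
Proof.
move=> mA; rewrite (jordan_decomp (hahn_posnegP nu) mA) /cadd /=.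
by rewrite -[cscale _ _ _]/((-1)%:E * _)%E EFinN mulN1e.
Qed.

Lemma bounded_intg m X f M : measurable X -> (m setT < +oo)%E ->
  measurable_fun X f -> (forall x, X x -> `|f x| <= M) -> m.-integrable X (EFin \o f).
Proof.
move=> mX moo mf fM; apply: measurable_bounded_integrable => //.
  by apply: le_lt_trans moo; apply: le_measure; rewrite ?inE.
by exists M; split; [exact: num_real|move=> y My x Dx /=; apply: (le_trans (fM _ Dx)); exact: ltW].
Qed.

Lemma Rint_measure_add m1 m2 X f : measurable X ->
  m1.-integrable X (EFin \o f) -> m2.-integrable X (EFin \o f) ->
  \int[measure_add m1 m2]_(x in X) f x = \int[m1]_(x in X) f x + \int[m2]_(x in X) f x.
Proof.
move=> mX i1 i2; rewrite /Rintegral integral_measure_add//.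
by rewrite fineD//; exact: integrable_fin_num.
Qed.

Lemma finite_measure_add (m1 m2 : measu) : (m1 setT < +oo)%E -> (m2 setT < +oo)%E ->
  (measure_add m1 m2 setT < +oo)%E.
Proof. by move=> h1 h2; rewrite measure_addE; exact: lte_add_pinfty. Qed.

Lemma fin_measure m A : measurable A -> (m setT < +oo)%E -> m A \is a fin_num.
Proof.
move=> mA moo; rewrite ge0_fin_numE//; apply: le_lt_trans moo.
by apply: le_measure; rewrite ?inE.
Qed.

Lemma jpos_fin nu : (jpos nu setT < +oo)%E.
Proof. by rewrite -ge0_fin_numE//; exact: fin_num_measure. Qed.

Lemma jneg_fin nu : (jneg nu setT < +oo)%E.
Proof. by rewrite -ge0_fin_numE//; exact: fin_num_measure. Qed.

Lemma charge_jordanE nu A : measurable A -> exists a b,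
  [/\ jpos nu A = a%:E, jneg nu A = b%:E & nu A = (a - b)%:E].
Proof.
move=> mA; have fp := fin_measure mA (jpos_fin nu); have fn := fin_measure mA (jneg_fin nu).
exists (fine (jpos nu A)), (fine (jneg nu A)).
by rewrite (charge_jordan nu mA) EFinB !fineK.
Qed.

(** [meas_integral] goes through a chosen Hahn decomposition. Any other way of writing [nu] as a
    difference of finite measures gives the same integral, because jpos + m2 = m1 + jneg as
    measures. The rules of linearity in the measure rest on this. *)
Lemma meas_integral_diff nu m1 m2 X f M : measurable X ->
  (m1 setT < +oo)%E -> (m2 setT < +oo)%E ->
  (forall A, measurable A -> nu A = (m1 A - m2 A)%E) ->
  measurable_fun X f -> (forall x, X x -> `|f x| <= M) ->
  meas_integral nu X f = \int[m1]_(x in X) f x - \int[m2]_(x in X) f x.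
Proof.
move=> mX m1oo m2oo nuE mf fM.
have p := bounded_intg mX (jpos_fin nu) mf fM; have n := bounded_intg mX (jneg_fin nu) mf fM.
have i1 := bounded_intg mX m1oo mf fM; have i2 := bounded_intg mX m2oo mf fM.
suff : \int[jpos nu]_(x in X) f x + \int[m2]_(x in X) f x =
   \int[m1]_(x in X) f x + \int[jneg nu]_(x in X) f x.
  exact: addr_exchange.
rewrite -!Rint_measure_add//; congr fine; apply: eq_measure_integral => A mA _.
apply: (etrans (measure_addE _ _ _)); apply: (etrans _ (esym (measure_addE _ _ _))).
change (jpos nu A + m2 A = m1 A + jneg nu A)%E.
have := nuE A mA; have [c [e [-> -> ->]]] := charge_jordanE nu mA.
have := fin_measure mA m1oo; have := fin_measure mA m2oo.
by move: (m1 A) (m2 A) => [a| |] [b| |] // _ _ [h]; apply: (congr1 EFin); lra.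
Qed.

Lemma meas_integral_add nu1 nu2 X f M : measurable X ->
  measurable_fun X f -> (forall x, X x -> `|f x| <= M) ->
  meas_integral (meas_add nu1 nu2) X f = meas_integral nu1 X f + meas_integral nu2 X f.
Proof.
move=> mX mf fM.
rewrite (@meas_integral_diff _ (measure_add (jpos nu1) (jpos nu2))
  (measure_add (jneg nu1) (jneg nu2)) _ _ M)//.
- have ip1 := bounded_intg mX (jpos_fin nu1) mf fM; have in1 := bounded_intg mX (jneg_fin nu1) mf fM.
  have ip2 := bounded_intg mX (jpos_fin nu2) mf fM; have in2 := bounded_intg mX (jneg_fin nu2) mf fM.
  rewrite !Rint_measure_add//.
  by rewrite /meas_integral -/(jpos nu1) -/(jneg nu1) -/(jpos nu2) -/(jneg nu2); ring.
- by apply: finite_measure_add; exact: jpos_fin.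
- by apply: finite_measure_add; exact: jneg_fin.
move=> A mA.
transitivity ((jpos nu1 A + jpos nu2 A) - (jneg nu1 A + jneg nu2 A))%E; last first.
  by congr (_ - _)%E; exact/esym/measure_addE.
rewrite -[meas_add _ _ A]/(nu1 A + nu2 A)%E.
have [a [b [-> -> ->]]] := charge_jordanE nu1 mA.
have [c [e [-> -> ->]]] := charge_jordanE nu2 mA.
by apply: (congr1 EFin); ring.
Qed.

Lemma Rint_mscale (k : {nonneg R}) m X f : measurable X -> m.-integrable X (EFin \o f) ->
  \int[mscale k m]_(x in X) f x = k%:num * \int[m]_(x in X) f x.
Proof.
move=> mX mi; have mf := measurable_int m mi.
rewrite /Rintegral integralE ge0_integral_mscale//; last exact: measurable_funepos.
rewrite ge0_integral_mscale//; last exact: measurable_funeneg.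
have := integrable_pos_fin_num mX mi; have := integrable_neg_fin_num mX mi.
rewrite [in RHS]integralE.
move: (integral _ _ _) (integral _ _ _) => [a| |] [b| |] //= _ _.
by rewrite mulrBr.
Qed.

Lemma mscale_fin (k : {nonneg R}) m : (m setT < +oo)%E -> (mscale k m setT < +oo)%E.
Proof. by move=> h; rewrite /mscale lte_mul_pinfty. Qed.

Lemma meas_integral_scale nu r X f M : measurable X ->
  measurable_fun X f -> (forall x, X x -> `|f x| <= M) ->
  meas_integral (meas_scale r nu) X f = r * meas_integral nu X f.
Proof.
move=> mX mf fM; have ip := bounded_intg mX (jpos_fin nu) mf fM.
have im := bounded_intg mX (jneg_fin nu) mf fM.
rewrite [in RHS]/meas_integral -/(jpos nu) -/(jneg nu).
have [r0|r0] := leP 0 r.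
  pose k := NngNum r0.
  rewrite (@meas_integral_diff _ (mscale k (jpos nu)) (mscale k (jneg nu)) _ _ M)//.
  - by rewrite !Rint_mscale//= mulrBr.
  - exact/mscale_fin/jpos_fin.
  - exact/mscale_fin/jneg_fin.
  move=> A mA; rewrite -[meas_scale _ _ A]/(r%:E * nu A)%E.
  transitivity (r%:E * jpos nu A - r%:E * jneg nu A)%E; last by [].
  have [a [b [-> -> ->]]] := charge_jordanE nu mA.
  by rewrite -!EFinM -EFinB mulrBr.
(* A negative factor exchanges the roles of the two Jordan parts. *)
have r1 : 0 <= - r by rewrite oppr_ge0 ltW.
pose k := NngNum r1.
rewrite (@meas_integral_diff _ (mscale k (jneg nu)) (mscale k (jpos nu)) _ _ M)//.
- by rewrite !Rint_mscale//=; ring.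
- exact/mscale_fin/jneg_fin.
- exact/mscale_fin/jpos_fin.
move=> A mA; rewrite -[meas_scale _ _ A]/(r%:E * nu A)%E.
transitivity ((- r)%:E * jneg nu A - (- r)%:E * jpos nu A)%E; last by [].
have [a [b [-> -> ->]]] := charge_jordanE nu mA.
by rewrite -!EFinM -EFinB; congr EFin; ring.
Qed.

Lemma meas_integral_sub nu1 nu2 X f M : measurable X ->
  measurable_fun X f -> (forall x, X x -> `|f x| <= M) ->
  meas_integral (meas_sub nu1 nu2) X f = meas_integral nu1 X f - meas_integral nu2 X f.
Proof.
move=> mX mf fM; rewrite (meas_integral_add _ _ mX mf fM).
by rewrite (meas_integral_scale _ _ mX mf fM) mulN1r.
Qed.

Lemma meas_integral_measure nu m X f M : measurable X -> (m setT < +oo)%E ->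
  (forall A, measurable A -> nu A = m A) ->
  measurable_fun X f -> (forall x, X x -> `|f x| <= M) ->
  meas_integral nu X f = \int[m]_(x in X) f x.
Proof.
move=> mX moo nuE mf fM; rewrite (@meas_integral_diff _ m mzero _ _ M)//.
- by rewrite [X in _ - X]/Rintegral integral_measure_zero/= subr0.
- by rewrite /mzero ltry.
- by move=> A mA; rewrite nuE// /mzero sube0.
Qed.

Lemma eq_meas_integral nu1 nu2 X f M : measurable X ->
  (forall A, measurable A -> nu1 A = nu2 A) ->
  measurable_fun X f -> (forall x, X x -> `|f x| <= M) ->
  meas_integral nu1 X f = meas_integral nu2 X f.
Proof.
move=> mX nuE mf fM; rewrite (@meas_integral_diff nu1 (jpos nu2) (jneg nu2) _ _ M)//.
- exact: jpos_fin.
- exact: jneg_fin.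
- by move=> A mA; rewrite nuE// charge_jordan.
Qed.

Lemma Rint_RN (m : {finite_measure set MR -> \bar R}) X f M : measurable X -> (m setT < +oo)%E -> m `<< leb ->
  measurable_fun X f -> (forall x, X x -> `|f x| <= M) ->
  exists2 r : R -> R, L1 setT r & (forall A, measurable A -> m A = (\int[leb]_(x in A) (r x)%:E)%E) /\
    \int[m]_(x in X) f x = \int[leb]_(x in X) (f x * r x).
Proof.
move=> mX moo mleb mf fM.
have dom : charge_of_finite_measure m `<< leb by exact: mleb.
have ri := Radon_Nikodym_integrable dom.
have rfin x := Radon_Nikodym_fin_num x dom.
exists (fine \o Radon_Nikodym (charge_of_finite_measure m) leb).
  by move: ri; apply: eq_integrable => // x _ /=; rewrite fineK.
split.
  move=> A mA; rewrite -[LHS]/(charge_of_finite_measure m A).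
  rewrite (Radon_Nikodym_integral dom mA); apply: eq_integral => x _ /=.
  by rewrite fineK.
congr fine; rewrite -[LHS](@Radon_Nikodym_change_of_variables _ _ _ m leb dom)//.
  by apply: eq_integral => x _; rewrite EFinM /= fineK.
exact: bounded_intg fM.
Qed.

(** Both Jordan parts are dominated by Lebesgue measure, and the difference of their Radon-Nikodym
    densities agrees with [g] almost everywhere since the integrals over all Borel sets agree. *)
Lemma meas_integral_density nu g X f M : measurable X -> L1 setT g ->
  (forall A, measurable A -> nu A = (\int[leb]_(x in A) (g x)%:E)%E) ->
  measurable_fun X f -> (forall x, X x -> `|f x| <= M) ->
  meas_integral nu X f = \int[leb]_(x in X) (f x * g x).
Proof.
move=> mX gi nuE mf fM.
have dom : nu `<< leb.
  move=> N nN A mA AN; rewrite nuE//.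
  apply: null_set_integral => //; last exact: nN.
  by apply/measurable_EFinP; apply: measurable_funS (intgM gi).
have [r1 r1i [r1E I1]] := Rint_RN mX (jpos_fin nu) (jordan_pos_dominates _ dom) mf fM.
have [r2 r2i [r2E I2]] := Rint_RN mX (jneg_fin nu) (jordan_neg_dominates _ dom) mf fM.
have -> : meas_integral nu X f = \int[leb]_(x in X) (f x * r1 x) - \int[leb]_(x in X) (f x * r2 x).
  by rewrite -I1 -I2.
have iX (h : R -> R) : L1 setT h -> L1 X h by apply: l_intgS.
have ifr (h : R -> R) : L1 setT h -> L1 X (fun x => f x * h x).
  move=> ri; have Mi : L1 X (fun x => M * `|h x|) by exact/l_intgZ/l_intg_abs/iX.
  apply: (l_intg_ae_le _ _ Mi) => //.
  - by apply: measurable_funM => //; exact: (intgM (iX _ ri)).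
  - apply: aeW => x Xx; rewrite normrM ler_wpM2r//; exact: fM.
rewrite -RintegralB//; try exact: ifr.
apply: l_ae_eq_Rint => //.
- apply: (@intgM _ _ _ leb); apply: l_intgB => //; exact: ifr.
- by apply: (@intgM _ _ _ leb); exact: ifr.
have : {ae leb, forall x, setT x -> (r1 x - r2 x)%:E = (g x)%:E}.
  apply: (@integral_ae_eq _ _ _ leb setT) => //.
  - exact: l_intgB.
  - exact: (measurable_int leb gi).
  move=> A _ mA; rewrite -nuE// charge_jordan//.
  transitivity (\int[leb]_(x in A) (r1 x)%:E - \int[leb]_(x in A) (r2 x)%:E)%E.
    by rewrite -integralB_EFin//; [exact: l_intgS r1i|exact: l_intgS r2i].
  by congr (_ - _)%E; [exact/esym/r1E|exact/esym/r2E].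
move=> h; apply: (lebS h) => x /(_ Logic.I) [<-] Xx; ring.
Qed.

(** For a Hahn decomposition P, N the total variation is nu P - nu N, whence the factor 2. *)
Lemma meas_norm_le nu B : (forall A, measurable A -> `|fine (nu A)| <= B) ->
  meas_norm nu <= 2 * B.
Proof.
move=> nuB; have [[mP _] [mN _] _ PN0] := hahn_posnegP nu.
rewrite /meas_norm /charge_variation fineD; [|exact: fin_measure (jpos_fin nu)|exact: fin_measure (jneg_fin nu)].
rewrite jordan_posE charge.cjordan_posE jordan_negE charge.cjordan_negE /crestr0 /crestr mem_set// !setTI.
rewrite fineN; have := nuB _ mP; have := nuB _ mN.
rewrite /hahn_posset /hahn_negset !ler_norml => /andP[? ?] /andP[? ?]; lra.
Qed.

Lemma jneg0 nu A : (forall A, measurable A -> (0 <= nu A)%E) -> measurable A -> jneg nu A = 0%E.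
Proof.
move=> nu0 mA; apply/eqP; rewrite eq_le measure_ge0 andbT.
rewrite /jneg jordan_negE charge.cjordan_negE /crestr0 mem_set// /crestr oppe_le0.
apply: nu0; apply: measurableI => //; by have [_ [mN _] _ _] := hahn_posnegP nu.
Qed.

Lemma jposE nu A : (forall A, measurable A -> (0 <= nu A)%E) -> measurable A -> jpos nu A = nu A.
Proof. by move=> nu0 mA; rewrite (charge_jordan nu mA) (jneg0 nu0 mA) sube0. Qed.

End Charges.

(** * Weak derivatives and H^1 *)

Section Weak_derivatives.
Context {R : realType}.
Local Notation leb := (@lebesgue_measure R).
Local Notation MR := (measurableTypeR R).
Implicit Types (nu : smeas R) (f g phi : R -> R) (a b c d M : R).

Lemma charge_meas_on (D : set MR) nu (A : set MR) : measurable D -> measurable A ->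
  meas_on D nu -> nu A = nu (A `&` D).
Proof. by move=> mD mA nuD; rewrite (chargeDI nu mA mD) nuD// add0e. Qed.

Lemma meas_integral_bumps (D : set MR) nu c d : measurable D -> c < d ->
  `]c, d[%classic `<=` D ->
  meas_integral nu D (bumps c d n) @[n --> \oo] --> fine (nu `]c, d[%classic).
Proof.
move=> mD cd cdD; have mcd : measurable (`]c, d[%classic : set MR) by [].
have [p [q [ep eq ->]]] := charge_jordanE nu mcd; rewrite /=.
have H (m : {finite_measure set MR -> \bar R}) :
    \int[m]_(x in D) bumps c d n x @[n --> \oo] --> fine (m `]c, d[%classic).
  have -> : fine (m `]c, d[%classic) = \int[m]_(x in D) (\1_(`]c, d[%classic) x : R).
    by rewrite /Rintegral integral_indic// setIidl.
  apply: (@Rint_dct _ _ _ m D _ _ (fun=> 1)) => //.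
  - move=> n; have [h _ _] := bumps_test n cdD cd.
    apply: measurable_funS (measurableT) _ _ => //.
    by apply: continuous_measurable_fun => x; apply: differentiable_continuous; apply/derivable1_diffP.
  - apply: (@bounded_intg _ m D _ 1) => //.
    + by rewrite -ge0_fin_numE//; exact: fin_num_measure.
    + by move=> x _; rewrite normr1.
  - by apply: aeW => x _; exact: bumps_cvg.
  - move=> n; apply: aeW => x _; have /andP[h1 h2] := bumps_itv n x cd.
    by rewrite ger0_norm.
have -> : p - q = fine (jpos nu `]c, d[%classic) - fine (jneg nu `]c, d[%classic) by rewrite ep eq.
by apply: cvgB; exact: H.
Qed.

(** Bumps recover the values on open subintervals of ]a, b[, and the open intervals form a pi-system
    that generates the Borel sets. *)
Lemma charge_eq_tests a b nu1 nu2 : meas_on `]a, b[ nu1 -> meas_on `]a, b[ nu2 ->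
  (forall phi, test_fun `]a, b[ phi ->
    meas_integral nu1 `]a, b[ phi = meas_integral nu2 `]a, b[ phi) ->
  forall A : set MR, measurable A -> nu1 A = nu2 A.
Proof.
move=> on1 on2 H; pose D : set MR := `]a, b[%classic.
have mD : measurable D by exact: measurable_itv.
have sub c d : c < d -> `]c, d[%classic `<=` D -> nu1 `]c, d[%classic = nu2 `]c, d[%classic.
  move=> cd cdD; have mcd : measurable (`]c, d[%classic : set MR) by [].
  have h1 := @meas_integral_bumps D nu1 c d mD cd cdD.
  have h2 := @meas_integral_bumps D nu2 c d mD cd cdD.
  rewrite -[LHS]fineK ?fin_num_measure// -[RHS]fineK ?fin_num_measure//; congr EFin.
  have e : (fun n => meas_integral nu1 D (bumps c d n)) = (fun n => meas_integral nu2 D (bumps c d n)).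
    by apply/funext => n; apply: H; exact: bumps_test.
  by rewrite e in h1; exact: (cvg_unique _ h1 h2).
have itv c d : nu1 `]c, d[%classic = nu2 `]c, d[%classic.
  rewrite (charge_meas_on mD _ on1)// (charge_meas_on mD _ on2)//.
  have -> : `]c, d[%classic `&` D = `]Num.max a c, Num.min b d[%classic.
    apply/seteqP; split => x; rewrite /D /= !in_itv/= gt_max lt_min.
      by move=> [/andP[-> ->] /andP[-> ->]].
    by move=> /andP[/andP[-> ->] /andP[-> ->]].
  have [h|h] := ltP (Num.max a c) (Num.min b d); last by rewrite set_itv_ge ?bnd_simp -?leNgt// !charge0.
  apply: sub => // x; rewrite /D /= !in_itv/= gt_max lt_min.
  by move=> /andP[/andP[-> _] /andP[-> _]].
(* Uniqueness on a pi-system is applied to nonnegative measures, so negative parts are moved to the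
   other side of the equality. *)
have Hm : forall A : set MR, measurable A ->
    measure_add (jpos nu1) (jneg nu2) A = measure_add (jpos nu2) (jneg nu1) A.
  apply: (@measure_unique _ R MR (@RGenOpens.G R) (fun k => `](- k%:R)%R, k%:R[%classic)
    (@RGenOpens.measurableE R) _ _ _ (measure_add (jpos nu1) (jneg nu2))
    (measure_add (jpos nu2) (jneg nu1))).
  - move=> _ _ [x [y ->]] [z [w ->]]; exists (Num.max x z), (Num.min y w).
    apply/seteqP; split => t /=; rewrite !in_itv/= gt_max lt_min.
      by move=> [/andP[-> ->] /andP[-> ->]].
    by move=> /andP[/andP[-> ->] /andP[-> ->]].
  - by move=> k; exists (- k%:R), k%:R.
  - rewrite -subTset => x _; exists (Num.truncn `|x|).+1 => //=.
    by rewrite in_itv/= -ltr_norml truncnS_gt.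
  - move=> _ [x [y ->]]; have mxy : measurable (`]x, y[%classic : set MR) by [].
    apply: (etrans (measure_addE _ _ _)); apply: (etrans _ (esym (measure_addE _ _ _))).
    change (jpos nu1 `]x, y[%classic + jneg nu2 `]x, y[%classic =
      jpos nu2 `]x, y[%classic + jneg nu1 `]x, y[%classic)%E.
    have := itv x y; have [p1 [q1 [-> -> ->]]] := charge_jordanE nu1 mxy.
    have [p2 [q2 [-> -> ->]]] := charge_jordanE nu2 mxy.
    by move=> [h]; apply: (congr1 EFin); lra.
  - move=> k; apply: (le_lt_trans _ (finite_measure_add (jpos_fin nu1) (jneg_fin nu2))).
    by apply: le_measure; rewrite ?inE.
move=> A mA; have := Hm A mA.
move=> /(etrans (esym (measure_addE _ _ _)))/esym/(etrans (esym (measure_addE _ _ _))).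
change ((jpos nu2 A + jneg nu1 A = jpos nu1 A + jneg nu2 A)%E -> nu1 A = nu2 A).
have [p1 [q1 [-> -> ->]]] := charge_jordanE nu1 mA.
have [p2 [q2 [-> -> ->]]] := charge_jordanE nu2 mA.
by move=> [h]; apply: (congr1 EFin); lra.
Qed.

Lemma meas_densityE (D : set MR) f : measurable D -> L1 D f ->
  L1 setT (f \_ D) /\ forall A : set MR, measurable A ->
    meas_density D f A = (\int[leb]_(x in A) ((f \_ D) x)%:E)%E.
Proof.
move=> mD fi; have fDi : L1 setT (f \_ D).
  by rewrite /L1 -restrict_EFin; apply: (iffLR (integrable_mkcond _ mD)).
split => // A mA; rewrite /meas_density.
by case: pselect => // h; exact: (False_rect _ (h fDi)).
Qed.

Lemma meas_density_on (D : set MR) f : measurable D -> L1 D f ->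
  meas_on D (meas_density D f).
Proof.
move=> mD fi A mA; have [_ ->] := meas_densityE mD fi; last exact: measurableD.
rewrite integral0_eq// => x [_ nD]; rewrite patchE memNset//.
Qed.

Lemma meas_integral_meas_density (D X : set MR) f phi M : measurable D -> measurable X -> L1 D f ->
  measurable_fun X phi -> (forall x, X x -> `|phi x| <= M) ->
  meas_integral (meas_density D f) X phi = \int[leb]_(x in X `&` D) (f x * phi x).
Proof.
move=> mD mX fi mphi pM; have [fDi fE] := meas_densityE mD fi.
rewrite (meas_integral_density mX fDi fE mphi pM) Rintegral_mkcondr.
apply: eq_Rintegral => x _; rewrite !patchE; case: ifPn => _; first by rewrite mulrC.
by rewrite mulr0.
Qed.

Lemma test_fun_bounded (D : set R) phi : test_fun D phi ->
  [/\ continuous phi, continuous (derive1 phi) & exists N : R, 0 < N /\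
   [/\ forall x, `|phi x| <= N, forall x, `|derive1 phi x| <= N &
      forall x, N < `|x| -> phi x = 0 /\ derive1 phi x = 0]].
Proof.
move=> [dphi cphi' [K [cK KD phi0]]].
have cphi : continuous phi.
  by move=> x; apply: differentiable_continuous; apply/derivable1_diffP.
have phi'0 x : ~ K x -> derive1 phi x = 0.
  move=> nK; rewrite derive1E -(derive_cst (0 : R) x 1); apply: near_eq_derive => //.
  have : open (~` K) by apply: closed_openC; exact: compact_closed.
  rewrite openE => /(_ _ nK); apply: filterS => y; exact: phi0.
split => //.
have bd (h : R -> R) : continuous h -> exists N : R, forall x, K x -> `|h x| <= N.
  move=> ch; have : compact (h @` K) by apply: continuous_compact => //; exact: continuous_subspaceT.
  move=> /compact_bounded[N [_ HN]]; exists (N + 1) => x Kx.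
  by apply: (HN (N + 1)); [rewrite ltrDl|exists x].
have [N1 h1] := bd _ cphi; have [N2 h2] := bd _ cphi'; have [N3 h3] : exists N : R, forall x, K x -> `|x| <= N.
  by apply: (bd id) => x; exact: cvg_id.
exists (`|N1| + `|N2| + `|N3| + 1).
have a1 := normr_ge0 N1; have a2 := normr_ge0 N2; have a3 := normr_ge0 N3.
have b1 := ler_norm N1; have b2 := ler_norm N2; have b3 := ler_norm N3.
split; first lra; split => x.
- have [Kx|nK] := pselect (K x); last by rewrite phi0// normr0; lra.
  by have := h1 x Kx; lra.
- have [Kx|nK] := pselect (K x); last by rewrite phi'0// normr0; lra.
  by have := h2 x Kx; lra.
- move=> xN; have nK : ~ K x by move=> /h3 /=; lra.
  by rewrite phi0// phi'0.
Qed.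

Lemma compact_support_L1 (D : set R) f M N : measurable D -> measurable_fun setT f ->
  (forall x, `|f x| <= M) -> (forall x, N < `|x| -> f x = 0) -> L1 D f.
Proof.
move=> mD mf fM f0; have mI : measurable (`[- N, N]%classic : set MR) by [].
have -> : f = f \_ `[- N, N].
  apply/funext => x; rewrite patchE; case: ifPn => //; rewrite notin_setE /= in_itv/= -ler_norml => /negP.
  by rewrite -ltNge => /f0 ->.
rewrite /L1 -restrict_EFin; apply/integrable_restrict => //.
apply: (@bounded_L1 _ _ _ M) => //.
- exact: measurableI.
- apply: (@le_lt_trans _ _ (leb `[- N, N]%classic)); last first.
    by rewrite lebesgue_measure_itv/= lte_fin; case: ifPn => _; rewrite -?EFinB ltry.
  by apply: le_measure; rewrite ?inE//; exact: measurableI.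
- exact: measurable_funS mf.
Qed.

Lemma compact_support_L2 (D : set R) f M N : measurable D -> measurable_fun setT f ->
  (forall x, `|f x| <= M) -> (forall x, N < `|x| -> f x = 0) -> L2 D f.
Proof.
move=> mD mf fM f0; have mDf : measurable_fun D f by exact: measurable_funS mf.
split => //; apply: (@compact_support_L1 _ _ (M ^+ 2) N) => //.
- exact: measurable_funX.
- by move=> x; rewrite normrX lerXn2r ?nnegrE//; apply: le_trans (fM x).
- by move=> x /f0 ->; rewrite expr0n.
Qed.

Lemma test_L2 (D E : set R) phi : measurable (E : set MR) -> test_fun D phi ->
  L2 E phi /\ L2 E (derive1 phi).
Proof.
move=> mE /test_fun_bounded[c1 c2 [N [N0 [b1 b2 z]]]].
split; apply: (@compact_support_L2 _ _ N N) => //; try exact: continuous_measurable_fun.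
- by move=> x /z[].
- by move=> x /z[].
Qed.

Lemma test_funS (D D' : set R) phi : D' `<=` D -> test_fun D' phi -> test_fun D phi.
Proof. by move=> sub [? ? [K [cK KD' ?]]]; split => //; exists K; split => // x /KD' /sub. Qed.

Lemma test_fun_out (D : set R) phi x : test_fun D phi -> ~ D x -> phi x = 0 /\ derive1 phi x = 0.
Proof.
move=> [dphi _ [K [cK KD phi0]]] nD; have nK : ~ K x by move=> /KD.
split; first exact: phi0.
rewrite derive1E -(derive_cst (0 : R) x 1); apply: near_eq_derive => //.
have : open (~` K) by apply: closed_openC; exact: compact_closed.
by rewrite openE => /(_ _ nK); apply: filterS => y; exact: phi0.
Qed.

Lemma weak_derivS (D D' : set R) f g : D' `<=` D -> weak_deriv D f g -> weak_deriv D' f g.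
Proof.
move=> sub H phi tphi; have := H phi (test_funS sub tphi).
have e (h psi : R -> R) : (forall x, ~ D' x -> psi x = 0) ->
    \int[leb]_(x in D) (h x * psi x) = \int[leb]_(x in D') (h x * psi x).
  move=> psi0; rewrite Rintegral_mkcond [RHS]Rintegral_mkcond; congr (Rintegral _ _ _).
  apply/funext => x; rewrite !patchE; have [/set_mem D'x|/negP nD'] := boolP (x \in D').
    by rewrite mem_set//; exact: sub.
  case: ifPn => // _; rewrite psi0 ?mulr0// => ?; apply: nD'; exact: mem_set.
by rewrite !e// => x nx; have [] := test_fun_out tphi nx.
Qed.

Lemma weak_derivB (D : set MR) f1 g1 f2 g2 : measurable D ->
  L2 D f1 -> L2 D g1 -> L2 D f2 -> L2 D g2 ->
  weak_deriv D f1 g1 -> weak_deriv D f2 g2 ->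
  weak_deriv D (fun x => f1 x - f2 x) (fun x => g1 x - g2 x).
Proof.
move=> mD h1 h2 h3 h4 w1 w2 phi tphi; have [t1 t2] := test_L2 mD tphi.
under eq_Rintegral do rewrite mulrBl; under [in RHS]eq_Rintegral do rewrite mulrBl.
rewrite !RintegralB//; try exact: L2M.
by rewrite w1// w2//; ring.
Qed.

Lemma weak_derivZ (D : set MR) f g k : measurable D ->
  L2 D f -> L2 D g -> weak_deriv D f g ->
  weak_deriv D (fun x => k * f x) (fun x => k * g x).
Proof.
move=> mD h1 h2 w phi tphi; have [t1 t2] := test_L2 mD tphi.
under eq_Rintegral do rewrite -mulrA; under [in RHS]eq_Rintegral do rewrite -mulrA.
by rewrite !RintegralZl//; try exact: L2M; rewrite w// mulrN.
Qed.

(** The two derivatives are densities of measures with the same integrals against all test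
    functions. *)
Lemma weak_deriv_unique_itv a b f g1 g2 : L2 `]a, b[ g1 -> L2 `]a, b[ g2 ->
  weak_deriv `]a, b[ f g1 -> weak_deriv `]a, b[ f g2 ->
  {ae leb, forall x, `]a, b[%classic x -> g1 x = g2 x}.
Proof.
move=> g1i g2i w1 w2; have mD : measurable (`]a, b[%classic : set MR) by [].
have Doo : (leb `]a, b[%classic < +oo)%E.
  by rewrite lebesgue_measure_itv/= lte_fin; case: ifPn => _; rewrite -?EFinB ltry.
have h1 := L2_L1 mD Doo g1i; have h2 := L2_L1 mD Doo g2i.
have : forall A : set MR, measurable A -> meas_density `]a, b[ g1 A = meas_density `]a, b[ g2 A.
  apply: (charge_eq_tests (a := a) (b := b)); try exact: meas_density_on.
  move=> phi tphi; have [c1 c2 [N [N0 [b1 _ _]]]] := test_fun_bounded tphi.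
  have mphi : measurable_fun (`]a, b[%classic : set MR) phi.
    by apply: measurable_funS (continuous_measurable_fun c1).
  rewrite !(@meas_integral_meas_density _ _ _ _ N)// setIid.
  by apply: oppr_inj; rewrite -w1// -w2.
have [i1 e1] := meas_densityE mD h1; have [i2 e2] := meas_densityE mD h2 => E.
have : {ae leb, forall x, setT x -> ((g1 \_ `]a, b[) x)%:E = ((g2 \_ `]a, b[) x)%:E}.
  apply: (@integral_ae_eq _ _ _ leb setT) => //; first exact: (measurable_int leb i2).
  by move=> A _ mA; rewrite -e1// -e2// E.
move=> h; apply: (lebS h) => x /(_ Logic.I) [] + Dx.
by rewrite !patchE mem_set.
Qed.

End Weak_derivatives.

(** Minkowski's inequality in the plane together with monotonicity of the norm: it combines the
    triangle inequalities for f and for f' into that of [H1dist]. *)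
Lemma minkowski2 (R : rcfType) (q1 q2 r1 r2 p1 p2 : R) : 0 <= q1 -> 0 <= q2 ->
  0 <= r1 -> 0 <= r2 -> 0 <= p1 -> 0 <= p2 -> p1 <= q1 + r1 -> p2 <= q2 + r2 ->
  Num.sqrt (p1 ^+ 2 + p2 ^+ 2) <= Num.sqrt (q1 ^+ 2 + q2 ^+ 2) + Num.sqrt (r1 ^+ 2 + r2 ^+ 2).
Proof.
move=> q10 q20 r10 r20 p10 p20 h1 h2.
have a0 := sqrtr_ge0 (q1 ^+ 2 + q2 ^+ 2); have b0 := sqrtr_ge0 (r1 ^+ 2 + r2 ^+ 2).
have ea : Num.sqrt (q1 ^+ 2 + q2 ^+ 2) ^+ 2 = q1 ^+ 2 + q2 ^+ 2.
  by rewrite sqr_sqrtr// addr_ge0// sqr_ge0.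
have eb : Num.sqrt (r1 ^+ 2 + r2 ^+ 2) ^+ 2 = r1 ^+ 2 + r2 ^+ 2.
  by rewrite sqr_sqrtr// addr_ge0// sqr_ge0.
move: (Num.sqrt (q1 ^+ 2 + _)) (Num.sqrt (r1 ^+ 2 + _)) a0 b0 ea eb => a b a0 b0 ea eb.
have ab : q1 * r1 + q2 * r2 <= a * b.
  rewrite -(@ler_pXn2r _ 2)// ?nnegrE ?mulr_ge0 ?addr_ge0 ?mulr_ge0// exprMn ea eb.
  rewrite -subr_ge0 (_ : _ - _ = (q1 * r2 - q2 * r1) ^+ 2) ?sqr_ge0//; ring.
rewrite -(@ger0_norm _ (a + b)) ?addr_ge0// -sqrtr_sqr ler_wsqrtr//.
have p1' : p1 ^+ 2 <= (q1 + r1) ^+ 2 by rewrite lerXn2r ?nnegrE ?addr_ge0.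
have p2' : p2 ^+ 2 <= (q2 + r2) ^+ 2 by rewrite lerXn2r ?nnegrE ?addr_ge0.
apply: (le_trans (lerD p1' p2')); rewrite sqrrD [leRHS]sqrrD ea eb.
move: ab; rewrite !sqrrD; lra.
Qed.

(** * Calculus in H^1 *)

Section H1_space.
Context {R : realType}.
Local Notation leb := (@lebesgue_measure R).
Local Notation MR := (measurableTypeR R).
Implicit Types (f g phi : R -> R) (a b c d M : R).

(** [wderiv] is a choice, determined almost everywhere once weak derivatives on the domain are
    unique. The predicate lets one calculus serve both ]0, L[ and the whole line. *)
Definition wd_unique (D : set MR) := measurable D /\ forall f g1 g2, L2 D g1 -> L2 D g2 ->
  weak_deriv D f g1 -> weak_deriv D f g2 -> {ae leb, forall x, D x -> g1 x = g2 x}.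

Lemma wd_unique_itv a b : wd_unique `]a, b[%classic.
Proof. by split=> [|f g1 g2]; [exact: measurable_itv|exact: weak_deriv_unique_itv]. Qed.

Lemma wd_unique_setT : wd_unique setT.
Proof.
split => // f g1 g2 h1 h2 w1 w2.
have H n : {ae leb, forall x, `](- n%:R)%R, n%:R[%classic x -> g1 x = g2 x}.
  apply: (@weak_deriv_unique_itv _ _ _ f).
  - by apply: L2S h1.
  - by apply: L2S h2.
  - exact: weak_derivS w1.
  - exact: weak_derivS w2.
have /ae_foralln := H; move=> h; apply: (lebS h) => x /(_ (Num.truncn `|x|).+1) + _; apply.
by rewrite /= in_itv/= -ltr_norml truncnS_gt.
Qed.

Section with_domain.
Variable D : set MR.
Hypothesis uD : wd_unique D.

Let mD : measurable D. Proof. by case: uD. Qed.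

Lemma wderivP f : H1 D f -> L2 D (wderiv D f) /\ weak_deriv D f (wderiv D f).
Proof.
by move=> [_ [g gi wg]]; have := @xgetPex _ (fun=> 0) [set g | L2 D g /\ weak_deriv D f g];
  apply; exists g.
Qed.

Lemma H1_L2 f : H1 D f -> L2 D f. Proof. by case. Qed.

Lemma wderiv_ae f g : L2 D f -> L2 D g -> weak_deriv D f g ->
  {ae leb, forall x, D x -> wderiv D f x = g x}.
Proof.
move=> fi gi wg; have [h1 h2] : L2 D (wderiv D f) /\ weak_deriv D f (wderiv D f).
  by apply: wderivP; split => //; exists g.
exact: uD.2 h1 gi h2 wg.
Qed.

Lemma H1B f g : H1 D f -> H1 D g -> H1 D (fun x => f x - g x).
Proof.
move=> hf hg; have [f1 f2] := wderivP hf; have [g1 g2] := wderivP hg.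
split; first by apply: L2B => //; exact: H1_L2.
exists (fun x => wderiv D f x - wderiv D g x); first exact: L2B.
by apply: weak_derivB => //; exact: H1_L2.
Qed.

Lemma H1Z f k : H1 D f -> H1 D (fun x => k * f x).
Proof.
move=> hf; have [f1 f2] := wderivP hf.
split; first by apply: L2Z => //; exact: H1_L2.
exists (fun x => k * wderiv D f x); first exact: L2Z.
by apply: weak_derivZ => //; exact: H1_L2.
Qed.

Lemma wderivB f g : H1 D f -> H1 D g ->
  {ae leb, forall x, D x -> wderiv D (fun x => f x - g x) x = wderiv D f x - wderiv D g x}.
Proof.
move=> hf hg; have [f1 f2] := wderivP hf; have [g1 g2] := wderivP hg.
apply: wderiv_ae.
- by apply: L2B => //; exact: H1_L2.
- exact: L2B.
- by apply: weak_derivB => //; exact: H1_L2.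
Qed.

Lemma wderivZ f k : H1 D f ->
  {ae leb, forall x, D x -> wderiv D (fun x => k * f x) x = k * wderiv D f x}.
Proof.
move=> hf; have [f1 f2] := wderivP hf.
apply: wderiv_ae.
- by apply: L2Z => //; exact: H1_L2.
- exact: L2Z.
- by apply: weak_derivZ => //; exact: H1_L2.
Qed.

Lemma H1distE f g : H1 D f -> H1 D g -> H1dist D f g =
  Num.sqrt (norm2 D (fun x => f x - g x) ^+ 2
    + norm2 D (fun x => wderiv D f x - wderiv D g x) ^+ 2).
Proof.
move=> hf hg; rewrite /H1dist /H1inner; congr Num.sqrt; congr (_ + _).
  by rewrite norm2_sqr; apply: eq_Rintegral => x _; rewrite expr2.
have [f1 f2] := wderivP hf; have [g1 g2] := wderivP hg.
have [h1 h2] := wderivP (H1B hf hg).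
have [mB _] := L2B mD f1 g1; have [mh _] := h1.
rewrite norm2_sqr; apply: l_ae_eq_Rint => //.
- exact: measurable_funM.
- exact: measurable_funX.
- by apply: (lebS (wderivB hf hg)) => x + Dx => /(_ Dx) ->; rewrite expr2.
Qed.

Lemma H1dist_ge0 f g : 0 <= H1dist D f g. Proof. exact: sqrtr_ge0. Qed.

Lemma norm2_le_H1dist f g : H1 D f -> H1 D g ->
  norm2 D (fun x => f x - g x) <= H1dist D f g.
Proof.
move=> hf hg; rewrite H1distE// -{1}[norm2 _ _]ger0_norm ?norm2_ge0// -sqrtr_sqr.
by rewrite ler_wsqrtr// lerDl sqr_ge0.
Qed.

Lemma norm2_wderiv_le_H1dist f g : H1 D f -> H1 D g ->
  norm2 D (fun x => wderiv D f x - wderiv D g x) <= H1dist D f g.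
Proof.
move=> hf hg; rewrite H1distE// -{1}[norm2 _ _]ger0_norm ?norm2_ge0// -sqrtr_sqr.
by rewrite ler_wsqrtr// lerDr sqr_ge0.
Qed.

Lemma H1dist_triangle f g h : H1 D f -> H1 D g -> H1 D h ->
  H1dist D f h <= H1dist D f g + H1dist D g h.
Proof.
move=> hf hg hh; rewrite !H1distE//.
have [f1 _] := wderivP hf; have [g1 _] := wderivP hg; have [h1 _] := wderivP hh.
have := norm2D mD (L2B mD (H1_L2 hf) (H1_L2 hg)) (L2B mD (H1_L2 hg) (H1_L2 hh)).
have := norm2D mD (L2B mD f1 g1) (L2B mD g1 h1).
rewrite (_ : (fun x => wderiv D f x - wderiv D g x + (wderiv D g x - wderiv D h x)) =
  (fun x => wderiv D f x - wderiv D h x)); last by apply/funext => x; ring.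
rewrite (_ : (fun x => f x - g x + (g x - h x)) =
  (fun x => f x - h x)); last by apply/funext => x; ring.
move: (norm2_ge0 D (fun x => f x - h x)) (norm2_ge0 D (fun x => wderiv D f x - wderiv D h x)).
move: (norm2_ge0 D (fun x => f x - g x)) (norm2_ge0 D (fun x => wderiv D f x - wderiv D g x)).
move: (norm2_ge0 D (fun x => g x - h x)) (norm2_ge0 D (fun x => wderiv D g x - wderiv D h x)).
move: (norm2 D _) (norm2 D _) (norm2 D _) (norm2 D _) (norm2 D _) (norm2 D _).
move=> p1 p2 q1 q2 r1 r2 p10 p20 q10 q20 r10 r20 H2 H1.
exact: minkowski2.
Qed.

End with_domain.

Lemma H1_restrict (D D' : set MR) f : measurable D -> measurable D' -> D' `<=` D ->
  H1 D f -> H1 D' f.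
Proof.
move=> mD mD' sub [fi [g gi wg]]; split; first exact: L2S fi.
by exists g; [exact: L2S gi|exact: weak_derivS wg].
Qed.

Lemma itv_lty a b (x y : bool) : (leb [set` Interval (BSide x a) (BSide y b)] < +oo)%E.
Proof. by rewrite lebesgue_measure_itv/= lte_fin; case: ifPn => _; rewrite -?EFinB ltry. Qed.

Lemma tent_integral (D : set MR) (dl s : R) : measurable D -> 0 < dl ->
  `[s - dl, s + dl]%classic `<=` D -> \int[leb]_(x in D) tent dl s x = 1.
Proof.
move=> mD d0 sub; have dn0 : dl != 0 by rewrite gt_eqF.
have -> : \int[leb]_(x in D) tent dl s x = \int[leb]_(x in `[s - dl, s + dl]) tent dl s x.
  rewrite Rintegral_mkcond [RHS]Rintegral_mkcond; congr (Rintegral _ _ _).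
  apply/funext => x; rewrite !patchE; have [/set_mem xI|nI] := boolP (x \in `[s - dl, s + dl]%classic).
    by rewrite mem_set//; exact: sub.
  case: ifPn => // _; apply: tent_out => //; move: nI.
  rewrite notin_setE /= in_itv/= => /negP; rewrite negb_and -!ltNge => /orP[h|h]; [left|right]; exact: ltW.
have sd : s - dl < s + dl by lra.
have dstep x : derivable (step dl s) x 1 by have [] := is_derive_step s x dn0.
have cstep : continuous (step dl s).
  by move=> x; apply: differentiable_continuous; apply/derivable1_diffP.
rewrite /Rintegral (@continuous_FTC2 _ (tent dl s) (step dl s))//.
- by rewrite -EFinB/= step_ge1// ?step_le0// ?subr0.
- exact/continuous_subspaceT/tent_continuous.
- split; [by move=> x _|apply: cvg_at_right_filter; exact: cstep|apply: cvg_at_left_filter; exact: cstep].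
- by move=> x _; rewrite derive1E; have [_ ->] := is_derive_step s x dn0.
Qed.

Lemma tent_supp_norm (dl s x : R) : 0 < dl -> tent dl s x != 0 -> `|x - s| < dl.
Proof.
move=> d0 /eqP t0; rewrite ltNge; apply/negP => h; apply: t0; apply: tent_out => //.
by move: h; rewrite ler_normr => /orP[h|h]; [right|left]; lra.
Qed.

Lemma tent_le (dl s x : R) : 0 < dl -> tent dl s x <= dl^-1.
Proof.
move=> d0; have -> : dl^-1 = (dl ^+ 2)^-1 * dl by field; rewrite gt_eqF.
rewrite /tent ler_wpM2l ?invr_ge0 ?sqr_ge0//.
by rewrite /Num.max; (do 3 case: ifPn); rewrite -?leNgt => *; lra.
Qed.

(** The tents form an approximate identity: mass 1 and support within [dl] of [s]. *)
Lemma tent_average (dl s e : R) f : continuous f -> 0 < dl ->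
  (forall x, `|x - s| < dl -> `|f x - f s| <= e) ->
  L1 setT (fun x => f x * tent dl s x) /\ `|\int[leb]_x (f x * tent dl s x) - f s| <= e.
Proof.
move=> cf d0 fe.
have d1 : 0 <= dl^-1 by rewrite invr_ge0 ltW.
have t0 x : `|s| + dl < `|x| -> tent dl s x = 0.
  move=> sx; apply/eqP/negPn/negP => /(tent_supp_norm d0).
  by have := lerB_dist x s; lra.
have mt : measurable_fun setT (tent dl s) by apply: continuous_measurable_fun; exact: tent_continuous.
have ti : L1 setT (tent dl s).
  apply: (compact_support_L1 (M := dl^-1) _ _ _ t0) => // x.
  by rewrite ger0_norm ?tent_ge0// tent_le.
have fi : L1 setT (fun x => f x * tent dl s x).
  apply: (compact_support_L1 (M := (`|f s| + e) * dl^-1) (N := `|s| + dl)) => //.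
  - by apply: measurable_funM => //; exact: continuous_measurable_fun.
  - move=> x; have [->|/(tent_supp_norm d0) xs] := eqVneq (tent dl s x) 0.
      rewrite mulr0 normr0 mulr_ge0// addr_ge0//; have := fe s; rewrite !subrr normr0; exact.
    rewrite normrM ler_pM//; last by rewrite ger0_norm ?tent_ge0 ?tent_le.
    by have := fe x xs; have := ler_normB (f x) (f s); have := lerB_dist (f x) (f s); lra.
  - by move=> x /t0 ->; rewrite mulr0.
split => //.
have -> : f s = \int[leb]_x (f s * tent dl s x) by rewrite RintegralZl// tent_integral// mulr1.
rewrite -RintegralB//; last exact: l_intgZ.
have -> : e = \int[leb]_x (e * tent dl s x) by rewrite RintegralZl// tent_integral// mulr1.
apply: l_Rint_norm_le => //.
- by apply: measurable_funB; [exact: (@intgM _ _ _ leb)|apply: measurable_funM].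
- exact: l_intgZ.
- apply: aeW => x _; rewrite -mulrBl normrM (ger0_norm (tent_ge0 _ _ _))//.
  have [->|/(tent_supp_norm d0) xs] := eqVneq (tent dl s x) 0; first by rewrite !mulr0.
  by rewrite ler_wpM2r ?tent_ge0//; exact: fe.
Qed.

(* Testing the weak derivative against the bumps of ]c, d[: the derivative of a bump is a
   difference of two unit-mass tents shrinking to c and to d. *)
Lemma H1_FTC f c d : H1 setT f -> continuous f -> c < d ->
  f d - f c = \int[leb]_(x in `]c, d[) wderiv setT f x.
Proof.
move=> hf cf cd; have [gi wg] := wderivP hf; set g := wderiv setT f in gi wg *.
have mI : measurable (`]c, d[%classic : set MR) by [].
have bt n : test_fun setT (bumps c d n) by exact: bumps_test.
have H1 : \int[leb]_x (g x * bumps c d n x) @[n --> \oo] --> \int[leb]_(x in `]c, d[) g x.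
  have e n : \int[leb]_x (g x * bumps c d n x) = \int[leb]_(x in `]c, d[) (g x * bumps c d n x).
    rewrite [RHS]Rintegral_mkcond; congr (Rintegral _ _ _); apply/funext => x; rewrite patchE.
    by case: ifPn => // /negP nx; rewrite bumps_out ?mulr0// => ?; apply: nx; rewrite inE.
  under eq_cvg do rewrite e.
  have giI : L1 (`]c, d[%classic : set MR) g.
    by apply: L2_L1 => //; [exact: itv_lty|exact: L2S gi].
  apply: (@Rint_dct _ _ _ leb _ _ _ (fun x => `|g x|)) => //.
  - move=> n; apply: measurable_funM; first exact: (intgM giI).
    have [[m _] _] := test_L2 mI (bt n); exact: m.
  - exact: (intgM giI).
  - exact: l_intg_abs.
  - apply: aeW => x xI; rewrite -[g x in X in _ --> X]mulr1; apply: cvgM; first exact: cvg_cst.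
    by have := @bumps_cvg _ c d x cd; rewrite indicE mem_set.
  - move=> n; apply: aeW => x xI; have /andP[b0 b1] := bumps_itv n x cd.
    by rewrite normrM (ger0_norm b0) ler_piMr.
have H2 : \int[leb]_x (f x * derive1 (bumps c d n) x) @[n --> \oo] --> f c - f d.
  apply/cvgrPdist_le => e e0.
  have near_c a : exists2 d0, 0 < d0 & forall x, `|x - a| < d0 -> `|f x - f a| <= e / 8.
    have /cvgrPdist_le/(_ (e / 8)) := cf a; rewrite divr_gt0// => /(_ isT).
    move=> /nbhs_ballP[d0 d00 h]; exists d0 => // x xa; rewrite distrC; apply: h.
    by rewrite /ball /= distrC.
  have [d1 d10 h1] := near_c c; have [d2 d20 h2] := near_c d.
  have m0 : 0 < Num.min d1 d2 / 4 by rewrite divr_gt0// lt_min d10 d20.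
  have /cvgrPdist_lt/(_ _ m0) := dlseq_cvg c d; apply: filterS => n.
  have t0 := dlseq_gt0 n cd; rewrite sub0r normrN gtr0_norm//.
  rewrite ltr_pdivlMr// lt_min => /andP[k1 k2].
  rewrite derive1_bump//; set t := dlseq c d n in t0 k1 k2 *.
  (* The tents are centred at c + 2t and d - 2t with half-width t, so their supports stay within 3t
     < d0 of the endpoints. *)
  have aux a d0 s : 0 < d0 -> (forall x, `|x - a| < d0 -> `|f x - f a| <= e / 8) ->
      t * 4 < d0 -> `|s - a| <= 2 * t ->
      (forall x, `|x - s| < t -> `|f x - f s| <= e / 4) /\ `|f s - f a| <= e / 8.
    move=> d00 h k sa; split; last by apply: h; lra.
    move=> x xs; have A : `|f x - f a| <= e / 8.
      by apply: h; have := ler_distD s x a; lra.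
    have B : `|f s - f a| <= e / 8 by apply: h; lra.
    by have := ler_distD (f a) (f x) (f s); rewrite [`|f a - f s|]distrC; lra.
  have [a1 b1] : (forall x, `|x - (c + 2 * t)| < t -> `|f x - f (c + 2 * t)| <= e / 4) /\
     `|f (c + 2 * t) - f c| <= e / 8.
    by apply: (aux c d1) => //; rewrite addrC addKr ger0_norm// mulr_ge0// ltW.
  have [a2 b2] : (forall x, `|x - (d - 2 * t)| < t -> `|f x - f (d - 2 * t)| <= e / 4) /\
     `|f (d - 2 * t) - f d| <= e / 8.
    by apply: (aux d d2) => //; rewrite addrC addKr normrN ger0_norm// mulr_ge0// ltW.
  have [i1 c1] := tent_average cf t0 a1; have [i2 c2] := tent_average cf t0 a2.
  under eq_Rintegral do rewrite mulrBr.
  rewrite RintegralB//; move: c1 c2 b1 b2; rewrite !ler_norml.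
  move=> /andP[? ?] /andP[? ?] /andP[? ?] /andP[? ?]; apply/andP; split; lra.
have e : (fun n => \int[leb]_x (f x * derive1 (bumps c d n) x)) =
   (fun n => - \int[leb]_x (g x * bumps c d n x)) by apply/funext => n; rewrite wg.
rewrite e in H2; have h := cvg_unique _ H2 (cvgN H1).
by rewrite -[RHS]opprK -h// opprB.
Qed.

End H1_space.

(** * Weak differentiability of paths in H^1 *)

Lemma cvg_unique_ext {R : realType} {I : Type} {F : set_system I} {FF : ProperFilter F} (u v : I -> R) (a b : R) :
  u i @[i --> F] --> a -> v i @[i --> F] --> b -> (forall i, u i = v i) -> a = b.
Proof. by move=> ua vb /funext uv; rewrite uv in ua; exact: cvg_unique ua vb. Qed.

(** * Monotone class induction and Riesz representation in L^2 *)

Section Function_class_induction.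
Context {R : realType}.
Local Notation leb := (@lebesgue_measure R).
Local Notation MR := (measurableTypeR R).
Implicit Types (f g h : R -> R) (A : set MR).

Section induction.
Import HBNNSimple.
Variables Q P : (R -> R) -> Prop.
Hypothesis Qm : forall f, Q f -> measurable_fun setT f.
Hypothesis Q_ideal : forall f g, Q f -> measurable_fun setT g ->
  (forall x, `|g x| <= `|f x|) -> Q g.
Hypothesis QD : forall f g, Q f -> Q g -> Q (fun x => f x + g x).
Hypothesis QZ : forall k f, Q f -> Q (fun x => k * f x).
Hypothesis PD : forall f g, Q f -> Q g -> P f -> P g -> P (fun x => f x + g x).
Hypothesis PZ : forall k f, Q f -> P f -> P (fun x => k * f x).
Hypothesis P_dct : forall f (f_ : nat -> R -> R), Q f ->
  (forall n, measurable_fun setT (f_ n)) -> (forall n x, `|f_ n x| <= `|f x|) ->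
  (forall x, f_ n x @[n --> \oo] --> f x) -> (forall n, P (f_ n)) -> P f.
Hypothesis P_indic : forall A, measurable A -> Q \1_A -> P \1_A.

Let Q0 f : Q f -> Q (fun=> 0).
Proof. by move=> Qf; apply: (Q_ideal Qf) => // x; rewrite normr0. Qed.

Let P0 f : Q f -> P (fun=> 0).
Proof.
move=> Qf; have := @P_indic set0 measurable0.
have -> : \1_set0 = (fun=> 0 : R) :> (R -> R) by apply/funext => x; rewrite indicE in_set0.
by apply; exact: Q0 Qf.
Qed.

Let P_nnsfun (g : {nnsfun MR >-> R}) : Q g -> P g.
Proof.
move=> Qg.
have -> : (g : R -> R) = (fun x => \sum_(y <- finmap.enum_fset (fset_set (range g))) y * \1_(g @^-1` [set y]) x).
  by apply/funext => x; rewrite {1}fimfunE fsbig_finite.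
have H y : Q (fun x => y * \1_(g @^-1` [set y]) x) /\ P (fun x => y * \1_(g @^-1` [set y]) x).
  have mA : measurable (g @^-1` [set y] : set MR) by exact: measurable_sfunP.
  have [->|y0] := eqVneq y 0.
    have -> : (fun x => 0 * \1_(g @^-1` [set 0]) x) = (fun=> 0 : R) by apply/funext => x; rewrite mul0r.
    by split; [exact: Q0 Qg|exact: P0 Qg].
  have QA : Q \1_(g @^-1` [set y]).
    apply: (Q_ideal (QZ y^-1 Qg)); first exact: measurable_indic.
    move=> x; rewrite indicE; case: (boolP (x \in _)) => [|_]; last by rewrite normr0.
    by rewrite inE /= => ->; rewrite mulVf// normr1.
  by split; [exact: QZ|apply: PZ => //; exact: P_indic].
suff : forall s : seq R, Q (fun x => \sum_(y <- s) y * \1_(g @^-1` [set y]) x) /\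
    P (fun x => \sum_(y <- s) y * \1_(g @^-1` [set y]) x) by move=> h; have [] := h (finmap.enum_fset (fset_set (range g))).
elim => [|y s [IHQ IHP]].
  have -> : (fun x => \sum_(y <- [::]) y * \1_(g @^-1` [set y]) x) = (fun=> 0 : R).
    by apply/funext => x; rewrite big_nil.
  by split; [exact: Q0 Qg|exact: P0 Qg].
have -> : (fun x => \sum_(y <- y :: s) y * \1_(g @^-1` [set y]) x) =
  (fun x => y * \1_(g @^-1` [set y]) x + \sum_(y <- s) y * \1_(g @^-1` [set y]) x).
  by apply/funext => x; rewrite big_cons.
by have [Hq Hp] := H y; split; [exact: QD|exact: PD].
Qed.

Let P_ge0 f : Q f -> (forall x, 0 <= f x) -> P f.
Proof.
move=> Qf f0; have mf : measurable_fun (setT : set MR) (EFin \o f) by apply/measurable_EFinP; exact: Qm.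
have F0 (x : MR) : setT x -> (0 <= (EFin \o f) x)%E by rewrite lee_fin.
pose g := nnsfun_approx measurableT mf.
have cg x : g n x @[n --> \oo] --> f x.
  have := @cvg_nnsfun_approx _ _ _ _ measurableT _ mf F0 x Logic.I.
  by move=> /fine_cvg; apply: cvg_trans.
have gf n x : `|g n x| <= `|f x|.
  rewrite !ger0_norm//.
  have nd : nondecreasing_seq (fun n => g n x).
    by move=> m k mk; have /lefP := nd_nnsfun_approx measurableT mf mk; apply.
  have := nondecreasing_cvgn_le nd; have c : cvgn (fun n => g n x) by apply/cvg_ex; exists (f x).
  by move=> /(_ c n); rewrite (cvg_lim _ (cg x)).
have mg n : measurable_fun (setT : set MR) (g n : MR -> R) by exact: (@measurable_funPT _ _ MR R (g n)).
apply: (@P_dct f (fun n (x : R) => g n x : R)) => // n.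
by apply: P_nnsfun; apply: (Q_ideal Qf) => //; exact: mg.
Qed.

(** From indicators to simple functions, to nonnegative functions by dominated approximation, to
    differences. [Q] is the class of admissible functions, stable under smaller absolute values; it
    serves for the bounded functions and for L^2. *)
Lemma fun_class_ind f : Q f -> P f.
Proof.
move=> Qf; have mf := Qm Qf.
have Qp : Q (f^\+)%R.
  apply: (Q_ideal Qf); first exact: measurable_funrpos.
  by move=> x; rewrite /funrpos /Num.max; case: ifPn => // _; rewrite normr0.
have Qn : Q (f^\-)%R.
  apply: (Q_ideal Qf); first exact: measurable_funrneg.
  by move=> x; rewrite /funrneg /Num.max; case: ifPn => // _; rewrite ?normr0// normrN.
have -> : f = (fun x => f^\+ x + (-1) * f^\- x)%R.
  apply/funext => x; rewrite mulN1r /funrpos /funrneg /Num.max.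
  by do 2 case: ifPn; rewrite -?leNgt => *; lra.
apply: PD => //; first exact: QZ.
- by apply: P_ge0 => // x; exact: funrpos_ge0.
- by apply: PZ => //; apply: P_ge0 => // x; exact: funrneg_ge0.
Qed.

End induction.

(** Dominated convergence with the majorant 4 f^2 for the squared difference. *)
Lemma norm2_dct (D : set MR) f (f_ : nat -> R -> R) : measurable D -> L2 D f ->
  (forall n, measurable_fun D (f_ n)) -> (forall n x, D x -> `|f_ n x| <= `|f x|) ->
  (forall x, D x -> f_ n x @[n --> \oo] --> f x) ->
  norm2 D (fun x => f_ n x - f x) @[n --> \oo] --> 0.
Proof.
move=> mD [mf fi] mf_ f_f cf; rewrite /norm2 -[X in _ --> X]sqrtr0.
apply: continuous_cvg; first exact: sqrt_continuous.
have -> : (0 : R) = \int[leb]_(x in D) 0 by rewrite Rintegral_cst// mul0r.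
have i4 : L1 D (fun x => 4 * f x ^+ 2) by exact: l_intgZ.
apply: (@Rint_dct _ _ _ leb D _ _ (fun x => 4 * f x ^+ 2)) => //.
- by move=> n; apply: measurable_funX; exact: measurable_funB.
- apply: aeW => x Dx; have h : f_ n x - f x @[n --> \oo] --> 0.
    by rewrite -(subrr (f x)); apply: cvgB; [exact: cf|exact: cvg_cst].
  by have h2 := cvgM h h; rewrite mulr0 in h2; exact: h2.
- move=> n; apply: aeW => x Dx; rewrite ger0_norm ?sqr_ge0//.
  have := f_f n x Dx; rewrite -[f x ^+ 2]real_normK ?num_real// -[(_ - _) ^+ 2]real_normK ?num_real//.
  have := ler_normB (f_ n x) (f x); have := normr_ge0 (f_ n x); have := normr_ge0 (f_ n x - f x).
  have := normr_ge0 (f x); move: `|_| `|_| `|_| => a b c; nra.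
Qed.

Section Riesz.
Variables (l : (R -> R) -> R) (B : R).
Hypothesis lD : forall f g, L2 setT f -> L2 setT g -> l (fun x => f x + g x) = l f + l g.
Hypothesis lZ : forall k f, L2 setT f -> l (fun x => k * f x) = k * l f.
Hypothesis lB : forall f, L2 setT f -> `|l f| <= B * norm2 setT f.

Let l_dct f (f_ : nat -> R -> R) : L2 setT f ->
  (forall n, measurable_fun setT (f_ n)) -> (forall n x, `|f_ n x| <= `|f x|) ->
  (forall x, f_ n x @[n --> \oo] --> f x) -> l (f_ n) @[n --> \oo] --> l f.
Proof.
move=> Lf mf_ f_f cf.
have Lf_ n : L2 setT (f_ n) by apply: (L2_le _ _ Lf) => //; apply: aeW => x _; exact: f_f.
have := norm2_dct measurableT Lf mf_ (fun n x _ => f_f n x) (fun x _ => cf x).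
move=> /(cvgM (cvg_cst B)); rewrite mulr0 => /cvgr0Pnorm_lt h.
apply/cvgrPdist_lt => e /h; apply: filterS => n; apply: le_lt_trans; rewrite distrC.
have -> : l (f_ n) - l f = l (fun x => f_ n x + (- 1) * f x).
  by rewrite lD ?lZ ?mulN1r//; exact: L2Z.
apply: (le_trans (lB _)); first by apply: L2D => //; exact: L2Z.
rewrite (_ : (fun x => _) = (fun x => f_ n x - f x)) ?ler_norm//.
by apply/funext => x; rewrite mulN1r.
Qed.

(** The line has infinite measure, so indicators are weighted: the square root of the Gaussian
    density is positive everywhere and lies in L^2. *)
Let g0 x : R := Num.sqrt (normal_pdf 0 1 x).

Let g0_gt0 x : 0 < g0 x.
Proof.
by rewrite sqrtr_gt0 normal_pdfE ?oner_eq0// mulr_gt0 ?expR_gt0// normal_peak_gt0// oner_eq0.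
Qed.

Let mg0 : measurable_fun setT g0.
Proof.
apply: (@measurableT_comp _ _ _ _ _ _ (@Num.sqrt R)); last exact: measurable_normal_pdf.
by apply: continuous_measurable_fun; exact: sqrt_continuous.
Qed.

Let mg0V : measurable_fun setT (fun x => (g0 x)^-1).
Proof.
apply: continuous_measurable_fun => x; apply: cvgV; first by rewrite gt_eqF.
by apply: continuous_cvg; [exact: sqrt_continuous|apply: continuous_normal_pdf; exact: oner_neq0].
Qed.

Let L2g0 : L2 setT g0.
Proof.
split => //; have := integrable_normal_pdf (0 : R) 1; apply: eq_integrable => // x _ /=.
by rewrite /g0 sqr_sqrtr// normal_pdf_ge0.
Qed.

Let L2Ag0 A : measurable A -> L2 setT (fun x => \1_A x * g0 x).
Proof.
move=> mA; apply: (L2_le _ _ L2g0) => //; first exact: measurable_funM.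
apply: aeW => x _; rewrite normrM ler_piMl// indicE.
by case: (_ \in _); rewrite ?normr1 ?normr0.
Qed.

Let nu A : \bar R := (l (fun x => \1_A x * g0 x))%:E.

Let nu0 : nu set0 = 0%E.
Proof.
rewrite /nu (_ : (fun x => _) = (fun x => 0 * g0 x)); last first.
  by apply/funext => x; rewrite indicE in_set0.
by rewrite lZ// mul0r.
Qed.

Let nu_fin A : measurable A -> nu A \is a fin_num. Proof. by []. Qed.

Let nu_sigma : semi_sigma_additive nu.
Proof.
move=> F mF tF mUF; rewrite /nu.
have mU n : measurable (\big[setU/set0]_(i < n) F i : set MR) by exact: bigsetU_measurable.
have -> : (fun n => \sum_(0 <= i < n) (l (fun x => \1_(F i) x * g0 x))%:E)%E =
    (fun n => (l (fun x => \1_(\big[setU/set0]_(i < n) F i) x * g0 x))%:E).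
  apply/funext => n; elim: n => [|n IH]; first by rewrite big_nil big_ord0 -/(nu set0) nu0.
  rewrite big_nat_recr//= IH -EFinD -lD//; try exact: L2Ag0.
  congr ((l _)%:E); apply/funext => x; rewrite -mulrDl; congr (_ * _).
  rewrite big_ord_recr/= !indicE in_setU.
  have [xF|] := boolP (x \in F n); last by rewrite orbF addr0.
  rewrite orbT; suff /negbTE -> : x \notin \big[setU/set0]_(i < n) F i by rewrite add0r.
  apply/negP; rewrite inE -bigcup_mkord => -[i /= ilt xi].
  have /trivIsetP/(_ i n Logic.I Logic.I) := tF; rewrite neq_ltn ilt => /(_ isT).
  by apply/eqP/set0P; exists x; split => //; rewrite inE in xF.
apply: cvg_EFin; first exact: nearW.
rewrite (_ : fine \o _ = fun n => l (fun x => \1_(\big[setU/set0]_(i < n) F i) x * g0 x)); last by [].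
apply: l_dct.
- exact: L2Ag0.
- by move=> n; exact: (L2Ag0 (mU n)).1.
- move=> n x; rewrite !normrM ler_wpM2r// !indicE.
  have [|_] := boolP (x \in \big[setU/set0]_(i < n) F i); last by rewrite normr0.
  by rewrite inE -bigcup_mkord => -[i _ xi]; rewrite mem_set//; exists i.
- move=> x; apply: cvgM; last exact: cvg_cst.
  rewrite indicE; have [|nx] := boolP (x \in _); last first.
    apply: cvg_near_cst; apply: nearW => n; rewrite indicE.
    case: (boolP (x \in _)) => //; rewrite inE -bigcup_mkord => -[i _ xi].
    by move: nx; rewrite mem_set//; exists i.
  rewrite inE => -[i _ xi]; apply: cvg_near_cst; exists i.+1 => // n /= ni.
  by rewrite indicE mem_set// -bigcup_mkord; exists i.
Qed.

(** The finite charge A |-> l(1_A g0) is dominated by Lebesgue measure; its density [h] yields v = h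
    / g0. The formula holds first for bounded multiples of [g0]; then [l] tested on truncations of
    [v] shows that [v] is in L^2, and truncations of [g] give the general case. *)
Lemma L2_Riesz : exists2 v, L2 setT v &
  forall g, L2 setT g -> l g = \int[leb]_x (v x * g x).
Proof.
pose nuc : smeas R := HB.pack_for (smeas R) nu (isCharge.Build _ MR R nu nu0 nu_fin nu_sigma).
have dom : nuc `<< leb.
  move=> N nN A mA AN; have A0 := nN A mA AN.
  rewrite /= /nu; congr EFin; apply/eqP; rewrite -normr_le0.
  apply: (le_trans (lB (L2Ag0 mA))).
  have -> : norm2 setT (fun x => \1_A x * g0 x) = norm2 setT (fun=> 0 : R); last by rewrite norm2_0// mulr0.
  apply: norm2_ae => //; first exact: (L2Ag0 mA).1.
  exists A; split => // x /= h; apply: contrapT => nA; apply: h => _.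
  by rewrite indicE memNset// mul0r.
pose h := fine \o Radon_Nikodym nuc leb.
have hi : L1 setT h.
  have := Radon_Nikodym_integrable dom; apply: eq_integrable => // x _ /=.
  by rewrite fineK// Radon_Nikodym_fin_num.
have mh : measurable_fun (setT : set R) h := intgM hi.
have hE A : measurable A -> l (fun x => \1_A x * g0 x) = \int[leb]_x (\1_A x * h x).
  move=> mA; have := Radon_Nikodym_integral dom mA; rewrite /= /nu => e.
  rewrite -[LHS]/(fine (l (fun x => \1_A x * g0 x))%:E) e.
  under [RHS]eq_Rintegral do rewrite mulrC.
  rewrite -Rint_setI setTI; congr fine; apply: eq_integral => x _ /=.
  by rewrite fineK// Radon_Nikodym_fin_num.
pose Q (f : R -> R) := measurable_fun setT f /\ exists M, forall x, `|f x| <= M.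
have QL f : Q f -> L2 setT (fun x => f x * g0 x).
  move=> [mf [M fM]]; apply: (L2_le _ _ (L2Z M _ L2g0)) => //; first exact: measurable_funM.
  apply: aeW => x _; rewrite !normrM ler_wpM2r//; apply: (le_trans (fM x)); exact: ler_norm.
have QL1 f : Q f -> L1 setT (fun x => f x * h x).
  move=> [mf [M fM]]; have Mi := l_intgZ M measurableT (l_intg_abs measurableT hi).
  apply: (l_intg_ae_le _ _ Mi) => //; first exact: measurable_funM.
  by apply: aeW => x _; rewrite normrM ler_wpM2r.
have main f : Q f -> l (fun x => f x * g0 x) = \int[leb]_x (f x * h x).
  apply: (@fun_class_ind Q (fun f => l (fun x => f x * g0 x) = \int[leb]_x (f x * h x))).
  - by move=> f1 [].
  - by move=> f1 f2 [_ [M fM]] m2 f21; split => //; exists M => x; exact: le_trans (fM x).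
  - move=> f1 f2 [m1 [M1 h1]] [m2 [M2 h2]]; split; first exact: measurable_funD.
    by exists (M1 + M2) => x; apply: (le_trans (ler_normD _ _)); exact: lerD.
  - move=> k f1 [m1 [M1 h1]]; split; first exact: measurable_funM.
    by exists (`|k| * M1) => x; rewrite normrM ler_wpM2l.
  - move=> f1 f2 q1 q2 e1 e2; under eq_Rintegral do rewrite mulrDl.
    rewrite RintegralD//; try exact: QL1.
    rewrite -e1 -e2 -lD; try exact: QL.
    by congr l; apply/funext => x; rewrite mulrDl.
  - move=> k f1 q1 e1; under eq_Rintegral do rewrite -mulrA.
    rewrite RintegralZl//; last exact: QL1.
    by rewrite -e1 -lZ; [congr l; apply/funext => x; rewrite mulrA|exact: QL].
  - move=> f1 f_ q1 m_ f_f c1 e_; have [m1 _] := q1.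
    have A : l (fun x => f_ n x * g0 x) @[n --> \oo] --> l (fun x => f1 x * g0 x).
      apply: l_dct; first exact: QL.
      + by move=> n; exact: measurable_funM.
      + by move=> n x; rewrite !normrM ler_wpM2r.
      + by move=> x; apply: cvgM; [exact: c1|exact: cvg_cst].
    have C : \int[leb]_x (f_ n x * h x) @[n --> \oo] --> \int[leb]_x (f1 x * h x).
      apply: (@Rint_dct _ _ _ leb setT _ _ (fun x => `|f1 x * h x|)) => //.
      + by move=> n; apply: measurable_funM; [exact: m_|exact: mh].
      + by apply: measurable_funM; [exact: m1|exact: mh].
      + by apply: l_intg_abs; [exact: measurableT|exact: QL1].
      + by apply: aeW => x _; apply: cvgM; [exact: c1|exact: cvg_cst].
      + by move=> n; apply: aeW => x _; rewrite !normrM ler_wpM2r.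
    by apply: (cvg_unique_ext A C) => n; exact: e_.
  - by move=> A mA _; exact: hE.
pose v (x : R) : R := h x / g0 x.
have mv : measurable_fun (setT : set MR) v.
  by apply: measurable_funM => //.
(* Cutting to 0 beyond the level, rather than to the level: the truncation is a product with an
   indicator, and its square is nondecreasing in [k]. *)
pose tr (k : nat) (r : R -> R) x := r x * \1_[set x | `|r x| <= k%:R] x.
have mtr (k : nat) (r : R -> R) : measurable_fun (setT : set MR) r -> measurable_fun (setT : set MR) (tr k r).
  move=> mr; apply: measurable_funM => //; apply: measurable_indic.
  have mn : measurable_fun (setT : set MR) (fun x => `|r x|) by exact: measurableT_comp.
  have := mn measurableT _ (measurable_itv `]-oo, k%:R]); rewrite setTI.
  by congr measurable; apply/seteqP; split => x /=; rewrite in_itv.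
have tr_le (k : nat) (r : R -> R) (x : R) : `|tr k r x| <= `|r x|.
  rewrite /tr normrM ler_piMr// indicE.
  by case: (_ \in _); rewrite ?normr1 ?normr0.
have tr_bd (k : nat) (r : R -> R) (x : R) : `|tr k r x| <= k%:R.
  rewrite /tr indicE; case: (boolP (x \in _)) => [|_]; last by rewrite mulr0 normr0.
  by rewrite inE /= mulr1.
have trE (k : nat) (r : R -> R) (x : R) : `|r x| <= k%:R -> tr k r x = r x.
  by move=> h1; rewrite /tr indicE mem_set// mulr1.
have tr_cvg (r : R -> R) (x : R) : tr k r x @[k --> \oo] --> r x.
  apply: cvg_near_cst; near=> k; apply: trE; near: k; exact: nbhs_infty_ger.
have Qtr (k : nat) (r : R -> R) : measurable_fun (setT : set MR) r -> Q (tr k r).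
  by move=> mr; split; [exact: mtr|exists k%:R => x; exact: tr_bd].
have mainL g : measurable_fun (setT : set MR) g -> forall k : nat,
    l (fun x => tr k (fun y => g y / g0 y) x * g0 x) = \int[leb]_x (v x * (tr k (fun y => g y / g0 y) x * g0 x)).
  move=> mg k; rewrite main; last first.
    by apply: Qtr; apply: measurable_funM => //.
  apply: eq_Rintegral => x _; rewrite /v; field.
  by rewrite gt_eqF.
pose w (k : nat) (x : R) : R := tr k (fun y => v y / g0 y) x * g0 x.
have wE (k : nat) (x : R) : w k x = v x * \1_[set x | `|v x / g0 x| <= k%:R] x.
  by rewrite /w /tr mulrAC divfK// gt_eqF.
have mvg : measurable_fun (setT : set MR) (fun y => v y / g0 y).
  by apply: measurable_funM => //.
(* l(w k) is the square of the norm of [w k] and at most B times that norm. The resulting bound is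
   uniform in [k], and monotone convergence carries it over to [v]. *)
have wB (k : nat) : \int[leb]_x (w k x ^+ 2) <= B ^+ 2.
  have Lw : L2 setT (w k) by apply: QL; exact: Qtr.
  have := lB Lw; rewrite mainL// => /(le_trans (ler_norm _)).
  have -> : \int[leb]_x (v x * (tr k (fun y => v y / g0 y) x * g0 x)) = norm2 setT (w k) ^+ 2.
    rewrite norm2_sqr; apply: eq_Rintegral => x _; rewrite -/(w k x) wE expr2.
    by rewrite indicE; case: (_ \in _); rewrite ?mulr1// !mulr0.
  have := norm2_ge0 setT (w k); rewrite le_eqVlt => /predU1P[e0 _|n0].
    by rewrite -norm2_sqr -e0 expr0n/= sqr_ge0.
  by rewrite expr2 ler_pM2r// => nB; rewrite -norm2_sqr lerXn2r ?nnegrE ?(le_trans (ltW n0) nB)// ltW.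
have L2v : L2 setT v.
  split => //; apply/integrableP; split; first by apply/measurable_EFinP; exact: measurable_funX.
  apply: (@le_lt_trans _ _ (B ^+ 2)%:E); last exact: ltry.
  have -> : (\int[leb]_x `|(EFin \o (fun x => (v x ^+ 2)%R)) x|)%E =
     (\int[leb]_x (fun x => limn (fun k => (w k x ^+ 2)%:E)) x)%E.
    apply: eq_integral => x _ /=; rewrite ger0_norm ?sqr_ge0//; apply/esym/cvg_lim => //.
    apply: cvg_EFin; first exact: nearW.
    have c : w k x @[k --> \oo] --> v x.
      rewrite -(divfK (lt0r_neq0 (g0_gt0 x)) (v x)); apply: cvgM; last exact: cvg_cst.
      exact: (tr_cvg (fun y => v y / g0 y)).
    exact: (cvgM c c).
  have mono : (\int[leb]_x (w k x ^+ 2)%:E)%E @[k --> \oo] -->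
     (\int[leb]_x (fun x => limn (fun k => (w k x ^+ 2)%:E)) x)%E.
    apply: cvg_monotone_convergence => //.
    + by move=> k; apply/measurable_EFinP/measurable_funX; have [] : L2 setT (w k) by apply: QL; exact: Qtr.
    + by move=> k x _; rewrite lee_fin sqr_ge0.
    + move=> x _ m n mn; rewrite lee_fin !wE !indicE.
      case: (boolP (x \in _)) => [|_]; last by rewrite mulr0 expr0n/= sqr_ge0.
      rewrite inE /= => hx; rewrite mem_set//=; apply: le_trans hx _.
      by rewrite ler_nat.
  rewrite -(cvg_lim _ mono)//; apply: lime_le; first by apply/cvg_ex; eexists; exact: mono.
  apply: nearW => k; have [_ wi] : L2 setT (w k) by apply: QL; exact: Qtr.
  rewrite -[leLHS]fineK; last exact: integrable_fin_num.
  by rewrite lee_fin; exact: wB.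
exists v => // g Lg; have [mg _] := Lg.
pose gk (k : nat) (x : R) : R := tr k (fun y => g y / g0 y) x * g0 x.
have gkE x : gk k x @[k --> \oo] --> g x.
  rewrite -(divfK (lt0r_neq0 (g0_gt0 x)) (g x)); apply: cvgM; last exact: cvg_cst.
  exact: (tr_cvg (fun y => g y / g0 y)).
have gk_le (k : nat) (x : R) : `|gk k x| <= `|g x|.
  rewrite /gk normrM (le_trans (ler_wpM2r _ (tr_le _ _ _)))// -normrM divfK// gt_eqF//.
have mgk (k : nat) : measurable_fun (setT : set MR) (gk k).
  by apply: measurable_funM => //; apply: mtr; apply: measurable_funM => //.
have A := l_dct Lg mgk gk_le gkE.
have C : \int[leb]_x (v x * gk k x) @[k --> \oo] --> \int[leb]_x (v x * g x).
  apply: (@Rint_dct _ _ _ leb setT _ _ (fun x => `|v x * g x|)) => //.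
  - by move=> n; exact: measurable_funM.
  - exact: measurable_funM.
  - by apply: l_intg_abs => //; exact: L2M.
  - by apply: aeW => x _; apply: cvgM; [exact: cvg_cst|exact: gkE].
  - move=> n; apply: aeW => x _; rewrite normrM [leRHS]normrM; exact: ler_wpM2l.
by apply: (cvg_unique_ext A C) => n; exact: mainL.
Unshelve. all: by end_near. Qed.

End Riesz.

End Function_class_induction.

(** * Density of rational intervals in L^2 *)

Section L2_density.
Context {R : realType}.
Local Notation leb := (@lebesgue_measure R).
Local Notation MR := (measurableTypeR R).
Implicit Types (f g h : R -> R) (A : set MR).

Lemma indic_in (S : set R) (x : R) : S x -> \1_S x = 1 :> R.
Proof. by move=> Sx; rewrite indicE mem_set. Qed.

Lemma indic_notin (S : set R) (x : R) : ~ S x -> \1_S x = 0 :> R.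
Proof. by move=> Sx; rewrite indicE memNset. Qed.

Lemma itvoo_setI (a b c d : R) :
  `]a, b[%classic `&` `]c, d[ = `]Num.max a c, Num.min b d[%classic :> set R.
Proof.
by apply/seteqP; split => x /=; rewrite !in_itv/= gt_max lt_min;
  [move=> [/andP[-> ->] /andP[-> ->]]|move=> /andP[/andP[-> ->] /andP[-> ->]]].
Qed.

Lemma L2_indic A (M : R) : measurable A -> A `<=` `]- M, M[ -> L2 setT (\1_A : R -> R).
Proof.
move=> mA AM; split; first exact: measurable_indic.
have i1 : L1 setT (\1_(`]- M, M[ : set R) : R -> R).
  exact: integrable_indic_itv.
apply: (l_intg_ae_le _ _ i1) => //; first by apply: measurable_funX; exact: measurable_indic.
apply: aeW => x _; rewrite !indicE.
case: (boolP (x \in A)) => [|_]; last by rewrite expr0n/= normr0.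
by rewrite inE => /AM xM; rewrite mem_set// expr1n normr1.
Qed.

Lemma itvoo_sub_sym (a b : R) : (`]a, b[ : set R) `<=` `]- (`|a| + `|b|), (`|a| + `|b|)[.
Proof.
move=> x /=; rewrite !in_itv/= => /andP[ax xb]; apply/andP; split.
- apply: le_lt_trans ax; rewrite opprD; have := ler_norm (- a); rewrite normrN.
  by have := normr_ge0 b; lra.
- by apply: (lt_le_trans xb); have := ler_norm b; have := normr_ge0 a; lra.
Qed.

Section density.
Variable P : (R -> R) -> Prop.
Hypothesis PD : forall f g, L2 setT f -> L2 setT g -> P f -> P g -> P (fun x => f x + g x).
Hypothesis PZ : forall k f, L2 setT f -> P f -> P (fun x => k * f x).
Hypothesis P_closed : forall f, L2 setT f -> (forall e : R, 0 < e ->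
  exists g, [/\ L2 setT g, P g & norm2 setT (fun x => g x - f x) < e]) -> P f.
Hypothesis P_itv : forall q r : rat, P \1_(`](ratr q : R), ratr r[ : set R).

Let P_dct f (f_ : nat -> R -> R) : L2 setT f ->
  (forall n, measurable_fun setT (f_ n)) -> (forall n x, `|f_ n x| <= `|f x|) ->
  (forall x, f_ n x @[n --> \oo] --> f x) -> (forall n, P (f_ n)) -> P f.
Proof.
move=> Lf mf_ f_f cf Pf_; apply: P_closed => // e e0.
have := norm2_dct measurableT Lf mf_ (fun n x _ => f_f n x) (fun x _ => cf x).
move=> /cvgr0Pnorm_lt/(_ e e0)[N _ /(_ N (leqnn N))] h.
exists (f_ N); split => //; last by apply: le_lt_trans h; rewrite ler_norm.
by apply: (L2_le _ _ Lf) => //; apply: aeW => x _; exact: f_f.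
Qed.

Let P_real_itv (a b : R) : P \1_(`]a, b[ : set R).
Proof.
have [ab|ba] := ltP a b; last first.
  rewrite (_ : (`]a, b[%classic : set R) = `](ratr (0 : rat) : R), ratr (0 : rat)[%classic); first exact: P_itv.
  by rewrite !set_itv_ge// ?bnd_simp ?ltxx// -leNgt.
pose d n : R := (b - a) / 2 / n.+1%:R.
have dn n : 0 < d n by rewrite !divr_gt0// subr_gt0.
have q_ex n : {q : rat | ratr q \in `]a, a + d n[}.
  by apply: cid; apply: rat_in_itvoo; rewrite ltrDl.
have r_ex n : {q : rat | ratr q \in `]b - d n, b[}.
  by apply: cid; apply: rat_in_itvoo; rewrite ltrBlDr ltrDl.
have dcvg : d n @[n --> \oo] --> 0.
  by rewrite -[X in _ --> X](mulr0 ((b - a) / 2)); apply: cvgM; [exact: cvg_cst|exact: cvg_harmonic].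
apply: (P_dct (f_ := fun n => \1_(`](ratr (projT1 (q_ex n)) : R), ratr (projT1 (r_ex n))[ : set R))).
- by apply: (@L2_indic _ (`|a| + `|b|)) => //; exact: itvoo_sub_sym.
- by move=> n; exact: measurable_indic.
- move=> n x; case: (q_ex n) (r_ex n) => q /= + [r /=]; rewrite !in_itv/= => /andP[aq _] /andP[_ rb].
  rewrite !indicE; case: (boolP (x \in _)) => [|_]; last by rewrite normr0.
  rewrite inE /= in_itv/= => /andP[qx xr]; rewrite mem_set//= in_itv/=.
  by rewrite (lt_trans aq qx) (lt_trans xr rb).
- move=> x; apply: cvg_near_cst.
  have [|nx] := pselect (`]a, b[%classic x); last first.
    rewrite (indic_notin nx); move: nx; rewrite /= in_itv/= => nx.
    apply: nearW => n; rewrite indic_notin//=.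
    case: (q_ex n) (r_ex n) => q /= + [r /=]; rewrite !in_itv/= => /andP[aq _] /andP[_ rb].
    by move=> /andP[qx xr]; apply: nx; rewrite (lt_trans aq qx) (lt_trans xr rb).
  move=> xab; rewrite (indic_in xab); move: xab; rewrite /= in_itv/= => /andP[ax xb].
  have m0 : 0 < Num.min (x - a) (b - x) by rewrite lt_min !subr_gt0 ax xb.
  move/cvgrPdist_lt : dcvg => /(_ _ m0); apply: filterS => n; rewrite sub0r normrN gtr0_norm; last exact: dn.
  rewrite lt_min => /andP[h1 h2].
  rewrite indicE mem_set//=; case: (q_ex n) (r_ex n) => q /= + [r /=]; rewrite !in_itv/=.
  by move=> /andP[_ qa] /andP[br _]; apply/andP; split; lra.
- by move=> n; exact: P_itv.
Qed.

(** Dynkin induction on [A]. The intersection with ]-M, M[ keeps every indicator in L^2, those of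
    complements included. *)
Let P_cap (M : R) A : measurable A -> P \1_(A `&` `]- M, M[).
Proof.
pose I := `]- M, M[%classic : set MR.
have LI (B : set MR) : measurable B -> L2 setT (\1_(B `&` I) : R -> R).
  move=> mB; apply: (@L2_indic _ M); last by move=> x [].
  by apply: measurableI => //; exact: measurable_itv.
move=> mA; have := mA; rewrite [measurable](@RGenOpens.measurableE R) => sA.
refine (@dynkin_induction _ MR (@RGenOpens.G R) (fun B : set MR => P \1_(B `&` I)) _ _ _ _ _ _ A sA).
- exact: RGenOpens.measurableE.
- move=> _ _ [a [b ->]] [c [d ->]]; exists (Num.max a c), (Num.min b d).
  by rewrite itvoo_setI.
- by rewrite setTI; exact: P_real_itv.
- move=> _ [a [b ->]]; rewrite /I itvoo_setI.
  exact: P_real_itv.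
- move=> B mB PB; have -> : \1_(~` B `&` I) = (fun x => \1_(setT `&` I) x + (- 1) * \1_(B `&` I) x : R).
    apply/funext => x; rewrite !indicE !in_setI in_setC in_setT /=.
    by case: (x \in B); case: (x \in I) => /=; lra.
  apply: PD; [exact: LI|by apply: L2Z => //; exact: LI| |by apply: PZ => //; exact: LI].
  by rewrite setTI; exact: P_real_itv.
move=> F mF tF PF.
have mU n : measurable (\big[setU/set0]_(i < n) F i : set MR) by exact: bigsetU_measurable.
have P0 : P (fun=> 0).
  have := PZ 0 (@L2_indic I M (measurable_itv _) (@subset_refl _ I)) (P_real_itv (- M) M).
  rewrite (_ : (fun x => _) = (fun=> 0)); first by apply.
  by apply/funext => x; rewrite mul0r.
apply: (P_dct (f_ := fun n => \1_((\big[setU/set0]_(i < n) F i) `&` I))).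
- by apply: LI; exact: bigcupT_measurable.
- by move=> n; exact: (LI _ (mU n)).1.
- move=> n x; rewrite !indicE.
  case: (boolP (x \in _)) => [|_]; last by rewrite normr0.
  rewrite inE => -[xU xI]; rewrite mem_set//; split => //; move: xU.
  by rewrite -bigcup_mkord => -[i _ Fi]; exists i.
- move=> x; apply: cvg_near_cst.
  have [|nx] := pselect ((\bigcup_k F k `&` I) x); last first.
    rewrite (indic_notin nx); apply: nearW => n; rewrite indic_notin//= => -[xU xI].
    by apply: nx; split => //; move: xU; rewrite -bigcup_mkord => -[i _ Fi]; exists i.
  move=> xUI; rewrite (indic_in xUI); case: xUI => -[i _ Fi] xI; exists i.+1 => // n /= ni.
  by rewrite indic_in//; split => //; rewrite -bigcup_mkord; exists i.
- elim => [|n IH].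
    rewrite big_ord0 set0I (_ : \1_set0 = (fun=> 0 : R))//.
    by apply/funext => x; rewrite indicE in_set0.
  have -> : \1_((\big[setU/set0]_(i < n.+1) F i) `&` I) =
      (fun x => \1_((\big[setU/set0]_(i < n) F i) `&` I) x + \1_(F n `&` I) x : R).
    apply/funext => x; rewrite big_ord_recr/= !indicE !in_setI in_setU.
    have [xF|] := boolP (x \in F n); last by rewrite orbF addr0.
    suff /negbTE -> : x \notin \big[setU/set0]_(i < n) F i by rewrite add0r.
    apply/negP; rewrite inE -bigcup_mkord => -[i /= ilt xi].
    have /trivIsetP/(_ i n Logic.I Logic.I) := tF; rewrite neq_ltn ilt => /(_ isT).
    by apply/eqP/set0P; exists x; split => //; rewrite inE in xF.
  by apply: PD => //; exact: LI.
Qed.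

(** [P] is assumed on rational intervals only: a property that holds at almost every time for each
    of countably many functions holds for all of them at almost every time. *)
Lemma L2_density f : L2 setT f -> P f.
Proof.
apply: (@fun_class_ind _ (L2 setT) P).
- by move=> g [].
- by move=> g h Lg mh gh; apply: (L2_le _ _ Lg) => //; apply: aeW => x _.
- by move=> g h Lg Lh; exact: L2D.
- by move=> k g Lg; exact: L2Z.
- exact: PD.
- exact: PZ.
- exact: P_dct.
- move=> A mA LA; apply: (P_dct (f_ := fun n : nat => \1_(A `&` `]- n%:R, n%:R[))) => //.
  + by move=> n; apply: measurable_indic; exact: measurableI.
  + move=> n x; rewrite !indicE in_setI.
    by case: (x \in A); case: (x \in _) => /=; rewrite ?normr0 ?normr1.
  + move=> x; apply: cvg_near_cst; near=> n; rewrite !indicE in_setI.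
    rewrite [x \in `]_, _[%classic]mem_set ?andbT//= in_itv/= -ltr_norml.
    near: n; exact: nbhs_infty_gtr.
  + by move=> n; exact: P_cap.
Unshelve. all: by end_near. Qed.

End density.

End L2_density.

(** * Weak derivatives of paths in L^2 *)

Section Weak_time_derivative.
Context {R : realType}.
Local Notation leb := (@lebesgue_measure R).
Local Notation MR := (measurableTypeR R).
Implicit Types (g h v : R -> R) (s t e k : R).

Lemma cvg_near_ext {I : Type} {F : set_system I} {FF : Filter F} (u v : I -> R) (l : R) :
  (\forall i \near F, v i = u i) -> u i @[i --> F] --> l -> v i @[i --> F] --> l.
Proof.
by move=> uv; apply: cvg_trans; apply: near_eq_cvg; apply: filterS uv => i ->.
Qed.

Lemma cvg_le_near {I : Type} {F : set_system I} {FF : ProperFilter F} (u : I -> R) (l B : R) :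
  u i @[i --> F] --> l -> (\forall i \near F, u i <= B) -> l <= B.
Proof.
move=> ul uB; rewrite -(cvg_lim _ ul)//; apply: limr_le => //.
exact: cvgP ul.
Qed.

Lemma ae_forall_count {I : countType} (P : I -> R -> Prop) :
  (forall i, {ae leb, forall x, P i x}) -> {ae leb, forall x, forall i, P i x}.
Proof.
move=> H; have K n : {ae leb, forall x, forall i : I, pickle i = n -> P i x}.
  have [[i ni]|nex] := pselect (exists i : I, pickle i = n); last first.
    by apply: aeW => x i ni; case: nex; exists i.
  apply: (lebS (H i)) => x Px j nj.
  have -> // : j = i.
  have inj : injective (@pickle I) by apply: pcan_inj; exact: pickleK.
  by apply: inj; rewrite ni nj.
by apply: (lebS (ae_foralln K)) => x h i; exact: h.
Qed.

Lemma near_dnbhs_itv (T t : R) : 0 < t < T -> \forall s \near t^', 0 <= s <= T /\ s != t.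
Proof.
move=> /andP[t0 tT].
have A : \forall s \near t, 0 <= s <= T.
  have m0 : 0 < Num.min t (T - t) by rewrite lt_min t0 subr_gt0.
  exists (Num.min t (T - t)) => // s /=; rewrite lt_min => /andP[].
  by rewrite !ltr_norml => /andP[? ?] /andP[? ?]; apply/andP; split; lra.
by rewrite /prop_near1 /dnbhs /within; move: A; apply: filterS => s sT /= ?; split.
Qed.

Lemma within_dnbhs_itv (T t : R) : 0 < t < T -> within `[0, T] t^' = t^'.
Proof.
move=> /near_dnbhs_itv h; apply/funext => P; apply/propext; split.
  by apply: filterS2 h => s [sT _]; apply; rewrite /= in_itv.
by apply: filterS => s Ps _.
Qed.

(** Where [V] is differentiable the difference quotients are bounded in L^2. If moreover their
    pairings with all rational intervals converge, density extends the convergence to every [g], and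
    the Riesz representation turns the limit functional into a function. *)
Lemma L2_weak_deriv_ae (T : R) (V : R -> R) (f : R -> R -> R) : 0 < T -> abs_continuous Rdist T V ->
  (forall t, 0 <= t <= T -> L2 setT (f t)) ->
  (forall s t, 0 <= s -> s <= t -> t <= T -> norm2 setT (fun x => f t x - f s x) <= V t - V s) ->
  {ae leb, forall t, 0 < t < T -> exists2 v, L2 setT v & forall g, L2 setT g ->
    \int[leb]_x ((f s x - f t x) / (s - t) * g x) @[s --> t^'] --> \int[leb]_x (v x * g x)}.
Proof.
move=> T0 acV Lf fV.
have Vnd s t : 0 <= s -> s <= t -> t <= T -> `|V t - V s| <= V t - V s.
  by move=> s0 st tT; rewrite ger0_norm// (le_trans _ (fV _ _ s0 st tT))// norm2_ge0.
have [gV giV gVE] := ac_density T0 acV Vnd.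
have aeV := density_derivable giV gVE.
pose I (p : rat * rat) : R -> R := \1_(`](ratr p.1 : R), ratr p.2[ : set R).
have LI p : L2 setT (I p).
  apply: (@L2_indic _ _ (`|ratr p.1| + `|ratr p.2|)); first exact: measurable_itv.
  exact: itvoo_sub_sym.
(* Normalizing by [c p] bounds the increments of each pairing by those of [V]; the added 1 keeps the
   divisor positive. *)
pose c p := norm2 setT (I p) + 1.
have c0 p : 0 < c p by rewrite ltr_pwDr// norm2_ge0.
pose phi p t := (\int[leb]_x (f t x * I p x)) / c p.
have phiV p s t : 0 <= s -> s <= t -> t <= T -> `|phi p t - phi p s| <= V t - V s.
  move=> s0 st tT; have Ls := Lf s _; have Lt := Lf t _.
  have {}Ls : L2 setT (f s) by apply: Ls; rewrite s0 (le_trans st).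
  have {}Lt : L2 setT (f t) by apply: Lt; rewrite tT (le_trans s0).
  rewrite /phi -mulrBl normrM normfV (gtr0_norm (c0 p)) ler_pdivrMr//.
  rewrite -RintegralB//; try exact: L2M.
  under eq_Rintegral do rewrite -mulrBl.
  apply: (le_trans (CS_norm measurableT (L2B measurableT Lt Ls) (LI p))).
  apply: ler_pM; rewrite ?norm2_ge0//; first exact: fV.
  by rewrite /c lerDl.
have aephi p : {ae leb, forall t, 0 < t < T -> exists l : R, (phi p s - phi p t) / (s - t) @[s --> t^'] --> l}.
  have [g gi gE] := ac_density T0 acV (phiV p).
  by apply: (lebS (density_derivable gi gE)) => t H tT; exists (g t); exact: H.
apply: (lebS (lebI aeV (ae_forall_count aephi))) => t [Vt Pt] tT.
have tT' : 0 <= t <= T by move: tT => /andP[/ltW -> /ltW ->].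
have [K K0 nK] : exists2 K, 0 < K & \forall s \near t^', norm2 setT (fun x => (f s x - f t x) / (s - t)) <= K.
  exists (`|gV t| + 1); first by rewrite ltr_pwDr.
  have /cvgrPdist_lt/(_ 1 ltr01) h := Vt tT.
  near=> s.
  have [sT st] : 0 <= s <= T /\ s != t by near: s; exact: near_dnbhs_itv.
  have hs : `|gV t - (V s - V t) / (s - t)| < 1 by near: s; exact: h.
  have e1 : norm2 setT (fun x => (f s x - f t x) / (s - t)) = `|(s - t)^-1| * norm2 setT (fun x => f s x - f t x).
    rewrite -norm2Z//; last by apply: L2B => //; exact: Lf.
    by congr norm2; apply/funext => x; rewrite mulrC.
  have e2 : `|(s - t)^-1| * norm2 setT (fun x => f s x - f t x) <= (V s - V t) / (s - t).
    have [lst|lts|] := ltgtP s t; last by move/eqP; rewrite (negbTE st).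
    - have -> : norm2 setT (fun x => f s x - f t x) = norm2 setT (fun x => f t x - f s x).
        by rewrite -norm2N; congr norm2; apply/funext => x; rewrite opprB.
      have -> : (V s - V t) / (s - t) = `|(s - t)^-1| * (V t - V s).
        rewrite normfV ltr0_norm ?subr_lt0//; field; lra.
      by apply: ler_wpM2l => //; apply: fV; [case/andP: sT|exact: ltW|case/andP: tT'].
    - have -> : (V s - V t) / (s - t) = `|(s - t)^-1| * (V s - V t).
        by rewrite normfV gtr0_norm ?subr_gt0// mulrC.
      by apply: ler_wpM2l => //; apply: fV; [case/andP: tT'|exact: ltW|case/andP: sT].
  rewrite e1; apply: (le_trans e2); have := ler_norm (gV t); move: hs; rewrite ltr_norml => /andP[]; lra.
pose q s x := (f s x - f t x) / (s - t).
have Lq : \forall s \near t^', L2 setT (q s).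
  near=> s; have [sT st] : 0 <= s <= T /\ s != t by near: s; exact: near_dnbhs_itv.
  rewrite (_ : q s = fun x => (s - t)^-1 * (f s x - f t x)); last by apply/funext => x; rewrite /q mulrC.
  by apply: L2Z => //; apply: L2B => //; exact: Lf.
pose Q g s := \int[leb]_x (q s x * g x).
have QB g : L2 setT g -> \forall s \near t^', `|Q g s| <= K * norm2 setT g.
  move=> Lg; apply: filterS2 Lq nK => s Ls ns.
  apply: (le_trans (CS_norm measurableT Ls Lg)).
  by apply: ler_wpM2r; [exact: norm2_ge0|exact: ns].
have QD g h : L2 setT g -> L2 setT h -> \forall s \near t^', Q (fun x => g x + h x) s = Q g s + Q h s.
  move=> Lg Lh; apply: filterS Lq => s Ls.
  by rewrite /Q -RintegralD//; try exact: L2M; apply: eq_Rintegral => x _; rewrite mulrDr.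
have QZ k g : L2 setT g -> \forall s \near t^', Q (fun x => k * g x) s = k * Q g s.
  move=> Lg; apply: filterS Lq => s Ls.
  by rewrite /Q -RintegralZl//; [apply: eq_Rintegral => x _; rewrite mulrCA|exact: L2M].
have cD g h (lg lh : R) : L2 setT g -> L2 setT h -> Q g s @[s --> t^'] --> lg -> Q h s @[s --> t^'] --> lh ->
    Q (fun x => g x + h x) s @[s --> t^'] --> lg + lh.
  by move=> Lg Lh cg ch; apply: (cvg_near_ext (QD _ _ Lg Lh)); exact: cvgD.
have cZ k g (lg : R) : L2 setT g -> Q g s @[s --> t^'] --> lg -> Q (fun x => k * g x) s @[s --> t^'] --> k * lg.
  by move=> Lg cg; apply: (cvg_near_ext (QZ k _ Lg)); exact: cvgM (cvg_cst k) cg.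
have cvgQ g : L2 setT g -> exists l : R, Q g s @[s --> t^'] --> l.
  apply: (@L2_density _ (fun g => exists l : R, Q g s @[s --> t^'] --> l)).
  - by move=> g1 g2 L1 L2 [l1 c1] [l2 c2]; exists (l1 + l2); exact: cD.
  - by move=> k g1 L1 [l1 c1]; exists (k * l1); exact: cZ.
  - move=> g1 L1 H; apply/cvg_ex; apply: cauchy_cvg; apply: cauchy_exP => e e0.
    (* The quotients paired with [g1] differ from those paired with a nearby [g2] by at most K |g2 -
       g1| <= e / 2, and the latter converge: the Cauchy criterion follows. *)
    have eK : 0 < e / (2 * K) by rewrite divr_gt0// mulr_gt0.
    have [g2 [L2g [l cl] gn]] := H _ eK; exists l.
    have L12 : L2 setT (fun x => g2 x - g1 x) by exact: L2B.
    have /cvgrPdist_lt/(_ (e / 2)) := cl; rewrite divr_gt0// => /(_ isT) h.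
    have hDZ : \forall s \near t^', Q g1 s = Q g2 s - Q (fun x => g2 x - g1 x) s.
      apply: filterS2 (QZ (- 1) _ L12) (QD _ _ L2g (L2Z (- 1) measurableT L12)) => s hZ hD.
      by rewrite -mulN1r -hZ -hD; congr (Q _ s); apply/funext => x; ring.
    rewrite /nbhs/= /fmap/=; apply: filterS3 (QB _ L12) h hDZ => s hB {}h hDZ; rewrite /ball/= hDZ.
    have -> : l - (Q g2 s - Q (fun x => g2 x - g1 x) s) = (l - Q g2 s) + Q (fun x => g2 x - g1 x) s by ring.
    apply: (le_lt_trans (ler_normD _ _)).
    have -> : e = e / 2 + e / 2 by field.
    apply: ltr_leD => //; apply: (le_trans hB).
    have : K * norm2 setT (fun x => g2 x - g1 x) <= K * (e / (2 * K)).
      by apply: ler_wpM2l; exact: ltW.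
    by rewrite (_ : K * (e / (2 * K)) = e / 2)//; field; rewrite gt_eqF.
  - move=> a b; have [l cl] := Pt (a, b) tT; exists (c (a, b) * l).
    apply: cvg_near_ext (cvgM (cvg_cst (c (a, b))) cl).
    near=> s; have [sT st] : 0 <= s <= T /\ s != t by near: s; exact: near_dnbhs_itv.
    have := L2M measurableT (Lf t tT') (LI (a, b)); have := L2M measurableT (Lf s sT) (LI (a, b)).
    move=> i1 i2; have e : Q (I (a, b)) s = (s - t)^-1 * (\int[leb]_x (f s x * I (a, b) x) - \int[leb]_x (f t x * I (a, b) x)).
      rewrite -RintegralB// -RintegralZl//; last by apply: l_intgB.
      by apply: eq_Rintegral => x _; rewrite /q; ring.
    rewrite -/(I (a, b)) e /phi /=; field; rewrite subr_eq0 st/=; exact: lt0r_neq0.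
pose l g := lim (Q g s @[s --> t^']).
have lP g : L2 setT g -> Q g s @[s --> t^'] --> l g.
  by move=> /cvgQ[y cy]; rewrite /l (cvg_lim _ cy).
have [v Lv vE] : exists2 v, L2 setT v & forall g, L2 setT g -> l g = \int[leb]_x (v x * g x).
  apply: (@L2_Riesz _ l K).
  - by move=> g h Lg Lh; apply/cvg_lim => //; apply: cD => //; exact: lP.
  - by move=> k g Lg; apply/cvg_lim => //; apply: cZ => //; exact: lP.
  - by move=> g Lg; apply: (cvg_le_near (cvg_norm (lP _ Lg))); exact: QB.
by exists v => // g Lg; rewrite -vE//; exact: lP.
Unshelve. all: by end_near. Qed.

End Weak_time_derivative.

(** * Paths in H^1 and their time derivative *)

Section H1_time_derivative.
Context {R : realType}.
Local Notation leb := (@lebesgue_measure R).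
Local Notation MR := (measurableTypeR R).
Implicit Types (f g h v z : R -> R) (s t e k : R).

Let mT : measurable (setT : set MR) := measurableT.
Let mI (a b : R) : measurable (`]a, b[%classic : set MR).
Proof. exact: measurable_itv. Qed.

Lemma norm2_subset (D : set MR) h : measurable D -> L2 setT h -> norm2 D h <= norm2 setT h.
Proof.
move=> mD [mh hi]; rewrite /norm2 ler_sqrt; last by apply: Rintegral_ge0 => x _; exact: sqr_ge0.
rewrite -[D]setTI Rint_setI.
have i1 : L1 setT (fun x => h x ^+ 2 * \1_D x).
  apply: (l_intg_ae_le _ _ hi) => //.
    by apply: measurable_funM; [exact: measurable_funX|exact: measurable_indic].
  apply: aeW => x _; rewrite normrM ger0_norm ?sqr_ge0// ler_piMr ?sqr_ge0// indicE.
  by case: (_ \in _); rewrite ?normr1 ?normr0.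
by apply: le_Rintegral => // x _; rewrite ler_piMr ?sqr_ge0// indicE; case: (_ \in _).
Qed.

Lemma Rint_mul_ae (D : set MR) f f' g : measurable D -> L2 D f -> L2 D f' -> L2 D g ->
  {ae leb, forall x, D x -> f x = f' x} ->
  \int[leb]_(x in D) (f x * g x) = \int[leb]_(x in D) (f' x * g x).
Proof.
move=> mD [mf _] [mf' _] [mg _] ff'; apply: ae_eq_Rint => //; try exact: measurable_funM.
by apply: (lebS ff') => x e Dx; rewrite e.
Qed.

Lemma fine_itvoo (a b : R) : a <= b -> fine (leb `]a, b[%classic) = b - a.
Proof.
move=> ab; rewrite lebesgue_measure_itv /=; case: ifPn => //=.
by rewrite lte_fin -leNgt => ba; apply/eqP; rewrite eq_sym subr_eq0 eq_le ba ab.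
Qed.

Lemma Rint_itv_norm2 (a b : R) h : a <= b -> L2 setT h ->
  \int[leb]_(x in `]a, b[) `|h x| <= Num.sqrt (b - a) * norm2 setT h.
Proof.
move=> ab Lh; have LhI := L2S mT (mI a b) (@subsetT _ _) Lh.
apply: (le_trans (Rint_norm_norm2 (mI a b) (itv_lty _ _ _ _) LhI)).
rewrite fine_itvoo//; apply: ler_wpM2l; first exact: sqrtr_ge0.
by apply: norm2_subset => //; exact: mI.
Qed.

Lemma L2_L1_itv (a b : R) h : L2 setT h -> L1 `]a, b[ h.
Proof.
move=> Lh; apply: (L2_L1 (mI a b) (itv_lty _ _ _ _)).
exact: (L2S mT (mI a b) (@subsetT _ _) Lh).
Qed.

Lemma H1_increment_le (a b : R) h : a <= b -> H1 setT h -> continuous h ->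
  `|h b - h a| <= Num.sqrt (b - a) * norm2 setT (wderiv setT h).
Proof.
rewrite le_eqVlt => /predU1P[-> _ _|ab hh ch].
  by rewrite subrr normr0 mulr_ge0 ?sqrtr_ge0 ?norm2_ge0.
have [Ld _] := wderivP hh.
rewrite (H1_FTC hh ch ab); apply: le_trans (Rint_itv_norm2 (ltW ab) Ld).
by apply: le_normr_Rintegral; [exact: mI|exact: L2_L1_itv].
Qed.

(** |h(0)| is at most |h(x)| plus sqrt(L) times the L^2 norm of h', for every x in ]0, L[; this is
    averaged over x. *)
Lemma H1_point_le (L : R) h : 0 < L -> H1 setT h -> continuous h ->
  `|h 0| <= (Num.sqrt L)^-1 * norm2 setT h + Num.sqrt L * norm2 setT (wderiv setT h).
Proof.
move=> L0 hh ch; have Lh := H1_L2 hh; have [Ld _] := wderivP hh.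
set B := Num.sqrt L * norm2 setT (wderiv setT h).
have hx x : 0 < x < L -> `|h 0| <= `|h x| + B.
  move=> /andP[x0 xL]; have := H1_increment_le (ltW x0) hh ch; rewrite subr0 distrC => hd.
  have : Num.sqrt x * norm2 setT (wderiv setT h) <= B.
    by apply: ler_wpM2r; [exact: norm2_ge0|rewrite ler_sqrt ltW].
  have := ler_normD (h x) (h 0 - h x); rewrite addrC subrK; lra.
have i1 : L1 `]0, L[ (fun x => `|h x|) by apply: l_intg_abs; [exact: mI|exact: L2_L1_itv].
have cst k : L1 `]0, L[ (fun=> k).
  by apply: (bounded_L1 (mI 0 L) (itv_lty _ _ _ _) (M := `|k|)) => //; exact: measurable_cst.
have : \int[leb]_(x in `]0, L[) `|h 0| <= \int[leb]_(x in `]0, L[) (`|h x| + B).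
  apply: le_Rintegral; [exact: mI|exact: cst|apply: l_intgD => //|]; try exact: mI; try exact: cst.
  by move=> x; rewrite /= in_itv/=; exact: hx.
rewrite RintegralD//; try exact: mI; try exact: cst.
rewrite !Rintegral_cst; try exact: mI.
rewrite fine_itvoo ?(ltW L0)// subr0.
move=> /le_trans/(_ (lerD (Rint_itv_norm2 (ltW L0) Lh) (lexx _))); rewrite subr0.
have S0 : 0 < Num.sqrt L by rewrite sqrtr_gt0.
have SS : Num.sqrt L * Num.sqrt L = L by rewrite -expr2 sqr_sqrtr// ltW.
move=> H; rewrite -(ler_pM2r L0) mulrDl.
have -> // : (Num.sqrt L)^-1 * norm2 setT h * L = Num.sqrt L * norm2 setT h.
by rewrite -{2}SS; field; rewrite gt_eqF.
Qed.

Lemma norm2_distC (D : set MR) f g : norm2 D (fun x => f x - g x) = norm2 D (fun x => g x - f x).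
Proof. by rewrite -norm2N; congr norm2; apply/funext => x; rewrite opprB. Qed.

Section path.
Variables (T : R) (w : R -> R -> R).
Hypothesis T_gt0 : 0 < T.
Hypothesis w_H1 : forall t : R, 0 <= t <= T -> H1 setT (w t).
Hypothesis w_AC : abs_continuous (H1dist setT) T w.

Lemma H1_variation : exists V : R -> R, abs_continuous Rdist T V /\
  forall s t, 0 <= s -> s <= t -> t <= T -> H1dist setT (w s) (w t) <= V t - V s.
Proof.
apply: (@variation_function R T (fun s t => H1dist setT (w s) (w t))).
- by move=> s t sT tT; exact: H1dist_ge0.
- by move=> r s t rT sT tT; apply: H1dist_triangle; [exact: wd_unique_setT|exact: w_H1..].
- exact: w_AC.
Qed.

Variable V : R -> R.
Hypothesis V_AC : abs_continuous Rdist T V.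
Hypothesis wV : forall s t, 0 <= s -> s <= t -> t <= T -> H1dist setT (w s) (w t) <= V t - V s.

Let sT_ s t : 0 <= s -> s <= t -> t <= T -> (0 <= s <= T) * (0 <= t <= T).
Proof. by move=> s0 st tT; split; [rewrite s0 (le_trans st)|rewrite tT (le_trans s0)]. Qed.

Lemma norm2_path_le s t : 0 <= s -> s <= t -> t <= T ->
  norm2 setT (fun x => w t x - w s x) <= V t - V s /\
  norm2 setT (fun x => wderiv setT (w t) x - wderiv setT (w s) x) <= V t - V s.
Proof.
move=> s0 st tT; have [/w_H1 hs /w_H1 ht] := sT_ s0 st tT.
have := norm2_le_H1dist wd_unique_setT hs ht; have := norm2_wderiv_le_H1dist wd_unique_setT hs ht.
rewrite (norm2_distC _ (w s)) (norm2_distC _ (wderiv setT (w s))).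
by move=> /le_trans/(_ (wV s0 st tT)) h1 /le_trans/(_ (wV s0 st tT)) h2.
Qed.

Hypothesis w_continuous : forall t : R, 0 <= t <= T -> continuous (w t).

Let diff_H1 s t : 0 <= s <= T -> 0 <= t <= T -> [/\ H1 setT (fun x => w t x - w s x),
  continuous (fun x => w t x - w s x) &
  norm2 setT (wderiv setT (fun x => w t x - w s x)) = norm2 setT (fun x => wderiv setT (w t) x - wderiv setT (w s) x)].
Proof.
move=> sT tT; have hs := w_H1 sT; have ht := w_H1 tT.
have hd : H1 setT (fun x => w t x - w s x) by apply: H1B => //; exact: wd_unique_setT.
split=> //.
  by move=> x; apply: cvgB; [exact: w_continuous|exact: w_continuous].
have [[m1 _] _] := wderivP hd; have [[m2 i2] _] := wderivP hs; have [[m3 i3] _] := wderivP ht.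
apply: norm2_ae => //; last exact: wderivB wd_unique_setT _ _ _ _.
exact: measurable_funB.
Qed.

Lemma path_point_le (L s t : R) : 0 < L -> 0 <= s -> s <= t -> t <= T ->
  `|w t 0 - w s 0| <= ((Num.sqrt L)^-1 + Num.sqrt L) * (V t - V s).
Proof.
move=> L0 s0 st tT; have [sT tT'] := sT_ s0 st tT.
have [hd cd nd] := diff_H1 sT tT'; have [n1 n2] := norm2_path_le s0 st tT.
apply: (le_trans (H1_point_le L0 hd cd)); rewrite nd mulrDl.
by apply: lerD; apply: ler_wpM2l => //; rewrite ?invr_ge0 sqrtr_ge0.
Qed.

Lemma path_increment_le (L s t : R) : 0 < L -> 0 <= s -> s <= t -> t <= T ->
  `|(w t L - w t 0) - (w s L - w s 0)| <= Num.sqrt L * (V t - V s).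
Proof.
move=> L0 s0 st tT; have [sT tT'] := sT_ s0 st tT.
have [hd cd nd] := diff_H1 sT tT'; have [n1 n2] := norm2_path_le s0 st tT.
have := H1_increment_le (ltW L0) hd cd; rewrite subr0 nd.
have -> : w t L - w s L - (w t 0 - w s 0) = w t L - w t 0 - (w s L - w s 0) by ring.
by move=> /le_trans; apply; apply: ler_wpM2l; [exact: sqrtr_ge0|].
Qed.

Let D0 t s x := (w s x - w t x) / (s - t).
Let D1 t s x := (wderiv setT (w s) x - wderiv setT (w t) x) / (s - t).

Let D_H1 t s : 0 <= s <= T -> 0 <= t <= T -> [/\ H1 setT (D0 t s), L2 setT (D1 t s) &
  {ae leb, forall x, setT x -> wderiv setT (D0 t s) x = D1 t s x}].
Proof.
move=> sT tT; have [hd cd nd] := diff_H1 tT sT.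
have e0 : D0 t s = fun x => (s - t)^-1 * (w s x - w t x) by apply/funext => x; rewrite /D0 mulrC.
have e1 : D1 t s = fun x => (s - t)^-1 * (wderiv setT (w s) x - wderiv setT (w t) x) by apply/funext => x; rewrite /D1 mulrC.
have [l2 _] := wderivP (w_H1 sT); have [l3 _] := wderivP (w_H1 tT).
rewrite e0 e1; split; first by apply: H1Z => //; exact: wd_unique_setT.
  by apply: L2Z => //; exact: L2B.
have ae1 := wderivZ wd_unique_setT (s - t)^-1 hd.
have ae2 := wderivB wd_unique_setT (w_H1 sT) (w_H1 tT).
by apply: (lebS (lebI ae1 ae2)) => x [h1 h2] _; rewrite h1// h2.
Qed.

(** The identity that defines a weak derivative passes to weak limits, so that [v0] is in H^1 with
    derivative [v1]; the scalar products of H^1 then converge term by term. *)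
Let H1_quot t v0 v1 : 0 < t < T -> L2 setT v0 -> L2 setT v1 ->
  (forall g, L2 setT g -> \int[leb]_x (D0 t s x * g x) @[s --> t^'] --> \int[leb]_x (v0 x * g x)) ->
  (forall g, L2 setT g -> \int[leb]_x (D1 t s x * g x) @[s --> t^'] --> \int[leb]_x (v1 x * g x)) ->
  [/\ H1 setT v0, {ae leb, forall x, setT x -> wderiv setT v0 x = v1 x} &
    forall z, H1 setT z -> H1inner setT (D0 t s) z @[s --> t^'] --> H1inner setT v0 z].
Proof.
move=> tT L0 L1_ c0 c1; have tT' : 0 <= t <= T by move: tT => /andP[/ltW -> /ltW ->].
have wd : weak_deriv setT v0 v1.
  move=> phi tphi; have [d1 d2 _] := tphi.
  have [Lphi Ld] := test_L2 mT tphi.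
  apply: (cvg_unique _ (c0 _ Ld)) => //.
  apply: cvg_near_ext (cvgN (c1 _ Lphi)); near=> s.
  have [sT _] : 0 <= s <= T /\ s != t by near: s; exact: near_dnbhs_itv.
  have [hD lD aeD] := D_H1 sT tT'.
  have [lw ww] := wderivP hD; rewrite ww//; congr (- _).
  by apply: Rint_mul_ae => //.
have h0 : H1 setT v0 by split => //; exists v1.
have ae0 := wderiv_ae wd_unique_setT L0 L1_ wd.
split=> // z hz; have [lz _] := wderivP hz.
rewrite /H1inner.
have -> : \int[leb]_x (wderiv setT v0 x * wderiv setT z x) = \int[leb]_x (v1 x * wderiv setT z x).
  by apply: Rint_mul_ae => //; exact: (wderivP h0).1.
apply: cvgD; first exact: c0 (H1_L2 hz).
apply: cvg_near_ext (c1 _ lz); near=> s.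
have [sT _] : 0 <= s <= T /\ s != t by near: s; exact: near_dnbhs_itv.
have [hD lD aeD] := D_H1 sT tT'.
by apply: Rint_mul_ae => //; exact: (wderivP hD).1.
Unshelve. all: by end_near. Qed.

(** [H1_dot] is a choice among weak limits; pairing two limits with their difference shows that they
    coincide, so its space derivative is [v1] a.e. The quotients of w(L) - w(0) are pairings with
    the indicator of ]0, L[, hence converge to the integral of that derivative. *)
Lemma H1_dot_ae (L : R) : 0 < L -> {ae leb, forall t, 0 < t < T ->
  L1 `]0, L[ (wderiv setT (H1_dot T w t)) /\
  ((w s L - w s 0) - (w t L - w t 0)) / (s - t) @[s --> t^'] -->
     \int[leb]_(x in `]0, L[) wderiv setT (H1_dot T w t) x}.
Proof.
move=> L0_.
have A0 := L2_weak_deriv_ae T_gt0 V_AC (fun t tT => H1_L2 (w_H1 tT))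
  (fun s t ps pst ptT => (norm2_path_le ps pst ptT).1).
have A1 := L2_weak_deriv_ae T_gt0 V_AC (fun t tT => (wderivP (w_H1 tT)).1)
  (fun s t ps pst ptT => (norm2_path_le ps pst ptT).2).
apply: (lebS (lebI A0 A1)) => t [B0 B1] tT.
have [v0 L0 c0] := B0 tT; have [v1 L1_ c1] := B1 tT.
have [h0 ae0 cv0] := H1_quot tT L0 L1_ c0 c1.
have tT' : 0 <= t <= T by move: tT => /andP[/ltW -> /ltW ->].
have ex : H1_time_deriv T w t v0.
  by split => // z hz; rewrite (within_dnbhs_itv tT); exact: cv0.
have [hv cv] : H1_time_deriv T w t (H1_dot T w t).
  by rewrite /H1_dot; case: xgetP => [v _ //|/(_ v0)].
have inner z : H1 setT z -> H1inner setT (H1_dot T w t) z = H1inner setT v0 z.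
  move=> hz; have := cv z hz; rewrite (within_dnbhs_itv tT) => c.
  exact: (cvg_unique _ c (cv0 z hz)).
set v := H1_dot T w t in hv inner *.
have [Lv _] := wderivP hv; have Lw := H1_L2 hv; have [Lv0 _] := wderivP h0.
have hd : H1 setT (fun x => v x - v0 x) by apply: H1B => //; exact: wd_unique_setT.
have [Ld _] := wderivP hd; have Ld0 := H1_L2 hd.
have n0 : norm2 setT (fun x => v x - v0 x) ^+ 2 + norm2 setT (wderiv setT (fun x => v x - v0 x)) ^+ 2 = 0.
  have aeB := wderivB wd_unique_setT hv h0.
  have e1 : H1inner setT v (fun x => v x - v0 x) - H1inner setT v0 (fun x => v x - v0 x) = 0.
    by rewrite inner// subrr.
  rewrite -e1 !norm2_sqr /H1inner opprD addrACA -!RintegralB//; try exact: L2M.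
  congr (_ + _); first by apply: eq_Rintegral => x _; rewrite -mulrBl -expr2.
  under [RHS]eq_Rintegral do rewrite -mulrBl.
  under [LHS]eq_Rintegral do rewrite expr2.
  by apply: Rint_mul_ae => //; exact: L2B.
have wae : {ae leb, forall x, setT x -> wderiv setT v x = v1 x}.
  have nd0 : norm2 setT (wderiv setT (fun x => v x - v0 x)) = 0.
    apply/eqP; rewrite -sqrf_eq0 eq_le sqr_ge0 andbT -n0 lerDr; exact: sqr_ge0.
  apply: (lebS (lebI ae0 (lebI (wderivB wd_unique_setT hv h0) (norm2_eq0 mT Ld nd0)))).
  move=> x [e0 [e1 e2]] _; rewrite -e0//; apply/eqP; rewrite -subr_eq0 -e1//.
  by rewrite e2.
have LI : L2 setT (\1_(`]0, L[%classic : set R) : R -> R).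
  by apply: (L2_indic (mI 0 L)); exact: itvoo_sub_sym.
split; first exact: L2_L1_itv.
have -> : \int[leb]_(x in `]0, L[) wderiv setT v x = \int[leb]_x (v1 x * \1_(`]0, L[%classic : set R) x).
  by rewrite -[`]0, L[%classic]setTI Rint_setI setTI; apply: Rint_mul_ae.
apply: cvg_near_ext (c1 _ LI); near=> s.
have [sT st] : 0 <= s <= T /\ s != t by near: s; exact: near_dnbhs_itv.
have [Ls _] := wderivP (w_H1 sT); have [Lt _] := wderivP (w_H1 tT').
rewrite -(Rint_setI leb setT) setTI (H1_FTC (w_H1 sT) (w_continuous sT) L0_) (H1_FTC (w_H1 tT') (w_continuous tT') L0_).
rewrite -RintegralB; [|exact: mI|exact: L2_L1_itv..].
rewrite mulrC -RintegralZl; [|exact: mI|].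
  by apply: eq_Rintegral => x _; rewrite mulrC.
by apply: l_intgB; [exact: mI|exact: L2_L1_itv..].
Unshelve. all: by end_near. Qed.

End path.

End H1_time_derivative.

(** * The space H^1_0 of an interval *)

Section H10_space.
Context {R : realType}.
Local Notation leb := (@lebesgue_measure R).
Local Notation MR := (measurableTypeR R).
Implicit Types (f g h phi psi : R -> R).

Let mT : measurable (setT : set MR) := measurableT.
Let mI (a b : R) : measurable (`]a, b[%classic : set MR).
Proof. exact: measurable_itv. Qed.

Lemma C1_FTC (a b : R) f : a <= b -> (forall x, derivable f x 1) -> continuous (derive1 f) ->
  \int[leb]_(x in `]a, b[) derive1 f x = f b - f a.
Proof.
rewrite le_eqVlt => /predU1P[->|ab] df cf'.
  by rewrite set_itv_ge ?bnd_simp ?ltxx// Rintegral_set0 subrr.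
have cf x : {for x, continuous f} by apply: differentiable_continuous; apply/derivable1_diffP.
have m' : measurable_fun (`]a, b[%classic : set MR) (EFin \o derive1 f).
  by apply/measurable_EFinP; apply: measurable_funS (continuous_measurable_fun cf').
rewrite /Rintegral -(integral_itv_bndoo true false m').
rewrite (@continuous_FTC2 _ _ f); [by []|exact: ab|exact: continuous_subspaceT| |by move=> x _].
split=> [x _||]; [exact: df|apply: cvg_within_filter; exact: cf|apply: cvg_within_filter; exact: cf].
Qed.

Lemma test_prod (D : set R) phi psi : test_fun D phi -> test_fun D psi ->
  test_fun D (fun x => phi x * psi x) /\
  derive1 (fun x => phi x * psi x) = (fun x => phi x * derive1 psi x + derive1 phi x * psi x).
Proof.
move=> tphi tpsi; have [dp cp' [K [cK KD p0]]] := tphi; have [ds cs' _] := tpsi.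
have [cp _ _] := test_fun_bounded tphi; have [cs _ _] := test_fun_bounded tpsi.
have e : derive1 (fun x => phi x * psi x) = (fun x => phi x * derive1 psi x + derive1 phi x * psi x).
  apply/funext => x; rewrite !derive1E; have := @deriveM _ _ phi psi x 1 (dp x) (ds x).
  by move=> ->; rewrite /GRing.scale/= [psi x * _]mulrC.
split; last exact: e.
split.
- by move=> x; apply: derivableM; [exact: dp|exact: ds].
- by rewrite e => x; apply: cvgD; apply: cvgM; [exact: cp|exact: cs'|exact: cp'|exact: cs].
- by exists K; split => // x /p0 ->; rewrite mul0r.
Qed.

Lemma eq_norm2 (D : set MR) f g : (forall x, D x -> f x = g x) -> norm2 D f = norm2 D g.
Proof.
by move=> fg; rewrite /norm2; congr (Num.sqrt _); apply: eq_Rintegral => x /set_mem Dx; rewrite fg.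
Qed.

Variable L : R.
Hypothesis L_gt0 : 0 < L.
Local Notation D := (`]0, L[%classic : set MR).
Let mD : measurable D := mI 0 L.
Let uD : @wd_unique R D := wd_unique_itv 0 L.
Let L_ge0 : 0 <= L := ltW L_gt0.

Let notD0 : ~ D 0. Proof. by rewrite /= in_itv/= ltxx. Qed.
Let notDL : ~ D L. Proof. by rewrite /= in_itv/= ltxx andbF. Qed.

(** Integration by parts: the product of two test functions vanishes at both ends. *)
Lemma test_weak_deriv phi : test_fun D phi -> weak_deriv D phi (derive1 phi).
Proof.
move=> tphi psi tpsi; have [tpp e] := test_prod tphi tpsi; have [d c _] := tpp.
have [Lp Lp'] := test_L2 mD tphi; have [Ls Ls'] := test_L2 mD tpsi.
have := C1_FTC L_ge0 d c; rewrite (test_fun_out tphi notD0).1 (test_fun_out tphi notDL).1 !mul0r subrr e.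
rewrite RintegralD//; try exact: L2M.
by move/eqP; rewrite addr_eq0 => /eqP.
Qed.

Lemma test_H1 phi : test_fun D phi -> H1 D phi /\ {ae leb, forall x, D x -> wderiv D phi x = derive1 phi x}.
Proof.
move=> tphi; have [Lp Lp'] := test_L2 mD tphi; have wd := test_weak_deriv tphi.
by split; [split => //; exists (derive1 phi)|exact: wderiv_ae].
Qed.

Lemma Rint_le_norm2 h (x : R) : 0 < x <= L -> L2 D h ->
  `|\int[leb]_(y in `]0, x[) h y| <= Num.sqrt L * norm2 D h.
Proof.
move=> /andP[x0 xL] Lh.
have sub : `]0, x[%classic `<=` D by apply: subset_itvl; rewrite bnd_simp.
have Lx := L2S mD (mI 0 x) sub Lh.
have i1 : L1 D (fun y => `|h y|) by apply: l_intg_abs => //; apply: L2_L1 => //; exact: itv_lty.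
have := Rint_norm_norm2 mD (itv_lty _ _ _ _) Lh; rewrite fine_itvoo// subr0; apply: le_trans.
apply: (@le_trans _ _ (\int[leb]_(y in `]0, x[) `|h y|)).
  by apply: le_normr_Rintegral; [exact: mI|exact: L2_L1 (mI 0 x) (itv_lty _ _ _ _) Lx].
rewrite -(setIidr sub) Rint_setI; apply: le_Rintegral => //.
  apply: (l_intg_ae_le _ _ i1) => //.
    apply: measurable_funM; last exact: measurable_indic.
    by apply: measurableT_comp => //; case: Lh.
  apply: aeW => y _; rewrite normrM normr_id ler_piMr// indicE.
  by case: (_ \in _); rewrite ?normr1 ?normr0.
by move=> y _; rewrite ler_piMr// indicE; case: (_ \in _).
Qed.

Lemma norm2_bounded f (M : R) : measurable_fun D f -> (forall x, D x -> `|f x| <= M) ->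
  norm2 D f <= Num.sqrt L * M.
Proof.
move=> mf fM; have M0 : 0 <= M.
  have Dm : D (L / 2) by rewrite /= in_itv/= divr_gt0//= ltr_pdivrMr// ltr_pMr// ltr1n.
  exact: le_trans (normr_ge0 (f (L / 2))) (fM _ Dm).
have LC : L2 D (fun=> M).
  by apply: (bounded_L2 mD (itv_lty _ _ _ _) (M := `|M|)) => //; exact: measurable_cst.
apply: (le_trans (norm2_le mD mf LC _)).
  by apply: aeW => x Dx; rewrite (ger0_norm M0); exact: fM.
rewrite /norm2 Rintegral_cst// fine_itvoo// subr0 [leRHS]mulrC.
by rewrite sqrtrM ?sqr_ge0// sqrtr_sqr ger0_norm.
Qed.

(** Both claims hold for test functions. The H^1 distance controls the primitives uniformly on ]0,
    L], which passes the value 0 at [L] to the limit and identifies [f] with the primitive almost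
    everywhere. *)
Lemma H10_FTC f : H10 D f ->
  \int[leb]_(x in D) wderiv D f x = 0 /\
  {ae leb, forall x, D x -> f x = \int[leb]_(y in `]0, x[) wderiv D f y}.
Proof.
move=> [hf [phi tphi cphi]]; have [Lw _] := wderivP hf; have Lf := H1_L2 hf.
have hphi n := (test_H1 (tphi n)).1.
pose d n := H1dist D (phi n) f.
have dw n : norm2 D (fun x => wderiv D (phi n) x - wderiv D f x) <= d n.
  exact: norm2_wderiv_le_H1dist.
have d0 n : norm2 D (fun x => phi n x - f x) <= d n by exact: norm2_le_H1dist.
have key n x : 0 < x <= L -> `|phi n x - \int[leb]_(y in `]0, x[) wderiv D f y| <= Num.sqrt L * d n.
  move=> xL; have [x0 xL'] := andP xL.
  have sub : `]0, x[%classic `<=` D by apply: subset_itvl; rewrite bnd_simp.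
  have [Lwn _] := wderivP (hphi n).
  have [dp cp _] := tphi n.
  have -> : phi n x = \int[leb]_(y in `]0, x[) wderiv D (phi n) y.
    have := C1_FTC (ltW x0) dp cp; rewrite (test_fun_out (tphi n) notD0).1 subr0 => <-.
    apply: ae_eq_Rint; [exact: mI| | |].
    - by apply: measurable_funS (continuous_measurable_fun cp).
    - by apply: measurable_funS sub _ => //; case: Lwn.
    - by apply: (lebS (test_H1 (tphi n)).2) => y e /sub Dy; rewrite e.
  have LL h : L2 D h -> L1 `]0, x[ h.
    move=> Lh; apply: L2_L1; [exact: mI|exact: itv_lty|]; exact: (L2S mD (mI 0 x) sub Lh).
  rewrite -RintegralB; [|exact: mI|exact: LL..].
  apply: (le_trans (Rint_le_norm2 xL (L2B mD Lwn Lw))).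
  by apply: ler_wpM2l; [exact: sqrtr_ge0|exact: dw].
have dcvg : Num.sqrt L * d n @[n --> \oo] --> 0.
  by rewrite -[X in _ --> X](mulr0 (Num.sqrt L)); apply: cvgM; [exact: cvg_cst|exact: cphi].
have kcvg x : 0 < x <= L -> phi n x @[n --> \oo] --> \int[leb]_(y in `]0, x[) wderiv D f y.
  move=> xL; apply/cvgrPdist_lt => e e0; move/cvgrPdist_lt : dcvg => /(_ e e0).
  apply: filterS => n; rewrite sub0r normrN => h; rewrite distrC.
  by apply: le_lt_trans h; apply: (le_trans (key n x xL)); exact: ler_norm.
split.
  have LL : 0 < L <= L by rewrite L_gt0 lexx.
  apply: (cvg_unique_ext (kcvg L LL) (cvg_cst (0 : R))) => n.
  by rewrite (test_fun_out (tphi n) notDL).1.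
pose psi x := \int[leb]_(y in `]0, x[) wderiv D f y.
have mpsi : measurable_fun D psi.
  apply: (@measurable_fun_cvg _ _ _ _ phi) => //.
    by move=> n; exact: (H1_L2 (hphi n)).1.
  by move=> x; rewrite /= in_itv/= => /andP[x0 xL]; apply: kcvg; rewrite x0 ltW.
have nB n : norm2 D (fun x => phi n x - psi x) <= Num.sqrt L * (Num.sqrt L * d n).
  have dn0 : 0 <= d n by exact: le_trans (norm2_ge0 _ _) (d0 n).
  have [mphi _] := H1_L2 (hphi n).
  apply: norm2_bounded; first exact: measurable_funB.
  by move=> x; rewrite /= in_itv/= => /andP[x0 xL]; apply: key; rewrite x0 ltW.
have Lpsi n : L2 D (fun x => phi n x - psi x).
  have [mphi _] := H1_L2 (hphi n).
  apply: (bounded_L2 mD (itv_lty _ _ _ _) (M := Num.sqrt L * d n)); first exact: measurable_funB.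
  by move=> x; rewrite /= in_itv/= => /andP[x0 xL]; apply: key; rewrite x0 ltW.
have Lfp : L2 D (fun x => f x - psi x).
  have := L2B mD (Lpsi 0%N) (L2B mD (H1_L2 (hphi 0%N)) Lf).
  by congr L2; apply/funext => x; ring.
have n0 : norm2 D (fun x => f x - psi x) = 0.
  apply/eqP; rewrite eq_le norm2_ge0 andbT.
  have c : d n + Num.sqrt L * (Num.sqrt L * d n) @[n --> \oo] --> 0.
    rewrite -[X in _ --> X](addr0 0) -{2}(mulr0 (Num.sqrt L)).
    by apply: cvgD => //; apply: cvgM; [exact: cvg_cst|exact: dcvg].
  rewrite leNgt; apply/negP => np; move/cvgrPdist_lt : c => /(_ _ np)[N _ /(_ N (leqnn N))].
  rewrite /= sub0r normrN; apply/negP; rewrite -leNgt; apply: le_trans (ler_norm _).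
  have := norm2D mD (Lpsi N) (L2N mD (L2B mD (H1_L2 (hphi N)) Lf)); rewrite norm2N.
  have -> : (fun x => phi N x - psi x + - (phi N x - f x)) = (fun x => f x - psi x) by apply/funext => x; ring.
  by move=> /le_trans; apply; rewrite addrC; apply: lerD; [exact: d0|exact: nB].
by apply: (lebS (norm2_eq0 mD Lfp n0)) => x e Dx; apply/eqP; rewrite -subr_eq0 e.
Qed.

(** The support interval [a, b] may be empty, with b < a: the zero function is then an instance for
    every [L]. *)
Definition cc_fun f := continuous f /\ exists a b, [/\ 0 < a, b < L &
  forall x, ~ (a <= x <= b) -> f x = 0].

Lemma cc_L12 f : cc_fun f -> L1 setT f /\ L2 setT f.
Proof.
move=> [cf [a [b [a0 bL f0]]]].
have zero (x : R) : `|a| + `|b| < `|x| -> f x = 0.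
  move=> h; apply: f0 => /andP[ax xb]; move: h; rewrite ltNge => /negP; apply.
  rewrite ler_norml; have := ler_norm (- a); rewrite normrN; have := ler_norm b.
  have := normr_ge0 a; have := normr_ge0 b; move=> *; apply/andP; split; lra.
have [M fM] : exists M, forall x, `|f x| <= M.
  have [ab|ba] := leP a b; last first.
    by exists 0 => x; rewrite f0 ?normr0// => /andP[? ?]; lra.
  have cn : {within `[a, b], continuous (fun x => `|f x|)}.
    by apply: continuous_subspaceT => x; apply: (continuous_comp (cf x)); exact: norm_continuous.
  have [c _ cM] := EVT_max ab cn; exists `|f c| => x.
  have [xab|nx] := pselect (a <= x <= b); first by apply: cM; rewrite in_itv.
  by rewrite (f0 _ nx) normr0.
by split; [apply: (@compact_support_L1 _ _ f M (`|a| + `|b|))|apply: (@compact_support_L2 _ _ f M (`|a| + `|b|))] => //;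
  exact: continuous_measurable_fun.
Qed.

Lemma cc_funD f g : cc_fun f -> cc_fun g -> cc_fun (fun x => f x + g x).
Proof.
move=> [cf [a [b [a0 bL f0]]]] [cg [c [d [c0 dL g0]]]]; split.
  by move=> x; apply: cvgD; [exact: cf|exact: cg].
exists (Num.min a c), (Num.max b d); rewrite lt_min a0 c0 gt_max bL dL; split => // x.
rewrite ge_min le_max => nx; rewrite f0 ?g0 ?addr0//.
- by move=> /andP[cx xd]; apply: nx; rewrite cx xd !orbT.
- by move=> /andP[ax xb]; apply: nx; rewrite ax xb.
Qed.

Lemma cc_funZ k f : cc_fun f -> cc_fun (fun x => k * f x).
Proof.
move=> [cf [a [b [a0 bL f0]]]]; split; first by move=> x; apply: cvgM; [exact: cvg_cst|exact: cf].
by exists a, b; split => // x nx; rewrite f0// mulr0.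
Qed.

Lemma cc_dense h (e : R) : L2 D h -> 0 < e ->
  exists2 c, cc_fun c & norm2 D (fun x => c x - h x) < e.
Proof.
move=> Lh; move: e.
pose h0 := h \_ D.
have Lh0 : L2 setT h0.
  case: Lh => mh ih; split; first by apply/measurable_restrict => //; rewrite setTI.
  have -> : (fun x => h0 x ^+ 2) = (fun x => h x ^+ 2) \_ D.
    by apply/funext => x; rewrite /h0 !patchE; case: ifPn => // _; rewrite expr0n.
  by rewrite /L1 -restrict_EFin; apply/integrable_restrict => //; rewrite setTI.
have : forall e, 0 < e -> exists2 c, cc_fun c & norm2 D (fun x => c x - h0 x) < e.
  apply: (@L2_density _ (fun g => forall e, 0 < e -> exists2 c, cc_fun c & norm2 D (fun x => c x - g x) < e)) Lh0.
  - move=> f g Lf Lg Hf Hg e e0; have e2 : 0 < e / 2 by rewrite divr_gt0.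
    have [c1 cc1 n1] := Hf _ e2; have [c2 cc2 n2] := Hg _ e2.
    exists (fun x => c1 x + c2 x); first exact: cc_funD.
    have S g1 : L2 setT g1 -> L2 D g1 by exact: L2S.
    have B1 := L2B mD (S _ (cc_L12 cc1).2) (S _ Lf); have B2 := L2B mD (S _ (cc_L12 cc2).2) (S _ Lg).
    have -> : (fun x => c1 x + c2 x - (f x + g x)) = (fun x => (c1 x - f x) + (c2 x - g x)) by apply/funext => x; ring.
    by apply: (le_lt_trans (norm2D mD B1 B2)); lra.
  - move=> k f Lf Hf e e0; have k0 : 0 < `|k| + 1 by rewrite ltr_wpDl.
    have [c cc n] := Hf (e / (`|k| + 1)) (divr_gt0 e0 k0).
    exists (fun x => k * c x); first exact: cc_funZ.
    have B1 := L2B mD (L2S mT mD (@subsetT _ _) (cc_L12 cc).2) (L2S mT mD (@subsetT _ _) Lf).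
    have -> : (fun x => k * c x - k * f x) = (fun x => k * (c x - f x)) by apply/funext => x; ring.
    rewrite norm2Z//; move: n; rewrite ltr_pdivlMr// mulrC; apply: le_lt_trans.
    by apply: ler_wpM2r; [exact: norm2_ge0|rewrite lerDl].
  - move=> f Lf H e e0; have e2 : 0 < e / 2 by rewrite divr_gt0.
    have [g [Lg Hg n1]] := H _ e2; have [c cc n2] := Hg _ e2; exists c => //.
    have S g1 : L2 setT g1 -> L2 D g1 by exact: L2S.
    have B1 := L2B mD (S _ (cc_L12 cc).2) (S _ Lg); have B2 := L2B mD (S _ Lg) (S _ Lf).
    have -> : (fun x => c x - f x) = (fun x => (c x - g x) + (g x - f x)) by apply/funext => x; ring.
    apply: (le_lt_trans (norm2D mD B1 B2)).
    have := norm2_subset mD (L2B mT Lg Lf); lra.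
  - move=> q r e e0; set a := Num.max 0 (ratr q : R); set b := Num.min L (ratr r : R).
    have eI (x : R) : D x -> \1_(`](ratr q : R), ratr r[%classic : set R) x = \1_(`]a, b[%classic : set R) x :> R.
      rewrite /= in_itv/= => /andP[x0 xL]; rewrite !indicE; congr (nat_of_bool _)%:R.
      by apply/idP/idP; rewrite !inE /= !in_itv/= gt_max lt_min x0 xL.
    have [ab|ba] := ltP a b; last first.
      exists (fun=> 0); first by split; [move=> x; exact: cvg_cst|exists 1, 0].
      rewrite (_ : norm2 _ _ = norm2 D (fun=> 0)); first by rewrite norm2_0.
      apply: eq_norm2 => x Dx.
      by rewrite eI// set_itv_ge ?bnd_simp -?leNgt// indicE in_set0 subrr.
    have a0 : 0 <= a by rewrite le_max lexx.
    have bL : b <= L by rewrite ge_min lexx.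
    have LI : L2 D (\1_(`]a, b[%classic : set R)).
      by apply: (L2S mT mD (@subsetT _ _)); apply: (L2_indic (mI a b)); exact: itvoo_sub_sym.
    have cb n : continuous (bumps a b n) by have [? _ _] := test_fun_bounded (bumps_test n (@subset_refl _ _) ab).
    have : norm2 D (fun x => bumps a b n x - \1_(`]a, b[%classic : set R) x) @[n --> \oo] --> 0.
      apply: norm2_dct => //; last by move=> x _; exact: bumps_cvg.
        by move=> n; apply: measurable_funS (continuous_measurable_fun (cb n)).
      move=> n x _; have [xab|nx] := pselect (`]a, b[%classic x); last by rewrite bumps_out// normr0.
      have /andP[b0 b1] := bumps_itv n x ab.
      by rewrite indic_in// normr1 ger0_norm.
    + move=> /cvgrPdist_lt/(_ e e0)[N _ /(_ N (leqnn N))]; rewrite /= sub0r normrN => small; exists (bumps a b N).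
        split => //; exists (a + dlseq a b N), (b - dlseq a b N).
        have d0 := dlseq_gt0 N ab; split; [lra|lra|] => x nx; apply: bump_out => //.
        exact: dlseq_le.
      apply: le_lt_trans small; apply: le_trans (ler_norm _).
      rewrite le_eqVlt; apply/orP; left; apply/eqP; apply: eq_norm2 => x Dx.
      by rewrite eI.
move=> H e /H[c cc n]; exists c => //; move: n; congr (_ < _).
apply: eq_norm2 => x Dx.
by rewrite /h0 patchE mem_set.
Qed.

(** The zero mean makes the primitive vanish to the right of the support as well. *)
Lemma cc_primitive c : cc_fun c -> \int[leb]_(x in D) c x = 0 ->
  exists2 F, test_fun D F & derive1 F = c.
Proof.
move=> cc c_int0; have [i1 _] := cc_L12 cc; have [cont [a [b [a0 bL c0]]]] := cc.
pose F (x : R) := \int[leb]_(y in `]-oo, x]) c y.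
have dF x : derivable F x 1 /\ derive1 F x = c x.
  apply: (@continuous_FTC1 _ c -oo%O x (x + 1)); rewrite ?ltrDl//; last exact: cont.
    by apply: l_intgS i1 => //; exact: measurable_itv.
  by rewrite ltNyr.
have eF : derive1 F = c by apply/funext => x; exact: (dF x).2.
exists F => //; split; [by move=> x; exact: (dF x).1|by rewrite eF|].
exists `[a, b]%classic; split; first exact: segment_compact.
  by move=> x /=; rewrite !in_itv/= => /andP[ax xb]; rewrite (lt_le_trans a0 ax) (le_lt_trans xb bL).
move=> x /=; rewrite in_itv/= => nx; have [xa|ax] := ltP x a.
  rewrite /F (_ : 0 = \int[leb]_(y in `]-oo, x]) 0); last by rewrite Rintegral_cst ?mul0r//; exact: measurable_itv.
  apply: eq_Rintegral => y /set_mem /=; rewrite in_itv/= => yx; apply: c0 => /andP[ay _].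
  by move: (le_lt_trans yx xa); rewrite ltNge ay.
have bx : b < x by rewrite ltNge; apply/negP => xb; apply: nx; rewrite ax xb.
rewrite -c_int0 /F Rintegral_mkcond [RHS]Rintegral_mkcond; congr (Rintegral _ _ _).
apply/funext => y; rewrite !patchE.
have [yab|ny] := pselect (a <= y <= b); last by rewrite (c0 _ ny); case: ifP; case: ifP.
have /andP[ay yb] := yab.
rewrite !mem_set//= in_itv/=; first by rewrite (lt_le_trans a0 ay) (le_lt_trans yb bL).
by rewrite (le_trans yb (ltW bx)).
Qed.

Lemma norm2_cvg_Rint f (f_ : nat -> R -> R) g : L2 D f -> (forall n, L2 D (f_ n)) -> L2 D g ->
  norm2 D (fun x => f_ n x - f x) @[n --> \oo] --> 0 ->
  \int[leb]_(x in D) (f_ n x * g x) @[n --> \oo] --> \int[leb]_(x in D) (f x * g x).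
Proof.
move=> Lf Lf_ Lg cf; apply/cvgrPdist_lt => e e0.
have c : norm2 D (fun x => f_ n x - f x) * norm2 D g @[n --> \oo] --> 0.
  by rewrite -[X in _ --> X](mul0r (norm2 D g)); apply: cvgM => //; exact: cvg_cst.
move/cvgrPdist_lt : c => /(_ e e0); apply: filterS => n; rewrite sub0r normrN; apply: le_lt_trans.
rewrite distrC -RintegralB//; try exact: L2M.
under eq_Rintegral do rewrite -mulrBl.
apply: (le_trans (CS_norm mD (L2B mD (Lf_ n) Lf) Lg)); exact: ler_norm.
Qed.

(** The converse of [H10_FTC], from which competitors are built. [h] is approximated in L^2 by
    continuous functions with compact support, corrected to zero mean; their primitives are test
    functions and converge in H^1. *)
Lemma H10_primitive h : L2 D h -> \int[leb]_(x in D) h x = 0 ->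
  let F x := \int[leb]_(y in `]0, x[) h y in
  H10 D F /\ {ae leb, forall x, D x -> wderiv D F x = h x}.
Proof.
move=> Lh h_int0 F.
have S g1 : L2 setT g1 -> L2 D g1 by exact: L2S.
(* A fixed profile of mass 1 inside ]0, L[: removing a multiple of it restores the zero mean at a
   cost proportional to that mean, which tends to 0. *)
pose rho := tent (L / 4) (L / 2).
have l4 : 0 < L / 4 by rewrite divr_gt0.
have ccr : cc_fun rho.
  split; first exact: tent_continuous.
  exists (L / 4), (L - L / 4); split; [lra|lra|] => x nx; apply: tent_out => //.
  have [xl|xl] := leP x (L / 2 - L / 4); first by left.
  right; rewrite leNgt; apply/negP => xr; apply: nx; apply/andP; split; lra.
have Lr := S _ (cc_L12 ccr).2.
have int_rho : \int[leb]_(x in D) rho x = 1.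
  by apply: tent_integral => // x /=; rewrite !in_itv/= => /andP[? ?]; apply/andP; split; lra.
have cex n : {c | cc_fun c /\ norm2 D (fun x => c x - h x) < n.+1%:R^-1}.
  by apply: cid; have [|c cc nc] := @cc_dense h n.+1%:R^-1 Lh; [rewrite invr_gt0|exists c].
pose c n := projT1 (cex n).
have cc n : cc_fun (c n) by rewrite /c; case: (cex n) => c' [].
have nc n : norm2 D (fun x => c n x - h x) < n.+1%:R^-1 by rewrite /c; case: (cex n) => c' [].
have Lc n := S _ (cc_L12 (cc n)).2.
have LL1 f : L2 D f -> L1 D f by move=> Lf; apply: L2_L1 => //; exact: itv_lty.
pose m n := \int[leb]_(x in D) c n x.
have mB n : `|m n| <= Num.sqrt L * n.+1%:R^-1.
  have -> : m n = \int[leb]_(x in `]0, L[) (c n x - h x).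
    by rewrite RintegralB ?h_int0 ?subr0//; exact: LL1.
  apply: (le_trans (Rint_le_norm2 (x := L) _ (L2B mD (Lc n) Lh))); first by rewrite L_gt0 lexx.
  by apply: ler_wpM2l; [exact: sqrtr_ge0|exact/ltW].
pose g n x := c n x + (- m n) * rho x.
have ccg n : cc_fun (g n) by apply: cc_funD => //; exact: cc_funZ.
have Lg n := S _ (cc_L12 (ccg n)).2.
have g_int0 n : \int[leb]_(x in D) g n x = 0.
  rewrite RintegralD//; [|exact: LL1|by apply: LL1; exact: L2Z].
  by rewrite RintegralZl//; [rewrite int_rho mulr1 subrr|exact: LL1].
pose b n := (1 + Num.sqrt L * norm2 D rho) * n.+1%:R^-1.
have bcvg : b n @[n --> \oo] --> 0.
  rewrite -[X in _ --> X](mulr0 (1 + Num.sqrt L * norm2 D rho)).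
  by apply: cvgM; [exact: cvg_cst|exact: cvg_harmonic].
have gB n : norm2 D (fun x => g n x - h x) <= b n.
  have -> : (fun x => g n x - h x) = (fun x => (c n x - h x) + (- m n) * rho x).
    by apply/funext => x; rewrite /g; ring.
  apply: (le_trans (norm2D mD (L2B mD (Lc n) Lh) (L2Z (- m n) mD Lr))).
  rewrite norm2Z// normrN /b mulrDl mul1r; apply: lerD; first exact: ltW.
  by rewrite mulrAC; apply: ler_wpM2r; [exact: norm2_ge0|exact: mB].
have Fex n : {G | test_fun D G /\ derive1 G = g n}.
  by apply: cid; have [G tG eG] := cc_primitive (ccg n) (g_int0 n); exists G.
pose G n := projT1 (Fex n).
have tG n : test_fun D (G n) by rewrite /G; case: (Fex n) => ? [].
have eG n : derive1 (G n) = g n by rewrite /G; case: (Fex n) => ? [].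
have [hG aeG] : (forall n, H1 D (G n)) /\ forall n, {ae leb, forall x, D x -> wderiv D (G n) x = derive1 (G n) x}.
  by split=> n; have [] := test_H1 (tG n).
have GF n x : 0 < x <= L -> `|G n x - F x| <= Num.sqrt L * b n.
  move=> xL; have [x0 xL'] := andP xL.
  have sub : `]0, x[%classic `<=` D by apply: subset_itvl; rewrite bnd_simp.
  have [dp cp _] := tG n.
  have := C1_FTC (ltW x0) dp cp; rewrite (test_fun_out (tG n) notD0).1 subr0 => <-; rewrite eG.
  have LL k : L2 D k -> L1 `]0, x[ k.
    move=> Lk; apply: L2_L1; [exact: mI|exact: itv_lty|]; exact: (L2S mD (mI 0 x) sub Lk).
  rewrite -RintegralB; [|exact: mI|exact: LL..].
  apply: (le_trans (Rint_le_norm2 xL (L2B mD (Lg n) Lh))).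
  by apply: ler_wpM2l; [exact: sqrtr_ge0|exact: gB].
have GFD n x : D x -> `|G n x - F x| <= Num.sqrt L * b n.
  by rewrite /= in_itv/= => /andP[x0 xL]; apply: GF; rewrite x0 ltW.
have sbcvg : Num.sqrt L * b n @[n --> \oo] --> 0.
  by rewrite -[X in _ --> X](mulr0 (Num.sqrt L)); apply: cvgM; [exact: cvg_cst|exact: bcvg].
have mF : measurable_fun D F.
  apply: (@measurable_fun_cvg _ _ _ _ G) => //; first by move=> n; exact: (H1_L2 (hG n)).1.
  move=> x Dx; apply/cvgrPdist_lt => e e0; move/cvgrPdist_lt : sbcvg => /(_ e e0).
  apply: filterS => n; rewrite sub0r normrN => small; rewrite distrC.
  by apply: le_lt_trans small; apply: (le_trans (GFD n x Dx)); exact: ler_norm.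
have mGF n : measurable_fun D (fun x => G n x - F x).
  by apply: measurable_funB => //; exact: (H1_L2 (hG n)).1.
have LGF n : L2 D (fun x => G n x - F x).
  exact: (bounded_L2 mD (itv_lty _ _ _ _) (mGF n) (GFD n)).
have LF : L2 D F.
  have := L2B mD (H1_L2 (hG 0%N)) (LGF 0%N).
  by congr L2; apply/funext => x; ring.
have nGF n : norm2 D (fun x => G n x - F x) <= Num.sqrt L * (Num.sqrt L * b n).
  by apply: norm2_bounded; [exact: mGF|exact: GFD].
have squeeze0 (v : nat -> R) (B : R) : (forall n, 0 <= v n <= B * b n) -> v n @[n --> \oo] --> 0.
  move=> vB; apply: (@squeeze_cvgr _ _ _ _ (fun=> 0) (fun n => B * b n)); [by apply: nearW|exact: cvg_cst|].
  by rewrite -[X in _ --> X](mulr0 B); apply: cvgM; [exact: cvg_cst|exact: bcvg].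
have wdF : weak_deriv D F h.
  move=> phi tphi; have [Lp Lp'] := test_L2 mD tphi.
  have A1 : \int[leb]_(x in D) (G n x * derive1 phi x) @[n --> \oo] --> \int[leb]_(x in D) (F x * derive1 phi x).
    apply: norm2_cvg_Rint => //; first by move=> n; exact: H1_L2.
    apply: (squeeze0 _ (Num.sqrt L * Num.sqrt L)) => n; rewrite norm2_ge0/= -mulrA; exact: nGF.
  have A2 : \int[leb]_(x in D) (g n x * phi x) @[n --> \oo] --> \int[leb]_(x in D) (h x * phi x).
    apply: norm2_cvg_Rint => //.
    by apply: (squeeze0 _ 1) => n; rewrite norm2_ge0/= mul1r; exact: gB.
  apply: (cvg_unique_ext A1 (cvgN A2)) => n.
  by rewrite (test_weak_deriv (tG n))// eG.
have hF : H1 D F by split => //; exists h.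
have aeF := wderiv_ae uD LF Lh wdF.
split => //; split => //; exists G => //.
apply: (squeeze0 _ (Num.sqrt L * Num.sqrt L + 1)) => n; rewrite H1dist_ge0/=.
rewrite H1distE//.
have -> : norm2 D (fun x => wderiv D (G n) x - wderiv D F x) = norm2 D (fun x => g n x - h x).
  have [l1 _] := wderivP (hG n); have [l2 _] := wderivP hF.
  apply: norm2_ae => //; [exact: (L2B mD l1 l2).1|exact: (L2B mD (Lg n) Lh).1|].
  by apply: (lebS (lebI (aeG n) aeF)) => x [e1 e2] Dx; rewrite e1// e2// eG.
have n1 := norm2_ge0 D (fun x => G n x - F x); have n2 := norm2_ge0 D (fun x => g n x - h x).
have := nGF n; have := gB n; move: n1 n2; move: (norm2 _ _) (norm2 _ _) => p q p0 q0 q1 p1.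
apply: (@le_trans _ _ (p + q)).
  have s0 := sqrtr_ge0 (p ^+ 2 + q ^+ 2); rewrite -(@ler_pXn2r _ 2)// ?nnegrE ?addr_ge0//.
  by rewrite sqr_sqrtr ?addr_ge0 ?sqr_ge0//; nra.
by rewrite mulrDl mul1r -mulrA addrC; exact: lerD.
Qed.

End H10_space.

(** * Weak-* convergence and distribution functions *)

Section Weak_star_limits.
Context {R : realType}.
Local Notation leb := (@lebesgue_measure R).
Local Notation MR := (measurableTypeR R).
Implicit Types (nu : smeas R) (X A : set MR) (f g phi psi : R -> R).

Lemma clamp_comp_continuous (L : R) phi : 0 <= L -> {within `[0, L], continuous phi} ->
  continuous (fun x => phi (clamp L x)).
Proof.
move=> L0 /subspace_continuousP cphi x.
have cl y : `[0, L]%classic (clamp L y) by rewrite /= in_itv/= clamp_itv.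
apply: (@cvg_comp _ _ _ (clamp L) phi _ (within `[0, L] (nbhs (clamp L x)))); last exact: cphi.
have c : clamp L y @[y --> x] --> clamp L x.
  apply/cvgrPdist_lt => e e0; exists e => //= y; rewrite /ball_/= => xy.
  have [yx|xy'] := leP y x.
    have := clamp_dist L0 yx; have := clamp_le L yx.
    move: xy; rewrite !ltr_norml => /andP[? ?] *; apply/andP; split; lra.
  have := clamp_dist L0 (ltW xy'); have := clamp_le L (ltW xy').
  move: xy; rewrite !ltr_norml => /andP[? ?] *; apply/andP; split; lra.
move=> P nP; have {c} c := c _ nP.
by apply: filterS (c : nbhs x _) => y /= Py; apply: Py; exact: cl.
Qed.

Definition nonneg nu : Prop := forall A, measurable A -> (0 <= nu A)%E.

Definition bmeas X f : Prop := measurable_fun X f /\ exists M, forall x, X x -> `|f x| <= M.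

Lemma meas_integral_nonneg nu X f : nonneg nu -> measurable X -> bmeas X f ->
  meas_integral nu X f = \int[jpos nu]_(x in X) f x /\ (jpos nu).-integrable X (EFin \o f).
Proof.
move=> nu0 mX [mf [M fM]]; split; last exact: bounded_intg (jpos_fin nu) mf fM.
apply: (meas_integral_measure mX (jpos_fin nu) _ mf fM) => A mA.
by apply/esym; exact: jposE.
Qed.

Lemma bmeasD X f g : bmeas X f -> bmeas X g -> bmeas X (fun x => f x + g x).
Proof.
move=> [mf [M fM]] [mg [N gN]]; split; first exact: measurable_funD.
by exists (M + N) => x Xx; apply: (le_trans (ler_normD _ _)); apply: lerD; [exact: fM|exact: gN].
Qed.

Lemma bmeasZ X k f : bmeas X f -> bmeas X (fun x => k * f x).
Proof.
move=> [mf [M fM]]; split; first exact: measurable_funM.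
by exists (`|k| * M) => x Xx; rewrite normrM ler_wpM2l// fM.
Qed.

Lemma bmeas_indic X A : measurable A -> measurable X -> bmeas X (\1_A).
Proof.
move=> mA mX; split; first exact: measurable_indic.
by exists 1 => x _; rewrite indicE; case: (_ \in _); rewrite ?normr1 ?normr0.
Qed.

Lemma meas_integral_funD nu X f g : nonneg nu -> measurable X -> bmeas X f -> bmeas X g ->
  meas_integral nu X (fun x => f x + g x) = meas_integral nu X f + meas_integral nu X g.
Proof.
move=> nu0 mX bf bg; have [-> i1] := meas_integral_nonneg nu0 mX bf.
have [-> i2] := meas_integral_nonneg nu0 mX bg; rewrite (meas_integral_nonneg nu0 mX (bmeasD bf bg)).1.
exact: RintegralD.
Qed.

Lemma meas_integral_funZ nu X k f : nonneg nu -> measurable X -> bmeas X f ->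
  meas_integral nu X (fun x => k * f x) = k * meas_integral nu X f.
Proof.
move=> nu0 mX bf; have [-> i1] := meas_integral_nonneg nu0 mX bf.
by rewrite (meas_integral_nonneg nu0 mX (bmeasZ k bf)).1 RintegralZl.
Qed.

Lemma meas_integral_indic nu X A : nonneg nu -> measurable X -> measurable A -> meas_on X nu ->
  meas_integral nu X (\1_A) = fine (nu A).
Proof.
move=> nu0 mX mA on; rewrite (meas_integral_nonneg nu0 mX (bmeas_indic mA mX)).1.
rewrite (charge_meas_on mX mA on) -(jposE nu0); last exact: measurableI.
by rewrite /Rintegral integral_indic.
Qed.

Lemma meas_integral_norm_le nu X f e : nonneg nu -> measurable X -> bmeas X f -> 0 <= e ->
  (forall x, X x -> `|f x| <= e) -> `|meas_integral nu X f| <= e * fine (nu setT).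
Proof.
move=> nu0 mX bf e0 fe; have [-> i1] := meas_integral_nonneg nu0 mX bf.
have ce : (jpos nu).-integrable X (EFin \o (fun=> e)).
  by apply: (@bounded_intg _ _ _ _ e mX (jpos_fin nu)) => //= x _; rewrite ger0_norm.
have [mf _] := bf.
apply: (le_trans (Rint_norm_le mX mf ce _)); first by apply: aeW => x Xx; exact: fe.
rewrite Rintegral_cst//; apply: ler_wpM2l => //; rewrite -[leLHS]/(fine (jpos nu X)) jposE//.
have fin B : measurable B -> nu B \is a fin_num by exact: fin_num_measure.
apply: fine_le; [exact: fin|exact: fin|].
by rewrite -!jposE//; apply: le_measure; rewrite ?inE//; exact: subsetT.
Qed.

Lemma eq_fun_meas_integral nu X f g : (forall x, X x -> f x = g x) ->
  meas_integral nu X f = meas_integral nu X g.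
Proof.
by move=> fg; rewrite /meas_integral; congr (_ - _); apply: eq_Rintegral => x /set_mem; exact: fg.
Qed.

Definition cdf nu (x : R) : R := fine (nu `]-oo, x]%classic).

Lemma cdf_itv nu (x y : R) : x <= y -> fine (nu `]x, y]%classic) = cdf nu y - cdf nu x.
Proof.
move=> xy; have m1 : measurable (`]-oo, x]%classic : set MR) by exact: measurable_itv.
have m2 : measurable (`]x, y]%classic : set MR) by exact: measurable_itv.
have d : `]-oo, x]%classic `&` `]x, y]%classic = set0 :> set MR.
  by rewrite -subset0 => z [] /=; rewrite !in_itv/= => zx /andP[xz _]; rewrite ltNge zx in xz.
have : nu `]-oo, y]%classic = (nu `]-oo, x]%classic + nu `]x, y]%classic)%E.
  rewrite -chargeU//; congr (nu _); apply/seteqP; split => z /=; rewrite !in_itv/=.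
    by move=> zy; have [zx|xz] := leP z x; [left|right; rewrite zy].
  by move=> [zx|/andP[]//]; exact: le_trans xy.
rewrite /cdf => ->; rewrite fineD; first by rewrite addrC addKr.
- exact: fin_num_measure.
- exact: fin_num_measure.
Qed.

Section cdf_cvg.
Variables (L : R) (I : Type) (F : set_system I) (FF : ProperFilter F).
Variables (nu_ : I -> smeas R) (nu : smeas R) (C : set R).
Hypothesis L_gt0 : 0 < L.
Hypothesis nu_ok : \forall i \near F, meas_on `[0, L] (nu_ i) /\ nonneg (nu_ i).
Hypothesis nu_on : meas_on `[0, L] nu.
Hypothesis nu_ge0 : nonneg nu.
Hypothesis C_dense : forall a b : R, a < b -> exists2 x, C x & a < x < b.
Hypothesis C_cvg : forall x, C x -> cdf (nu_ i) x @[i --> F] --> cdf nu x.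

Let X := (`[0, L]%classic : set MR).
Let mX : measurable X. Proof. exact: measurable_itv. Qed.

Let step_itv (x y : R) : C x -> C y -> x <= y ->
  meas_integral (nu_ i) X (\1_(`]x, y]%classic : set MR)) @[i --> F] --> meas_integral nu X (\1_(`]x, y]%classic : set MR)).
Proof.
move=> Cx Cy xy; have m2 : measurable (`]x, y]%classic : set MR) by exact: measurable_itv.
rewrite meas_integral_indic// cdf_itv//.
apply: cvg_near_ext (cvgB (C_cvg Cy) (C_cvg Cx)).
by apply: filterS nu_ok => i [on ge0]; rewrite meas_integral_indic// cdf_itv.
Qed.

(** Step functions with jumps in [C], so that their integrals converge. The supremum [z] of the
    points up to which such an approximation exists can always be passed, by continuity of [psi] at
    [z], unless [L] has been reached. *)
Let approx psi (e : R) : continuous psi -> 0 < e -> exists s, [/\ bmeas X s,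
  forall x, X x -> `|psi x - s x| <= e &
  meas_integral (nu_ i) X s @[i --> F] --> meas_integral nu X s].
Proof.
move=> cpsi e0.
(* The first jump lies below 0: the pieces ]x, y] are open on the left, and an atom at 0 has to be
   counted. *)
have [a Ca /andP[a1 a0]] := C_dense (ltrN10 R).
pose ok y := C y /\ a <= y /\ exists s, [/\ bmeas X s,
  forall x, X x -> x <= y -> `|psi x - s x| <= e &
  meas_integral (nu_ i) X s @[i --> F] --> meas_integral nu X s] /\ (forall x, y < x -> s x = 0).
suff [y [oky Ly]] : exists y, ok y /\ L <= y.
  move: oky => [_ [_ [s [[bs se cs] _]]]]; exists s; split => // x Xx; apply: se => //.
  by apply: le_trans Ly; move: Xx; rewrite /X /= in_itv/= => /andP[].
have bm0 : bmeas X (fun=> 0) by split; [exact: measurable_cst|exists 0 => x _; rewrite normr0].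
have m0 k : nonneg k -> meas_integral k X (fun=> 0) = 0.
  by move=> k0; rewrite (meas_integral_nonneg k0 mX bm0).1 Rintegral_cst// mul0r.
have oka : ok a.
  split => //; split => //; exists (fun=> 0); split; last by [].
  split => //.
  - move=> x; rewrite /X /= in_itv/= => /andP[x0 _] xa.
    by move: (le_lt_trans xa a0); rewrite ltNge x0.
  - rewrite m0//; apply: cvg_near_ext (cvg_cst (0 : R)).
    by apply: filterS nu_ok => i [_ ge0]; rewrite m0.
apply: contrapT => nex.
have okL y : ok y -> y < L by move=> oky; rewrite ltNge; apply/negP => Ly; apply: nex; exists y.
have hs : has_sup [set y | ok y] by split; [exists a|exists L => y /okL /ltW].
set z := sup [set y | ok y].
have e2 : 0 < e / 2 by rewrite divr_gt0.
have [d /= d0 Hd] : \forall x \near z, `|psi z - psi x| < e / 2.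
  by have /cvgrPdist_lt := cpsi z; exact.
have [y oky zy] := sup_adherent d0 hs; rewrite -/z in zy.
have yz : y <= z by apply: sup_upper_bound.
have [y' Cy' /andP[zy' y'd]] := C_dense (ltr_pwDr d0 (lexx z)).
have : ok y'.
  have [Cy [ay [s [[bs se cs] s0]]]] := oky.
  have yy' : y <= y' by rewrite (le_trans yz)// ltW.
  have mi : measurable (`]y, y']%classic : set MR) by exact: measurable_itv.
  have bi := bmeasZ (psi y') (bmeas_indic mi mX).
  split => //; split; first by rewrite (le_trans ay).
  exists (fun x => s x + psi y' * \1_(`]y, y']%classic : set MR) x); split; last first.
    move=> x y'x; rewrite s0 ?(le_lt_trans yy')// indicE memNset ?mulr0 ?addr0//= in_itv/=.
    by move=> /andP[_]; rewrite leNgt y'x.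
  split; first exact: bmeasD.
  - move=> x Xx xy'; have [xy|yx] := leP x y.
      rewrite indicE memNset ?mulr0 ?addr0; first exact: se.
      by rewrite /= in_itv/= => /andP[]; rewrite ltNge xy.
    rewrite s0// add0r indicE mem_set ?mulr1; last by rewrite /= in_itv/= yx.
    have h1 : `|psi z - psi x| < e / 2.
      by apply: Hd; rewrite /ball_/= ltr_norml; apply/andP; split; lra.
    have h2 : `|psi z - psi y'| < e / 2.
      by apply: Hd; rewrite /ball_/= ltr_norml; apply/andP; split; lra.
    have := ler_normB (psi z - psi y') (psi z - psi x).
    have -> : psi z - psi y' - (psi z - psi x) = psi x - psi y' by ring.
    by move: h1 h2; lra.
  - rewrite meas_integral_funD// meas_integral_funZ//; last exact: bmeas_indic.
    apply: cvg_near_ext (cvgD cs (cvgM (cvg_cst (psi y')) (step_itv Cy Cy' yy'))).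
    apply: filterS nu_ok => i [_ ge0].
    by rewrite meas_integral_funD// meas_integral_funZ//; exact: bmeas_indic.
move=> oky'; have : y' <= z by apply: sup_upper_bound.
by rewrite leNgt zy'.
Qed.

Let mass_cvg : fine (nu_ i setT) @[i --> F] --> fine (nu setT).
Proof.
have [y Cy /andP[Ly _]] := C_dense (ltr_pwDr ltr01 (lexx L)).
have e (k : smeas R) : meas_on X k -> fine (k setT) = cdf k y.
  move=> on; rewrite /cdf (charge_meas_on mX measurableT on).
  rewrite [in RHS](charge_meas_on mX (measurable_itv `]-oo, y]) on).
  congr (fine (k _)); rewrite setTI; apply/esym/setIidPr => x; rewrite /X /= !in_itv/= => /andP[_ xL].
  exact: le_trans (ltW Ly).
rewrite e//; apply: cvg_near_ext (C_cvg Cy).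
by apply: filterS nu_ok => i [on _]; rewrite e.
Qed.

(** A step function is uniformly close to [phi] on [0, L], its integrals converge, and the error is
    controlled by the masses, which converge too as values of the distribution functions beyond
    [L]. *)
Lemma wstar_cvg_cdf : wstar_cvg L F nu_ nu.
Proof.
move=> phi cphi.
have L0 := ltW L_gt0.
pose psi x := phi (clamp L x).
have cpsi : continuous psi by exact: clamp_comp_continuous.
have bpsi : bmeas X psi.
  split; first by apply: measurable_funS (continuous_measurable_fun cpsi).
  have cn : {within `[0, L], continuous (fun x => `|psi x|)}.
    by apply: continuous_subspaceT => x; apply: (continuous_comp (cpsi x)); exact: norm_continuous.
  by have [c _ cM] := EVT_max L0 cn; exists `|psi c| => x Xx; exact: cM.
have eX k : meas_integral k `[0, L] phi = meas_integral k X psi.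
  by apply: eq_fun_meas_integral => x; rewrite /= in_itv/= => xL; rewrite /psi clampE.
rewrite eX; under eq_fun do rewrite eX.
apply/cvgrPdist_le => e e0.
pose M := fine (nu setT) + 1.
have nu0 : 0 <= fine (nu setT) by apply: fine_ge0; exact: nu_ge0.
have M0 : 0 < M by rewrite ltr_wpDl.
have eM : 0 < e / (3 * M) by rewrite divr_gt0// mulr_gt0.
have [s [bs se cs]] := approx cpsi eM.
have bd : bmeas X (fun x => psi x - s x).
  have := bmeasD bpsi (bmeasZ (- 1) bs); congr bmeas; apply/funext => x; ring.
have split_ k : nonneg k -> meas_integral k X psi = meas_integral k X s + meas_integral k X (fun x => psi x - s x).
  by move=> k0; rewrite -meas_integral_funD//; apply: eq_fun_meas_integral => x _; ring.
have e3 : 0 < e / 3 by rewrite divr_gt0.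
move/cvgrPdist_lt : cs => /(_ _ e3) cs; move/cvgrPdist_lt : mass_cvg => /(_ _ ltr01) cm.
near=> i.
have [on ge0] : meas_on X (nu_ i) /\ nonneg (nu_ i) by near: i; exact: nu_ok.
have mi : fine (nu_ i setT) <= M.
  have : `|fine (nu setT) - fine (nu_ i setT)| < 1 by near: i; exact: cm.
  by rewrite /M ltr_norml => /andP[]; lra.
have ci : `|meas_integral nu X s - meas_integral (nu_ i) X s| < e / 3 by near: i; exact: cs.
rewrite !split_//.
have B k : nonneg k -> fine (k setT) <= M -> `|meas_integral k X (fun x => psi x - s x)| <= e / 3.
  move=> k0 kM; apply: (le_trans (meas_integral_norm_le k0 mX bd (ltW eM) se)).
  have -> : e / 3 = e / (3 * M) * M by field; rewrite gt_eqF.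
  by apply: ler_wpM2l => //; exact: ltW.
have B1 := B nu nu_ge0 (_ : fine (nu setT) <= M).
have {}B1 : `|meas_integral nu X (fun x => psi x - s x)| <= e / 3 by apply: B1; rewrite /M lerDl.
have B2 := B _ ge0 mi.
rewrite opprD addrACA; apply: (le_trans (ler_normD _ _)).
have := ler_normB (meas_integral nu X (fun x => psi x - s x)) (meas_integral (nu_ i) X (fun x => psi x - s x)).
move: ci; move: (meas_integral _ _ _) => *; lra.
Unshelve. all: by end_near. Qed.

End cdf_cvg.

End Weak_star_limits.

(** * Helly's theorem on a closed interval *)

Section Weak_star_compactness.
Context {R : realType}.
Local Notation leb := (@lebesgue_measure R).
Local Notation MR := (measurableTypeR R).
Implicit Types (nu : smeas R) (x y e : R) (q r : rat).

Lemma nonneg_mono nu (A B : set MR) : nonneg nu -> measurable A -> measurable B -> A `<=` B ->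
  fine (nu A) <= fine (nu B).
Proof.
move=> nu0 mA mB AB; apply: fine_le; [exact: fin_num_measure|exact: fin_num_measure|].
by rewrite -!jposE//; apply: le_measure; rewrite ?inE.
Qed.

Lemma cdf_le nu x y : nonneg nu -> x <= y -> cdf nu x <= cdf nu y.
Proof.
move=> nu0 xy; apply: nonneg_mono => //; try exact: measurable_itv.
by move=> z /=; rewrite !in_itv/= => /le_trans; apply.
Qed.

Lemma cdf_ge0 nu x : nonneg nu -> 0 <= cdf nu x.
Proof. by move=> nu0; apply: fine_ge0; apply: nu0; exact: measurable_itv. Qed.

Lemma cdf_lt0 (L : R) nu x : meas_on `[0, L] nu -> x < 0 -> cdf nu x = 0.
Proof.
move=> on x0; have mX : measurable (`[0, L]%classic : set MR) by exact: measurable_itv.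
rewrite /cdf (charge_meas_on mX (measurable_itv `]-oo, x]) on).
rewrite (_ : _ `&` _ = set0) ?charge0// -subset0 => y [] /=; rewrite !in_itv/= => yx /andP[y0 _].
by move: (le_lt_trans yx x0); rewrite ltNge y0.
Qed.

Lemma cdf_geL (L : R) nu x : meas_on `[0, L] nu -> L <= x -> cdf nu x = fine (nu setT).
Proof.
move=> on Lx; have mX : measurable (`[0, L]%classic : set MR) by exact: measurable_itv.
rewrite /cdf (charge_meas_on mX measurableT on) (charge_meas_on mX (measurable_itv `]-oo, x]) on).
congr (fine (nu _)); rewrite setTI; apply/setIidPr => y; rewrite /= !in_itv/= => /andP[_ yL].
exact: le_trans Lx.
Qed.

Section limit.
Variables (L : R) (I : Type) (F : set_system I) (FF : ProperFilter F).
Variables (nu_ : I -> smeas R) (D : rat -> R).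
Hypothesis L_gt0 : 0 < L.
Hypothesis nu_ok : \forall i \near F, meas_on `[0, L] (nu_ i) /\ nonneg (nu_ i).
Hypothesis D_cvg : forall q, cdf (nu_ i) (ratr q) @[i --> F] --> D q.

Let D_lt0 q : (ratr q : R) < 0 -> D q = 0.
Proof.
move=> q0; apply: (cvg_unique _ (@D_cvg q)) => //; apply: cvg_near_ext (cvg_cst (0 : R)).
by apply: filterS nu_ok => i [on _]; rewrite (cdf_lt0 on).
Qed.

Let D_ge0 q : 0 <= D q.
Proof.
rewrite -oppr_le0; apply: (cvg_le_near (cvgN (@D_cvg q))).
by apply: filterS nu_ok => i [_ nu0]; rewrite oppr_le0; exact: cdf_ge0.
Qed.

Let D_geL q r : L <= ratr q -> L <= ratr r -> D q = D r.
Proof.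
move=> Lq Lr; apply: (cvg_unique _ (@D_cvg q)) => //; apply: cvg_near_ext (@D_cvg r).
by apply: filterS nu_ok => i [on _]; rewrite !(cdf_geL on).
Qed.

Let S x : set R := [set D q | q in [set q | x < ratr q]].

Let rat_between x y : x < y -> exists q, x < ratr q < y.
Proof. by move=> /rat_in_itvoo[q]; rewrite in_itv; exists q. Qed.

Let S0 x : S x !=set0.
Proof.
by have [q /andP[xq _]] := rat_between (ltr_pwDr ltr01 (lexx x)); exists (D q); exists q.
Qed.

Let Slb x : has_lbound (S x).
Proof. by exists 0 => _ [q _ <-]; exact: D_ge0. Qed.

(** Limits at rational points need not be right-continuous; [H] is their right-continuous
    regularization. *)
Let H x : R := inf (S x).

Let H_le x q : x < ratr q -> H x <= D q.
Proof. by move=> xq; apply: ge_inf; [exact: Slb|exists q]. Qed.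

Let le_H x y : (forall q, x < ratr q -> y <= D q) -> y <= H x.
Proof. by move=> h; apply: lb_le_inf; [exact: S0|move=> _ [q xq <-]; exact: h]. Qed.

Let H_adh x e : 0 < e -> exists2 q, x < ratr q & D q < H x + e.
Proof.
move=> e0; have hi : has_inf (S x) by split; [exact: S0|exact: Slb].
by have [_ [q xq <-] h] := inf_adherent e0 hi; exists q.
Qed.

Let H_mono : nondecreasing H.
Proof. by move=> x y xy; apply: le_H => q yq; apply: H_le; exact: le_lt_trans yq. Qed.

Let H_rc : right_continuous H.
Proof.
move=> x; apply/cvgrPdist_lt => e e0; have [q xq Dq] := H_adh x e0.
near=> y; have xy : x <= y by [].
have yq : y < ratr q by near: y; exact: nbhs_right_lt.
rewrite distrC ger0_norm ?subr_ge0; last exact: H_mono.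
by rewrite ltrBlDl (le_lt_trans (H_le yq)).
Unshelve. all: by end_near. Qed.

Let H_lt0 x : x < 0 -> H x = 0.
Proof.
move=> x0; apply/eqP; rewrite eq_le; apply/andP; split; last by apply: le_H => q _; exact: D_ge0.
have [q /andP[xq q0]] := rat_between x0; rewrite -(D_lt0 q0); exact: H_le.
Qed.

Let H_geL x y : L <= x -> L <= y -> H x = H y.
Proof.
suff h a b : L <= a -> L <= b -> H a <= H b by move=> Lx Ly; apply/eqP; rewrite eq_le !h.
move=> La Lb; have [q /andP[aq _]] := rat_between (ltr_pwDr ltr01 (lexx a)).
apply: le_H => r br; apply: (le_trans (H_le aq)).
by rewrite (@D_geL q r)//; [exact: le_trans (ltW aq)|exact: le_trans (ltW br)].
Qed.

Let Hc : cumulative R R := HB.pack_for (cumulative R R) H (isCumulative.Build R _ R H H_mono H_rc).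

Let N1L : -1 <= L. Proof. by apply: le_trans (ltW L_gt0); rewrite lerN10. Qed.

Let ls_oo : (lebesgue_stieltjes_measure Hc `](-1)%R, L]%classic < +oo)%E.
Proof. by rewrite lebesgue_stieltjes_itv ?ltry. Qed.

Let mJ : measurable (`](-1)%R, L]%classic : set MR).
Proof. exact: measurable_itv. Qed.

(** Cutting the Stieltjes measure to ]-1, L] keeps the jump of [H] at 0, that is, a possible atom at
    the left end of the bar. *)
Let m : {finite_measure set MR -> \bar R} := mfrestr mJ ls_oo.

Let nu : smeas R := charge_of_finite_measure m.

Let nuE (A : set MR) : nu A = lebesgue_stieltjes_measure Hc (A `&` `](-1)%R, L]%classic).
Proof. by []. Qed.

Let nu_ge0 : nonneg nu.
Proof. by move=> A mA; rewrite nuE measure_ge0. Qed.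

Let nu_cdf x : cdf nu x = H x.
Proof.
rewrite /cdf nuE; have [x1|x1] := ltP x (-1).
  rewrite (_ : _ `&` _ = set0) ?measure0 ?H_lt0//; first exact: lt_trans (ltrN10 R).
  rewrite -subset0 => y [] /=; rewrite !in_itv/= => yx /andP[y1 _].
  by move: (lt_trans (le_lt_trans yx x1) y1); rewrite ltxx.
have -> : `]-oo, x]%classic `&` `](-1)%R, L]%classic = `](-1)%R, Num.min x L]%classic :> set R.
  apply/seteqP; split => y /=; rewrite !in_itv/= le_min; first by move=> [-> /andP[-> ->]].
  by move=> /andP[-> /andP[-> ->]].
rewrite lebesgue_stieltjes_itv ?le_min ?x1//= [X in _ - X]H_lt0 ?ltrN10// subr0.
by have [Lx|xL] := ltP L x => //; apply: H_geL => //; exact: ltW.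
Qed.

Let nu_on : meas_on `[0, L] nu.
Proof.
move=> A mA; have mX : measurable (`[0, L]%classic : set MR) by exact: measurable_itv.
pose ms : {measure set MR -> \bar R} := lebesgue_stieltjes_measure Hc.
have sub : (A `\` `[0, L]%classic) `&` `](-1)%R, L]%classic `<=`
    \bigcup_(k : nat) (`](-1)%R, - (k.+1%:R^-1)]%classic : set MR).
  move=> x [[_ nx]] /=; rewrite in_itv/= => /andP[x1 xL].
  have x0 : x < 0 by rewrite ltNge; apply/negP => x0; apply: nx; rewrite /= in_itv/= x0.
  have nx0 : 0 < - x by rewrite oppr_gt0.
  have [k /andP[_ kx]] : exists k : nat, (0 : R) <= k.+1%:R^-1 <= - x.
    have := @cvg_harmonic R => /cvgrPdist_lt/(_ _ nx0)[k _ /(_ k (leqnn k))].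
    rewrite /= sub0r normrN ger0_norm ?invr_ge0// => h; exists k; rewrite invr_ge0 ler0n/=.
    exact: ltW.
  by exists k => //=; rewrite in_itv/= x1 lerNr.
have nU : ms.-negligible (\bigcup_(k : nat) (`](-1)%R, - (k.+1%:R^-1)]%classic : set MR)).
  apply: negligible_bigcup => k; apply/negligibleP; first exact: measurable_itv.
  have k0 : - (k.+1%:R^-1) < 0 :> R by rewrite oppr_lt0 invr_gt0.
  rewrite /ms /= lebesgue_stieltjes_itv; first by rewrite /= !H_lt0 ?ltrN10// subrr.
  by rewrite lerN2 invf_le1// ler1n.
rewrite nuE -[LHS]/(ms _); have mS : measurable ((A `\` `[0, L]%classic) `&` `](-1)%R, L]%classic : set MR).
  by apply: measurableI => //; exact: measurableD.
by have [B [mB B0 UB]] := nU; apply/eqP; rewrite eq_le measure_ge0 andbT -B0; apply: le_measure;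
  rewrite ?inE//; exact: subset_trans UB.
Qed.

(** The points at which the limits [D] from the left come up to [H x]; there monotonicity squeezes
    the distribution functions between rational values. *)
Let C : set R := [set x | forall e, 0 < e -> exists2 q, ratr q < x & H x - e < D q].

Let C_cvg x : C x -> cdf (nu_ i) x @[i --> F] --> cdf nu x.
Proof.
move=> Cx; rewrite nu_cdf; apply/cvgrPdist_lt => e e0.
have e2 : 0 < e / 2 by rewrite divr_gt0.
have [q qx Hq] := Cx _ e2; have [r xr Hr] := H_adh x e2.
move/cvgrPdist_lt : (@D_cvg q) => /(_ _ e2) cq; move/cvgrPdist_lt : (@D_cvg r) => /(_ _ e2) cr.
apply: filterS3 nu_ok cq cr => i [_ nu0]; rewrite !ltr_norml => /andP[? ?] /andP[? ?].
have := cdf_le nu0 (ltW qx); have := cdf_le nu0 (ltW xr) => *; apply/andP; split; lra.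
Qed.

(** Outside [C] there is a gap between the values of [D] to the left of the point and [H] at the
    point. Gaps at distinct points are ordered as the points are, so a rational number chosen in
    each is injective. *)
Let C_countable : countable (~` C).
Proof.
have ex x : exists r : rat, ~ C x -> (forall q, ratr q < x -> D q <= ratr r) /\ ratr r < H x.
  have [Cx|nCx] := pselect (C x); first by exists 0.
  have [e e0 he] : exists2 e, 0 < e & forall q, ratr q < x -> D q <= H x - e.
    apply: contrapT => h; apply: nCx => e e0; apply: contrapT => h2; apply: h; exists e => // q qx.
    by rewrite leNgt; apply/negP => lt; apply: h2; exists q.
  have [|r /andP[hr rH]] := @rat_between (H x - e) (H x); first by rewrite ltrBlDr ltrDl.
  by exists r => _; split => // q qx; apply: le_trans (ltW hr); exact: he.
have [r rP] := choice ex.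
apply/countable_injP; exists (pickle \o r) => x y; rewrite !inE => nx ny /= /(pcan_inj pickleK) rxy.
suff h a b : ~ C a -> ~ C b -> a < b -> r a = r b -> False.
  by have [xy|yx|//] := ltgtP x y; [case: (h x y)|case: (h y x)].
move=> na nb ab rab; have [q /andP[aq qb]] := rat_between ab.
have [_ ra] := rP a na; have [rb _] := rP b nb.
by have := lt_le_trans ra (le_trans (H_le aq) (rb q qb)); rewrite rab ltxx.
Qed.

Let C_dense x y : x < y -> exists2 z, C z & x < z < y.
Proof.
move=> xy; apply: contrapT => nex.
have : countable (`]x, y[%classic : set R).
  apply: sub_countable C_countable; apply: subset_card_le => z /=; rewrite in_itv/= => xzy Cz.
  by apply: nex; exists z.
move=> /countable_lebesgue_measure0; rewrite lebesgue_measure_itv/= lte_fin xy.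
by move=> /eqP; rewrite -EFinD eqe subr_eq0 gt_eqF.
Qed.

(** Convergence at rational points yields the limit measure. The filter is arbitrary, so that the
    result serves both for eps going to 0 and for difference quotients as s goes to t. *)
Lemma wstar_limit : exists nu : smeas R, [/\ nonneg nu, meas_on `[0, L] nu, wstar_cvg L F nu_ nu &
  {ae leb, forall x, cdf (nu_ i) x @[i --> F] --> cdf nu x}].
Proof.
exists nu; split; [exact: nu_ge0|exact: nu_on|exact: (@wstar_cvg_cdf R L I F FF nu_ nu C L_gt0 nu_ok nu_on nu_ge0 (@C_dense) (@C_cvg))|].
exists (~` C); split.
- by apply: countable_measurable => // x; exact: measurable_set1.
- exact: countable_lebesgue_measure0.
- by move=> x /= h Cx; apply: h; exact: C_cvg.
Qed.

End limit.

Lemma jordan_out nu (X A : set MR) : measurable X -> meas_on X nu -> measurable A ->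
  A `&` X = set0 -> jpos nu A = 0%E /\ jneg nu A = 0%E.
Proof.
move=> mX on mA AX; have [[mP _] [mN _] _ _] := hahn_posnegP nu.
have z (P : set MR) : measurable P -> nu (A `&` P) = 0%E.
  move=> mP'; rewrite (charge_meas_on mX (measurableI _ _ mA mP') on).
  by rewrite setIAC AX set0I charge0.
rewrite /jpos /jneg jordan_posE charge.cjordan_posE jordan_negE charge.cjordan_negE /crestr0 /crestr mem_set//.
by rewrite !z// oppe0.
Qed.

Lemma meas_integral_on nu (X E : set MR) (f : R -> R) (M : R) : measurable X -> measurable E -> X `<=` E ->
  meas_on X nu -> measurable_fun E f -> (forall x, E x -> `|f x| <= M) ->
  meas_integral nu E f = meas_integral nu X f.
Proof.
move=> mX mE XE on mf fM; have mEX : measurable (E `\` X) by exact: measurableD.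
have [p0 n0] : jpos nu (E `\` X) = 0%E /\ jneg nu (E `\` X) = 0%E.
  by apply: (jordan_out mX on mEX); rewrite setDE -setIA setICl setI0.
have key (m : {measure set MR -> \bar R}) : m (E `\` X) = 0%E ->
    \int[m]_(x in E) f x = \int[m]_(x in X) f x.
  move=> mEX0; rewrite -[in RHS](setIidr XE) Rint_setI; apply: ae_eq_Rint => //.
    by apply: measurable_funM => //; exact: measurable_indic.
  exists (E `\` X); split => // x /= h; apply: contrapT => nx; apply: h => Ex.
  by rewrite indicE mem_set ?mulr1//; apply: contrapT => nX; apply: nx.
by rewrite /meas_integral !key.
Qed.

(** Test functions of ]0, L[ do not see atoms at 0 and L, so the measures are compared on the larger
    interval ]-1, L + 1[. *)
Lemma wstar_unique (L : R) nu1 nu2 : 0 < L -> meas_on `[0, L] nu1 -> meas_on `[0, L] nu2 ->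
  (forall phi, {within `[0, L], continuous phi} -> meas_integral nu1 `[0, L] phi = meas_integral nu2 `[0, L] phi) ->
  forall A : set MR, measurable A -> nu1 A = nu2 A.
Proof.
move=> L0 on1 on2 e.
have mX : measurable (`[0, L]%classic : set MR) by exact: measurable_itv.
pose E : set MR := `](-1)%R, (L + 1)%R[%classic.
have mE : measurable E by exact: measurable_itv.
have XE : `[0, L]%classic `<=` E.
  move=> x /=; rewrite /E /= !in_itv/= => /andP[x0 xL].
  by rewrite (lt_le_trans (ltrN10 R) x0)/= (le_lt_trans xL)// ltrDl.
have onE (k : smeas R) : meas_on `[0, L] k -> meas_on E k.
  move=> on A mA; rewrite (charge_meas_on mX (measurableD mA mE) on).
  by rewrite (_ : _ `&` _ = set0) ?charge0// -subset0 => x [[_ nE] /XE].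
apply: (@charge_eq_tests _ (-1) (L + 1)); [exact: onE|exact: onE|].
move=> phi tphi; have [c1 _ [N [N0 [b1 _ _]]]] := test_fun_bounded tphi.
have red (k : smeas R) : meas_on `[0, L] k -> meas_integral k E phi = meas_integral k `[0, L] phi.
  by move=> on; apply: (@meas_integral_on _ _ _ _ N) => //; apply: measurable_funS (continuous_measurable_fun c1).
by rewrite !red//; apply: e; exact: continuous_subspaceT.
Qed.

End Weak_star_compactness.

(** * The scalar Griffith law *)

Section Scalar_Griffith.
Context {R : realType}.
Variables (T S c0 : R) (W V C : R -> R).
Hypothesis S_gt0 : 0 < S.
Hypothesis c0_gt0 : 0 < c0.
Hypothesis V_AC : abs_continuous Rdist T V.
Hypothesis WV : forall s t : R, 0 <= s -> s <= t -> t <= T -> `|W t - W s| <= V t - V s.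
Hypothesis C_ge : forall t : R, 0 <= t -> t <= T -> c0 <= C t.
Hypothesis C_mono : forall s t : R, 0 <= s -> s <= t -> t <= T -> C s <= C t.
Hypothesis W_le : forall t : R, 0 <= t -> t <= T -> `|W t| <= S * C t.

Let sg t := W t / C t.
(** The energy up to a constant, with the dissipated part expressed by the compliance; for fixed W
    it is minimal at C = |W| / S. *)
Let E t := W t ^+ 2 / (2 * C t) + S ^+ 2 / 2 * C t.

(** A derivative-free form of dE = sg dW: replacing the stress by its value at the initial time
    costs at most its oscillation [B] times the variation of W. *)
Hypothesis energy : forall s t B : R, 0 <= s -> s <= t -> t <= T ->
  (forall r, s <= r -> r <= t -> `|sg r - sg s| <= B) ->
  `|E t - E s - sg s * (W t - W s)| <= B * (V t - V s).

Let V_mono s t : 0 <= s -> s <= t -> t <= T -> V s <= V t.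
Proof. by move=> s0 st tT; rewrite -subr_ge0; apply: le_trans (WV s0 st tT). Qed.

Let C_gt0 t : 0 <= t -> t <= T -> 0 < C t.
Proof. by move=> t0 tT; apply: lt_le_trans (C_ge t0 tT). Qed.

Let sg_le t : 0 <= t -> t <= T -> `|sg t| <= S.
Proof.
move=> t0 tT; have c := C_gt0 t0 tT; rewrite /sg normrM normfV (gtr0_norm c) ler_pdivrMr//.
exact: W_le.
Qed.

(* The energy is strictly convex in [C] above its minimizer [|W| / S], so that a jump of [C]
   would cost energy. *)
Let C_holder s t : 0 <= s -> s <= t -> t <= T -> (C t - C s) ^+ 2 <= 8 * C t / S * (V t - V s).
Proof.
move=> s0 st tT; have t0 := le_trans s0 st; have sT := le_trans st tT.
have cs := C_gt0 s0 sT; have ct := C_gt0 t0 tT; have cst := C_mono s0 st tT.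
have /energy : forall r, s <= r -> r <= t -> `|sg r - sg s| <= 2 * S.
  move=> r sr rt; apply: (le_trans (ler_normB _ _)).
  by have := sg_le (le_trans s0 sr) (le_trans rt tT); have := sg_le s0 sT; lra.
move=> /(_ s0 st tT) hE.
have hW := WV s0 st tT; have ws := W_le s0 sT; have wt := W_le t0 tT.
have dV : 0 <= V t - V s by apply: le_trans hW.
have sgW : `|sg s * (W t - W s)| <= S * (V t - V s).
  by rewrite normrM; apply: ler_pM => //; exact: sg_le.
have dE : E t - E s <= 3 * S * (V t - V s).
  have := ler_norm (E t - E s - sg s * (W t - W s)); have := ler_norm (sg s * (W t - W s)); lra.
have e1 : 2 * C t * (E t - E s) = (W t ^+ 2 - W s ^+ 2) + (C t - C s) * (S ^+ 2 * C t - W s ^+ 2 / C s).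
  by rewrite /E; field; rewrite !gt_eqF.
have h1 : - (2 * S * C t * (V t - V s)) <= W t ^+ 2 - W s ^+ 2.
  have : `|W t ^+ 2 - W s ^+ 2| <= 2 * S * C t * (V t - V s).
    rewrite subr_sqr normrM mulrC; apply: ler_pM => //.
    apply: (le_trans (ler_normD _ _)); have : S * C s <= S * C t by rewrite ler_pM2l.
    lra.
  by rewrite ler_norml => /andP[].
have h2 : W s ^+ 2 / C s <= S ^+ 2 * C s.
  rewrite ler_pdivrMr// -mulrA -expr2 -exprMn -[W s ^+ 2]real_normK ?num_real//.
  by rewrite lerXn2r ?nnegrE// mulr_ge0// ltW.
have h3 : (C t - C s) * (S ^+ 2 * (C t - C s)) <= (C t - C s) * (S ^+ 2 * C t - W s ^+ 2 / C s).
  by apply: ler_wpM2l; [rewrite subr_ge0|lra].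
have h4 : 2 * C t * (E t - E s) <= 2 * C t * (3 * S * (V t - V s)).
  by apply: ler_wpM2l => //; rewrite mulr_ge0// ltW.
have h5 : S ^+ 2 * (C t - C s) ^+ 2 <= S * (8 * C t * (V t - V s)).
  have -> : S ^+ 2 * (C t - C s) ^+ 2 = (C t - C s) * (S ^+ 2 * (C t - C s)) by ring.
  have -> : S * (8 * C t * (V t - V s)) = 2 * C t * (3 * S * (V t - V s)) + 2 * S * C t * (V t - V s) by ring.
  lra.
have -> : 8 * C t / S * (V t - V s) = 8 * C t * (V t - V s) / S by ring.
rewrite ler_pdivlMr//; rewrite expr2 -mulrA ler_pM2l// in h5; lra.
Qed.

(** On a subdivision whose pieces have V-increments at most [eta], quadratic bounds add up to K eta
    (V(b) - V(a)), which tends to 0 with [eta]. *)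
Let square_increments (a b K d0 : R) : 0 <= a -> a <= b -> b <= T -> 0 <= K -> 0 < d0 ->
  (forall s t, a <= s -> s <= t -> t <= b -> V t - V s <= d0 -> C t - C s <= K * (V t - V s) ^+ 2) ->
  C b <= C a.
Proof.
move=> a_ge0 ab bT K0 d0_gt0 H; rewrite -subr_le0.
have Vab : 0 <= V b - V a by rewrite subr_ge0; exact: V_mono.
suff small eta : 0 < eta -> eta <= d0 -> C b - C a <= K * eta * (V b - V a).
  rewrite leNgt; apply/negP => p.
  have q0 : 0 < K * (V b - V a) + 1 by rewrite ltr_wpDl// mulr_ge0.
  (* This makes K eta (V(b) - V(a)) at most half of C(b) - C(a). *)
  pose eta := Num.min d0 ((C b - C a) / 2 / (K * (V b - V a) + 1)).
  have eta0 : 0 < eta by rewrite lt_min d0_gt0 !divr_gt0.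
  have etad : eta <= d0 by rewrite ge_min lexx.
  have := small eta eta0 etad.
  have : eta * (K * (V b - V a) + 1) <= (C b - C a) / 2.
    by rewrite -ler_pdivlMr// ge_min lexx orbT.
  by move=> h1; rewrite [K * eta]mulrC -mulrA => h2; move: h1; rewrite mulrDr mulr1; lra.
move=> eta0 etad; have [dl dl0 Hd] := abs_continuous_cont V_AC eta0.
have [N hN] : exists N : nat, (b - a) / N.+1%:R < dl.
  have q0 : 0 < dl / (b - a + 1) by rewrite divr_gt0// ltr_wpDl// subr_ge0.
  have := @cvg_harmonic R => /cvgrPdist_lt/(_ _ q0)[N _ /(_ N (leqnn N))].
  rewrite /= sub0r normrN ger0_norm ?invr_ge0// => h; exists N.
  move: h; rewrite ltr_pdivlMr ?ltr_wpDl ?subr_ge0// mulrDr mulr1 mulrC => h.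
  by apply: lt_trans h; rewrite ltrDl invr_gt0.
pose p i : R := a + (b - a) * i%:R / N.+1%:R.
have N0 : 0 < N.+1%:R :> R by rewrite ltr0n.
have pS i : p i.+1 = p i + (b - a) / N.+1%:R.
  by rewrite /p -natr1; field; rewrite gt_eqF.
have p_le i : p i <= p i.+1 by rewrite pS lerDl divr_ge0 ?subr_ge0// ltW.
have p_ge i : a <= p i by rewrite /p lerDl divr_ge0 ?mulr_ge0 ?subr_ge0// ltW.
have pb i : (i <= N.+1)%N -> p i <= b.
  move=> iN; rewrite /p -lerBrDl ler_pdivrMr// ler_wpM2l ?subr_ge0//.
  by rewrite ler_nat.
have ind i : (i <= N.+1)%N -> C (p i) - C a <= K * eta * (V (p i) - V a).
  elim: i => [_|i IH iN].
    have -> : p 0%N = a by rewrite /p mulr0 mul0r addr0.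
    by rewrite !subrr mulr0.
  have {}IH := IH (ltnW iN).
  have pi0 := le_trans a_ge0 (p_ge i); have piT := le_trans (pb _ iN) bT.
  have dV : V (p i.+1) - V (p i) <= eta.
    have : `|V (p i) - V (p i.+1)| < eta.
      by apply: Hd => //; rewrite pS addrC addKr.
    by rewrite distrC => /ltW; apply: le_trans; exact: ler_norm.
  have dV0 : 0 <= V (p i.+1) - V (p i) by rewrite subr_ge0; exact: V_mono.
  have := H _ _ (p_ge i) (p_le i) (pb _ iN) (le_trans dV etad).
  have : K * (V (p i.+1) - V (p i)) ^+ 2 <= K * (eta * (V (p i.+1) - V (p i))).
    by apply: ler_wpM2l => //; rewrite expr2; exact: ler_wpM2r.
  by lra.
have := ind N.+1 (leqnn _).
have -> // : p N.+1 = b.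
by rewrite /p; field; rewrite gt_eqF.
Qed.

(** Suppose C(t) > c and take c1 strictly between. After the last time [z] with C <= c1 the stress
    stays strictly below S, so increments of C are quadratic and C is constant; at [z] itself the
    bound of [C_holder] excludes a jump. So C could not have left c1. *)
Lemma Griffith_upper_bound (t c : R) : 0 <= t -> t <= T -> C 0 <= c ->
  (forall r, 0 <= r -> r <= t -> `|W r| <= S * c) -> C t <= c.
Proof.
move=> t0 tT C0c Wc; have T0 := le_trans t0 tT.
have c_gt0 : 0 < c by apply: lt_le_trans C0c; exact: C_gt0.
rewrite leNgt; apply/negP => cC.
have [c1 [cc1 c1C]] : exists c1, c < c1 /\ c1 < C t by exists ((c + C t) / 2); split; lra.
have c1_gt0 : 0 < c1 by lra.
have Ct := C_gt0 t0 tT.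
pose A := [set r | [/\ 0 <= r, r <= t & C r <= c1]].
have A0 : A 0 by split => //; lra.
have hsA : has_sup A by split; [exists 0|exists t => r []].
pose z := sup A.
have z0 : 0 <= z by apply: sup_upper_bound.
have zt : z <= t by apply: ge_sup; [exists 0|move=> r []].
(* Once C >= c1 the stress is at most S c / c1, and [g] bounds S^2 - sg^2 from below. *)
pose g := S ^+ 2 * (1 - (c / c1) ^+ 2).
have g0 : 0 < g.
  rewrite mulr_gt0 ?exprn_gt0// subr_gt0 expr_lt1 ?divr_ge0 ?ltW//.
  by rewrite ltr_pdivrMr// mul1r.
pose K := 4 / (g * c0).
have K0 : 0 < K by rewrite divr_gt0// mulr_gt0.
(* For V-increments up to [d0] the mixed term 2 S dC dV is at most half of g c0 dC; the other half
   is then bounded by 2 dV^2, which is the constant [K]. *)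
pose d0 := g * c0 / (4 * S).
have d00 : 0 < d0 by rewrite divr_gt0// mulr_gt0.
have quad b s r : 0 <= b -> b <= s -> s <= r -> r <= t -> c1 <= C b -> V r - V s <= d0 ->
    C r - C s <= K * (V r - V s) ^+ 2.
  move=> b0 bs sr rt hb hd; have s0 := le_trans b0 bs; have r0 := le_trans s0 sr.
  have rT := le_trans rt tT; have sT := le_trans sr rT.
  have cs := C_gt0 s0 sT; have cr := C_gt0 r0 rT; have csr := C_mono s0 sr rT.
  have c1s : c1 <= C s by apply: (le_trans hb); exact: C_mono.
  have dV0 : 0 <= V r - V s by rewrite subr_ge0; exact: V_mono.
  have hB y : s <= y -> y <= r -> `|sg y - sg s| <= (V r - V s + S * (C r - C s)) / c0.
    move=> sy yr; have y0 := le_trans s0 sy; have yT := le_trans yr rT.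
    have cy := C_gt0 y0 yT.
    have -> : sg y - sg s = ((W y - W s) - sg s * (C y - C s)) / C y.
      by rewrite /sg; field; rewrite !gt_eqF.
    rewrite normrM normfV (gtr0_norm cy).
    have hc := C_ge y0 yT.
    have num : `|W y - W s - sg s * (C y - C s)| <= V r - V s + S * (C r - C s).
      apply: (le_trans (ler_normB _ _)); apply: lerD.
        by apply: (le_trans (WV s0 sy yT)); rewrite lerD2r; exact: V_mono.
      rewrite normrM; apply: ler_pM => //; first exact: sg_le.
      have := C_mono s0 sy yT; have := C_mono y0 yr rT => *; rewrite ger0_norm; lra.
    apply: (@le_trans _ _ (`|W y - W s - sg s * (C y - C s)| / c0)).
      by apply: ler_wpM2l => //; rewrite lef_pV2.
    by apply: ler_wpM2r => //; rewrite invr_ge0 ltW.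
  have := energy s0 sr rT hB.
  (* Exact second-order expansion of the energy. The square is discarded; the second term measures
     the cost of growth of C below the critical stress. *)
  have -> : E r - E s - sg s * (W r - W s) = C r / 2 * (sg r - sg s) ^+ 2 + (S ^+ 2 - sg s ^+ 2) * (C r - C s) / 2.
    by rewrite /E /sg; field; rewrite !gt_eqF.
  move=> /(le_trans (ler_norm _)) hE.
  have sq : 0 <= C r / 2 * (sg r - sg s) ^+ 2 by rewrite mulr_ge0 ?sqr_ge0// divr_ge0// ltW.
  have hg : g <= S ^+ 2 - sg s ^+ 2.
    rewrite /g mulrBr mulr1 lerD2l lerN2 -exprMn -[sg s ^+ 2]real_normK ?num_real//.
    have SC0 : 0 <= S * (c / c1) by rewrite mulr_ge0 ?divr_ge0// ltW.
    rewrite lerXn2r ?nnegrE//.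
    rewrite /sg normrM normfV (gtr0_norm cs) ler_pdivrMr//.
    apply: (le_trans (Wc s s0 (le_trans sr rt))); rewrite -mulrA ler_pM2l// mulrAC ler_pdivlMr//.
    by rewrite ler_pM2l.
  have dC0 : 0 <= C r - C s by rewrite subr_ge0.
  have h1 : g * (C r - C s) <= (S ^+ 2 - sg s ^+ 2) * (C r - C s) by exact: ler_wpM2r.
  have h2 : g * (C r - C s) <= 2 * ((V r - V s + S * (C r - C s)) / c0 * (V r - V s)) by lra.
  have h3 : g * c0 * (C r - C s) <= 2 * (V r - V s) ^+ 2 + 2 * S * (C r - C s) * (V r - V s).
    have := ler_wpM2r (ltW c0_gt0) h2.
    have -> : 2 * ((V r - V s + S * (C r - C s)) / c0 * (V r - V s)) * c0 =
      2 * (V r - V s) ^+ 2 + 2 * S * (C r - C s) * (V r - V s) by field; rewrite gt_eqF.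
    lra.
  have h4 : 2 * S * (C r - C s) * (V r - V s) <= g * c0 / 2 * (C r - C s).
    have -> : g * c0 / 2 * (C r - C s) = 2 * S * (C r - C s) * d0.
      by rewrite /d0; field; rewrite gt_eqF.
    by apply: ler_wpM2l => //; rewrite mulr_ge0// mulr_ge0// ltW.
  have -> : K * (V r - V s) ^+ 2 = 4 * (V r - V s) ^+ 2 / (g * c0) by rewrite /K; ring.
  have gc0 : 0 < g * c0 by rewrite mulr_gt0.
  rewrite ler_pdivlMr//; move: h3 h4; rewrite [_ * (g * c0)]mulrC.
  by move: (g * c0) (V r - V s) (C r - C s) => p q d; lra.
(* Points on both sides of [z] with V-increment below [e]: C is at most c1 at the left one and has
   already reached C(t) at the right one. *)
have key e : 0 < e -> exists a b, [/\ A a, 0 <= a, a <= b, b <= t & V b - V a < e] /\ C t <= C b.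
  move=> e0; have [dl dl0 Hd] := abs_continuous_cont V_AC e0.
  have dl2 : 0 < dl / 2 by rewrite divr_gt0.
  have [a Aa za] := sup_adherent dl2 hsA; rewrite -/z in za.
  have az : a <= z by apply: sup_upper_bound.
  have [a0 at_ _] := Aa.
  pose b := Num.min t (z + dl / 3).
  have ab : a <= b by rewrite le_min at_/=; lra.
  have bt : b <= t by rewrite ge_min lexx.
  exists a, b; split; first split => //.
    have bz : b <= z + dl / 3 by rewrite ge_min lexx orbT.
    have : `|V a - V b| < e by apply: Hd => //; [exact: le_trans tT|lra].
    by rewrite distrC; apply: le_lt_trans; exact: ler_norm.
  have b0 := le_trans a0 ab.
  have [tz|zt'] := leP t (z + dl / 3).
    by rewrite (_ : b = t)//; apply/min_idPl.
  have bE : b = z + dl / 3 by apply/min_idPr; exact: ltW.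
  have c1b : c1 <= C b.
    rewrite leNgt; apply/negP => h; have : b <= z by apply: sup_upper_bound => //; split => //; exact: ltW.
    by rewrite bE; lra.
  apply: (@square_increments b t K d0) => //; first exact: ltW.
  by move=> s r bs sr rt hd; exact: (quad b).
have hq : 0 < (C t - c1) ^+ 2 by rewrite exprn_gt0// subr_gt0.
(* Chosen so that the bound of [C_holder] on (C(b) - C(a))^2 falls below (C(t) - c1)^2. *)
have e0 : 0 < (C t - c1) ^+ 2 / (8 * C t / S) by rewrite !divr_gt0// mulr_gt0.
have [a [b [[[a0 at_ Ca] _ ab bt Vab] Cb]]] := key _ e0.
have := C_holder a0 ab (le_trans bt tT).
have Cb' : C b = C t by apply/eqP; rewrite eq_le Cb andbT; apply: C_mono => //; exact: le_trans ab.
rewrite Cb' => h; move: Vab; rewrite ltr_pdivlMr; last by rewrite divr_gt0// mulr_gt0.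
rewrite mulrC => h2; have : (C t - c1) ^+ 2 <= (C t - C a) ^+ 2.
  by rewrite lerXn2r ?nnegrE ?subr_ge0//; lra.
by rewrite leNgt (le_lt_trans h h2).
Qed.

End Scalar_Griffith.

(** * The homogenized evolution at fixed eps *)

Section Work_of_the_boundary_datum.
Context {R : realType}.
Local Notation leb := (@lebesgue_measure R).
Local Notation MR := (measurableTypeR R).

Section ae_eq.
Import HBNNSimple.
Local Open Scope ereal_scope.

(** The integral of a nonnegative function is a supremum over simple functions below it, whether or
    not it is measurable. This matters for the integrand of the energy balance, whose measurability
    in time is not known beforehand. *)
Lemma ae_eq_integral_nomeas (f g : R -> \bar R) (D : set R) :
  {ae leb, forall x, D x -> f x = g x} -> \int[leb]_(x in D) f x = \int[leb]_(x in D) g x.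
Proof.
move=> [N [mN N0 subN]].
have fgN x : ~ N x -> (f \_ D) x = (g \_ D) x.
  move=> nN; rewrite !patchE; case: ifPn => // /set_mem Dx; apply: contrapT => ne.
  by apply: nN; apply: subN => /= h; apply: ne; exact: h.
pose nn (h : MR -> \bar R) := ereal_sup [set sintegral leb k | k in [set k : {nnsfun MR >-> R} | forall x, (k x)%:E <= h x]].
have le_nn (h1 h2 : MR -> \bar R) : (forall x, 0 <= h2 x) -> (forall x, ~ N x -> h1 x = h2 x) -> nn h1 <= nn h2.
  move=> h20 h12; apply: ge_ereal_sup => _ [k /= kh <-].
  (* Setting the simple function to 0 on the null set leaves its integral unchanged and brings it
     below the other function. *)
  pose k' : {nnsfun MR >-> R} := proj_nnsfun k (measurableC mN).
  have k'E x : k' x = (k x * \1_(~` N) x)%R by [].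
  have -> : sintegral leb k = sintegral leb k'.
    rewrite -!integralT_nnsfun; apply: ge0_ae_eq_integral => //.
    - by apply/measurable_EFinP; exact: (@measurable_funPT _ _ MR R k).
    - by apply/measurable_EFinP; exact: (@measurable_funPT _ _ MR R k').
    - by move=> x _; rewrite lee_fin; exact: fun_ge0.
    - by move=> x _; rewrite lee_fin; exact: fun_ge0.
    - exists N; split => // x ne; apply: contrapT => nN; apply: ne => _; congr EFin.
      by rewrite k'E indicE mem_set ?mulr1.
  apply: ereal_sup_ubound; exists k' => // x; rewrite k'E.
  have [Nx|nN] := pselect (N x); last by rewrite indicE mem_set ?mulr1// -h12.
  by rewrite indicE memNset ?mulr0//= => nNx; apply: nNx.
have eq_nn (h1 h2 : MR -> \bar R) : (forall x, 0 <= h1 x) -> (forall x, 0 <= h2 x) ->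
    (forall x, ~ N x -> h1 x = h2 x) -> nn h1 = nn h2.
  by move=> h10 h20 h; apply/eqP; rewrite eq_le !le_nn// => x nN; rewrite h.
rewrite /integral; congr (_ - _); apply: eq_nn => x; rewrite ?funepos_ge0 ?funeneg_ge0// => nN;
  by rewrite ?funepos.unlock ?funeneg.unlock fgN.
Qed.

End ae_eq.

Lemma ae_eq_Rint_nomeas (f g : R -> R) (D : set R) :
  {ae leb, forall x, D x -> f x = g x} -> \int[leb]_(x in D) f x = \int[leb]_(x in D) g x.
Proof.
move=> fg; rewrite /Rintegral; congr fine; apply: ae_eq_integral_nomeas.
by apply: (lebS fg) => x e Dx; rewrite e.
Qed.

(** Collects all that later arguments use of the path [w]: one function [V] that dominates its
    boundary values, densities of V and W, and the identification of the power of the boundary datum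
    with W'. *)
Lemma work_density (L T : R) (w : R -> R -> R) : 0 < L -> 0 < T ->
  (forall t : R, 0 <= t <= T -> H1 setT (w t)) ->
  (forall t : R, 0 <= t <= T -> continuous (w t)) ->
  abs_continuous (H1dist setT) T w ->
  exists (V gV gW : R -> R),
   [/\ abs_continuous Rdist T V,
       forall s t : R, 0 <= s -> s <= t -> t <= T -> `|w t 0 - w s 0| <= V t - V s,
       forall s t : R, 0 <= s -> s <= t -> t <= T ->
         `|(w t L - w t 0) - (w s L - w s 0)| <= V t - V s,
       [/\ L1 setT gV, L1 setT gW,
          forall s t : R, 0 <= s -> s <= t -> t <= T -> V t - V s = \int[leb]_(x in `]s, t]) gV x &
          forall s t : R, 0 <= s -> s <= t -> t <= T ->
            (w t L - w t 0) - (w s L - w s 0) = \int[leb]_(x in `]s, t]) gW x] &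
       {ae leb, forall t : R, 0 < t < T -> [/\ `|gW t| <= gV t,
         L1 `]0, L[ (wderiv setT (H1_dot T w t)) &
         \int[leb]_(x in `]0, L[) wderiv setT (H1_dot T w t) x = gW t]}].
Proof.
move=> L0 T0 wH wc wAC; have [V0 [V0ac wV0]] := H1_variation wH wAC.
(* The constant of the pointwise bound at 0; it is larger than the constant sqrt(L) of the bound on
   increments, so one multiple of [V0] serves both. *)
pose k := ((Num.sqrt L)^-1 + Num.sqrt L); pose V t := k * V0 t.
have S0 : 0 < Num.sqrt L by rewrite sqrtr_gt0.
have Si0 : 0 < (Num.sqrt L)^-1 by rewrite invr_gt0.
have k0 : 0 < k by rewrite addr_gt0.
have V0m s t : 0 <= s -> s <= t -> t <= T -> 0 <= V0 t - V0 s.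
  move=> s0 st tT; apply: le_trans (wV0 s t s0 st tT); exact: H1dist_ge0.
have Vac : abs_continuous Rdist T V.
  apply: (abs_continuous_dominated V0ac (ltW k0)) => s t s0 st tT.
  by rewrite /Rdist /V -mulrBr normrM (gtr0_norm k0) distrC.
have hw0 s t : 0 <= s -> s <= t -> t <= T -> `|w t 0 - w s 0| <= V t - V s.
  by move=> s0 st tT; rewrite /V -mulrBr; exact: (path_point_le wH wV0 wc).
have hW s t : 0 <= s -> s <= t -> t <= T -> `|(w t L - w t 0) - (w s L - w s 0)| <= V t - V s.
  move=> s0 st tT; apply: (le_trans (path_increment_le wH wV0 wc L0 s0 st tT)).
  by rewrite /V -mulrBr; apply: ler_wpM2r; [exact: V0m|rewrite lerDr ltW].
have hV s t : 0 <= s -> s <= t -> t <= T -> `|V t - V s| <= V t - V s.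
  by move=> s0 st tT; rewrite ger0_norm// /V -mulrBr mulr_ge0 ?V0m// ltW.
have [gV iV eV] := ac_density T0 Vac hV.
have [gW iW eW] := ac_density (f := fun t => w t L - w t 0) T0 Vac hW.
exists V, gV, gW; split => //.
have aV := density_derivable iV eV; have aW := density_derivable iW eW.
apply: (lebS (lebI aV (lebI aW (H1_dot_ae T0 wH V0ac wV0 wc L0)))) => t [cV [cW cd]] tT.
have [id cd'] := cd tT; split => //.
- have tT' : 0 <= t <= T by move: tT => /andP[/ltW -> /ltW ->].
  have c : (`|(w s L - w s 0 - (w t L - w t 0)) / (s - t)| - (V s - V t) / (s - t)) @[s --> t^']
      --> `|gW t| - gV t by apply: cvgB; [exact: cvg_norm (cW tT)|exact: cV].
  rewrite -subr_le0; apply: (cvg_le_near c).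
  near=> s; have [/andP[s0 sT] st] : 0 <= s <= T /\ s != t by near: s; exact: near_dnbhs_itv.
  have /andP[t0 t1] := tT'.
  rewrite subr_le0 normrM normfV; have [lst|lts|] := ltgtP s t; last by move/eqP; rewrite (negbTE st).
  + rewrite [in leRHS](_ : (V s - V t) / (s - t) = (V t - V s) / `|s - t|); last first.
      by rewrite ltr0_norm ?subr_lt0//; field; lra.
    rewrite ler_pM2r; first by rewrite distrC; apply: hW => //; exact: ltW.
    by rewrite invr_gt0 normr_gt0 subr_eq0.
  + rewrite [in leRHS](_ : (V s - V t) / (s - t) = (V s - V t) / `|s - t|); last first.
      by rewrite gtr0_norm ?subr_gt0.
    rewrite ler_pM2r; first by apply: hW => //; exact: ltW.
    by rewrite invr_gt0 normr_gt0 subr_eq0.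
- exact: (cvg_unique _ cd' (cW tT)).
Unshelve. all: by end_near. Qed.

End Work_of_the_boundary_datum.

(** * Admissible displacements *)

Section Boundary_datum.
Context {R : realType}.
Local Notation leb := (@lebesgue_measure R).
Local Notation MR := (measurableTypeR R).
Variable L : R.
Hypothesis L_gt0 : 0 < L.
Local Notation D := (`]0, L[%classic : set MR).
Variable w : R -> R.
Hypothesis w_H1 : H1 setT w.
Hypothesis w_cont : continuous w.

Let mD : measurable D. Proof. exact: measurable_itv. Qed.
Let uD : @wd_unique R D := wd_unique_itv 0 L.
Let wD_H1 : H1 D w. Proof. exact: H1_restrict w_H1. Qed.

Let wderiv_restr : {ae leb, forall x, D x -> wderiv D w x = wderiv setT w x}.
Proof.
have [Lw ww] := wderivP w_H1; apply: wderiv_ae => //.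
- by apply: H1_L2.
- exact: (L2S measurableT mD (@subsetT _ _) Lw).
- exact: weak_derivS ww.
Qed.

Let Rint_wderiv (x : R) : 0 < x <= L -> \int[leb]_(y in `]0, x[) wderiv D w y = w x - w 0.
Proof.
move=> /andP[x0 xL]; have [Lw _] := wderivP w_H1; have [[md _] _] := wderivP wD_H1.
have sub : `]0, x[%classic `<=` D by apply: subset_itvl; rewrite bnd_simp.
have mx : measurable (`]0, x[%classic : set MR) by exact: measurable_itv.
rewrite (H1_FTC w_H1 w_cont x0); apply: ae_eq_Rint_nomeas.
by apply: (lebS wderiv_restr) => y e /sub; exact: e.
Qed.

Lemma boundary_increment (u : R -> R) : H1 D u -> H10 D (fun x => u x - w x) ->
  \int[leb]_(x in D) wderiv D u x = w L - w 0 /\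
  {ae leb, forall x, D x -> u x = w 0 + \int[leb]_(y in `]0, x[) wderiv D u y}.
Proof.
move=> hu h0; have [i0 ae0] := H10_FTC L_gt0 h0.
have [Lu _] := wderivP hu; have [Lw _] := wderivP wD_H1.
have aeB := wderivB uD hu wD_H1.
have LL (x : R) (f : R -> R) : x <= L -> L2 D f -> L1 `]0, x[ f.
  move=> xL Lf; have sub : `]0, x[%classic `<=` D by apply: subset_itvl; rewrite bnd_simp.
  have mx : measurable (`]0, x[%classic : set MR) by exact: measurable_itv.
  by apply: (L2_L1 mx (itv_lty _ _ _ _)); exact: (L2S mD mx sub Lf).
have key (x : R) : 0 < x <= L -> \int[leb]_(y in `]0, x[) wderiv D (fun x => u x - w x) y =
    \int[leb]_(y in `]0, x[) wderiv D u y - (w x - w 0).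
  move=> xL; have /andP[x0 xL'] := xL; have sub : `]0, x[%classic `<=` D by apply: subset_itvl; rewrite bnd_simp.
  have mx : measurable (`]0, x[%classic : set MR) by exact: measurable_itv.
  rewrite -Rint_wderiv// -RintegralB//; try exact: LL.
  by apply: ae_eq_Rint_nomeas; apply: (lebS aeB) => y e /sub; exact: e.
split.
  have LLL : 0 < L <= L by rewrite L_gt0 lexx.
  by have := key L LLL; rewrite i0 => /eqP; rewrite eq_sym subr_eq0 => /eqP.
apply: (lebS ae0) => x e; rewrite /= in_itv/= => /andP[x0 xL].
have := e (_ : D x); rewrite /= in_itv/= x0 xL => /(_ isT); rewrite key ?x0 ?(ltW xL)//.
by move=> h; apply: (addIr (- w x)); rewrite h; ring.
Qed.

(** Every square-integrable strain with the right mean is admissible: its difference with w' has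
    zero mean and is the derivative of an H^1_0 function. *)
Lemma competitor (h : R -> R) : L2 D h -> \int[leb]_(x in D) h x = w L - w 0 ->
  exists v, [/\ H1 D v, H10 D (fun x => v x - w x) & {ae leb, forall x, D x -> wderiv D v x = h x}].
Proof.
move=> Lh hI; have [Lw _] := wderivP wD_H1; have LLL : 0 < L <= L by rewrite L_gt0 lexx.
have LB := L2B mD Lh Lw.
have LL1 (f : R -> R) : L2 D f -> L1 D f by move=> Lf; exact: (L2_L1 mD (itv_lty _ _ _ _) Lf).
have [|HF aeF] := H10_primitive L_gt0 LB.
  by rewrite RintegralB//; [rewrite hI (Rint_wderiv LLL) subrr|exact: LL1..].
pose F (x : R) := \int[leb]_(y in `]0, x[) (h y - wderiv D w y).
have {}HF : H10 D F := HF.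
have {}aeF : {ae leb, forall x, D x -> wderiv D F x = h x - wderiv D w x} := aeF.
have hF : H1 D F := HF.1.
have hF1 := H1Z uD (- 1) hF.
exists (fun x => w x - (- 1) * F x); split; first exact: H1B.
- by rewrite (_ : (fun x => _) = F)//; apply/funext => x; ring.
- apply: (lebS (lebI (wderivB uD wD_H1 hF1) (lebI (wderivZ uD (- 1) hF) aeF))).
  by move=> x [e1 [e2 e3]] Dx; rewrite e1// e2// e3//; ring.
Qed.

End Boundary_datum.

(** * Stress, energy and compliance of an evolution *)

Section Homogenized_evolution.
Context {R : realType}.
Local Notation leb := (@lebesgue_measure R).
Local Notation MR := (measurableTypeR R).
Variables (L T kappa a0 a1 eps : R) (w u Theta a : R -> R -> R).
Hypothesis L_gt0 : 0 < L.
Hypothesis T_gt0 : 0 < T.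
Hypothesis kappa_gt0 : 0 < kappa.
Hypothesis a0_gt0 : 0 < a0.
Hypothesis a1_gt0 : 0 < a1.
Hypothesis eps_gt0 : 0 < eps.
Hypothesis eps_a : eps * a0 < a1.
Hypothesis w_H1 : forall t : R, 0 <= t <= T -> H1 setT (w t).
Hypothesis w_cont : forall t : R, 0 <= t <= T -> continuous (w t).
Hypothesis be : brittle_evolution L T kappa a0 a1 w eps u Theta a.
Local Notation D := (`]0, L[%classic : set MR).
Let mD : measurable D. Proof. exact: measurable_itv. Qed.
Let Doo : (leb D < +oo)%E. Proof. exact: itv_lty. Qed.
Let uD : @wd_unique R D := wd_unique_itv 0 L.

Let al := eps * a0.
Let al_gt0 : 0 < al. Proof. exact: mulr_gt0. Qed.
(** The rate at which the compliance grows with the damage density: 1 / a = 1 / a1 + bt rho with rho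
    = (1 - Theta) / eps. It tends to 1 / a0 as eps goes to 0. *)
Definition damage_slope : R := a0^-1 - eps / a1.
Local Notation bt := damage_slope.
Lemma damage_slope_gt0 : 0 < bt.
Proof. by rewrite subr_gt0 ltr_pdivrMr// ltr_pdivlMl// mulrC. Qed.
Let bt_gt0 := damage_slope_gt0.
Let alE : al^-1 = a1^-1 + bt / eps.
Proof. by rewrite /bt /al; field; rewrite !gt_eqF. Qed.

Let W t := w t L - w t 0.
Let A t x := (1 - Theta t x) / al + Theta t x / a1.
Let rho t x := (1 - Theta t x) / eps.
Let AE t x : A t x = a1^-1 + bt * rho t x.
Proof. by rewrite /A /rho /bt /al; field; rewrite !gt_eqF. Qed.

Definition total_compliance t : R := L / a1 + bt * \int[leb]_(x in D) rho t x.
Local Notation C := total_compliance.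

Section time.
Variable t : R.
Hypothesis tT : 0 <= t <= T.

Let Th : measurable_fun D (Theta t) /\ {ae leb, forall x, D x -> 0 <= Theta t x <= 1}.
Proof. by have [m b] := be_Theta_Linf be tT; split; [exact: m|exact: b]. Qed.

Let L2_ae_bounded (f : R -> R) (M : R) : measurable_fun D f -> {ae leb, forall x, D x -> `|f x| <= M} -> L2 D f.
Proof.
move=> mf fM; have LM : L2 D (fun=> M).
  by apply: (bounded_L2 mD Doo (M := `|M|)) => //; exact: measurable_cst.
apply: (L2_le mD mf LM); apply: (lebS fM) => x h Dx; apply: (le_trans (h Dx)); exact: ler_norm.
Qed.

Let mrho : measurable_fun D (rho t).
Proof.
apply: measurable_funM => //; apply: measurable_funB => //; exact: Th.1.
Qed.

Let rho_itv : {ae leb, forall x, D x -> 0 <= rho t x <= eps^-1}.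
Proof.
apply: (lebS Th.2) => x h Dx; have /andP[h0 h1] := h Dx; rewrite /rho.
rewrite divr_ge0 ?subr_ge0 ?(ltW eps_gt0)//= ler_piMl ?invr_ge0 ?(ltW eps_gt0)//.
by rewrite gerBl.
Qed.

Let L2rho : L2 D (rho t).
Proof.
apply: (L2_ae_bounded (M := eps^-1) mrho); apply: (lebS rho_itv) => x h Dx.
by have /andP[h0 h1] := h Dx; rewrite ger0_norm.
Qed.

Let LL1 (f : R -> R) : L2 D f -> L1 D f. Proof. by move=> Lf; exact: (L2_L1 mD Doo Lf). Qed.

Lemma damage_density_L1 : L1 D (rho t). Proof. exact: LL1 L2rho. Qed.

Lemma damage_density_ge0 : {ae leb, forall x, D x -> 0 <= rho t x}.
Proof. by apply: (lebS rho_itv) => x h Dx; have /andP[] := h Dx. Qed.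

Let A_itv : {ae leb, forall x, D x -> a1^-1 <= A t x <= al^-1}.
Proof.
apply: (lebS rho_itv) => x h Dx; have /andP[h0 h1] := h Dx.
by rewrite AE alE lerDl mulr_ge0 ?(ltW bt_gt0)//= lerD2l ler_wpM2l ?(ltW bt_gt0).
Qed.

Let L2A : L2 D (A t).
Proof.
rewrite (_ : A t = fun x => a1^-1 + bt * rho t x); last by apply/funext => x; exact: AE.
apply: L2D => //; last exact: L2Z.
by apply: (bounded_L2 mD Doo (M := `|a1^-1|)) => //; exact: measurable_cst.
Qed.

Let cst_L1 (k : R) : L1 D (fun=> k).
Proof. by apply: (bounded_L1 mD Doo (M := `|k|)) => //; exact: measurable_cst. Qed.

Let Rint_cst (k : R) : \int[leb]_(x in D) k = k * L.
Proof. by rewrite Rintegral_cst// fine_itvoo ?subr0// ltW. Qed.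

Let CE : \int[leb]_(x in D) A t x = C t.
Proof.
under eq_Rintegral do rewrite AE.
rewrite RintegralD//; [|exact: cst_L1|by apply: LL1; exact: L2Z].
rewrite RintegralZl//; last exact: LL1.
by rewrite Rint_cst mulrC.
Qed.

Lemma total_compliance_ge : L / a1 <= C t.
Proof.
rewrite lerDl mulr_ge0 ?(ltW bt_gt0)//; apply: ae_Rint_ge0 => //.
exact: damage_density_ge0.
Qed.

Lemma total_compliance_gt0 : 0 < C t.
Proof. by apply: lt_le_trans total_compliance_ge; rewrite divr_gt0. Qed.
Let Cgt0 := total_compliance_gt0.

Let aA : {ae leb, forall x, D x -> [/\ a t x = (A t x)^-1, 0 < A t x & 0 < a t x]}.
Proof.
apply: (lebS (lebI (be_a_def be tT) A_itv)) => x [h1 h2] Dx.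
have /andP[h3 _] := h2 Dx; have A0 : 0 < A t x by apply: lt_le_trans h3; rewrite invr_gt0.
have e : a t x = (A t x)^-1 by apply: h1; move: Dx; rewrite /= in_itv.
by split => //; rewrite e invr_gt0.
Qed.

Let us := wderiv D (u t).
Let Lus : L2 D us. Proof. by have [] := wderivP (be_u_H1 be tT). Qed.
Let hw := w_H1 tT.
Let cw := w_cont tT.

Let us_int : \int[leb]_(x in D) us x = W t.
Proof. exact: (boundary_increment L_gt0 hw cw (be_u_H1 be tT) (be_dirichlet be tT)).1. Qed.

(** The competitor damages a constant fraction [tau] everywhere. The new compliance density is [q],
    and a strain proportional to it has constant stress, hence energy W^2 / (2 Q) with Q the
    integral of [q]. *)
Let one_sided (tau : R) : 0 <= tau <= 1 ->
  2^-1 * \int[leb]_(x in D) (a t x * us x ^+ 2) <=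
  2^-1 * (W t ^+ 2 / (tau / al * L + (1 - tau) * C t)) + kappa / eps * (tau * \int[leb]_(x in D) Theta t x).
Proof.
move=> /andP[tau0 tau1].
pose q x := tau / al + (1 - tau) * A t x; set Q := tau / al * L + (1 - tau) * C t.
have Q0 : 0 < Q.
  have q1 : 0 <= tau / al * L by rewrite mulr_ge0 ?divr_ge0// ltW.
  have q2 : 0 <= (1 - tau) * C t by rewrite mulr_ge0 ?subr_ge0// ltW.
  have [t0|t0] := eqVneq tau 0; first by rewrite /Q t0 subr0 mul1r mul0r mul0r add0r.
  by rewrite ltr_pwDl// mulr_gt0// divr_gt0// lt_neqAle eq_sym t0.
have Lc : L2 D (fun=> tau / al).
  by apply: (bounded_L2 mD Doo (M := `|tau / al|)) => //; exact: measurable_cst.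
have Lq : L2 D q := L2D mD Lc (L2Z (1 - tau) mD L2A).
have qI : \int[leb]_(x in D) q x = Q.
  rewrite RintegralD//; [|exact: cst_L1|by apply: LL1; exact: L2Z].
  rewrite Rint_cst RintegralZl; [|exact: mD|exact: LL1].
  by rewrite CE.
have [|v [hv h0v wv]] := competitor L_gt0 hw cw (L2Z (W t / Q) mD Lq).
  by rewrite RintegralZl//; [rewrite qI divfK// gt_eqF|exact: LL1].
have th : Linf01 D (fun=> tau).
  by split; [exact: measurable_cst|apply: aeW => x _; rewrite tau0 tau1].
have := be_one_sided_minimality be tT hv h0v th; rewrite -/us => h; apply: (le_trans h).
apply: lerD; last by rewrite RintegralZl//; apply: LL1; apply: (L2_ae_bounded (M := 1) Th.1);
   apply: (lebS Th.2) => x {}h Dx; have /andP[p1 p2] := h Dx; rewrite ger0_norm.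
apply: ler_wpM2l; first by rewrite invr_ge0.
rewrite le_eqVlt; apply/orP; left; apply/eqP.
have -> : W t ^+ 2 / Q = \int[leb]_(x in D) ((W t / Q) ^+ 2 * q x).
  by rewrite RintegralZl//; [rewrite qI; field; rewrite gt_eqF|exact: LL1].
apply: ae_eq_Rint_nomeas; apply: (lebS (lebI aA wv)) => x [h1 h2] Dx.
have [e1 A0 ax0] := h1 Dx; rewrite h2// e1.
have q0 : 0 < q x.
  have [t0|t0] := eqVneq tau 0; first by rewrite /q t0 subr0 mul1r mul0r add0r.
  rewrite /q ltr_pwDl//; first by rewrite divr_gt0// lt_neqAle eq_sym t0.
  by rewrite mulr_ge0 ?subr_ge0// ltW.
have -> : eps * a0 * (A t x)^-1 / (tau * (A t x)^-1 + (1 - tau) * (eps * a0)) = (q x)^-1.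
  rewrite -/al; have d : tau * (A t x)^-1 + (1 - tau) * al = q x * al * (A t x)^-1.
    by rewrite /q; field; rewrite !gt_eqF.
  by rewrite d; field; rewrite !gt_eqF.
by field; rewrite !gt_eqF.
Qed.

Let us2_L1 : L1 D (fun x => a t x * us x ^+ 2).
Proof.
have [mus ius] := Lus.
apply: (l_intg_ae_le mD _ (l_intgZ a1 mD ius)).
  apply: measurable_funM; last exact: measurable_funX.
  by have m := be_a_measurable be tT; exact: m.
apply: (lebS (lebI aA A_itv)) => x [h1 h2] Dx; have [e1 A0 ax0] := h1 Dx; have /andP[h3 _] := h2 Dx.
rewrite normrM (gtr0_norm ax0) ger0_norm ?sqr_ge0//; apply: ler_wpM2r; first exact: sqr_ge0.
by rewrite e1 -[leRHS]invrK lef_pV2 ?posrE ?invr_gt0.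
Qed.

(** With tau = 0 the elastic energy is at most W^2 / (2 C), which is the reverse of the
    Cauchy-Schwarz bound. The integral of a (u' - k / a)^2, with k = W / C, is therefore 0. *)
Lemma strain_flux : {ae leb, forall x, D x -> wderiv D (u t) x = W t / C t * (a1^-1 + bt * rho t x)}.
Proof.
have := @one_sided 0; rewrite lexx ler01 => /(_ isT); rewrite !mul0r mulr0 addr0 add0r subr0 mul1r => h.
have {}h : \int[leb]_(x in D) (a t x * us x ^+ 2) <= W t ^+ 2 / C t.
  by rewrite -(@ler_pM2l _ 2^-1)// invr_gt0.
set k := W t / C t.
have LkA := L2Z (k ^+ 2) mD L2A; have Lku := L2Z (2 * k) mD Lus.
have i2 : L1 D (fun x => a t x * us x ^+ 2 - 2 * k * us x + k ^+ 2 * A t x).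
  by apply: l_intgD => //; [apply: l_intgB => //; exact: LL1|exact: LL1].
have e : {ae leb, forall x, D x -> a t x * us x ^+ 2 - 2 * k * us x + k ^+ 2 * A t x = a t x * (us x - k * A t x) ^+ 2}.
  apply: (lebS aA) => x h1 Dx; have [e1 A0 _] := h1 Dx; rewrite e1; field; rewrite gt_eqF//.
have z : {ae leb, forall x, D x -> a t x * us x ^+ 2 - 2 * k * us x + k ^+ 2 * A t x = 0}.
  apply: ae_eq0_Rint => //.
    apply: (lebS (lebI aA e)) => x [h1 h2] Dx; rewrite h2//; have [_ _ ax] := h1 Dx.
    by rewrite mulr_ge0 ?sqr_ge0// ltW.
  rewrite RintegralD//; [|by apply: l_intgB => //; exact: LL1|exact: LL1].
  rewrite RintegralB//; last exact: LL1.
  rewrite !RintegralZl ?us_int ?CE//; [|exact: LL1..].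
  have e2 : W t ^+ 2 / C t = k ^+ 2 * C t by rewrite /k; field; rewrite gt_eqF.
  rewrite e2 in h.
  have -> : 2 * k * W t = 2 * k ^+ 2 * C t by rewrite /k; field; rewrite gt_eqF.
  lra.
apply: (lebS (lebI aA (lebI e z))) => x [h1 [h2 h3]] Dx; have [_ _ ax] := h1 Dx.
have := h3 Dx; rewrite h2// => /eqP; rewrite mulf_eq0 (gt_eqF ax)/= sqrf_eq0 subr_eq0 => /eqP.
by rewrite -/us AE.
Qed.

Lemma stress_flux : {ae leb, forall x, D x -> a t x * wderiv D (u t) x = W t / C t}.
Proof.
apply: (lebS (lebI aA strain_flux)) => x [h1 h2] Dx; have [e1 A0 _] := h1 Dx.
by rewrite h2// e1 -AE; field; rewrite !gt_eqF.
Qed.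

(** [stress] is a choice; two constants that agree a.e. on a bar of positive length are equal. *)
Lemma stressE : stress L (u t) (a t) = W t / C t.
Proof.
rewrite /stress; case: xgetP => [s _ hs|/(_ (W t / C t))]; last first.
  by case; apply: (lebS stress_flux) => x h xL; apply: h; rewrite /= in_itv.
apply: contrapT => ne.
have [N [mN N0 sub]] := lebI hs stress_flux.
have : (leb D <= leb N)%E.
  apply: le_measure; rewrite ?inE// => x Dx; apply: sub => -[h1 h2]; apply: ne.
  by rewrite -h2// h1//; move: Dx; rewrite /= in_itv.
by rewrite N0 lebesgue_measure_itv/= lte_fin L_gt0 sube0 lee_fin leNgt L_gt0.
Qed.

(** Adding compliance costs kappa / bt per unit and releases sigma^2 / 2 of elastic energy per unit;
    the two balance at this stress. *)
Definition crit_stress : R := Num.sqrt (2 * kappa / bt).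
Local Notation S := crit_stress.
Lemma crit_stress_gt0 : 0 < S.
Proof. by rewrite sqrtr_gt0 !divr_gt0// mulr_gt0. Qed.
Lemma crit_stress_sqr : S ^+ 2 = 2 * kappa / bt.
Proof. by rewrite sqr_sqrtr// divr_ge0 ?mulr_ge0// ltW. Qed.

Let elastic : \int[leb]_(x in D) (a t x * us x ^+ 2) = W t ^+ 2 / C t.
Proof.
have -> : W t ^+ 2 / C t = \int[leb]_(x in D) ((W t / C t) ^+ 2 * A t x).
  by rewrite RintegralZl ?CE//; [field; rewrite gt_eqF|exact: LL1].
apply: ae_eq_Rint_nomeas; apply: (lebS (lebI aA strain_flux)) => x [h1 h2] Dx.
by have [e1 A0 _] := h1 Dx; rewrite /us h2// e1 -AE; field; rewrite !gt_eqF.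
Qed.

Lemma brittle_energyE : brittle_energy L kappa eps (u t) (Theta t) (a t) =
  W t ^+ 2 / (2 * C t) + S ^+ 2 / 2 * C t - S ^+ 2 / 2 * (L / a1).
Proof.
rewrite /brittle_energy -/us elastic crit_stress_sqr.
have -> : \int[leb]_(x in `]0, L[) (1 - Theta t x) = eps * \int[leb]_(x in D) rho t x.
  rewrite -RintegralZl//; last exact: LL1.
  by apply: eq_Rintegral => x _; rewrite /rho; field; rewrite gt_eqF.
have -> : \int[leb]_(x in D) rho t x = (C t - L / a1) / bt.
  by rewrite /total_compliance -/rho; field; rewrite !gt_eqF.
by field; rewrite !gt_eqF.
Qed.

(* In the one-sided minimality the competitors [theta = tau], constant, are optimized as
   [tau] goes to 0; a completely damaged bar must be excluded. *)
Lemma stress_bound : `|W t| <= S * (L / al) -> `|W t| <= S * C t.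
Proof.
move=> full; pose th := \int[leb]_(x in D) Theta t x.
have LTh : L1 D (Theta t).
  by apply: LL1; apply: (L2_ae_bounded (M := 1) Th.1);
    apply: (lebS Th.2) => x h Dx; have /andP[p1 p2] := h Dx; rewrite ger0_norm.
have Cth : L / al - C t = bt / eps * th.
  have -> : L / al = \int[leb]_(x in D) al^-1 by rewrite Rint_cst mulrC.
  rewrite -CE -RintegralB; [|exact: mD|exact: cst_L1|exact: LL1].
  rewrite /th -RintegralZl//; apply: eq_Rintegral => x _.
  by rewrite AE alE /rho; field; rewrite !gt_eqF.
have th_ge0 : 0 <= th.
  have [m h] := Th; apply: ae_Rint_ge0; [exact: mD|exact: m|].
  by apply: (lebS h) => x {}h Dx; have /andP[] := h Dx.
have [th0|thn0] := eqVneq th 0.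
  have -> // : C t = L / al.
  by move: Cth; rewrite th0 mulr0 => /eqP; rewrite subr_eq0 eq_sym => /eqP.
have th_gt0 : 0 < th by rewrite lt_neqAle eq_sym thn0.
have S0 := crit_stress_gt0.
suff H : W t ^+ 2 <= (S * C t) ^+ 2.
  by rewrite -(@ler_pXn2r _ 2)// ?nnegrE ?real_normK ?num_real// mulr_ge0// ltW.
rewrite exprMn crit_stress_sqr.
have dC : 0 < L / al - C t by rewrite Cth mulr_gt0// divr_gt0.
have key (tau : R) : 0 < tau <= 1 -> W t ^+ 2 <= 2 * kappa / bt * C t * (C t + tau * (L / al - C t)).
  move=> /andP[tau0 tau1]; have := @one_sided tau; rewrite (ltW tau0) tau1 => /(_ isT).
  rewrite elastic -/th.
  have -> : tau / al * L + (1 - tau) * C t = C t + tau * (L / al - C t) by ring.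
  set Q := C t + _; have Q0 : 0 < Q by rewrite ltr_pwDl// mulr_ge0 ?(ltW tau0)// ltW.
  have -> : th = (L / al - C t) * eps / bt by rewrite Cth; field; rewrite !gt_eqF.
  (* From 1 / C - 1 / Q = (Q - C) / (C Q), both sides share the factor tau (L / al - C), and
     dividing by it leaves the condition on the stress. *)
  have -> : 2^-1 * (W t ^+ 2 / C t) = 2^-1 * (W t ^+ 2 / Q) + (tau * (L / al - C t)) * (2^-1 * (W t ^+ 2 / (C t * Q))).
    have eX : tau * (L / al - C t) = Q - C t by rewrite /Q; ring.
    by rewrite eX; clearbody Q; field; rewrite !gt_eqF.
  rewrite lerD2l.
  have -> : kappa / eps * (tau * ((L / al - C t) * eps / bt)) = (tau * (L / al - C t)) * (kappa / bt).
    by field; rewrite !gt_eqF.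
  rewrite ler_pM2l; last by rewrite mulr_gt0.
  move=> h; have : W t ^+ 2 / (C t * Q) <= 2 * kappa / bt by lra.
  by rewrite ler_pdivrMr ?mulr_gt0// mulrA.
rewrite leNgt; apply/negP => lt.
pose X := 2 * kappa / bt * C t * (L / al - C t).
have X0 : 0 < X by apply: mulr_gt0 => //; apply: mulr_gt0 => //; apply: divr_gt0 => //; exact: mulr_gt0.
pose gap := W t ^+ 2 - 2 * kappa / bt * C t ^+ 2.
have gap0 : 0 < gap by rewrite subr_gt0.
(* Small enough for tau X <= gap / 2, which the estimate [key] contradicts; the minimum with 1 keeps
   it admissible. *)
pose tau := Num.min 1 (gap / (2 * X)).
have tau0 : 0 < tau by rewrite lt_min ltr01 divr_gt0// mulr_gt0.
have := key tau; rewrite tau0 ge_min lexx => /(_ isT).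
have : tau * X <= gap / 2.
  have : tau <= gap / (2 * X) by rewrite ge_min lexx orbT.
  rewrite -(ler_pM2r X0) => /le_trans; apply; rewrite le_eqVlt; apply/orP; left; apply/eqP.
  by field; rewrite gt_eqF.
have -> : 2 * kappa / bt * C t * (C t + tau * (L / al - C t)) = 2 * kappa / bt * C t ^+ 2 + tau * X by rewrite /X; ring.
rewrite /gap in gap0 *; lra.
Qed.

Lemma total_compliance_le : C t <= L / al.
Proof.
have -> : L / al = \int[leb]_(x in D) al^-1 by rewrite Rint_cst mulrC.
rewrite -CE; apply: ae_le_Rint; [exact: mD|exact: LL1|exact: cst_L1|].
by apply: (lebS A_itv) => x h Dx; have /andP[] := h Dx.
Qed.

(** The competitor is a homogeneous bar of total compliance [c]. For fixed W the energy increases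
    with the compliance beyond |W| / S, so C > c >= |W| / S would violate minimality. *)
Lemma initial_compliance_le (c : R) : t = 0 -> L / a1 <= c -> c <= L / al -> `|W t| <= S * c -> C t <= c.
Proof.
move=> t0 c1 c2 Wc; have c_gt0 : 0 < c by apply: lt_le_trans c1; rewrite divr_gt0.
have S0 := crit_stress_gt0.
(* The damaged fraction that gives the homogeneous bar the compliance [c]: c / L = 1 / a1 + tau bt /
   eps. The bounds on [c] are exactly 0 <= tau <= 1. *)
pose tau := (c / L - a1^-1) * (eps / bt).
have tau_ge0 : 0 <= tau.
  by rewrite mulr_ge0 ?divr_ge0 ?(ltW bt_gt0) ?(ltW eps_gt0)// subr_ge0 ler_pdivlMr// mulrC.
have tau_le1 : tau <= 1.
  rewrite -ler_pdivlMr ?divr_gt0// mul1r invf_div lerBlDl -alE ler_pdivrMr//.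
  by rewrite mulrC.
have Lk : L2 D (fun=> W t / L).
  by apply: (bounded_L2 mD Doo (M := `|W t / L|)) => //; exact: measurable_cst.
have [|v [hv h0v wv]] := competitor L_gt0 hw cw Lk.
  by rewrite Rint_cst divfK// gt_eqF.
have th : Linf01 D (fun=> tau).
  by split; [exact: measurable_cst|apply: aeW => x _; rewrite tau_ge0 tau_le1].
have h0v' : H10 D (fun x => v x - w 0 x) by move: h0v; rewrite t0.
have [ea [eu eT]] : a 0 = a t /\ u 0 = u t /\ Theta 0 = Theta t by rewrite t0.
have := be_initial_minimality be hv h0v' th; rewrite ea eu eT.
have -> : \int[leb]_(x in `]0, L[) (2^-1 * a t x * wderiv `]0, L[ (u t) x ^+ 2 + kappa / eps * (1 - Theta t x)) =
    brittle_energy L kappa eps (u t) (Theta t) (a t).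
  have i1 : L1 D (fun x => 2^-1 * (a t x * us x ^+ 2)) by exact: l_intgZ.
  have i2 : L1 D (fun x => 1 - Theta t x).
    rewrite (_ : (fun x => 1 - Theta t x) = (fun x => eps * rho t x)).
      by apply: LL1; exact: L2Z.
    by apply/funext => x; rewrite /rho; field; rewrite gt_eqF.
  rewrite /brittle_energy -!RintegralZl// -RintegralD//; last exact: l_intgZ.
  by apply: eq_Rintegral => x _; rewrite mulrA.
have -> : \int[leb]_(x in `]0, L[) (2^-1 * (eps * a0 * a1 / (tau * a1 + (1 - tau) * (eps * a0))) *
      wderiv `]0, L[ v x ^+ 2 + kappa / eps * tau) = \int[leb]_(x in D) (2^-1 * (L / c) * (W t / L) ^+ 2 + kappa / eps * tau).
  apply: ae_eq_Rint_nomeas; apply: (lebS wv) => x h Dx; rewrite h//; congr (_ * _ * _ + _).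
  have e : tau * a1 + (1 - tau) * (eps * a0) = c / L * (al * a1).
    have -> : c / L = a1^-1 + tau * (bt / eps) by rewrite /tau; field; rewrite !gt_eqF.
    have -> : tau * (bt / eps) = tau * (al^-1 - a1^-1) by rewrite alE; ring.
    by rewrite -/al; field; rewrite !gt_eqF.
  by rewrite e -/al; field; rewrite !gt_eqF.
rewrite Rint_cst brittle_energyE.
have -> : (2^-1 * (L / c) * (W t / L) ^+ 2 + kappa / eps * tau) * L =
   W t ^+ 2 / (2 * c) + S ^+ 2 / 2 * c - S ^+ 2 / 2 * (L / a1).
  by rewrite crit_stress_sqr /tau; field; rewrite !gt_eqF.
rewrite lerD2r leNgt => /negP h; rewrite leNgt; apply/negP => cC; apply: h.
rewrite -subr_gt0.
have -> : W t ^+ 2 / (2 * C t) + S ^+ 2 / 2 * C t - (W t ^+ 2 / (2 * c) + S ^+ 2 / 2 * c) =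
  2^-1 * (C t - c) * (S ^+ 2 * (c * C t) - W t ^+ 2) / (c * C t) by field; rewrite !gt_eqF.
rewrite divr_gt0 ?mulr_gt0// ?subr_gt0//.
have : W t ^+ 2 <= (S * c) ^+ 2.
  by rewrite -[W t ^+ 2]real_normK ?num_real// lerXn2r ?nnegrE// mulr_ge0// ltW.
move=> /le_lt_trans; apply; rewrite exprMn ltr_pM2l ?exprn_gt0// expr2 ltr_pM2l//.
Qed.

Lemma displacementE : {ae leb, forall x, D x ->
  u t x = w t 0 + W t / C t * (x / a1 + bt * \int[leb]_(y in `]0, x[) rho t y)}.
Proof.
have [_ h] := boundary_increment L_gt0 hw cw (be_u_H1 be tT) (be_dirichlet be tT).
apply: (lebS h) => x e Dx; rewrite e//; congr (_ + _).
have [x0 xL] : 0 < x /\ x < L by move: Dx; rewrite /= in_itv/= => /andP[].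
have sub : `]0, x[%classic `<=` D by apply: subset_itvl; rewrite bnd_simp ltW.
have mx : measurable (`]0, x[%classic : set MR) by exact: measurable_itv.
have irho : L1 `]0, x[ (rho t) by apply: l_intgS damage_density_L1.
have ic (k : R) : L1 `]0, x[ (fun=> k).
  by apply: (bounded_L1 mx (itv_lty _ _ _ _) (M := `|k|)) => //; exact: measurable_cst.
have -> : x / a1 + bt * \int[leb]_(y in `]0, x[) rho t y = \int[leb]_(y in `]0, x[) (a1^-1 + bt * rho t y).
  rewrite RintegralD//; [|exact: ic|exact: l_intgZ].
  by rewrite RintegralZl// Rintegral_cst// fine_itvoo ?subr0 1?mulrC// ltW.
rewrite -RintegralZl//; last by apply: l_intgD; [exact: mx|exact: ic|exact: l_intgZ].
by apply: ae_eq_Rint_nomeas; apply: (lebS strain_flux) => y {}h /sub Dy; exact: h.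
Qed.

End time.

Lemma damage_density_mono s t : 0 <= s -> s <= t -> t <= T ->
  {ae leb, forall x, D x -> rho s x <= rho t x}.
Proof.
move=> s0 st tT; apply: (lebS (be_monotonicity be s0 st tT)) => x h Dx.
have xL : 0 < x < L by move: Dx; rewrite /= in_itv.
by have [_ h2] := h xL; rewrite /rho ler_pM2r ?invr_gt0// lerD2l lerN2.
Qed.

Let sT_ s t : 0 <= s -> s <= t -> t <= T -> (0 <= s <= T) * (0 <= t <= T).
Proof. by move=> s0 st tT; split; [rewrite s0 (le_trans st)|rewrite tT (le_trans s0)]. Qed.

Lemma total_compliance_mono s t : 0 <= s -> s <= t -> t <= T -> C s <= C t.
Proof.
move=> s0 st tT; have [sT tT'] := sT_ s0 st tT.
rewrite lerD2l ler_pM2l//; apply: ae_le_Rint; [exact: mD|exact: damage_density_L1..|].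
exact: damage_density_mono.
Qed.

Lemma ae_neq (c : R) : {ae leb, forall x, x != c}.
Proof.
exists [set c]; split => //; first exact: lebesgue_measure_set1.
by move=> x /= /negP; rewrite negbK => /eqP.
Qed.

Section upper_bound.
Variables (V gV gW : R -> R).
Hypothesis V_AC : abs_continuous Rdist T V.
Hypothesis WV : forall s t : R, 0 <= s -> s <= t -> t <= T -> `|W t - W s| <= V t - V s.
Hypothesis gV_L1 : L1 setT gV.
Hypothesis gW_L1 : L1 setT gW.
Hypothesis VE : forall s t : R, 0 <= s -> s <= t -> t <= T -> V t - V s = \int[leb]_(x in `]s, t]) gV x.
Hypothesis WE : forall s t : R, 0 <= s -> s <= t -> t <= T -> W t - W s = \int[leb]_(x in `]s, t]) gW x.
Hypothesis work : {ae leb, forall t : R, 0 < t < T -> [/\ `|gW t| <= gV t,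
         L1 `]0, L[ (wderiv setT (H1_dot T w t)) &
         \int[leb]_(x in `]0, L[) wderiv setT (H1_dot T w t) x = gW t]}.
Hypothesis not_full : forall t, 0 <= t <= T -> `|W t| <= crit_stress * (L / al).
Local Notation S := crit_stress.

Let sg t := W (clamp T t) / C (clamp T t).

(** C, V and W + V are nondecreasing, hence measurable; the stress is built from them. *)
Let msg : measurable_fun (setT : set MR) sg.
Proof.
have nd (f : R -> R) : (forall s t, 0 <= s -> s <= t -> t <= T -> f s <= f t) ->
    measurable_fun (setT : set MR) (fun t => f (clamp T t)).
  move=> fm; apply: nondecreasing_measurable => // s t st.
  have /andP[s0 _] := clamp_itv s (ltW T_gt0); have /andP[_ tT] := clamp_itv t (ltW T_gt0).
  by apply: fm => //; exact: clamp_le.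
have mC := nd C total_compliance_mono.
have mV : measurable_fun (setT : set MR) (fun t => V (clamp T t)).
  by apply: nd => s t s0 st tT; rewrite -subr_ge0; apply: le_trans (WV s0 st tT).
have mWV : measurable_fun (setT : set MR) (fun t => W (clamp T t) + V (clamp T t)).
  apply: (nd (fun t => W t + V t)) => s t s0 st tT; have := WV s0 st tT.
  by rewrite ler_norml => /andP[]; lra.
rewrite (_ : sg = fun t => (W (clamp T t) + V (clamp T t) - V (clamp T t)) / C (clamp T t)); last first.
  by apply/funext => t; rewrite addrK.
apply: measurable_funM; first exact: measurable_funB.
(* The maximum with L / a1 does not change C and makes the inverse a continuous function on the
   whole line. *)
rewrite (_ : (fun x => (C (clamp T x))^-1) = (fun y => (Num.max y (L / a1))^-1) \o (fun t => C (clamp T t))).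
  apply: measurableT_comp => //; apply: continuous_measurable_fun => y.
  have p : 0 < Num.max y (L / a1) by rewrite lt_max divr_gt0// orbT.
  apply: cvgV; first exact: lt0r_neq0.
  have mx z : Num.max z (L / a1) = Num.max (z - L / a1) 0 + L / a1 by rewrite addr_maxl subrK add0r.
  rewrite (mx y) (_ : (fun x : R => Num.max x (L / a1)) = (fun x => Num.max (x - L / a1) 0 + L / a1)).
    by apply: cvgD; [exact: continuous_max0|exact: cvg_cst].
  by apply/funext => z; exact: mx.
apply/funext => t /=; congr (_^-1); apply/esym/max_idPl; apply: total_compliance_ge.
exact: clamp_itv (ltW T_gt0).
Qed.

Let sg_le t : `|sg t| <= S.
Proof.
have tT := clamp_itv t (ltW T_gt0); have C0 := total_compliance_gt0 tT.
by rewrite /sg normrM normfV (gtr0_norm C0) ler_pdivrMr//; apply: stress_bound => //; exact: not_full.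
Qed.

Let sgW_L1 : L1 setT (fun t => sg t * gW t).
Proof.
have mgW := intgM gW_L1.
apply: (l_intg_ae_le measurableT _ (l_intgZ S measurableT (l_intg_abs measurableT gW_L1))).
  by apply: measurable_funM; [exact: msg|exact: mgW].
by apply: aeW => x _; rewrite normrM ler_wpM2r.
Qed.

Let L1_itv f (I : set MR) : measurable I -> L1 setT f -> L1 I f.
Proof. by move=> mI; exact: l_intgS. Qed.

Let E t := W t ^+ 2 / (2 * C t) + S ^+ 2 / 2 * C t.

(** By [stress_flux] the space integral at almost every time is the constant stress times the
    integral of the derivative of the datum, that is, sg W'. *)
Let E0E t : 0 <= t <= T -> E t - E 0 = \int[leb]_(s in `]0, t]) (sg s * gW s).
Proof.
move=> tT; have T0 : (0 : R) <= 0 <= T by rewrite lexx/= ltW.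
have := be_energy_balance be tT; rewrite !brittle_energyE// => h.
have -> : E t - E 0 = \int[leb]_(s in `[0, t]) \int[leb]_(x in `]0, L[)
    (a s x * wderiv `]0, L[ (u s) x * wderiv setT (H1_dot T w s) x) by rewrite /E; lra.
rewrite Rintegral_itv_obnd_cbnd; last by apply: L1_itv => //; exact: measurable_itv.
apply: ae_eq_Rint_nomeas; apply: (lebS (lebI work (lebI (ae_neq 0) (ae_neq T)))) => s [hs [s0 sT]].
rewrite /= in_itv/= => /andP[s0' st]; have /andP[_ tT'] := tT.
have s0T : 0 < s < T by rewrite !lt_neqAle s0' eq_sym s0 sT (le_trans st).
have [_ iw ew] := hs s0T.
have sT' : 0 <= s <= T by case/andP: s0T => /ltW -> /ltW ->.
rewrite -ew /sg clampE// -RintegralZl//.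
by apply: ae_eq_Rint_nomeas; apply: (lebS (stress_flux sT')) => x e Dx; rewrite e.
Qed.

(** Verifies the hypotheses of the scalar law: initial minimality gives the bound at time 0, and the
    balance in integral form gives the estimate of energy increments. *)
Lemma total_compliance_upper_bound (t c : R) : 0 <= t <= T -> L / a1 <= c ->
  (forall r, 0 <= r -> r <= t -> `|W r| <= S * c) -> C t <= c.
Proof.
move=> /andP[t0 tT] c1 Wc.
have T0 : (0 : R) <= 0 <= T by rewrite lexx/= ltW.
have C0c : C 0 <= c.
  (* Above L / al, the compliance of the fully damaged bar, no competitor exists, but the bound is
     then automatic. *)
  have [cL|Lc] := leP c (L / al); last by apply: (le_trans (total_compliance_le T0)); exact: ltW.
  by apply: initial_compliance_le => //; exact: Wc.
have La1 : 0 < L / a1 by rewrite divr_gt0.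
apply: (@Griffith_upper_bound R T S (L / a1) W V C crit_stress_gt0 La1 V_AC WV _ total_compliance_mono _ _ t c) => //.
- by move=> r r0 rT; apply: total_compliance_ge; rewrite r0.
- by move=> r r0 rT; apply: stress_bound; [rewrite r0|apply: not_full; rewrite r0].
- move=> s r B s0 sr rT hB; have [sT rT'] := sT_ s0 sr rT.
  have mI : measurable (`]s, r]%classic : set MR) by exact: measurable_itv.
  have i1 : L1 `]s, r] (fun x => sg x * gW x) by exact: L1_itv.
  have i2 : L1 `]s, r] gW by exact: L1_itv.
  have Esr : E r - E s = \int[leb]_(x in `]s, r]) (sg x * gW x).
    rewrite -(@Rintegral_itvB _ _ (BRight 0) (BRight r) s) ?bnd_simp//.
      by rewrite -!E0E//; ring.
    by apply: L1_itv => //; exact: measurable_itv.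
  have -> : W r ^+ 2 / (2 * C r) + S ^+ 2 / 2 * C r - (W s ^+ 2 / (2 * C s) + S ^+ 2 / 2 * C s) = E r - E s by [].
  rewrite Esr WE// -RintegralZl// -RintegralB//; last exact: l_intgZ.
  under eq_Rintegral do rewrite -mulrBl.
  rewrite VE// -RintegralZl//; last exact: L1_itv.
  have B0 : 0 <= B by apply: le_trans (hB s (lexx s) sr).
  apply: Rint_norm_le => //.
  + have mg := intgM gW_L1.
    apply: measurable_funM; last exact: measurable_funS mg.
    by apply: measurable_funB => //; exact: measurable_funS msg.
  + by apply: l_intgZ => //; exact: L1_itv.
  + apply: (lebS (lebI work (ae_neq T))) => x [hx xT]; rewrite /= in_itv/= => /andP[sx xr].
    have x0T : 0 < x < T by rewrite (le_lt_trans s0 sx) lt_neqAle xT (le_trans xr).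
    have [h1 _ _] := hx x0T; rewrite normrM; apply: ler_pM => //.
    rewrite /sg clampE; first by apply: hB => //; exact: ltW.
    by case/andP: x0T => /ltW -> /ltW ->.
Qed.

End upper_bound.

End Homogenized_evolution.

(** * Compactness, BV functions and traces *)

Section Selection.
Context {R : realType}.

Lemma ultra_bounded_cvg {I : Type} (U : set_system I) (x : I -> R) (B : R) : UltraFilter U ->
  (\forall i \near U, `|x i| <= B) -> exists l : R, x i @[i --> U] --> l.
Proof.
move=> uU xB; have pU : ProperFilter U by exact: ultra_proper.
have := @segment_compact _ (- B) B => /(_ (x @ U) _)[|p [_ cp]].
  by apply: filterS xB => i; rewrite /= in_itv/= -ler_norml.
exists p; apply/cvgrPdist_lt => e e0.
have [//|nU] := in_ultra_setVsetC [set i | `|p - x i| < e] uU.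
have [||y [/= h1 h2]] := cp [set y | ~ (`|p - y| < e)] (ball p e) => //.
exact: nbhsx_ballx.
Qed.

(** An ultrafilter selects all limits at once. The n-th index is then taken so that the entries with
    code at most n are within 1 / (n + 1) of their limits, without nested subsequences. *)
Lemma diagonal_subsequence {I : countType} (x : nat -> I -> R) (B : I -> R) :
  (forall i, \forall n \near \oo, `|x n i| <= B i) ->
  exists2 k : nat -> nat, {homo k : m n / (m < n)%N} &
    forall i, exists l : R, x (k n) i @[n --> \oo] --> l.
Proof.
move=> xB; have [U [uU ooU]] := ultraFilterLemma (eventually_filter : ProperFilter eventually).
have pU : ProperFilter U by exact: ultra_proper.
have [g gP] := choice (fun i => ultra_bounded_cvg uU (ooU _ (xB i))).
have step (m j : nat) : exists n, (m < n)%N /\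
    forall i, (pickle i <= j)%N -> `|g i - x n i| < j.+1%:R^-1.
  have H (s : seq I) : \forall n \near U, forall i, i \in s -> `|g i - x n i| < j.+1%:R^-1.
    elim: s => [|i s IH]; first by apply: filterS (filterT : U setT) => n _ i; rewrite in_nil.
    have j0 : 0 < j.+1%:R^-1 :> R by rewrite invr_gt0.
    move/cvgrPdist_lt : (gP i) => /(_ _ j0); apply: filterS2 IH => n h1 h2 i'.
    by rewrite inE => /predU1P[->//|]; exact: h1.
  have m0 : U [set n | (m < n)%N] by apply: ooU; exists m.+1.
  have [n [mn hn]] := filter_ex (filterI m0 (H (pmap unpickle (iota 0 j.+1)))).
  exists n; split => // i ij; apply: hn; rewrite mem_pmap; apply/mapP; exists (pickle i).
    by rewrite mem_iota.
  by rewrite pickleK.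
have [f fP] := choice (fun p : nat * nat => step p.1 p.2).
pose k := fix k n := match n with 0%N => f (0%N, 0%N) | n.+1 => f (k n, n.+1) end.
exists k.
  by apply: homo_ltn; [exact: ltn_trans|move=> n; have [] := fP (k n, n.+1)].
move=> i; exists (g i); apply/cvgrPdist_lt => e e0.
have := @cvg_harmonic R => /cvgrPdist_lt/(_ _ e0) h.
near=> n; have ni : (pickle i <= n)%N by near: n; exact: nbhs_infty_ge.
have kn : `|g i - x (k n) i| < n.+1%:R^-1.
  by case: (n) ni => [|n'] ni; [have [_] := fP (0%N, 0%N); exact|have [_] := fP (k n', n'.+1); exact].
apply: (lt_trans kn); have : `|0 - n.+1%:R^-1| < e by near: n; exact: h.
by rewrite sub0r normrN ger0_norm ?invr_ge0.
Unshelve. all: by end_near. Qed.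

End Selection.

(** * Derivatives and traces of functions of bounded variation *)

Section BV_functions.
Context {R : realType}.
Local Notation leb := (@lebesgue_measure R).
Local Notation MR := (measurableTypeR R).
Implicit Types (nu : smeas R) (A : set MR).

(** [BVderiv] is a choice; test functions determine the measure. *)
Lemma BVderivP (L : R) v nu : distr_deriv_meas `]0, L[ v nu ->
  forall A, measurable A -> BVderiv `]0, L[ v A = nu A.
Proof.
move=> dv; rewrite /BVderiv; case: pselect => [ex|]; last by case; exists nu.
case: cid => /= nu' dv'; apply: (@charge_eq_tests _ 0 L); [exact: dv'.1|exact: dv.1|].
move=> phi tphi; apply: oppr_inj; rewrite -(dv'.2 _ tphi); exact: dv.2.
Qed.

Lemma meas_norm_BVderiv (L B : R) v nu : distr_deriv_meas `]0, L[ v nu ->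
  (forall A, measurable A -> `|fine (nu A)| <= B) -> meas_norm (BVderiv `]0, L[ v) <= 2 * B.
Proof. by move=> dv nuB; apply: meas_norm_le => A mA; rewrite (BVderivP dv)//; exact: nuB. Qed.

Lemma meas_density_cst (a b k : R) A : measurable A ->
  meas_density `]a, b[ (fun=> k) A = (k * fine (leb (A `&` `]a, b[%classic)))%:E.
Proof.
move=> mA; have mD : measurable (`]a, b[%classic : set MR) by exact: measurable_itv.
have ik : L1 `]a, b[ (fun=> k).
  by apply: (bounded_L1 mD (itv_lty _ _ _ _) (M := `|k|)) => //; exact: measurable_cst.
have [_ ->//] := meas_densityE mD ik.
have -> : (\int[leb]_(x in A) (((fun=> k) \_ `]a, b[) x)%:E)%E = (\int[leb]_(x in A `&` `]a, b[) k%:E)%E.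
  rewrite integral_mkcondr; apply: eq_integral => x _; rewrite !patchE; by case: ifP.
have mAD : measurable (A `&` `]a, b[%classic) by exact: measurableI.
rewrite integral_cst// EFinM fineK// ge0_fin_numE//.
by apply: le_lt_trans (itv_lty a b false true); apply: le_measure; rewrite ?inE.
Qed.

Lemma fineD_meas nu1 nu2 A : measurable A -> fine (meas_add nu1 nu2 A) = fine (nu1 A) + fine (nu2 A).
Proof. by move=> mA; rewrite -fineD//; apply: fin_num_measure. Qed.

Lemma fineZ_meas r nu A : measurable A -> fine (meas_scale r nu A) = r * fine (nu A).
Proof. by move=> mA; rewrite -[RHS]/(fine r%:E * fine (nu A)) -fineM//; apply: fin_num_measure. Qed.

Lemma fineB_meas nu1 nu2 A : measurable A -> fine (meas_sub nu1 nu2 A) = fine (nu1 A) - fine (nu2 A).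
Proof. by move=> mA; rewrite fineD_meas// fineZ_meas// mulN1r. Qed.

Lemma fine_meas_inj nu1 nu2 A : measurable A -> fine (nu1 A) = fine (nu2 A) -> nu1 A = nu2 A.
Proof.
by move=> mA e; rewrite -[LHS]fineK ?e ?fineK//; apply: fin_num_measure.
Qed.

Lemma nonneg_fine nu : (forall A, measurable A -> 0 <= fine (nu A)) -> nonneg nu.
Proof.
by move=> h A mA; rewrite -[nu A]fineK ?lee_fin ?h//; apply: fin_num_measure.
Qed.

Definition meas_restr nu (D : set MR) (mD : measurable D) : smeas R := crestr0 nu mD.

Lemma meas_restrE nu (D : set MR) (mD : measurable D) A : measurable A ->
  meas_restr nu mD A = nu (A `&` D).
Proof. by move=> mA; rewrite /meas_restr /= /crestr0 /crestr mem_set. Qed.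

Lemma meas_integral_eq_on nu1 nu2 (X : set MR) (f : R -> R) : nonneg nu1 -> nonneg nu2 -> measurable X ->
  bmeas X f -> meas_eq_on X nu1 nu2 -> meas_integral nu1 X f = meas_integral nu2 X f.
Proof.
move=> n1 n2 mX bf e; rewrite (meas_integral_nonneg n1 mX bf).1 (meas_integral_nonneg n2 mX bf).1.
rewrite /Rintegral; congr fine; apply: eq_measure_integral => A mA AX.
by apply: (etrans (jposE n1 mA)); apply: (etrans (e A mA AX)); exact/esym/jposE.
Qed.

Section traces.
Variables (a b : R) (v : R -> R) (l : R).
Hypothesis ab : a < b.
Hypothesis v_L1 : L1 `]a, b[ v.

Let mI (c d : R) : measurable (`]c, d[%classic : set MR). Proof. exact: measurable_itv. Qed.

Let cst_L1 (c d k : R) : L1 `]c, d[ (fun=> k).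
Proof. by apply: (bounded_L1 (mI c d) (itv_lty _ _ _ _) (M := `|k|)) => //; exact: measurable_cst. Qed.

Let avg_le (c d e l' : R) : c < d -> a <= c -> d <= b ->
  (forall x, c < x < d -> `|v x - l'| <= e) -> (d - c)^-1 * \int[leb]_(x in `]c, d[) `|v x - l'| <= e.
Proof.
move=> cd ac db h; have dc : 0 < d - c by rewrite subr_gt0.
rewrite mulrC ler_pdivrMr//.
have sub : (`]c, d[%classic : set R) `<=` `]a, b[ by apply: subset_itv; rewrite bnd_simp.
have i1 : L1 `]c, d[ (fun x => `|v x - l'|).
  by apply: l_intg_abs; [exact: mI|apply: l_intgB; [exact: mI|exact: l_intgS v_L1|exact: cst_L1]].
have -> : e * (d - c) = \int[leb]_(x in `]c, d[) e.
  by rewrite Rintegral_cst; [rewrite fine_itvoo// ltW|exact: mI].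
apply: le_Rintegral; [exact: mI|exact: i1|exact: cst_L1|].
by move=> x; rewrite /= in_itv; exact: h.
Qed.

Let avg_unique (c d l1 l2 : R) : c < d -> a <= c -> d <= b ->
  `|l1 - l2| <= (d - c)^-1 * \int[leb]_(x in `]c, d[) `|v x - l1| + (d - c)^-1 * \int[leb]_(x in `]c, d[) `|v x - l2|.
Proof.
move=> cd ac db; have dc : 0 < d - c by rewrite subr_gt0.
have sub : (`]c, d[%classic : set R) `<=` `]a, b[ by apply: subset_itv; rewrite bnd_simp.
have i1 k : L1 `]c, d[ (fun x => `|v x - k|).
  by apply: l_intg_abs; [exact: mI|apply: l_intgB; [exact: mI|exact: l_intgS v_L1|exact: cst_L1]].
rewrite -mulrDr mulrC ler_pdivlMr// -RintegralD; [|exact: mI|exact: i1|exact: i1].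
have <- : \int[leb]_(x in `]c, d[) `|l1 - l2| = `|l1 - l2| * (d - c).
  by rewrite Rintegral_cst; [rewrite fine_itvoo// ltW|exact: mI].
apply: le_Rintegral; [exact: mI|exact: cst_L1|by apply: l_intgD; [exact: mI|exact: i1..]|].
move=> x _; rewrite [`|v x - l1|]distrC; have -> : l1 - l2 = (l1 - v x) + (v x - l2) by ring.
exact: ler_normD.
Qed.

(** A pointwise one-sided limit is also an approximate limit, and averages over the same interval
    show that approximate limits are unique. *)
Lemma traceLE : (forall e, 0 < e -> exists2 d, 0 < d & forall x, a < x < a + d -> `|v x - l| <= e) ->
  traceL a v = l.
Proof.
move=> h; have nr : \forall r \near (0 : R)^'+, 0 < r < b - a.
  by near=> r; apply/andP; split => //; near: r; apply: nbhs_right_lt; rewrite subr_gt0.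
have c : r^-1 * \int[leb]_(x in `]a, (a + r)[) `|v x - l| @[r --> (0 : R)^'+] --> (0 : R).
  apply/cvgrPdist_le => e e0; have [d d0 hd] := h e e0; near=> r.
  have /andP[r0 rb] : 0 < r < b - a by near: r.
  have rd : r < d by near: r; exact: nbhs_right_lt.
  rewrite sub0r normrN ger0_norm; last first.
    by apply: mulr_ge0; [rewrite invr_ge0 ltW|apply: Rintegral_ge0 => x _].
  have e1 : a + r - a = r by ring.
  rewrite -{1}e1; apply: avg_le; [by rewrite ltrDl|by []|lra|].
  by move=> x /andP[x1 x2]; apply: hd; rewrite x1/=; lra.
rewrite /traceL; case: xgetP => [l' _ /= c'|/(_ l)//]; apply/eqP; rewrite -subr_eq0 -normr_eq0 eq_le normr_ge0 andbT.
have cc : 0 - (r^-1 * \int[leb]_(x in `]a, (a + r)[) `|v x - l'| + r^-1 * \int[leb]_(x in `]a, (a + r)[) `|v x - l|) @[r --> (0 : R)^'+] --> (0 - (0 + 0) : R).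
  by apply: cvgB; [exact: cvg_cst|exact: cvgD].
have e0 : `|l' - l| <= - (0 - (0 + 0)) -> `|l' - l| <= 0 by rewrite addr0 subr0 oppr0.
apply: e0; rewrite lerNr; apply: (cvg_le_near cc); near=> r.
have /andP[r0 rb] : 0 < r < b - a by near: r.
rewrite sub0r lerN2; have := @avg_unique a (a + r) l' l.
have -> : a + r - a = r by ring.
by apply; [rewrite ltrDl|exact: lexx|lra].
Unshelve. all: by end_near. Qed.

Lemma traceRE : (forall e, 0 < e -> exists2 d, 0 < d & forall x, b - d < x < b -> `|v x - l| <= e) ->
  traceR b v = l.
Proof.
move=> h; have nr : \forall r \near (0 : R)^'+, 0 < r < b - a.
  by near=> r; apply/andP; split => //; near: r; apply: nbhs_right_lt; rewrite subr_gt0.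
have c : r^-1 * \int[leb]_(x in `](b - r), b[) `|v x - l| @[r --> (0 : R)^'+] --> (0 : R).
  apply/cvgrPdist_le => e e0; have [d d0 hd] := h e e0; near=> r.
  have /andP[r0 rb] : 0 < r < b - a by near: r.
  have rd : r < d by near: r; exact: nbhs_right_lt.
  rewrite sub0r normrN ger0_norm; last first.
    by apply: mulr_ge0; [rewrite invr_ge0 ltW|apply: Rintegral_ge0 => x _].
  have e1 : b - (b - r) = r by ring.
  rewrite -{1}e1; apply: avg_le; [by rewrite ltrBlDr ltrDl|lra|by []|].
  by move=> x /andP[x1 x2]; apply: hd; rewrite x2 andbT; lra.
rewrite /traceR; case: xgetP => [l' _ /= c'|/(_ l)//]; apply/eqP; rewrite -subr_eq0 -normr_eq0 eq_le normr_ge0 andbT.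
have cc : 0 - (r^-1 * \int[leb]_(x in `](b - r), b[) `|v x - l'| + r^-1 * \int[leb]_(x in `](b - r), b[) `|v x - l|) @[r --> (0 : R)^'+] --> (0 - (0 + 0) : R).
  by apply: cvgB; [exact: cvg_cst|exact: cvgD].
have e0 : `|l' - l| <= - (0 - (0 + 0)) -> `|l' - l| <= 0 by rewrite addr0 subr0 oppr0.
apply: e0; rewrite lerNr; apply: (cvg_le_near cc); near=> r.
have /andP[r0 rb] : 0 < r < b - a by near: r.
rewrite sub0r lerN2; have := @avg_unique (b - r) b l' l.
have -> : b - (b - r) = r by ring.
by apply; [rewrite ltrBlDr ltrDl|lra|exact: lexx].
Unshelve. all: by end_near. Qed.

End traces.

Lemma cdf_right nu (x e : R) : nonneg nu -> 0 < e -> exists2 d, 0 < d &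
  forall y, x < y < x + d -> `|cdf nu y - cdf nu x| <= e.
Proof.
move=> nu0 e0; pose F n : set MR := `]-oo, x + n.+1%:R^-1]%classic.
have mF n : measurable (F n) by exact: measurable_itv.
have IF : \bigcap_n F n = `]-oo, x]%classic.
  apply/seteqP; split => y /=; last first.
    by rewrite in_itv/= => yx n _; rewrite /F /= in_itv/= (le_trans yx)// lerDl.
  move=> h; rewrite in_itv/= leNgt; apply/negP => xy.
  have p : 0 < y - x by rewrite subr_gt0.
  have := @cvg_harmonic R => /cvgrPdist_lt/(_ _ p)[N _ /(_ N (leqnn N))].
  rewrite /= sub0r normrN ger0_norm ?invr_ge0// => hN.
  by have := h N Logic.I; rewrite /F /= in_itv/= leNgt -ltrBrDl hN.
have mx : measurable (`]-oo, x]%classic : set MR) by exact: measurable_itv.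
have : (jpos nu \o F) n @[n --> \oo] --> (fine (jpos nu `]-oo, x]%classic))%:E.
  rewrite fineK; last exact: fin_measure mx (jpos_fin nu).
  rewrite -IF; apply: nonincreasing_cvg_mu.
  - by apply: le_lt_trans (jpos_fin nu); apply: le_measure; rewrite ?inE//; exact: mF.
  - exact: mF.
  - by rewrite IF.
  - move=> m n mn; apply/subsetPset => y; rewrite /F /= !in_itv/= => /le_trans; apply.
    by rewrite lerD2l lef_pV2 ?posrE// ler_nat.
move=> /fine_cvgP[_].
move=> /cvgrPdist_lt/(_ _ e0)[N _ /(_ N (leqnn N))] /=; rewrite !jposE//.
rewrite -/(cdf nu x) -/(cdf nu (x + N.+1%:R^-1)) => h.
exists N.+1%:R^-1; first by rewrite invr_gt0.
move=> y /andP[xy yN]; have h1 := cdf_le nu0 (ltW xy); have h2 := cdf_le nu0 (ltW yN).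
rewrite ger0_norm ?subr_ge0//; move: h; rewrite ltr_norml => /andP[]; lra.
Qed.

(** The limit from the left does not count an atom at [x], hence the open half-line. *)
Lemma cdf_left nu (x e : R) : nonneg nu -> 0 < e -> exists2 d, 0 < d &
  forall y, x - d < y < x -> `|cdf nu y - fine (nu `]-oo, x[%classic)| <= e.
Proof.
move=> nu0 e0; pose F n : set MR := `]-oo, x - n.+1%:R^-1]%classic.
have mF n : measurable (F n) by exact: measurable_itv.
have mx : measurable (`]-oo, x[%classic : set MR) by exact: measurable_itv.
have UF : \bigcup_n F n = `]-oo, x[%classic.
  apply/seteqP; split => y /=.
    by move=> [n _]; rewrite /F /= !in_itv/= => /le_lt_trans; apply; rewrite ltrBlDr ltrDl invr_gt0.
  rewrite in_itv/= => yx; have p : 0 < x - y by rewrite subr_gt0.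
  have := @cvg_harmonic R => /cvgrPdist_lt/(_ _ p)[N _ /(_ N (leqnn N))].
  rewrite /= sub0r normrN ger0_norm ?invr_ge0// => hN; exists N => //.
  by rewrite /F /= in_itv/= lerBrDr -lerBrDl ltW.
have : (jpos nu \o F) n @[n --> \oo] --> (fine (jpos nu `]-oo, x[%classic))%:E.
  rewrite fineK; last exact: fin_measure mx (jpos_fin nu).
  rewrite -UF; apply: nondecreasing_cvg_mu.
  - exact: mF.
  - by rewrite UF.
  - move=> m n mn; apply/subsetPset => y; rewrite /F /= !in_itv/= => /le_trans; apply.
    by rewrite lerD2l lerN2 lef_pV2 ?posrE// ler_nat.
move=> /fine_cvgP[_].
move=> /cvgrPdist_lt/(_ _ e0)[N _ /(_ N (leqnn N))] /=; rewrite !jposE//.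
rewrite -/(cdf nu (x - N.+1%:R^-1)) => h.
exists N.+1%:R^-1; first by rewrite invr_gt0.
move=> y /andP[yN yx]; have h1 := cdf_le nu0 (ltW yN).
have h2 : cdf nu y <= fine (nu `]-oo, x[%classic).
  apply: nonneg_mono => //.
  by move=> z /=; rewrite !in_itv/= => /le_lt_trans; apply.
rewrite distrC ger0_norm ?subr_ge0//; move: h; rewrite ltr_norml => /andP[]; lra.
Qed.

End BV_functions.

(** * Monotone families of bounded measures *)

Section Bounded_measures.
Context {R : realType}.
Local Notation leb := (@lebesgue_measure R).
Local Notation MR := (measurableTypeR R).
Implicit Types (nu : smeas R).

Lemma meas_density_fine (D A : set MR) (f : R -> R) : measurable D -> measurable A -> L1 D f ->
  fine (meas_density D f A) = \int[leb]_(x in A `&` D) f x.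
Proof.
move=> mD mA Lf; have [_ ->//] := meas_densityE mD Lf.
rewrite /Rintegral integral_mkcondr; congr fine; apply: eq_integral => x _.
by rewrite !patchE; case: ifP.
Qed.

Lemma meas_density_sub (D A : set MR) (f g : R -> R) : measurable D -> measurable A -> L1 D f -> L1 D g ->
  meas_density D (fun x => f x - g x) A = meas_sub (meas_density D f) (meas_density D g) A.
Proof.
move=> mD mA Lf Lg; have mAD : measurable (A `&` D) by exact: measurableI.
have i1 : L1 (A `&` D) f by apply: l_intgS Lf.
have i2 : L1 (A `&` D) g by apply: l_intgS Lg.
apply: fine_meas_inj => //; rewrite fineB_meas// !meas_density_fine ?RintegralB//.
exact: l_intgB.
Qed.

Lemma meas_density_nonneg (D : set MR) (f : R -> R) : measurable D -> L1 D f ->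
  {ae leb, forall x, D x -> 0 <= f x} -> nonneg (meas_density D f).
Proof.
move=> mD Lf f0; apply: nonneg_fine => A mA; rewrite meas_density_fine//.
apply: ae_Rint_ge0; [exact: measurableI|have := intgM Lf; exact: measurable_funS|].
by apply: (lebS f0) => x h [_ Dx]; exact: h.
Qed.

Lemma meas_onS (X Y : set MR) (nu : smeas R) : measurable X -> measurable Y -> X `<=` Y ->
  meas_on X nu -> meas_on Y nu.
Proof.
move=> mX mY XY on A mA; rewrite (charge_meas_on mX (measurableD mA mY) on).
by rewrite (_ : _ `&` _ = set0) ?charge0// -subset0 => x [[_ nY] /XY].
Qed.

Lemma continuous_bmeas (L : R) phi : 0 < L -> {within `[0, L], continuous phi} -> bmeas (`[0, L]%classic : set MR) phi.
Proof.
move=> L0 cphi; have cc := clamp_comp_continuous (ltW L0) cphi.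
have eq x : `[0, L]%classic x -> phi (clamp L x) = phi x.
  by rewrite /= in_itv/= => xL; rewrite clampE.
split.
  apply: (@eq_measurable_fun _ _ _ _ _ (fun x => phi (clamp L x))).
    by move=> x /set_mem; exact: eq.
  by apply: measurable_funS (continuous_measurable_fun cc).
have [c _ cP] := EVT_max (ltW L0) (continuous_subspaceT cc).
have [d _ dP] := EVT_min (ltW L0) (continuous_subspaceT cc).
exists (`|phi (clamp L c)| + `|phi (clamp L d)|) => x xL; rewrite -(eq x xL).
have h1 := cP x xL; have h2 := dP x xL.
have h3 := ler_norm (phi (clamp L c)); have h4 := ler_norm (- phi (clamp L d)); rewrite normrN in h4.
have h5 := normr_ge0 (phi (clamp L c)); have h6 := normr_ge0 (phi (clamp L d)).
by rewrite ler_norml; apply/andP; split; lra.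
Qed.

Lemma cvg_homo_oo (k : nat -> nat) : {homo k : m n / (m < n)%N} -> k @ \oo --> \oo.
Proof.
move=> kh; have kn n : (n <= k n)%N by elim: n => // n IH; apply: (leq_ltn_trans IH); exact: kh.
move=> A [N _ NA]; exists N => // n /= Nn; apply: NA => /=; exact: leq_trans (kn n).
Qed.

(** For ordered measures the increment on every set is bounded by the increment of the total mass.
    This reduces moduli of continuity of measures to those of a scalar. *)
Lemma meas_sub_bound nu1 nu2 (A : set MR) : nonneg (meas_sub nu1 nu2) -> measurable A ->
  0 <= fine (nu1 A) - fine (nu2 A) <= fine (nu1 setT) - fine (nu2 setT).
Proof.
move=> h mA; rewrite -!fineB_meas//; apply/andP; split; first by rewrite fine_ge0// h.
exact: nonneg_mono.
Qed.

Lemma cdf_sub_bound nu1 nu2 x : nonneg (meas_sub nu1 nu2) ->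
  0 <= cdf nu1 x - cdf nu2 x <= fine (nu1 setT) - fine (nu2 setT).
Proof. by move=> h; apply: meas_sub_bound => //; exact: measurable_itv. Qed.

Lemma cdf_sub nu1 nu2 x : cdf (meas_sub nu1 nu2) x = cdf nu1 x - cdf nu2 x.
Proof. by rewrite /cdf fineB_meas//; exact: measurable_itv. Qed.

Lemma cdf_scale r nu x : cdf (meas_scale r nu) x = r * cdf nu x.
Proof. by rewrite /cdf fineZ_meas//; exact: measurable_itv. Qed.

Lemma nonneg_meas_integral_sub nu1 nu2 (X : set MR) f : measurable X -> bmeas X f ->
  meas_integral (meas_sub nu1 nu2) X f = meas_integral nu1 X f - meas_integral nu2 X f.
Proof. by move=> mX [mf [N bN]]; exact: (meas_integral_sub _ _ mX mf bN). Qed.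

Lemma meas_integral_scale_bmeas r nu (X : set MR) f : measurable X -> bmeas X f ->
  meas_integral (meas_scale r nu) X f = r * meas_integral nu X f.
Proof. by move=> mX [mf [N bN]]; exact: (meas_integral_scale _ _ mX mf bN). Qed.

Lemma meas_integral_add_bmeas nu1 nu2 (X : set MR) f : measurable X -> bmeas X f ->
  meas_integral (meas_add nu1 nu2) X f = meas_integral nu1 X f + meas_integral nu2 X f.
Proof. by move=> mX [mf [N bN]]; exact: (meas_integral_add _ _ mX mf bN). Qed.

(** The constant 1 is an admissible test function on the closed interval, so no mass is lost at the
    ends. *)
Lemma wstar_cvg_mass (L : R) (I : Type) (F : set_system I) (FF : ProperFilter F) (nu_ : I -> smeas R) nu : 0 < L ->
  (\forall i \near F, meas_on `[0, L] (nu_ i) /\ nonneg (nu_ i)) ->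
  meas_on `[0, L] nu -> nonneg nu -> wstar_cvg L F nu_ nu ->
  fine (nu_ i setT) @[i --> F] --> fine (nu setT).
Proof.
move=> L0 ok on ge0 cv.
have m1 m : meas_on `[0, L] m -> nonneg m -> meas_integral m `[0, L] (fun=> 1) = fine (m setT).
  move=> mon mge; have mX : measurable (`[0, L]%classic : set MR) by exact: measurable_itv.
  rewrite -(meas_integral_indic mge mX measurableT mon); apply: eq_fun_meas_integral => x _.
  by rewrite indicT.
rewrite -(m1 nu)//; have c1 : {within `[0, L], continuous (fun=> 1 : R)} by apply: continuous_subspaceT => x; exact: cvg_cst.
apply: cvg_near_ext (cv _ c1).
by near=> i; rewrite m1//; have [] : meas_on `[0, L] (nu_ i) /\ nonneg (nu_ i) by near: i.
Unshelve. all: by end_near. Qed.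

End Bounded_measures.

(** * The limit evolution *)

Section Limit_of_evolutions.
Context {R : realType}.
Local Notation leb := (@lebesgue_measure R).
Local Notation MR := (measurableTypeR R).

Variables (L T kappa a0 a1 : R) (w : R -> R -> R).
Variables (eps : nat -> R) (u_ Theta_ a_ : nat -> R -> R -> R).
Hypothesis L_gt0 : 0 < L.
Hypothesis T_gt0 : 0 < T.
Hypothesis kappa_gt0 : 0 < kappa.
Hypothesis a0_gt0 : 0 < a0.
Hypothesis a1_gt0 : 0 < a1.
Hypothesis w_H1 : forall t : R, 0 <= t <= T -> H1 setT (w t).
Hypothesis w_cont : forall t : R, 0 <= t <= T -> continuous (w t).
Hypothesis eps_gt0 : forall n, 0 < eps n.
Hypothesis eps_a : forall n, eps n * a0 < a1.
Hypothesis eps_cvg0 : eps n @[n --> \oo] --> 0.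
Hypothesis be : forall n, brittle_evolution L T kappa a0 a1 w (eps n) (u_ n) (Theta_ n) (a_ n).
Let W t := w t L - w t 0.
Variables (V gV gW : R -> R).
Hypothesis V_AC : abs_continuous Rdist T V.
Hypothesis w0V : forall s t : R, 0 <= s -> s <= t -> t <= T -> `|w t 0 - w s 0| <= V t - V s.
Hypothesis WV : forall s t : R, 0 <= s -> s <= t -> t <= T -> `|W t - W s| <= V t - V s.
Hypothesis gV_L1 : L1 setT gV.
Hypothesis gW_L1 : L1 setT gW.
Hypothesis VE : forall s t : R, 0 <= s -> s <= t -> t <= T -> V t - V s = \int[leb]_(x in `]s, t]) gV x.
Hypothesis WE : forall s t : R, 0 <= s -> s <= t -> t <= T -> W t - W s = \int[leb]_(x in `]s, t]) gW x.
Hypothesis work : {ae leb, forall t : R, 0 < t < T -> [/\ `|gW t| <= gV t,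
         L1 `]0, L[ (wderiv setT (H1_dot T w t)) &
         \int[leb]_(x in `]0, L[) wderiv setT (H1_dot T w t) x = gW t]}.
(** The load stays below what the fully damaged bar, of compliance L / (eps a0), carries at the
    critical stress. *)
Hypothesis not_full : forall n t, 0 <= t <= T ->
  `|W t| <= crit_stress kappa a0 a1 (eps n) * (L / (eps n * a0)).
Local Notation D := (`]0, L[%classic : set MR).
Local Notation X := (`[0, L]%classic : set MR).
Let mD : measurable D. Proof. exact: measurable_itv. Qed.
Let mX : measurable X. Proof. exact: measurable_itv. Qed.

Let bt n := damage_slope a0 a1 (eps n).
Let Sn n := crit_stress kappa a0 a1 (eps n).
Let S : R := Num.sqrt (2 * kappa * a0).
Let Cn n t := total_compliance L a0 a1 (eps n) (Theta_ n) t.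
Let rho n t x := (1 - Theta_ n t x) / eps n.
Let mu_ n t := damage_meas L (eps n) (Theta_ n t).

Let bt_gt0 n : 0 < bt n. Proof. exact: damage_slope_gt0. Qed.
Let Sn_gt0 n : 0 < Sn n. Proof. exact: crit_stress_gt0. Qed.
Let S_gt0 : 0 < S. Proof. by rewrite sqrtr_gt0 !mulr_gt0. Qed.
Let La1 : 0 < L / a1. Proof. exact: divr_gt0. Qed.

Let bt_cvg : bt n @[n --> \oo] --> a0^-1.
Proof.
rewrite -[X in _ --> X]subr0; apply: cvgB; first exact: cvg_cst.
by rewrite -(mul0r a1^-1); apply: cvgM; [exact: eps_cvg0|exact: cvg_cst].
Qed.

Let Sn_cvg : Sn n @[n --> \oo] --> S.
Proof.
rewrite /Sn /crit_stress /S; apply: continuous_cvg; first exact: sqrt_continuous.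
apply: cvgM; first exact: cvg_cst.
rewrite -[X in _ --> X]invrK; apply: cvgV; last exact: bt_cvg.
by rewrite invr_neq0// gt_eqF.
Qed.

Let sT_ s t : 0 <= s -> s <= t -> t <= T -> (0 <= s <= T) * (0 <= t <= T).
Proof. by move=> s0 st tT; split; [rewrite s0 (le_trans st)|rewrite tT (le_trans s0)]. Qed.

Let WS t : set R := [set `|W r| | r in [set r | 0 <= r <= t]].
Let mm t := sup (WS t).

Let WS_sup t : 0 <= t <= T -> has_sup (WS t).
Proof.
move=> /andP[t0 tT]; split; first by exists `|W 0|, 0 => //=; rewrite lexx.
exists (`|W 0| + (V t - V 0)) => _ [r /= /andP[r0 rt] <-].
have := WV (lexx 0) r0 (le_trans rt tT); have := ler_normD (W 0) (W r - W 0).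
rewrite addrC subrK => h1 h2; have := WV r0 rt tT; have := normr_ge0 (W t - W r); lra.
Qed.

Let mm_ge t r : 0 <= t <= T -> 0 <= r -> r <= t -> `|W r| <= mm t.
Proof. by move=> tT r0 rt; apply: sup_upper_bound; [exact: WS_sup|exists r => //=; rewrite r0]. Qed.

Let mm_le t c : 0 <= t <= T -> (forall r, 0 <= r -> r <= t -> `|W r| <= c) -> mm t <= c.
Proof.
move=> /andP[t0 tT] h; apply: ge_sup; first by exists `|W 0|, 0 => //=; rewrite lexx.
by move=> _ [r /= /andP[r0 rt] <-]; exact: h.
Qed.

Definition limit_compliance t := Num.max (L / a1) (mm t / S).
Local Notation C := limit_compliance.

(** The upper bound is the scalar Griffith law with [c] equal to the right-hand side; the lower one
    combines the stress bound at all earlier times with the monotonicity of the compliance. *)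
Let CnE n t : 0 <= t <= T -> Cn n t = Num.max (L / a1) (mm t / Sn n).
Proof.
move=> tT; have /andP[t0 tT'] := tT; apply/eqP; rewrite eq_le; apply/andP; split.
  apply: (total_compliance_upper_bound L_gt0 T_gt0 kappa_gt0 a0_gt0 a1_gt0 (eps_gt0 n) (eps_a n) w_H1 w_cont
    (be n) V_AC WV gV_L1 gW_L1 VE WE work (not_full n) tT); first by rewrite le_max lexx.
  move=> r r0 rt; rewrite -ler_pdivrMl//; last exact: Sn_gt0.
  rewrite le_max; apply/orP; right; rewrite mulrC; apply: ler_wpM2r; [rewrite invr_ge0; exact: ltW (Sn_gt0 n)|exact: (mm_ge tT r0 rt)].
rewrite ge_max (total_compliance_ge a0_gt0 a1_gt0 (eps_gt0 n) (eps_a n) (be n) tT)/=.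
rewrite ler_pdivrMr//; apply: mm_le => // r r0 rt; have rT := le_trans rt tT'.
have rT' : 0 <= r <= T by rewrite r0.
rewrite mulrC; apply: (le_trans (stress_bound L_gt0 kappa_gt0 a0_gt0 a1_gt0 (eps_gt0 n) (eps_a n) w_H1 w_cont (be n) rT' (not_full n rT'))).
rewrite -/(Sn n) ler_pM2l//.
exact: (total_compliance_mono a0_gt0 a1_gt0 (eps_gt0 n) (eps_a n) (be n) r0 rt tT').
Qed.

Let Cn_cvg t : 0 <= t <= T -> Cn n t @[n --> \oo] --> C t.
Proof.
move=> tT; rewrite (_ : (fun n => Cn n t) = fun n => Num.max (mm t / Sn n - L / a1) 0 + L / a1); last first.
  by apply/funext => n; rewrite CnE// addr_maxl subrK add0r maxC.
have -> : C t = Num.max (mm t / S - L / a1) 0 + L / a1 by rewrite addr_maxl subrK add0r maxC.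
apply: cvgD; last exact: cvg_cst.
apply: (@cvg_comp _ _ _ (fun n => mm t / Sn n) (fun y => Num.max (y - L / a1) 0) _ (nbhs (mm t / S))); last exact: continuous_max0.
by apply: cvgM; [exact: cvg_cst|apply: cvgV; [exact: lt0r_neq0|exact: Sn_cvg]].
Qed.

Let C_ge t : L / a1 <= C t. Proof. by rewrite le_max lexx. Qed.
Let C_gt0 t : 0 < C t. Proof. exact: lt_le_trans (C_ge t). Qed.
Let Cn_ge n t : 0 <= t <= T -> L / a1 <= Cn n t.
Proof. by move=> tT; rewrite CnE// le_max lexx. Qed.
Let Cn_gt0 n t : 0 <= t <= T -> 0 < Cn n t.
Proof. by move=> tT; exact: lt_le_trans (Cn_ge n tT). Qed.

Let W_le t : 0 <= t <= T -> `|W t| <= S * C t.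
Proof.
move=> tT; have /andP[t0 _] := tT; rewrite mulrC -ler_pdivrMr// le_max; apply/orP; right.
by rewrite ler_pM2r ?invr_gt0//; exact: mm_ge.
Qed.

Let mm_inc s t : 0 <= s -> s <= t -> t <= T -> mm s <= mm t <= mm s + (V t - V s).
Proof.
move=> s0 st tT; have [sT tT'] := sT_ s0 st tT; apply/andP; split.
  by apply: mm_le => // r r0 rs; apply: mm_ge => //; exact: le_trans st.
have dV : 0 <= V t - V s by apply: le_trans (WV s0 st tT).
apply: mm_le => // r r0 rt; have [rs|sr] := leP r s.
  by apply: (le_trans (mm_ge sT r0 rs)); rewrite lerDl.
have := WV s0 (ltW sr) (le_trans rt tT); have := ler_normD (W s) (W r - W s).
rewrite addrC subrK; have := mm_ge sT s0 (lexx s).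
have : V r <= V t by rewrite -subr_ge0; apply: le_trans (WV r0 rt tT).
lra.
Qed.

(** A running maximum grows no faster than the variation of W; all moduli of continuity of the limit
    come from this one. *)
Let C_inc s t : 0 <= s -> s <= t -> t <= T -> C s <= C t <= C s + (V t - V s) / S.
Proof.
move=> s0 st tT; have /andP[m1 m2] := mm_inc s0 st tT.
have dV : 0 <= V t - V s by apply: le_trans (WV s0 st tT).
have dVS : 0 <= (V t - V s) / S by rewrite divr_ge0// ltW.
have h1 : mm s / S <= mm t / S by rewrite ler_pM2r ?invr_gt0.
have h2 : mm t / S <= mm s / S + (V t - V s) / S by rewrite -mulrDl ler_pM2r ?invr_gt0.
apply/andP; split; first by rewrite ge_max !le_max lexx h1 orbT.
rewrite ge_max; apply/andP; split; first by apply: (le_trans (C_ge s)); rewrite lerDl.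
by apply: (le_trans h2); rewrite lerD2r le_max lexx orbT.
Qed.

Definition limit_stress t := W t / C t.
Local Notation sg := limit_stress.

Let sg_le t : 0 <= t <= T -> `|sg t| <= S.
Proof. by move=> tT; rewrite /sg normrM normfV (gtr0_norm (C_gt0 t)) ler_pdivrMr// W_le. Qed.

Let sg_inc s t : 0 <= s -> s <= t -> t <= T -> `|sg t - sg s| <= 2 / (L / a1) * (V t - V s).
Proof.
move=> s0 st tT; have [sT tT'] := sT_ s0 st tT; have /andP[c1 c2] := C_inc s0 st tT.
have dV : 0 <= V t - V s by apply: le_trans (WV s0 st tT).
have ct := C_gt0 t; have cs := C_gt0 s.
have -> : sg t - sg s = ((W t - W s) - sg s * (C t - C s)) / C t.
  by rewrite /sg; field; rewrite !gt_eqF.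
rewrite normrM normfV (gtr0_norm ct).
(* One increment of V comes from W; the other from sg times the increment of C, as S cancels 1 /
   S. *)
have num : `|W t - W s - sg s * (C t - C s)| <= 2 * (V t - V s).
  have hh : `|sg s * (C t - C s)| <= S * ((V t - V s) / S).
    rewrite normrM; apply: ler_pM => //; first exact: sg_le.
    by rewrite ger0_norm ?subr_ge0//; lra.
  rewrite mulrCA mulfV ?mulr1 ?gt_eqF// in hh.
  by apply: (le_trans (ler_normB _ _)); have := WV s0 st tT; lra.
apply: (@le_trans _ _ (`|W t - W s - sg s * (C t - C s)| / (L / a1))).
  by apply: ler_wpM2l => //; rewrite lef_pV2.
by rewrite [leRHS]mulrAC ler_pM2r ?invr_gt0.
Qed.

Let sgn n t := stress L (u_ n t) (a_ n t).

Let sgnE n t : 0 <= t <= T -> sgn n t = W t / Cn n t.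
Proof. move=> tT; exact: (stressE L_gt0 a0_gt0 a1_gt0 (eps_gt0 n) (eps_a n) w_H1 w_cont (be n) tT). Qed.

Lemma limit_stress_cvg t : 0 <= t <= T -> stress L (u_ n t) (a_ n t) @[n --> \oo] --> sg t.
Proof.
move=> tT; rewrite (_ : (fun n => _) = fun n => W t / Cn n t); last by apply/funext => n; exact: sgnE.
by apply: cvgM; [exact: cvg_cst|apply: cvgV; [exact: lt0r_neq0|exact: Cn_cvg]].
Qed.

Let Mn n t := \int[leb]_(x in D) rho n t x.
Definition limit_mass t := (C t - L / a1) * a0.
Local Notation M := limit_mass.

Let MnE n t : Mn n t = (Cn n t - L / a1) / bt n.
Proof. by rewrite /Cn /total_compliance -/(bt n) addrC addKr mulrAC mulfV ?mul1r// gt_eqF. Qed.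

Let Mn_cvg t : 0 <= t <= T -> Mn n t @[n --> \oo] --> M t.
Proof.
move=> tT; rewrite (_ : (fun n => _) = fun n => (Cn n t - L / a1) / bt n); last by apply/funext => n; exact: MnE.
apply: cvgM; first by apply: cvgB; [exact: Cn_cvg|exact: cvg_cst].
rewrite -[X in _ --> X]invrK; apply: cvgV; last exact: bt_cvg.
by rewrite invr_neq0// gt_eqF.
Qed.

Let rho_L1 n t : 0 <= t <= T -> L1 D (rho n t).
Proof. by move=> tT; exact: (damage_density_L1 (eps_gt0 n) (be n) tT). Qed.

Let rho_ge0 n t : 0 <= t <= T -> {ae leb, forall x, D x -> 0 <= rho n t x}.
Proof. by move=> tT; exact: (damage_density_ge0 (eps_gt0 n) (be n) tT). Qed.

Let DX : D `<=` X. Proof. by apply: subset_itv; rewrite bnd_simp. Qed.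

Let mu_on n t : 0 <= t <= T -> meas_on X (mu_ n t).
Proof. by move=> tT; apply: (meas_onS mD mX DX); apply: meas_density_on => //; exact: rho_L1. Qed.

Let mu_ge0 n t : 0 <= t <= T -> nonneg (mu_ n t).
Proof. by move=> tT; apply: meas_density_nonneg; [exact: mD|exact: rho_L1|exact: rho_ge0]. Qed.

Let mu_mass n t : 0 <= t <= T -> fine (mu_ n t setT) = Mn n t.
Proof.
by move=> tT; rewrite /mu_ /damage_meas meas_density_fine//; [rewrite setTI|exact: rho_L1].
Qed.

Let mu_cdf n t x : 0 <= t <= T -> D x -> cdf (mu_ n t) x = \int[leb]_(y in `]0, x[) rho n t y.
Proof.
move=> tT; rewrite /= in_itv/= => /andP[x0 xL].
rewrite /cdf /mu_ /damage_meas meas_density_fine; [|exact: mD|exact: measurable_itv|exact: rho_L1].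
have -> : `]-oo, x]%classic `&` `]0, L[%classic = `]0, x]%classic :> set MR.
  apply/seteqP; split => y /=; rewrite !in_itv/=; first by move=> [-> /andP[-> _]].
  by move=> /andP[y0 yx]; rewrite y0 yx (le_lt_trans yx).
rewrite -Rintegral_itv_bndo_bndc//; apply: l_intgS (rho_L1 n tT) => //.
by apply: subset_itvl; rewrite bnd_simp ltW.
Qed.

Let mu_inc n s t : 0 <= s -> s <= t -> t <= T ->
  nonneg (meas_sub (mu_ n t) (mu_ n s)) /\ meas_on X (meas_sub (mu_ n t) (mu_ n s)).
Proof.
move=> s0 st tT; have [sT tT'] := sT_ s0 st tT.
have i : L1 D (fun x => rho n t x - rho n s x) by apply: l_intgB => //; exact: rho_L1.
have e A : measurable A -> meas_density D (fun x => rho n t x - rho n s x) A = meas_sub (mu_ n t) (mu_ n s) A.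
  by move=> mA; apply: meas_density_sub => //; exact: rho_L1.
split.
  have ge0 : nonneg (meas_density D (fun x => rho n t x - rho n s x)).
    apply: meas_density_nonneg => //.
    by apply: (lebS (damage_density_mono (eps_gt0 n) (be n) s0 st tT)) => x h Dx; rewrite subr_ge0; exact: h.
  by move=> A mA; rewrite -e//; exact: ge0.
move=> A mA; rewrite -e; last exact: measurableD.
by apply: (meas_onS mD mX DX _ mA); exact: meas_density_on.
Qed.

Let M_inc (s t : R) : 0 <= s -> s <= t -> t <= T -> 0 <= M t - M s <= a0 / S * (V t - V s).
Proof.
move=> s0 st tT; have /andP[c1 c2] := C_inc s0 st tT.
have -> : M t - M s = a0 * (C t - C s) by rewrite /limit_mass; ring.
apply/andP; split; first by apply: mulr_ge0; [exact: ltW|rewrite subr_ge0].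
by rewrite -mulrA; apply: ler_wpM2l; [exact: ltW|rewrite [_^-1 * _]mulrC; lra].
Qed.

(** A rational time slightly before [t] with almost the same mass. The clamp handles t = 0, where
    the rational number is negative. *)
Let M_cont (t e : R) : 0 <= t <= T -> 0 < e -> exists q : rat, [/\ 0 <= clamp T (ratr q : R),
  clamp T (ratr q) <= t & M t - M (clamp T (ratr q)) < e].
Proof.
move=> /andP[t0 tT] e0; have e1 : 0 < e / (a0 / S) by rewrite !divr_gt0.
have [d d0 dV] := abs_continuous_cont V_AC e1.
have td0 : t - d < t by rewrite gtrBl.
have [q] := rat_in_itvoo td0.
rewrite in_itv/= => /andP[q1 q2]; exists q.
have /andP[c0 cT] := clamp_itv (ratr q) (ltW T_gt0).
have ct : clamp T (ratr q) <= t by rewrite -[leRHS](@clampE _ T) ?t0//; apply: clamp_le; exact: ltW.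
split=> //; have /andP[m0 m1] := M_inc c0 ct tT; apply: (le_lt_trans m1).
have td : t - clamp T (ratr q) < d.
  rewrite -{1}[t](@clampE _ T) ?t0//; apply: (le_lt_trans (clamp_dist (ltW T_gt0) (ltW q2))); lra.
have := dV _ _ c0 ct tT td; rewrite distrC => h.
have aS : 0 < a0 / S by exact: divr_gt0.
rewrite mulrC -ltr_pdivlMr//; exact: le_lt_trans (ler_norm _) h.
Qed.

Let mu_cdf_dist n (s t x : R) : 0 <= s -> s <= t -> t <= T ->
  `|cdf (mu_ n t) x - cdf (mu_ n s) x| <= Mn n t - Mn n s.
Proof.
move=> s0 st tT; have [sT tT'] := sT_ s0 st tT; have /andP[h0 h1] := cdf_sub_bound x (mu_inc n s0 st tT).1.
by rewrite ger0_norm// -!mu_mass.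
Qed.

(** The extraction runs over rational times and points. Convergence at every rational point is kept
    next to a.e. convergence, because increments in time are to be passed to the limit through
    [wstar_limit], and the limit at a rational atom need not be the value of the distribution
    function there. *)
Lemma Helly_selection : exists2 k : nat -> nat, {homo k : m n / (m < n)%N} &
  exists mu : R -> smeas R, forall t, 0 <= t <= T ->
  [/\ nonneg (mu t), meas_on X (mu t), wstar_cvg L \oo (fun n => mu_ (k n) t) (mu t) &
    {ae leb, forall x, cdf (mu_ (k n) t) x @[n --> \oo] --> cdf (mu t) x}] /\
    forall q : rat, exists l : R, cdf (mu_ (k n) t) (ratr q) @[n --> \oo] --> l.
Proof.
pose tm (q : rat) := clamp T (ratr q : R).
have tmT q : 0 <= tm q <= T by exact: clamp_itv (ltW T_gt0).
pose x n (i : rat * rat) := cdf (mu_ n (tm i.1)) (ratr i.2).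
have xB i : \forall n \near \oo, `|x n i| <= `|M (tm i.1)| + 1.
  have h : `|M (tm i.1)| < `|M (tm i.1)| + 1 by rewrite ltrDl.
  have h' := cvgr_norm_lt _ (Mn_cvg (tmT i.1)) _ h; near=> n.
  have hn : `|Mn n (tm i.1)| < `|M (tm i.1)| + 1 by near: n; exact: h'.
  have x0 : 0 <= x n i by exact: (cdf_ge0 (ratr i.2) (mu_ge0 n (tmT i.1))).
  have x1 : x n i <= Mn n (tm i.1).
    by rewrite -mu_mass//; apply: nonneg_mono => //; exact: mu_ge0.
  by rewrite ger0_norm//; apply: ltW; apply: (le_lt_trans x1); exact: le_lt_trans (ler_norm _) hn.
have [k kh kl] := diagonal_subsequence xB; exists k => //.
have Mk (t : R) : 0 <= t <= T -> Mn (k n) t @[n --> \oo] --> M t.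
  by move=> tT; apply: cvg_comp (cvg_homo_oo kh) (Mn_cvg tT).
have Dl (t : R) : 0 <= t <= T -> forall q : rat, exists l : R, cdf (mu_ (k n) t) (ratr q) @[n --> \oo] --> l.
  move=> tT q; have /andP[t0 tT'] := tT; suff : cvg (cdf (mu_ (k n) t) (ratr q) @[n --> \oo]) by move=> h; eexists; exact: h.
  (* At other times the distribution functions differ from those at a nearby earlier rational time
     by at most the increment of mass, uniformly in the point. *)
  apply: cauchy_cvg; apply: cauchy_exP => e e0.
  have e2 : 0 < e / 2 by rewrite divr_gt0.
  have [r [r0 rt rM]] := M_cont tT e2; have [l xl] := kl (r, q).
  have dM : Mn (k n) t - Mn (k n) (tm r) @[n --> \oo] --> M t - M (tm r) by apply: cvgB; [exact: Mk|exact: Mk].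
  exists l; have h1 := @cvgr_lt _ _ _ _ _ _ dM _ rM.
  have h2 := @cvgr_dist_lt _ _ _ _ _ _ _ xl _ e2.
  suff : \forall n \near \oo, `|l - cdf (mu_ (k n) t) (ratr q)| < e by [].
  near=> n.
  have b1 : Mn (k n) t - Mn (k n) (tm r) < e / 2 by near: n; exact: h1.
  have b2 : `|l - x (k n) (r, q)| < e / 2 by near: n; exact: h2.
  have b3 := mu_cdf_dist (k n) (ratr q) r0 rt tT'.
  have -> : l - cdf (mu_ (k n) t) (ratr q) = (l - x (k n) (r, q)) - (cdf (mu_ (k n) t) (ratr q) - cdf (mu_ (k n) (tm r)) (ratr q)).
    by rewrite /x/=; ring.
  by apply: (le_lt_trans (ler_normB _ _)); rewrite [ltRHS]splitr; apply: ltr_leD => //; apply: ltW; apply: le_lt_trans b3 b1.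
have : forall t : R, exists nu : smeas R, 0 <= t <= T -> [/\ nonneg nu, meas_on X nu, wstar_cvg L \oo (fun n => mu_ (k n) t) nu &
    {ae leb, forall x, cdf (mu_ (k n) t) x @[n --> \oo] --> cdf nu x}].
  move=> t; have [tT|nT] := boolP (0 <= t <= T); last by exists meas_zero.
  have [l lP] := choice (Dl t tT).
  have ok : \forall n \near \oo, meas_on `[0, L] (mu_ (k n) t) /\ nonneg (mu_ (k n) t).
    by apply: nearW => n; split; [exact: mu_on|exact: mu_ge0].
  by have [nu h] := wstar_limit _ L_gt0 ok lP; exists nu.
by move=> /choice[mu muP]; exists mu => t tT; split; [exact: muP|exact: Dl].
Unshelve. all: by end_near. Qed.

(** * Passage to the limit along the subsequence *)

Variables (k : nat -> nat) (mu : R -> smeas R).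
Hypothesis kh : {homo k : m n / (m < n)%N}.
Hypothesis muP : forall t, 0 <= t <= T ->
  [/\ nonneg (mu t), meas_on X (mu t), wstar_cvg L \oo (fun n => mu_ (k n) t) (mu t) &
    {ae leb, forall x, cdf (mu_ (k n) t) x @[n --> \oo] --> cdf (mu t) x}] /\
    forall q : rat, exists l : R, cdf (mu_ (k n) t) (ratr q) @[n --> \oo] --> l.

Let mu0 (t : R) : 0 <= t <= T -> nonneg (mu t). Proof. by move=> /muP[[]]. Qed.
Let muX (t : R) : 0 <= t <= T -> meas_on X (mu t). Proof. by move=> /muP[[]]. Qed.
Let mu_w (t : R) : 0 <= t <= T -> wstar_cvg L \oo (fun n => mu_ (k n) t) (mu t). Proof. by move=> /muP[[]]. Qed.

Let subseq (u : nat -> R) (l : R) : u n @[n --> \oo] --> l -> u (k n) @[n --> \oo] --> l.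
Proof. exact: cvg_comp (cvg_homo_oo kh). Qed.

Let mass (t : R) : 0 <= t <= T -> fine (mu t setT) = M t.
Proof.
move=> tT; have c1 : fine (mu_ (k n) t setT) @[n --> \oo] --> fine (mu t setT).
  apply: (wstar_cvg_mass _ L_gt0 _ (muX tT) (mu0 tT) (mu_w tT)).
  by apply: nearW => n; split; [exact: mu_on|exact: mu_ge0].
by apply: (cvg_unique_ext c1 (subseq (Mn_cvg tT))) => n; exact: mu_mass.
Qed.

(** Increments of mu_eps are nonnegative and have, by [wstar_limit], a nonnegative limit; uniqueness
    identifies it with the increment of [mu]. *)
Lemma limit_measure_inc (s t : R) : 0 <= s -> s <= t -> t <= T -> nonneg (meas_sub (mu t) (mu s)).
Proof.
move=> s0 st tT; have [sT tT'] := sT_ s0 st tT.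
have ok : \forall n \near \oo, meas_on `[0, L] (meas_sub (mu_ (k n) t) (mu_ (k n) s)) /\
    nonneg (meas_sub (mu_ (k n) t) (mu_ (k n) s)).
  by apply: nearW => n; have [h1 h2] := mu_inc (k n) s0 st tT.
have [lt ltP] := choice (muP tT').2; have [ls lsP] := choice (muP sT).2.
have cv q : cdf (meas_sub (mu_ (k n) t) (mu_ (k n) s)) (ratr q) @[n --> \oo] --> lt q - ls q.
  apply: (@cvg_near_ext _ _ _ _ (fun n => cdf (mu_ (k n) t) (ratr q) - cdf (mu_ (k n) s) (ratr q))).
    by apply: nearW => n; exact: cdf_sub.
  by apply: cvgB; [exact: ltP|exact: lsP].
have [nu [nu0 nuX nuw _]] := wstar_limit _ L_gt0 ok cv.
have onB : meas_on X (meas_sub (mu t) (mu s)).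
  move=> A mA; have mAX : measurable (A `\` X) by exact: measurableD.
  suff -> : meas_sub (mu t) (mu s) (A `\` X) = meas_zero (A `\` X) by [].
  apply: (fine_meas_inj mAX); rewrite fineB_meas//.
  by rewrite (muX tT')// (muX sT)//= subr0.
suff e A : measurable A -> nu A = meas_sub (mu t) (mu s) A by move=> A mA; rewrite -e//; exact: nu0.
apply: (wstar_unique L_gt0 nuX onB) => phi cphi.
have bphi := continuous_bmeas L_gt0 cphi.
rewrite nonneg_meas_integral_sub//.
have c1 : meas_integral (mu_ (k n) t) X phi - meas_integral (mu_ (k n) s) X phi @[n --> \oo]
    --> meas_integral (mu t) X phi - meas_integral (mu s) X phi.
  by apply: cvgB; [exact: mu_w|exact: mu_w].
apply: (cvg_unique_ext (nuw _ cphi) c1) => n; exact: nonneg_meas_integral_sub.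
Qed.

Let mu_fine_inc (s t : R) (A : set MR) : 0 <= s -> s <= t -> t <= T -> measurable A ->
  0 <= fine (mu t A) - fine (mu s A) <= a0 / S * (V t - V s).
Proof.
move=> s0 st tT mA; have [sT tT'] := sT_ s0 st tT.
have /andP[h0 h1] := meas_sub_bound (limit_measure_inc s0 st tT) mA.
rewrite h0/=; apply: (le_trans h1); rewrite !mass//.
by have /andP[] := M_inc s0 st tT.
Qed.

Let mu_fine_le (t : R) (A : set MR) : 0 <= t <= T -> measurable A -> 0 <= fine (mu t A) <= M t.
Proof.
move=> tT mA; rewrite fine_ge0 ?mu0//= -mass//; exact: nonneg_mono (mu0 tT) _ _ _.
Qed.

Definition limit_displacement t x : R := w t 0 + sg t * (cdf (mu t) x / a0 + x / a1).
Local Notation u := limit_displacement.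

Let Cmass t : L / a1 + M t / a0 = C t.
Proof. by rewrite /limit_mass mulfK ?gt_eqF//; ring. Qed.

(** The displacement departs from w(t)(0) by a fraction of W(t), the share of compliance found on
    ]0, x]. This is the majorant for dominated convergence. *)
Let un_le n t : 0 <= t <= T -> {ae leb, forall x, D x -> `|u_ n t x - w t 0| <= `|W t|}.
Proof.
move=> tT; have dE := displacementE L_gt0 a0_gt0 a1_gt0 (eps_gt0 n) (eps_a n) w_H1 w_cont (be n) tT.
apply: (lebS dE) => x h Dx; rewrite (h Dx) -/(W t) -/(bt n) -/(Cn n t) addrC addKr.
have cn := Cn_gt0 n tT; have := Dx; rewrite /= in_itv/= => /andP[x0 xL].
rewrite normrM normrM normfV (gtr0_norm cn) -mulrA; apply: ler_piMr => //.
rewrite mulrC ler_pdivrMr// mul1r -[\int[_]_(_ in _) _](mu_cdf n tT Dx).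
have c0 := cdf_ge0 x (mu_ge0 n tT).
have c1 : cdf (mu_ n t) x <= Mn n t.
  by rewrite -mu_mass//; apply: nonneg_mono => //; exact: mu_ge0.
have xa : x / a1 <= L / a1 by rewrite ler_pM2r ?invr_gt0// ltW.
have xa0 : 0 <= x / a1 by rewrite divr_ge0// ltW.
rewrite ger0_norm; last by rewrite addr_ge0// mulr_ge0// ltW.
by rewrite /Cn /total_compliance -/(bt n) -/(Mn n t); apply: lerD => //; rewrite ler_pM2l.
Qed.

Let u_le t x : 0 <= t <= T -> D x -> `|u t x - w t 0| <= `|W t|.
Proof.
move=> tT Dx; have := Dx; rewrite /= in_itv/= => /andP[x0 xL].
rewrite /limit_displacement addrC addKr /limit_stress.
have ct := C_gt0 t.
rewrite normrM normrM normfV (gtr0_norm ct) -mulrA; apply: ler_piMr => //.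
rewrite mulrC ler_pdivrMr// mul1r -Cmass.
have /andP[c0 c1] := mu_fine_le tT (measurable_itv `]-oo, x] : measurable (`]-oo, x]%classic : set MR)).
have xa : x / a1 <= L / a1 by rewrite ler_pM2r ?invr_gt0// ltW.
have xa0 : 0 <= x / a1 by rewrite divr_ge0// ltW.
have ma0 : 0 <= cdf (mu t) x / a0 by rewrite divr_ge0// ltW.
rewrite ger0_norm ?addr_ge0// addrC lerD// ler_pM2r ?invr_gt0//.
Qed.

Let un_cvg t : 0 <= t <= T -> {ae leb, forall x, D x -> u_ (k n) t x @[n --> \oo] --> u t x}.
Proof.
move=> tT; have dE : {ae leb, forall x, forall n, D x -> u_ n t x = w t 0 + W t / Cn n t * (x / a1 + bt n * \int[leb]_(y in `]0, x[) rho n t y)}.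
  apply: ae_forall_count => n.
  exact: (displacementE L_gt0 a0_gt0 a1_gt0 (eps_gt0 n) (eps_a n) w_H1 w_cont (be n) tT).
have [[_ _ _ cE] _] := muP tT.
apply: (lebS (lebI dE cE)) => x [h1 h2] Dx.
apply: (@cvg_near_ext _ _ _ _ (fun n => w t 0 + W t / Cn (k n) t * (x / a1 + bt (k n) * cdf (mu_ (k n) t) x))).
  by apply: nearW => n; rewrite h1// mu_cdf.
rewrite /limit_displacement; apply: cvgD; first exact: cvg_cst.
apply: cvgM.
  apply: cvgM; [exact: cvg_cst|apply: cvgV; [exact: lt0r_neq0|exact: (subseq (Cn_cvg tT))]].
rewrite addrC; apply: cvgD; first exact: cvg_cst.
rewrite mulrC; apply: cvgM; first exact: (subseq bt_cvg).
exact: h2.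
Qed.

Let mcdf (nu : smeas R) : nonneg nu -> measurable_fun (setT : set MR) (cdf nu).
Proof. by move=> nu0; apply: nondecreasing_measurable => // x y; exact: cdf_le. Qed.

Let mu_t t : 0 <= t <= T -> measurable_fun D (u t).
Proof.
move=> tT; apply: measurable_funD; first exact: measurable_cst.
apply: measurable_funM; first exact: measurable_cst.
apply: measurable_funD; last by apply: measurable_funM; [exact: measurable_id|exact: measurable_cst].
apply: measurable_funM; last exact: measurable_cst.
by apply: measurable_funS (mcdf (mu0 tT)).
Qed.

Let Doo : (leb D < +oo)%E. Proof. exact: itv_lty. Qed.

Let cst_D (c : R) : L1 D (fun=> c).
Proof. by apply: (bounded_L1 mD Doo (M := `|c|)) => //; exact: measurable_cst. Qed.

Let un_H1 n t : 0 <= t <= T -> H1 D (u_ n t). Proof. exact: be_u_H1 (be n) t. Qed.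

Let u_L1 t : 0 <= t <= T -> L1 D (u t).
Proof.
move=> tT; apply: (bounded_L1 mD Doo (mu_t tT) (M := `|W t| + `|w t 0|)) => x Dx.
have := u_le tT Dx; have := ler_normD (u t x - w t 0) (w t 0); rewrite subrK; lra.
Qed.

Let un_L1 n t : 0 <= t <= T -> L1 D (u_ n t).
Proof. by move=> tT; apply: L2_L1 => //; exact: (un_H1 n tT).1. Qed.

Let L1_cvg t : 0 <= t <= T -> \int[leb]_(x in D) `|u_ (k n) t x - u t x| @[n --> \oo] --> (0 : R).
Proof.
move=> tT; have z : \int[leb]_(x in D) (0 : R) = 0 by rewrite Rint_eq0//; exact: aeW.
rewrite -[X in _ --> X]z.
apply: (@Rint_dct _ _ _ _ _ _ _ (fun=> 2 * `|W t|)) => //.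
- move=> n; apply: measurableT_comp; first exact: normr_measurable.
  by apply: measurable_funB; [exact: (intgM (un_L1 (k n) tT))|exact: mu_t].
- exact: cst_D.
- apply: (lebS (un_cvg tT)) => x h Dx.
  by rewrite -(normr0 R) -(subrr (u t x)); apply: cvg_norm; apply: cvgB; [exact: h|exact: cvg_cst].
- move=> n; apply: (lebS (un_le (k n) tT)) => x h Dx; rewrite normr_id.
  have := h Dx; have := u_le tT Dx.
  have -> : u_ (k n) t x - u t x = (u_ (k n) t x - w t 0) - (u t x - w t 0) by ring.
  have := ler_normB (u_ (k n) t x - w t 0) (u t x - w t 0); lra.
Qed.

Let bmeasD_of (phi : R -> R) : bmeas X phi -> bmeas D phi.
Proof.
move=> [mphi [N bN]]; split; first by apply: measurable_funS mphi.
by exists N => x Dx; apply: bN; exact: DX.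
Qed.

Let bmeas_test (phi : R -> R) : test_fun D phi -> bmeas X phi.
Proof.
move=> /test_fun_bounded[c1 _ [N [_ [bN _ _]]]]; split; first by apply: measurable_funS (continuous_measurable_fun c1).
by exists N.
Qed.

Let L1_bmeas (f : R -> R) : bmeas D f -> L1 D f.
Proof. by move=> [mf [N bN]]; exact: (bounded_L1 mD Doo mf bN). Qed.

Let flux n t (phi : R -> R) : 0 <= t <= T -> bmeas X phi ->
  \int[leb]_(x in D) (wderiv D (u_ n t) x * phi x)
  = W t / Cn n t * (a1^-1 * \int[leb]_(x in D) phi x + bt n * meas_integral (mu_ n t) X phi).
Proof.
move=> tT bphi; have [mphi [N bN]] := bphi.
have sf := strain_flux L_gt0 a0_gt0 a1_gt0 (eps_gt0 n) (eps_a n) w_H1 w_cont (be n) tT.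
have DXI : X `&` D = D by apply/setIidPr.
rewrite (meas_integral_meas_density mD mX (rho_L1 n tT) mphi bN) DXI.
have iphi := L1_bmeas (bmeasD_of bphi).
have irp : L1 D (fun x => rho n t x * phi x).
  apply: (l_intg_ae_le (g := fun x => N * `|rho n t x|)) => //.
  - apply: measurable_funM; [exact: (intgM (rho_L1 n tT))|exact: (intgM iphi)].
  - by apply: l_intgZ => //; apply: l_intg_abs => //; exact: rho_L1.
  - apply: aeW => x Dx; rewrite normrM mulrC; apply: ler_wpM2r => //; apply: bN; exact: DX.
rewrite (@ae_eq_Rint_nomeas _ _ (fun x => W t / Cn n t * (a1^-1 * phi x + bt n * (rho n t x * phi x)))); last first.
  apply: (lebS sf) => x h Dx; transitivity (W t / Cn n t * (a1^-1 + bt n * rho n t x) * phi x); last by ring.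
  by congr (_ * _); exact: h.
have i1 : L1 D (fun x => a1^-1 * phi x) by exact: l_intgZ.
have i2 : L1 D (fun x => bt n * (rho n t x * phi x)) by exact: l_intgZ.
rewrite RintegralZl//; last exact: l_intgD.
by rewrite RintegralD// !RintegralZl.
Qed.

Let flux_cvg t (phi : R -> R) : 0 <= t <= T -> {within `[0, L], continuous phi} ->
  \int[leb]_(x in D) (wderiv D (u_ (k n) t) x * phi x) @[n --> \oo]
  --> sg t * (a1^-1 * \int[leb]_(x in D) phi x + a0^-1 * meas_integral (mu t) X phi).
Proof.
move=> tT cphi; have bphi := continuous_bmeas L_gt0 cphi.
rewrite (_ : (fun n => _) = fun n => W t / Cn (k n) t * (a1^-1 * \int[leb]_(x in D) phi x + bt (k n) * meas_integral (mu_ (k n) t) X phi)); last first.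
  by apply/funext => n; exact: flux.
apply: cvgM.
  apply: cvgM; [exact: cvg_cst|apply: cvgV; [exact: lt0r_neq0|exact: (subseq (Cn_cvg tT))]].
apply: cvgD; first exact: cvg_cst.
by apply: cvgM; [exact: (subseq bt_cvg)|exact: mu_w].
Qed.

Let un_wL1 n t : 0 <= t <= T -> L1 D (wderiv D (u_ n t)).
Proof. by move=> tT; apply: L2_L1 => //; exact: (wderivP (un_H1 n tT)).1. Qed.

Let un_distr n t : 0 <= t <= T -> distr_deriv_meas D (u_ n t) (meas_density D (wderiv D (u_ n t))).
Proof.
move=> tT; have iw := un_wL1 n tT; split; first exact: meas_density_on.
move=> phi tphi; rewrite (wderivP (un_H1 n tT)).2//.
have [mphi [N bN]] := bmeasD_of (bmeas_test tphi).
by rewrite (meas_integral_meas_density mD mD iw mphi bN) setIid.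
Qed.

Let un_BV n t : 0 <= t <= T -> BVfun D (u_ n t).
Proof. by move=> tT; split; [exact: un_L1|eexists; exact: un_distr]. Qed.

Let un_BVderiv n t (phi : R -> R) : 0 <= t <= T -> bmeas X phi ->
  meas_integral (BVderiv D (u_ n t)) D phi = \int[leb]_(x in D) (wderiv D (u_ n t) x * phi x).
Proof.
move=> tT bphi; have [mphi [N bN]] := bmeasD_of bphi.
rewrite (eq_meas_integral mD (BVderivP (un_distr n tT)) mphi bN).
by rewrite (meas_integral_meas_density mD mD (un_wL1 n tT) mphi bN) setIid.
Qed.

(** Atoms of [mu] at 0 and L are removed: they belong to the relaxed boundary condition and not to
    Du. *)
Let inner_compliance t : smeas R :=
  meas_add (meas_scale a0^-1 (meas_restr (mu t) mD)) (meas_density D (fun=> a1^-1)).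
Let Du t : smeas R := meas_scale (sg t) (inner_compliance t).

Let restr_on (nu : smeas R) : meas_on D (meas_restr nu mD).
Proof.
move=> A mA; rewrite meas_restrE; last exact: measurableD.
by rewrite setDE -setIA setICl setI0 charge0.
Qed.

Let dens_cst_on (c : R) : meas_on D (meas_density D (fun=> c)).
Proof. by apply: meas_density_on => //; exact: cst_D. Qed.

Let Du_on t : meas_on D (Du t).
Proof.
move=> A mA; have mAD : measurable (A `\` D) by exact: measurableD.
suff -> : Du t (A `\` D) = meas_zero (A `\` D) by [].
apply: (fine_meas_inj mAD); rewrite fineZ_meas// fineD_meas// fineZ_meas//.
by rewrite (restr_on _ mA) (dens_cst_on _ mA)/= mulr0 addr0 mulr0.
Qed.

(** Functions that vanish at the ends do not see mass accumulating there, so weak-* convergence on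
    [0, L] can be used for derivatives on ]0, L[. *)
Let meas_integral_vanish (nu : smeas R) (phi : R -> R) : (forall x, X x -> ~ D x -> phi x = 0) ->
  meas_integral nu D phi = meas_integral nu X phi.
Proof.
move=> z; have e : phi \_ D = phi \_ X.
  apply/funext => x; rewrite !patchE; case: ifPn => Dx; case: ifPn => Xx //.
    by move: Xx; rewrite notin_setE => /(_ (DX (set_mem Dx))).
  by rewrite z//; [exact: set_mem|move: Dx; rewrite notin_setE].
have r m : Rintegral m D phi = Rintegral m X phi by rewrite Rintegral_mkcond e -Rintegral_mkcond.
by rewrite /meas_integral !r.
Qed.

Let Du_integral t (phi : R -> R) : 0 <= t <= T -> bmeas X phi -> (forall x, X x -> ~ D x -> phi x = 0) ->
  meas_integral (Du t) D phi = sg t * (a1^-1 * \int[leb]_(x in D) phi x + a0^-1 * meas_integral (mu t) X phi).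
Proof.
move=> tT bphi z; have bD := bmeasD_of bphi; have [mphi [N bN]] := bD.
rewrite meas_integral_scale_bmeas// meas_integral_add_bmeas// meas_integral_scale_bmeas//.
rewrite (meas_integral_meas_density mD mD (cst_D _) mphi bN) setIid addrC RintegralZl//; last exact: L1_bmeas.
rewrite -(meas_integral_vanish _ z); congr (_ * (_ + _ * _)).
apply: meas_integral_eq_on => //; last by move=> A mA AD; rewrite meas_restrE//; congr (mu t _); apply/setIidPl.
  by move=> A mA; rewrite meas_restrE//; apply: mu0 => //; exact: measurableI.
exact: mu0.
Qed.

Let test_out (phi : R -> R) : test_fun D phi -> forall x, X x -> ~ D x -> phi x = 0.
Proof. by move=> tphi x _ nD; have [] := test_fun_out tphi nD. Qed.

(** The weak derivative identity of [u_ (k n)] passes to the limit: the left-hand side by L^1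
    convergence, the right-hand side by [flux_cvg]. *)
Let u_distr t : 0 <= t <= T -> distr_deriv_meas D (u t) (Du t).
Proof.
move=> tT; split; first exact: Du_on.
move=> phi tphi; have [c1 c2 [N [N0 [b1 b2 _]]]] := test_fun_bounded tphi.
rewrite Du_integral//; [|exact: bmeas_test|exact: test_out].
have cv := flux_cvg tT (continuous_subspaceT c1).
have iprod (f : R -> R) : L1 D f -> L1 D (fun x => f x * derive1 phi x).
  move=> i; apply: (l_intg_ae_le (g := fun x => N * `|f x|)) => //.
  - apply: measurable_funM; [exact: (intgM i)|].
    by apply: measurable_funS (continuous_measurable_fun c2).
  - by apply: l_intgZ => //; apply: l_intg_abs.
  - by apply: aeW => x Dx; rewrite normrM mulrC; apply: ler_wpM2r.
have cvu : \int[leb]_(x in D) (u_ (k n) t x * derive1 phi x) @[n --> \oo] --> \int[leb]_(x in D) (u t x * derive1 phi x).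
  have iun n := un_L1 n tT; have iu := u_L1 tT.
  have b n : `|\int[leb]_(x in D) (u_ (k n) t x * derive1 phi x) - \int[leb]_(x in D) (u t x * derive1 phi x)|
     <= N * \int[leb]_(x in D) `|u_ (k n) t x - u t x|.
    have idf : L1 D (fun x => u_ (k n) t x - u t x) by exact: (l_intgB mD (iun (k n)) iu).
    rewrite -RintegralB//; [|exact: iprod|exact: iprod].
    rewrite -RintegralZl//; last exact: l_intg_abs.
    apply: Rint_norm_le => //.
    - by apply: (intgM (mu := leb)); apply: l_intgB => //; exact: iprod.
    - by apply: l_intgZ => //; exact: l_intg_abs.
    - by apply: aeW => x Dx; rewrite -mulrBl normrM mulrC; apply: ler_wpM2r.
  apply/cvgrPdist_le => e e0; have eN : 0 < e / N by exact: divr_gt0.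
  have h := @cvgr_dist_le _ _ _ _ _ _ _ (L1_cvg tT) _ eN; near=> n.
  rewrite distrC; apply: (le_trans (b n)); rewrite mulrC -ler_pdivlMr//.
  have : `|0 - \int[leb]_(x in D) `|u_ (k n) t x - u t x| | <= e / N by near: n; exact: h.
  by rewrite sub0r normrN => h'; apply: le_trans h'; exact: ler_norm.
have cvN : (- \int[leb]_(x in D) (wderiv D (u_ (k n) t) x * phi x)) @[n --> \oo]
  --> - (sg t * (a1^-1 * \int[leb]_(x in D) phi x + a0^-1 * meas_integral (mu t) X phi)) by apply: cvgN; exact: cv.
apply: (cvg_unique_ext cvu cvN) => n.
by rewrite (wderivP (un_H1 (k n) tT)).2.
Unshelve. all: by end_near. Qed.

Let u_BV t : 0 <= t <= T -> BVfun D (u t).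
Proof. by move=> tT; split; [exact: u_L1|eexists; exact: u_distr]. Qed.

Lemma displacement_cvg t : 0 <= t <= T -> wstar_BV_cvg L (fun n => u_ (k n) t) (u t).
Proof.
move=> tT; split; [by move=> n; exact: un_BV|exact: u_BV|exact: L1_cvg|].
move=> phi cphi p0 pL; have bphi := continuous_bmeas L_gt0 cphi.
have z x : X x -> ~ D x -> phi x = 0.
  rewrite /= !in_itv/= => /andP[x0 xL] /negP; rewrite negb_and -!leNgt => /orP[h|h].
    by have -> : x = 0 by apply/eqP; rewrite eq_le h.
  by have -> : x = L by apply/eqP; rewrite eq_le h xL.
have [mphi [N bN]] := bmeasD_of bphi.
rewrite (eq_meas_integral mD (BVderivP (u_distr tT)) mphi bN) Du_integral//.
by apply: cvg_near_ext (flux_cvg tT cphi); apply: nearW => n; exact: un_BVderiv.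
Qed.

Lemma plastic_cvg t : 0 <= t <= T ->
  wstar_cvg L \oo (fun n => meas_scale (stress L (u_ (k n) t) (a_ (k n) t) / a0) (damage_meas L (eps (k n)) (Theta_ (k n) t)))
    (meas_scale (sg t / a0) (mu t)).
Proof.
move=> tT phi cphi; have bphi := continuous_bmeas L_gt0 cphi.
rewrite meas_integral_scale_bmeas//.
apply: (@cvg_near_ext _ _ _ _ (fun n => sgn (k n) t / a0 * meas_integral (mu_ (k n) t) X phi)).
  by apply: nearW => n; rewrite meas_integral_scale_bmeas.
apply: cvgM; last exact: mu_w.
by apply: cvgM; [exact: (subseq (limit_stress_cvg tT))|exact: cvg_cst].
Qed.

Let Theta01 n t : 0 <= t <= T -> {ae leb, forall x, D x -> 0 <= Theta_ n t x <= 1}.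
Proof. by move=> tT; exact: (be_Theta_Linf (be n) tT).2. Qed.

Let Theta_L2 n t : 0 <= t <= T -> L2 D (Theta_ n t).
Proof.
move=> tT; apply: (L2_le mD (be_Theta_Linf (be n) tT).1 (L2_1 mD Doo)).
by apply: (lebS (Theta01 n tT)) => x h Dx; have /andP[h0 h1] := h Dx; rewrite normr1 ger0_norm.
Qed.

(** From 0 <= Theta <= 1 follows (1 - Theta)^2 <= 1 - Theta = eps rho, and the mass of rho
    converges: Theta tends to 1 strongly in L^2. *)
Let Theta_cvg t : 0 <= t <= T -> norm2 D (fun x => Theta_ n t x - 1) @[n --> \oo] --> 0.
Proof.
move=> tT; have L2T1 n : L2 D (fun x => Theta_ n t x - 1) by exact: (L2B mD (Theta_L2 n tT) (L2_1 mD Doo)).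
rewrite -[X in _ --> X](@sqrtr0 R) /norm2; apply: continuous_cvg; first exact: sqrt_continuous.
apply: (@squeeze_cvgr _ _ _ _ (fun=> 0) (fun n => eps n * Mn n t)); last first.
- by rewrite -(mul0r (M t)); apply: cvgM; [exact: eps_cvg0|exact: Mn_cvg].
- exact: cvg_cst.
apply: nearW => n; apply/andP; split.
  by apply: ae_Rint_ge0 => //; [exact: (intgM (L2T1 n).2)|apply: aeW => x _; exact: sqr_ge0].
rewrite /Mn -RintegralZl//; last exact: rho_L1.
apply: ae_le_Rint => //; [exact: (L2T1 n).2|by apply: l_intgZ => //; exact: rho_L1|].
apply: (lebS (Theta01 n tT)) => x h Dx; have /andP[h0 h1] := h Dx.
rewrite /rho mulrCA mulfV ?gt_eqF// mulr1 -sqrrN opprB expr2.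
have y0 : 0 <= 1 - Theta_ n t x by rewrite subr_ge0.
by apply: ler_piMr => //; rewrite lerBlDr lerDl.
Qed.

Lemma elastic_cvg t : 0 <= t <= T ->
  weak_L2_cvg D (fun n x => stress L (u_ (k n) t) (a_ (k n) t) / a1 * Theta_ (k n) t x) (fun=> sg t / a1).
Proof.
move=> tT; split.
- by move=> n; apply: L2Z => //; exact: Theta_L2.
- by have := L2Z (sg t / a1) mD (L2_1 mD Doo); congr L2; apply/funext => x; rewrite mulr1.
- move=> g Lg; have c1 := @norm2_cvg_Rint _ _ _ _ _ (L2_1 mD Doo) (fun n => Theta_L2 n tT) Lg (Theta_cvg tT).
  have -> : \int[leb]_(x in D) (sg t / a1 * g x) = sg t / a1 * \int[leb]_(x in D) (1 * g x).
    by rewrite RintegralZl//; [under [in RHS]eq_Rintegral do rewrite mul1r|exact: L2_L1].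
  apply: (@cvg_near_ext _ _ _ _ (fun n => sgn (k n) t / a1 * \int[leb]_(x in D) (Theta_ (k n) t x * g x))).
    apply: nearW => n; rewrite -RintegralZl//; last by apply: L2M => //; exact: Theta_L2.
    by under eq_Rintegral do rewrite -mulrA.
  apply: cvgM; last exact: (subseq c1).
  by apply: cvgM; [exact: (subseq (limit_stress_cvg tT))|exact: cvg_cst].
Qed.

Let DuE t (A : set MR) : measurable A -> A `<=` D ->
  fine (Du t A) = sg t * (a0^-1 * fine (mu t A) + a1^-1 * fine (leb A)).
Proof.
move=> mA AD; rewrite fineZ_meas// fineD_meas// fineZ_meas// meas_restrE// meas_density_cst//=.
by have -> : A `&` D = A by exact/setIidPl.
Qed.

Lemma additive_decomposition t : 0 <= t <= T ->
  meas_eq_on D (BVderiv D (u t)) (meas_add (meas_density D (fun=> sg t / a1)) (meas_scale (sg t / a0) (mu t))).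
Proof.
move=> tT A mA AD; rewrite (BVderivP (u_distr tT))//; apply: fine_meas_inj => //.
rewrite DuE// fineD_meas// fineZ_meas// meas_density_cst//=.
have -> : A `&` D = A by exact/setIidPl.
by ring.
Qed.

Lemma compliance_law t : 0 <= t <= T ->
  meas_eq_on D (BVderiv D (u t)) (meas_scale (sg t) (compliance L a0 a1 (mu t))).
Proof.
move=> tT A mA AD; rewrite (BVderivP (u_distr tT))//; apply: fine_meas_inj => //.
rewrite DuE// fineZ_meas// fineD_meas// fineZ_meas// meas_density_cst//=.
by have -> : A `&` D = A by exact/setIidPl.
Qed.

Let fine_setI1 (nu : smeas R) (A : set MR) (a : R) : fine (nu (A `&` [set a])) = \1_A a * fine (nu [set a]).
Proof.
have [Aa|nA] := pselect (A a).
  rewrite indic_in// mul1r; congr (fine (nu _)); apply/seteqP; split => [x []//|x /= ->]; by split.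
rewrite indic_notin// mul0r (_ : _ `&` _ = set0) ?charge0// -subset0 => x [Ax /= xa].
by apply: nA; rewrite -xa.
Qed.

Let fine_pair (nu : smeas R) (A : set MR) : A `<=` [set 0; L] -> measurable A ->
  fine (nu A) = \1_A 0 * fine (nu [set (0 : R)]) + \1_A L * fine (nu [set L]).
Proof.
move=> A0L mA; rewrite -!fine_setI1.
have m1 : measurable (A `&` [set (0 : R)]) by apply: measurableI => //; exact: measurable_set1.
have m2 : measurable (A `&` [set L]) by apply: measurableI => //; exact: measurable_set1.
have d : (A `&` [set (0 : R)]) `&` (A `&` [set L]) = set0.
  by rewrite -subset0 => x [[_ /= x0] [_ /= xL]]; move: L_gt0; rewrite -xL x0 ltxx.
have -> : nu A = (nu (A `&` [set (0%R : R)]) + nu (A `&` [set L]))%E.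
  rewrite -chargeU// -setIUr; congr (nu _); apply/seteqP; split => x; first by move=> Ax; split => //; exact: A0L.
  by move=> [].
by rewrite fineD//; exact: fin_num_measure.
Qed.

Let dirac1 (a b : R) : fine (meas_dirac a [set b]) = (a == b)%:R.
Proof.
change (fine (@dirac _ MR a R [set b]) = (a == b)%:R); rewrite diracE/=.
by have [->|/eqP ab] := eqVneq a b; [rewrite mem_set|rewrite memNset].
Qed.

(** The inner trace already includes the jump carried by the atom of [mu] at 0, since the
    distribution function is right-continuous. *)
Let traceL_u t : 0 <= t <= T -> traceL 0 (u t) = w t 0 + sg t / a0 * fine (mu t [set 0]).
Proof.
move=> tT; have c0 : cdf (mu t) 0 = fine (mu t [set (0 : R)]).
  rewrite /cdf (charge_meas_on mX (measurable_itv _) (muX tT)); congr (fine (mu t _)).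
  apply/seteqP; split => x /=; rewrite !in_itv/=.
    by move=> [x0 /andP[x1 _]]; apply/eqP; rewrite eq_le x0.
  by move=> ->; rewrite lexx ltW.
apply: (traceLE L_gt0 (u_L1 tT)) => e e0; have S1 : 0 < S + 1 by rewrite addr_gt0.
have e1 : 0 < e / 2 / (S + 1) * a0 by rewrite !(mulr_gt0, invr_gt0).
have [d d0 dP] := cdf_right 0 (mu0 tT) e1.
have e2 : 0 < e / 2 / (S + 1) * a1 by rewrite !(mulr_gt0, invr_gt0).
exists (Num.min d (e / 2 / (S + 1) * a1)); first by rewrite lt_min d0.
move=> x; rewrite add0r lt_min => /and3P[x0 xd xe].
have := dP x; rewrite add0r x0 xd c0 => /(_ isT) h.
have -> : u t x - (w t 0 + sg t / a0 * fine (mu t [set 0])) = sg t * ((cdf (mu t) x - fine (mu t [set 0])) / a0 + x / a1).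
  by rewrite /limit_displacement; ring.
rewrite normrM.
have h2 : `|(cdf (mu t) x - fine (mu t [set 0])) / a0 + x / a1| <= e / (S + 1).
  apply: (le_trans (ler_normD _ _)); have -> : e / (S + 1) = e / 2 / (S + 1) + e / 2 / (S + 1) by field; rewrite gt_eqF.
  apply: lerD; first by rewrite normrM normfV (gtr0_norm a0_gt0) ler_pdivrMr.
  by rewrite ger0_norm ?divr_ge0 ?ltW// ltr_pdivrMr.
apply: (@le_trans _ _ ((S + 1) * (e / (S + 1)))); last by rewrite mulrCA mulfV ?mulr1// gt_eqF.
by apply: ler_pM => //; apply: (le_trans (sg_le tT)); rewrite lerDl.
Qed.

(** From the left only the mass of [0, L[ is seen. With w(L) = w(0) + sg C the missing part is the
    jump at L, carried by the atom there. *)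
Let traceR_u t : 0 <= t <= T -> traceR L (u t) = w t L - sg t / a0 * fine (mu t [set L]).
Proof.
move=> tT; set m := fine (mu t `]-oo, L[%classic).
have mE : m = M t - fine (mu t [set L]).
  have m1 : measurable (`]-oo, L[%classic : set MR) by exact: measurable_itv.
  have m2 : measurable ([set L] : set MR) by exact: measurable_set1.
  have d : `]-oo, L[%classic `&` [set L] = set0 :> set MR.
    by rewrite -subset0 => x [/=]; rewrite in_itv/= => xL xE; rewrite xE ltxx in xL.
  have -> : M t = fine (mu t (`]-oo, L[%classic `|` [set L])).
    rewrite -mass// (charge_meas_on mX measurableT (muX tT)) (charge_meas_on mX (measurableU _ _ m1 m2) (muX tT)).
    congr (fine (mu t _)); apply/seteqP; split => x [] //= _ xX; split => //.
    move: xX; rewrite !in_itv/= => /andP[_]; rewrite le_eqVlt => /orP[/eqP ->|]; [by right|by left].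
  by rewrite chargeU// fineD ?fin_num_measure// addrK.
have lE : w t L - sg t / a0 * fine (mu t [set L]) = w t 0 + sg t * (m / a0 + L / a1).
  have -> : w t L = w t 0 + sg t * C t by rewrite /limit_stress mulfVK ?gt_eqF// /W addrC subrK.
  by rewrite -Cmass mE; field; rewrite !gt_eqF.
rewrite lE; apply: (traceRE L_gt0 (u_L1 tT)) => e e0; have S1 : 0 < S + 1 by rewrite addr_gt0.
have e1 : 0 < e / 2 / (S + 1) * a0 by rewrite !(mulr_gt0, invr_gt0).
have [d d0 dP] := cdf_left L (mu0 tT) e1.
have e2 : 0 < e / 2 / (S + 1) * a1 by rewrite !(mulr_gt0, invr_gt0).
exists (Num.min d (e / 2 / (S + 1) * a1)); first by rewrite lt_min d0.
move=> x /andP[xd xL]; rewrite ltrBlDr -ltrBlDl lt_min in xd; have /andP[xd' xe] := xd.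
have := dP x; rewrite xL andbT -/m ltrBlDr -ltrBlDl xd' => /(_ isT) h.
have -> : u t x - (w t 0 + sg t * (m / a0 + L / a1)) = sg t * ((cdf (mu t) x - m) / a0 - (L - x) / a1).
  by rewrite /limit_displacement; ring.
rewrite normrM.
have h2 : `|(cdf (mu t) x - m) / a0 - (L - x) / a1| <= e / (S + 1).
  apply: (le_trans (ler_normB _ _)); have -> : e / (S + 1) = e / 2 / (S + 1) + e / 2 / (S + 1) by field; rewrite gt_eqF.
  apply: lerD; first by rewrite normrM normfV (gtr0_norm a0_gt0) ler_pdivrMr.
  by rewrite ger0_norm; [rewrite ler_pdivrMr// ltW|rewrite divr_ge0 ?subr_ge0 ?ltW].
apply: (@le_trans _ _ ((S + 1) * (e / (S + 1)))); last by rewrite mulrCA mulfV ?mulr1// gt_eqF.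
by apply: ler_pM => //; apply: (le_trans (sg_le tT)); rewrite lerDl.
Qed.

Lemma relaxed_dirichlet t : 0 <= t <= T ->
  meas_eq_on [set 0; L] (meas_scale (sg t / a0) (mu t))
    (meas_sub (meas_scale (w t L - traceR L (u t)) (meas_dirac L))
              (meas_scale (w t 0 - traceL 0 (u t)) (meas_dirac 0))).
Proof.
move=> tT A mA A0L; apply: fine_meas_inj => //; rewrite !(fine_pair _ A0L mA).
have m0 : measurable ([set 0] : set MR) by exact: measurable_set1.
have mL : measurable ([set L] : set MR) by exact: measurable_set1.
rewrite !fineB_meas// !fineZ_meas// !dirac1 !eqxx (gt_eqF L_gt0) (lt_eqF L_gt0) traceR_u// traceL_u//.
by rewrite /=; ring.
Qed.

Lemma equilibrium_law t (phi : R -> R) : H10 D phi -> - (\int[leb]_(x in D) (sg t * wderiv D phi x)) = 0.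
Proof.
move=> hphi; have [e _] := H10_FTC L_gt0 hphi.
rewrite RintegralZl//; first by rewrite e mulr0 oppr0.
by apply: L2_L1 => //; exact: (wderivP hphi.1).1.
Qed.

(** * Absolute continuity in time *)

Let K1 : R := 2 / (L / a1).
Let K1_ge0 : 0 <= K1. Proof. by rewrite divr_ge0// ltW. Qed.
Let aS_ge0 : 0 <= a0 / S. Proof. by rewrite divr_ge0// ltW. Qed.

Let dV_norm (s t : R) : 0 <= s -> s <= t -> t <= T -> `|V t - V s| = V t - V s.
Proof. by move=> s0 st tT; rewrite ger0_norm//; apply: le_trans (WV s0 st tT). Qed.

Let TT : 0 <= T <= T. Proof. by rewrite lexx ltW. Qed.

Let C_leT t : 0 <= t <= T -> C t <= C T.
Proof. by move=> /andP[t0 tT]; have /andP[] := C_inc t0 tT (lexx T). Qed.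

Let M_le t : 0 <= t <= T -> 0 <= M t <= C T * a0.
Proof.
move=> tT; rewrite /limit_mass; apply/andP; split.
  by apply: mulr_ge0; [rewrite subr_ge0; exact: C_ge|exact: ltW].
by rewrite ler_pM2r//; have := C_leT tT; have := La1; lra.
Qed.

Lemma stress_AC : abs_continuous Rdist T sg.
Proof.
apply: (abs_continuous_dominated (K := K1) V_AC) => // s t s0 st tT.
by rewrite /Rdist distrC dV_norm//; exact: sg_inc.
Qed.

Lemma elastic_AC : abs_continuous Rdist T (fun t => sg t / a1).
Proof.
have K0 : 0 <= K1 / a1 by rewrite divr_ge0// ltW.
apply: (abs_continuous_dominated (K := K1 / a1) V_AC) => // s t s0 st tT.
rewrite /Rdist distrC dV_norm// -mulrBl normrM normfV (gtr0_norm a1_gt0) mulrAC ler_pM2r ?invr_gt0//.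
exact: sg_inc.
Qed.

Lemma measure_AC : abs_continuous meas_dist T mu.
Proof.
have K0 : 0 <= 2 * (a0 / S) by rewrite mulr_ge0.
apply: (abs_continuous_dominated (K := 2 * (a0 / S)) V_AC) => // s t s0 st tT.
rewrite dV_norm// -mulrA; apply: meas_norm_le => A mA; rewrite fineB_meas// distrC.
by have /andP[h0 h1] := mu_fine_inc s0 st tT mA; rewrite ger0_norm.
Qed.

(* The increment of a product is split as (x - x') y + x' (y - y'). *)
Let prod_inc (x x' y y' cx cy dx dy : R) : `|x - x'| <= dx -> `|y| <= cy -> `|x'| <= cx -> `|y - y'| <= dy ->
  `|x * y - x' * y'| <= dx * cy + cx * dy.
Proof.
move=> h1 h2 h3 h4; have -> : x * y - x' * y' = (x - x') * y + x' * (y - y') by ring.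
by apply: (le_trans (ler_normD _ _)); rewrite !normrM; apply: lerD; apply: ler_pM.
Qed.

Lemma plastic_AC : abs_continuous meas_dist T (fun t => meas_scale (sg t / a0) (mu t)).
Proof.
pose K2 := (K1 * (C T * a0) + S * (a0 / S)) / a0.
have CT := C_gt0 T.
have K20 : 0 <= K2.
  apply: divr_ge0; last exact: ltW.
  by apply: addr_ge0; apply: mulr_ge0 => //; [apply: mulr_ge0; exact: ltW|exact: ltW].
have K0 : 0 <= 2 * K2 by rewrite mulr_ge0.
apply: (abs_continuous_dominated (K := 2 * K2) V_AC) => // s t s0 st tT.
have [sT tT'] := sT_ s0 st tT.
rewrite dV_norm// -mulrA; apply: meas_norm_le => A mA; rewrite fineB_meas// !fineZ_meas//.
have -> : sg s / a0 * fine (mu s A) - sg t / a0 * fine (mu t A) = (sg s * fine (mu s A) - sg t * fine (mu t A)) / a0 by ring.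
have -> : K2 * (V t - V s) = (K1 * (V t - V s) * (C T * a0) + S * (a0 / S * (V t - V s))) / a0 by rewrite /K2; ring.
rewrite normrM normfV (gtr0_norm a0_gt0) ler_pM2r ?invr_gt0//.
have /andP[m0 m1] := mu_fine_le sT mA; have /andP[m2 m3] := M_le sT.
have /andP[h0 h1] := mu_fine_inc s0 st tT mA.
apply: prod_inc.
- by rewrite distrC; exact: sg_inc.
- by rewrite ger0_norm//; exact: le_trans m3.
- exact: sg_le.
- by rewrite distrC ger0_norm.
Qed.

Let int_test (f phi : R -> R) : L1 D f -> test_fun D phi -> L1 D (fun x => f x * derive1 phi x).
Proof.
move=> i tphi; have [c1 c2 [N [N0 [b1 b2 _]]]] := test_fun_bounded tphi.
apply: (l_intg_ae_le (g := fun x => N * `|f x|)) => //.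
- apply: measurable_funM; [exact: (intgM i)|].
  by apply: measurable_funS (continuous_measurable_fun c2).
- by apply: l_intgZ => //; apply: l_intg_abs.
- by apply: aeW => x Dx; rewrite normrM mulrC; apply: ler_wpM2r.
Qed.

Let u_distrB s t : 0 <= s <= T -> 0 <= t <= T ->
  distr_deriv_meas D (fun x => u s x - u t x) (meas_sub (Du s) (Du t)).
Proof.
move=> sT tT; split.
  move=> A mA; have mAD : measurable (A `\` D) by exact: measurableD.
  suff -> : meas_sub (Du s) (Du t) (A `\` D) = meas_zero (A `\` D) by [].
  by apply: (fine_meas_inj mAD); rewrite fineB_meas// (Du_on s mA) (Du_on t mA)/= subr0.
move=> phi tphi; have bphi := bmeasD_of (bmeas_test tphi).
rewrite nonneg_meas_integral_sub// opprB.
have /= [_ h1] := u_distr sT; have /= [_ h2] := u_distr tT.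
have is1 := int_test (u_L1 sT) tphi; have is2 := int_test (u_L1 tT) tphi.
under eq_Rintegral do rewrite mulrBl.
by rewrite RintegralB// h1// h2// opprK addrC.
Qed.

(** [K1 * C T] bounds the effect of the change of stress, and 1 is the product of S and 1 / S from
    the change of compliance. *)
Let K2 := K1 * C T + 1.
Let K2_ge0 : 0 <= K2. Proof. by rewrite addr_ge0// mulr_ge0// ltW. Qed.

(** Used twice: for pointwise values, with the mass of ]-oo, x] and l = x, and for values of Du on a
    set, with its mass and its length. *)
Let strain_inc (s t m m' l : R) : 0 <= s -> s <= t -> t <= T -> 0 <= m <= M s -> 0 <= m' - m <= a0 / S * (V t - V s) ->
  0 <= l <= L -> `|sg s * (m / a0 + l / a1) - sg t * (m' / a0 + l / a1)| <= K2 * (V t - V s).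
Proof.
move=> s0 st tT /andP[m0 mM] /andP[d0 d1] /andP[l0 lL]; have [sT tT'] := sT_ s0 st tT.
have -> : K2 * (V t - V s) = K1 * (V t - V s) * C T + S * ((V t - V s) / S).
  by rewrite /K2; field; rewrite gt_eqF.
apply: prod_inc.
- by rewrite distrC; exact: sg_inc.
- rewrite ger0_norm; last by rewrite addr_ge0// divr_ge0// ltW.
  apply: le_trans (C_leT sT); rewrite -Cmass addrC; apply: lerD; first by rewrite ler_pM2r ?invr_gt0.
  by rewrite ler_pM2r ?invr_gt0.
- exact: sg_le.
- have -> : m / a0 + l / a1 - (m' / a0 + l / a1) = - ((m' - m) / a0) by ring.
  rewrite normrN ger0_norm; last by rewrite divr_ge0// ltW.
  by rewrite ler_pdivrMr// (_ : _ * a0 = a0 / S * (V t - V s))//; ring.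
Qed.

Lemma displacement_AC : abs_continuous (BVdist D) T u.
Proof.
have K0 : 0 <= (1 + K2) * L + 2 * K2.
  by apply: addr_ge0; [apply: mulr_ge0; [exact: addr_ge0|exact: ltW]|exact: mulr_ge0].
apply: (abs_continuous_dominated (K := (1 + K2) * L + 2 * K2) V_AC) => // s t s0 st tT.
have [sT tT'] := sT_ s0 st tT.
rewrite dV_norm// /BVdist mulrDl; apply: lerD.
  have -> : (1 + K2) * L * (V t - V s) = \int[leb]_(x in D) ((1 + K2) * (V t - V s)).
    by rewrite Rintegral_cst//= fine_itvoo ?ltW// subr0; ring.
  apply: ae_le_Rint => //; [by apply: l_intg_abs => //; apply: l_intgB => //; exact: u_L1|exact: cst_D|].
  apply: aeW => x Dx; have := Dx; rewrite /= in_itv/= => /andP[x0 xL].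
  have mx : measurable (`]-oo, x]%classic : set MR) by exact: measurable_itv.
  have xl : 0 <= x <= L by rewrite !ltW.
  have h := strain_inc s0 st tT (mu_fine_le sT mx) (mu_fine_inc s0 st tT mx) xl.
  rewrite mulrDl mul1r; have := w0V s0 st tT; rewrite distrC => hw.
  have -> : u s x - u t x = (w s 0 - w t 0) + (sg s * (cdf (mu s) x / a0 + x / a1) - sg t * (cdf (mu t) x / a0 + x / a1)).
    by rewrite /limit_displacement; ring.
  by apply: (le_trans (ler_normD _ _)); exact: lerD.
rewrite -mulrA; apply: (meas_norm_BVderiv (u_distrB sT tT')) => A mA.
have mAD : measurable (A `&` D) by exact: measurableI.
rewrite fineB_meas// !fineZ_meas// !fineD_meas// !fineZ_meas// !meas_restrE// meas_density_cst//=.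
have l0 : 0 <= fine (leb (A `&` D)) <= L.
  have lD : (leb (A `&` D) <= leb D)%E by apply: le_measure; rewrite ?inE//; exact: subIsetr.
  have DL : fine (leb D) = L by rewrite fine_itvoo ?ltW// subr0.
  rewrite fine_ge0//= -[leRHS]DL; apply: fine_le => //; rewrite ge0_fin_numE//.
  exact: le_lt_trans lD Doo.
have := strain_inc s0 st tT (mu_fine_le sT mAD) (mu_fine_inc s0 st tT mAD) l0.
by rewrite ![_ / a0]mulrC ![_ / a1]mulrC.
Qed.

(** * Evolution of the effective compliance *)

Local Notation c := (fun t : R => compliance L a0 a1 (mu t)).

Let compliance_sub (s t : R) (A : set MR) : measurable A ->
  fine (meas_sub (c s) (c t) A) = a0^-1 * (fine (mu s A) - fine (mu t A)).
Proof. by move=> mA; rewrite fineB_meas// !fineD_meas// !fineZ_meas//; ring. Qed.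

Let dens0 : nonneg (meas_density D (fun=> a1^-1)).
Proof.
apply: (meas_density_nonneg mD (cst_D _)).
by apply: aeW => x _; rewrite invr_ge0 ltW.
Qed.

Lemma compliance_nonneg t : 0 <= t <= T -> nonneg (c t).
Proof.
move=> tT; apply: nonneg_fine => A mA; rewrite fineD_meas// fineZ_meas//.
apply: addr_ge0; last by rewrite fine_ge0//; exact: dens0.
by apply: mulr_ge0; [rewrite invr_ge0 ltW|rewrite fine_ge0//; exact: mu0].
Qed.

Lemma compliance_on t : 0 <= t <= T -> meas_on X (c t).
Proof.
move=> tT A mA; have mAX : measurable (A `\` X) by exact: measurableD.
suff -> : c t (A `\` X) = meas_zero (A `\` X) by [].
apply: (fine_meas_inj mAX); rewrite fineD_meas// fineZ_meas// (muX tT mA)/= mulr0 add0r.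
by rewrite (meas_onS mD mX DX (@dens_cst_on _) mA).
Qed.

Lemma compliance_mono s t : 0 <= s -> s <= t -> t <= T -> meas_le (c s) (c t).
Proof.
move=> s0 st tT A mA; have [sT tT'] := sT_ s0 st tT.
have : 0 <= fine (meas_sub (c t) (c s) A).
  rewrite compliance_sub//; have /andP[h _] := mu_fine_inc s0 st tT mA.
  by apply: mulr_ge0 => //; rewrite invr_ge0 ltW.
by rewrite fineB_meas// subr_ge0 -lee_fin !fineK// fin_num_measure.
Qed.

(** If the load after [s] never exceeds S C(s), the running maximum does not push the compliance
    above its value at [s]. *)
Let C_const (s t : R) : 0 <= s -> s <= t -> t <= T -> (forall r, s <= r -> r <= t -> `|W r| <= S * C s) -> C t = C s.
Proof.
move=> s0 st tT h; have [sT tT'] := sT_ s0 st tT; have /andP[c1 _] := C_inc s0 st tT.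
apply/eqP; rewrite eq_le c1 andbT ge_max C_ge/= ler_pdivrMr// mulrC.
apply: mm_le => // r r0 rt; have [rs|sr] := leP r s; last exact: h (ltW sr) rt.
have h1 := mm_ge sT r0 rs; apply: (le_trans h1); rewrite mulrC -ler_pdivrMr//.
by rewrite le_max lexx orbT.
Qed.

Let near_dist (t d : R) : 0 < d -> \forall s \near t^', `|s - t| < d.
Proof.
move=> d0; have : \forall s \near t, `|s - t| < d.
  by near=> s; rewrite distrC; near: s; exact: (@nbhsx_ballx _ R).
exact: cvg_within.
Unshelve. all: by end_near. Qed.

(** [g] is the distance of |W| from the critical load. Near [t] the variation of V is below g / 2: W
    and S C each move by less than that, so the critical load is not reached on either side of
    [t]. *)
Let C_locally_const (t : R) : 0 < t < T -> `|sg t| < S -> \forall s \near t^', C s = C t.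
Proof.
move=> /andP[t0 tT] sub; pose g := S * C t - `|W t|.
have tT' : 0 <= t <= T by rewrite !ltW.
have g0 : 0 < g.
  by rewrite subr_gt0 -ltr_pdivrMr//; move: sub; rewrite normrM normfV (gtr0_norm (C_gt0 t)).
have g2 : 0 < g / 2 by rewrite divr_gt0.
have [d d0 dV] := abs_continuous_cont V_AC g2.
near=> s; have sd : `|s - t| < d by near: s; exact: near_dist.
have [/andP[s0 sT] _] : 0 <= s <= T /\ s != t by near: s; apply: near_dnbhs_itv; rewrite t0.
have [st|ts] := leP s t.
  have dd : t - s < d by rewrite -normrN opprB in sd; exact: le_lt_trans (ler_norm _) sd.
  have := dV _ _ s0 st (ltW tT) dd; rewrite distrC dV_norm// ?ltW// => dVg.
  apply/esym; apply: C_const => //; first exact: ltW.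
  move=> r sr rt; have r0 := le_trans s0 sr.
  have w1 := WV r0 rt (ltW tT); have w2 := ler_normD (W t) (W r - W t); rewrite addrC subrK (distrC (W r)) in w2.
  have w3 : V s <= V r by rewrite -subr_ge0; apply: le_trans (WV s0 sr (le_trans rt (ltW tT))).
  have /andP[_ c2] := C_inc s0 st (ltW tT).
  have c3 : S * C t <= S * C s + (V t - V s).
    have -> : S * C s + (V t - V s) = S * (C s + (V t - V s) / S) by field; rewrite gt_eqF.
    by rewrite ler_pM2l.
  by move: dVg; rewrite /g; lra.
have dd : s - t < d by exact: le_lt_trans (ler_norm _) sd.
have := dV _ _ (ltW t0) (ltW ts) sT dd; rewrite distrC dV_norm// ?ltW// => dVg.
apply: C_const => //; [exact: ltW|exact: ltW|].
move=> r tr rs; have w1 := WV (ltW t0) tr (le_trans rs sT).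
have w2 := ler_normD (W t) (W r - W t); rewrite addrC subrK in w2.
have w3 : V r <= V s by rewrite -subr_ge0; apply: le_trans (WV (le_trans (ltW t0) tr) rs sT).
by move: dVg g0; rewrite /g; lra.
Unshelve. all: by end_near. Qed.

(** Each distribution function of [c] at a rational point is absolutely continuous in time; the
    countably many exceptional null sets are united. *)
Let compliance_derivable : {ae leb, forall t : R, 0 < t < T -> forall q : rat, exists l : R,
  (cdf (c s) (ratr q) - cdf (c t) (ratr q)) / (s - t) @[s --> t^'] --> l}.
Proof.
have VS_AC : abs_continuous Rdist T (fun t => V t / S).
  have K0 : 0 <= S^-1 by rewrite invr_ge0 ltW.
  apply: (abs_continuous_dominated (K := S^-1) V_AC) => // s t s0 st tT.
  by rewrite /Rdist -mulrBl normrM normfV (gtr0_norm S_gt0) distrC mulrC.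
suff h : {ae leb, forall t : R, forall q : rat, 0 < t < T -> exists l : R,
  (cdf (c s) (ratr q) - cdf (c t) (ratr q)) / (s - t) @[s --> t^'] --> l}.
  by apply: (lebS h) => t ht tT q; exact: ht.
apply: ae_forall_count => q.
have [g Lg gE] : exists2 g : R -> R, L1 setT g & forall s t, 0 <= s -> s <= t -> t <= T ->
    cdf (c t) (ratr q) - cdf (c s) (ratr q) = \int[leb]_(x in `]s, t]) g x.
  apply: (ac_density T_gt0 VS_AC) => s t s0 st tT; rewrite -cdf_sub.
  have mq : measurable (`]-oo, (ratr q : R)]%classic : set MR) by exact: measurable_itv.
  rewrite /cdf compliance_sub//; have /andP[h0 h1] := mu_fine_inc s0 st tT mq.
  rewrite ger0_norm; last by apply: mulr_ge0 => //; rewrite invr_ge0 ltW.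
  rewrite mulrC ler_pdivrMr// -mulrBl (_ : _ * a0 = a0 / S * (V t - V s))//; ring.
apply: (lebS (density_derivable Lg gE)) => t ht tT; exists (g t); exact: ht.
Qed.

(** The difference quotients of [c] are nonnegative measures whose distribution functions converge
    at rational points, so [wstar_limit] produces the derivative at almost every time. *)
Lemma griffith_law : {ae leb, forall t : R, 0 <= t <= T -> exists cdot : smeas R,
  [/\ meas_time_deriv L T c t cdot, meas_le meas_zero cdot &
      meas_eq_on X (meas_scale (2 * kappa * a0 - sg t ^+ 2) cdot) meas_zero]}.
Proof.
apply: (lebS (lebI compliance_derivable (lebI (ae_neq 0) (ae_neq T)))) => t [der [t0 tnT]] tT.
have tT' : 0 < t < T by have /andP[h0 hT] := tT; rewrite !lt_neqAle h0 hT tnT eq_sym t0.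
have [l lP] := choice (der tT').
pose nu_ s := meas_scale (s - t)^-1 (meas_sub (c s) (c t)).
have ok : \forall s \near t^', meas_on `[0, L] (nu_ s) /\ nonneg (nu_ s).
  near=> s; have [sT st] : 0 <= s <= T /\ s != t by near: s; exact: near_dnbhs_itv.
  split.
    move=> A mA; have mAX : measurable (A `\` X) by exact: measurableD.
    suff -> : nu_ s (A `\` X) = meas_zero (A `\` X) by [].
    apply: (fine_meas_inj mAX); rewrite fineZ_meas// fineB_meas//.
    by rewrite (compliance_on sT mA) (compliance_on tT mA)/= subrr mulr0.
  apply: nonneg_fine => A mA; rewrite fineZ_meas// compliance_sub//.
  have /andP[h0 hT] := tT; have /andP[s0 hsT] := sT.
  have [lts|lst] := ltP t s.
    have /andP[h _] := mu_fine_inc h0 (ltW lts) hsT mA.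
    by apply: mulr_ge0; [rewrite invr_ge0 subr_ge0 ltW|apply: mulr_ge0 => //; rewrite invr_ge0 ltW].
  have /andP[h _] := mu_fine_inc s0 lst hT mA.
  (* For s before t the increments of time and of compliance change sign together. *)
  rewrite -(opprB t s) invrN mulNr -mulrN -mulrN opprB.
  by apply: mulr_ge0; [rewrite invr_ge0 subr_ge0|apply: mulr_ge0 => //; rewrite invr_ge0 ltW].
have cv q : cdf (nu_ s) (ratr q) @[s --> t^'] --> l q.
  apply: cvg_near_ext (lP q); apply: nearW => s.
  by rewrite cdf_scale cdf_sub mulrC.
have [cdot [cdot0 cdotX cdotw _]] := wstar_limit _ L_gt0 ok cv; exists cdot; split.
- by split => //; rewrite within_dnbhs_itv.
- by move=> A mA; exact: cdot0.
(* At |sg| = S the scalar factor itself is 0; otherwise the limit of the quotients has mass 0. *)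
- have := sg_le tT; rewrite le_eqVlt => /orP[/eqP e|sub] A mA _; apply: fine_meas_inj => //; rewrite fineZ_meas//.
    have -> : 2 * kappa * a0 - sg t ^+ 2 = 0.
      by rewrite -real_normK ?num_real// e /S sqr_sqrtr ?subrr// ltW// !mulr_gt0.
    by rewrite mul0r.
  have m0 : fine (nu_ s setT) @[s --> t^'] --> (0 : R).
    apply: (@cvg_near_ext _ _ _ _ (fun=> 0)); last exact: cvg_cst.
    near=> s; have [sT st] : 0 <= s <= T /\ s != t by near: s; exact: near_dnbhs_itv.
    have e : C s = C t by near: s; exact: C_locally_const.
    by rewrite fineZ_meas// compliance_sub// !mass// /limit_mass e subrr !mulr0.
  have m1 : fine (nu_ i setT) @[i --> t^'] --> fine (cdot setT).
    by apply: (wstar_cvg_mass _ L_gt0 ok cdotX cdot0 cdotw).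
  have z : fine (cdot setT) = 0 by exact: (cvg_unique_ext m1 m0).
  have -> : fine (cdot A) = 0; last by rewrite mulr0.
  apply/eqP; rewrite eq_le fine_ge0 ?cdot0// andbT -z; exact: nonneg_mono.
Unshelve. all: by end_near. Qed.

(** Stated for an abstract sequence of evolutions, so that it can be applied to a shifted one. *)
Lemma subsequence_limit :
  exists (u : R -> R -> R) (e : R -> R) (p : R -> smeas R) (sigma : R -> R),
  [/\ (forall t : R, 0 <= t <= T ->
        [/\ BVfun `]0, L[ (u t), meas_on `[0, L] (p t),
            sigma t \in `[- Num.sqrt (2 * kappa * a0), Num.sqrt (2 * kappa * a0)]
          & meas_on `[0, L] (mu t)]) /\
      [/\ abs_continuous (BVdist `]0, L[) T u, abs_continuous Rdist T e, abs_continuous meas_dist T p,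
          abs_continuous Rdist T sigma & abs_continuous meas_dist T mu],
      forall t : R, 0 <= t <= T ->
        [/\ wstar_BV_cvg L (fun n => u_ (k n) t) (u t),
            wstar_cvg L \oo (fun n => damage_meas L (eps (k n)) (Theta_ (k n) t)) (mu t),
            stress L (u_ (k n) t) (a_ (k n) t) @[n --> \oo] --> sigma t,
            weak_L2_cvg `]0, L[
              (fun n x => stress L (u_ (k n) t) (a_ (k n) t) / a1 * Theta_ (k n) t x) (fun=> e t)
          & wstar_cvg L \oo
              (fun n => meas_scale (stress L (u_ (k n) t) (a_ (k n) t) / a0)
                          (damage_meas L (eps (k n)) (Theta_ (k n) t))) (p t)],
      forall t : R, 0 <= t <= T ->
        [/\ meas_eq_on `]0, L[ (BVderiv `]0, L[ (u t))
              (meas_add (meas_density `]0, L[ (fun=> e t)) (p t)),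
            meas_eq_on [set 0; L] (p t)
              (meas_sub
                 (meas_scale (w t L - traceR L (u t)) (meas_dirac L))
                 (meas_scale (w t 0 - traceL 0 (u t)) (meas_dirac 0))),
            sigma t = a1 * e t,
            forall phi, H10 `]0, L[ phi ->
              - (\int[leb]_(x in `]0, L[) (sigma t * wderiv `]0, L[ phi x)) = 0
          & sigma t \in `[- Num.sqrt (2 * kappa * a0), Num.sqrt (2 * kappa * a0)]]
    & let c t := compliance L a0 a1 (mu t) in
      [/\ forall t : R, 0 <= t <= T ->
            meas_on `[0, L] (c t) /\ meas_le meas_zero (c t),
          forall s t : R, 0 <= s -> s <= t -> t <= T -> meas_le (c s) (c t),
          forall t : R, 0 <= t <= T ->
            meas_eq_on `]0, L[ (BVderiv `]0, L[ (u t))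
              (meas_scale (sigma t) (c t))
        & {ae leb, forall t : R, 0 <= t <= T ->
            exists cdot : smeas R,
              [/\ meas_time_deriv L T c t cdot, meas_le meas_zero cdot
                & meas_eq_on `[0, L]
                    (meas_scale (2 * kappa * a0 - sigma t ^+ 2) cdot)
                    meas_zero]}]].
Proof.
have sgK t : 0 <= t <= T -> sg t \in `[- Num.sqrt (2 * kappa * a0), Num.sqrt (2 * kappa * a0)].
  by move=> tT; rewrite in_itv/= -ler_norml; exact: sg_le.
exists u, (fun t => sg t / a1), (fun t => meas_scale (sg t / a0) (mu t)), sg; split.
- split.
    move=> t tT; split; [exact: u_BV| |exact: sgK|exact: muX].
    move=> A mA; have mAX : measurable (A `\` X) by exact: measurableD.
    suff -> : meas_scale (sg t / a0) (mu t) (A `\` X) = meas_zero (A `\` X) by [].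
    by apply: (fine_meas_inj mAX); rewrite fineZ_meas// (muX tT mA)/= mulr0.
  by split; [exact: displacement_AC|exact: elastic_AC|exact: plastic_AC|exact: stress_AC|exact: measure_AC].
- move=> t tT; split; [exact: displacement_cvg|exact: mu_w|exact: (subseq (limit_stress_cvg tT))|exact: elastic_cvg|exact: plastic_cvg].
- move=> t tT; split; [exact: additive_decomposition|exact: relaxed_dirichlet| |exact: equilibrium_law|exact: sgK].
  by rewrite mulrCA mulfV ?mulr1// gt_eqF.
- split.
  + move=> t tT; split; first exact: compliance_on.
    by move=> A mA; exact: compliance_nonneg.
  + exact: compliance_mono.
  + exact: compliance_law.
  + exact: griffith_law.
Qed.

End Limit_of_evolutions.

Theorem theorem1p1 (R : realType) (L T kappa a0 a1 : R)
    (L_gt0 : 0 < L) (T_gt0 : 0 < T) (kappa_gt0 : 0 < kappa)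
    (a0_gt0 : 0 < a0) (a1_gt0 : 0 < a1)
    (w : R -> R -> R)
    (w_H1 : forall t : R, 0 <= t <= T -> H1 setT (w t))
    (w_continuous : forall t : R, 0 <= t <= T -> continuous (w t))
    (w_AC : abs_continuous (H1dist setT) T w)
    (u_ Theta_ a_ : R -> R -> R -> R)
    (evol : forall eps : R, 0 < eps -> eps * a0 < a1 ->
       brittle_evolution L T kappa a0 a1 w eps
         (u_ eps) (Theta_ eps) (a_ eps))
    (eps_ : nat -> R)
    (eps_gt0 : forall n, 0 < eps_ n)
    (eps_small : forall n, eps_ n * a0 < a1)
    (eps_cvg0 : eps_ n @[n --> \oo] --> 0) :
  let sigma_ eps t := stress L (u_ eps t) (a_ eps t) in
  let mu_ eps t := damage_meas L eps (Theta_ eps t) in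
  let K := `[- Num.sqrt (2 * kappa * a0), Num.sqrt (2 * kappa * a0)] in
  exists k : nat -> nat, {homo k : m n / (m < n)%N} /\
  exists (u : R -> R -> R) (e : R -> R) (p : R -> smeas R) (sigma : R -> R)
    (mu : R -> smeas R),
  (* (u, e, p, sigma, mu) is absolutely continuous with values in
     BV((0, L)) x R x M([0, L]) x K x M([0, L]) *)
  [/\ (forall t : R, 0 <= t <= T ->
        [/\ BVfun `]0, L[ (u t), meas_on `[0, L] (p t), sigma t \in K
          & meas_on `[0, L] (mu t)]) /\
      [/\ abs_continuous (BVdist `]0, L[) T u, abs_continuous Rdist T e, abs_continuous meas_dist T p,
          abs_continuous Rdist T sigma & abs_continuous meas_dist T mu],
  (* convergences *)
      forall t : R, 0 <= t <= T ->
        [/\ wstar_BV_cvg L (fun n => u_ (eps_ (k n)) t) (u t),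
            wstar_cvg L \oo (fun n => mu_ (eps_ (k n)) t) (mu t),
            sigma_ (eps_ (k n)) t @[n --> \oo] --> sigma t,
            weak_L2_cvg `]0, L[
              (fun n x => sigma_ (eps_ (k n)) t / a1 * Theta_ (eps_ (k n)) t x)
              (fun=> e t)
          & wstar_cvg L \oo
              (fun n => meas_scale (sigma_ (eps_ (k n)) t / a0)
                          (mu_ (eps_ (k n)) t)) (p t)],
  (* (i) -- (v) *)
      forall t : R, 0 <= t <= T ->
        [/\ meas_eq_on `]0, L[ (BVderiv `]0, L[ (u t))
              (meas_add (meas_density `]0, L[ (fun=> e t)) (p t)),
            meas_eq_on [set 0; L] (p t)
              (meas_sub
                 (meas_scale (w t L - traceR L (u t)) (meas_dirac L))
                 (meas_scale (w t 0 - traceL 0 (u t)) (meas_dirac 0))),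
            sigma t = a1 * e t,
            forall phi, H10 `]0, L[ phi ->
              - (\int[lebesgue_measure]_(x in `]0, L[)
                   (sigma t * wderiv `]0, L[ phi x)) = 0
          & sigma t \in K]
  (* effective compliance *)
    & let c t := compliance L a0 a1 (mu t) in
      [/\ forall t : R, 0 <= t <= T ->
            meas_on `[0, L] (c t) /\ meas_le meas_zero (c t),
          forall s t : R, 0 <= s -> s <= t -> t <= T -> meas_le (c s) (c t),
  (* (vi) *)
          forall t : R, 0 <= t <= T ->
            meas_eq_on `]0, L[ (BVderiv `]0, L[ (u t))
              (meas_scale (sigma t) (c t))
  (* (vii) *)
        & {ae lebesgue_measure, forall t : R, 0 <= t <= T ->
            exists cdot : smeas R,
              [/\ meas_time_deriv L T c t cdot, meas_le meas_zero cdot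
                & meas_eq_on `[0, L]
                    (meas_scale (2 * kappa * a0 - sigma t ^+ 2) cdot)
                    meas_zero]}]].
Proof.
move=> sigma_ mu_ K; pose W t := w t L - w t 0.
have [V [gV [gW [V_AC w0V WV [gV1 gW1 VE WE] work]]]] := work_density L_gt0 T_gt0 w_H1 w_continuous w_AC.
pose S : R := Num.sqrt (2 * kappa * a0).
have S0 : 0 < S by rewrite sqrtr_gt0 !mulr_gt0.
(* A bound for |W| on [0, T]. *)
pose B := `|W 0| + (V T - V 0).
have B0 : 0 <= B by rewrite addr_ge0//; apply: le_trans (WV 0 T (lexx 0) (ltW T_gt0) (lexx T)).
have WB t : 0 <= t <= T -> `|W t| <= B.
  move=> /andP[t0 tT]; have := ler_normD (W 0) (W t - W 0); rewrite addrC subrK.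
  have := WV 0 t (lexx 0) t0 tT; have := le_trans (normr_ge0 _) (WV t T t0 tT (lexx T)).
  by rewrite /B /W; lra.
(* Below this threshold S L / (eps a0) exceeds [B]: the load can never reach the critical one of the
   fully damaged bar. *)
have d0 : 0 < S * L / (a0 * (B + 1)) by rewrite divr_gt0 ?mulr_gt0// ltr_pwDr.
have [N0 _ small] : \forall n \near \oo, eps_ n < S * L / (a0 * (B + 1)) by exact: (cvgr_lt _ eps_cvg0).
pose eps n := eps_ (n + N0)%N.
have shift : {homo (fun n : nat => (n + N0)%N) : m n / (m < n)%N} by move=> m n; rewrite ltn_add2r.
have epsc : eps n @[n --> \oo] --> 0 by exact: (cvg_comp _ _ (cvg_homo_oo shift) eps_cvg0).
have be n := evol (eps n) (eps_gt0 _) (eps_small _).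
(* Along this tail the bar is nowhere fully damaged. *)
have not_full n t : 0 <= t <= T ->
    `|W t| <= crit_stress kappa a0 a1 (eps n) * (L / (eps n * a0)).
  move=> tT; apply: (le_trans (WB t tT)); have en : 0 < eps n := eps_gt0 _.
  have bt0 := damage_slope_gt0 a0_gt0 a1_gt0 (eps_small (n + N0)%N).
  (* The critical stresses decrease to their limit, because the damage slope 1 / a0 - eps / a1 lies
     below 1 / a0. *)
  have SS : S <= crit_stress kappa a0 a1 (eps n).
    rewrite ler_sqrt; last by rewrite divr_ge0 ?mulr_ge0// ltW.
    apply: ler_wpM2l; first by rewrite mulr_ge0// ltW.
    rewrite -[leLHS]invrK lef_pV2 ?posrE ?invr_gt0// /damage_slope gerBl divr_ge0// ltW//.
  have se : eps n <= S * L / (a0 * (B + 1)) by apply/ltW/small; exact: leq_addl.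
  apply: (@le_trans _ _ (S * (L / (eps n * a0)))); last by rewrite ler_pM2r// divr_gt0 ?mulr_gt0.
  rewrite mulrA ler_pdivlMr ?mulr_gt0//.
  move: se; rewrite ler_pdivlMr ?mulr_gt0 ?ltr_pwDr//; have := mulr_gt0 en a0_gt0.
  by nra.
have [k kh [mu muP]] := Helly_selection L_gt0 T_gt0 kappa_gt0 a0_gt0 a1_gt0 w_H1 w_continuous
  (fun n => eps_gt0 _) (fun n => eps_small _) epsc be V_AC WV gV1 gW1 VE WE work not_full.
have [u [e [p [sigma H]]]] := subsequence_limit L_gt0 T_gt0 kappa_gt0 a0_gt0 a1_gt0 w_H1 w_continuous
  (fun n => eps_gt0 _) (fun n => eps_small _) epsc be V_AC w0V WV gV1 gW1 VE WE work not_full kh muP.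
(* The selection was made along the tail, so its indices are shifted back. *)
exists (fun n => (k n + N0)%N); split; first by move=> m n mn; apply: shift; exact: kh.
by exists u, e, p, sigma, mu; exact: H.
Qed.
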